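(* Let $J=(f_1,f_2,f_3)\subset R=k[x_1,\ldots,x_n]$ ($n\ge 3$) be a three-equigenerated ideal with $\deg(f_i)=d$ and $\gcd(f_1,f_2,f_3)=1$, and let $e=\operatorname{indeg}(\operatorname{Syz}(J))$. If $J$ is an almost complete intersection, then $$\deg(R/J)+\operatorname{Bour}(J)=d^2+e^2-ed.$$ Moreover, the following hold: (1) $\operatorname{Bour}(J)=0$ if and only if $J$ is perfect. (2) $\operatorname{Bour}(J)=1$ if and only if the Bourbaki ideal is a complete intersection generated by two independent linear forms. (3) $\operatorname{Bour}(J)=2$ if and only if the Bourbaki ideal is either the intersection of two codimension-two linear primes, or a codimension-two linear primary ideal of multiplicity two, or a complete intersection of type $(1,2)$. (4) $\operatorname{Bour}(J)=d^2-1$ if and only if $e=d$ and $\deg(R/J)=1$. (5) $\operatorname{Bour}(J)=d^2$ if and only if $J$ is a complete intersection. Assume furthermore that $\operatorname{Syz}(J)$ is locally free on the punctured spectrum. Then $$\operatorname{Bour}(J)\le e^2\quad\text{and}\quad d(d-e)\le\deg(R/J)\le d^2+e^2-ed.$$ In the quadratic case, if $J$ has height two and $\deg(f_i)=2$, then: (a) if $n=3$, then $\operatorname{Bour}(J)\neq 2$; (b) if $n\ge 4$, $\Theta$ is locally free, and $J$ is saturated, then $\operatorname{Bour}(J)\neq 2$.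
   Context: $k$ is an algebraically closed field of characteristic zero and $R$ is standard graded with homogeneous maximal ideal $\mathfrak m=(x_1,\ldots,x_n)$. A three-equigenerated ideal is an ideal generated by three homogeneous forms of the same degree $d$. An ideal $J$ is a complete intersection if it is generated by $\operatorname{ht}(J)$ elements, an almost complete intersection if it is minimally generated by $\operatorname{ht}(J)+1$ elements, and perfect if $R/J$ is Cohen--Macaulay. $\operatorname{Syz}(J)=\ker\bigl((f_1\ f_2\ f_3):R^3\to R(d)\bigr)$, and $\operatorname{indeg}(E)=\min\{i: E_i\neq 0\}$ for a graded module $E$. The matrix associated to $J$ is $$\Theta=\begin{bmatrix}0&0&0&1\\ f_1&f_2&f_3&0\end{bmatrix}:R^4\to R\oplus R(d),$$ so that the ideal of $2\times 2$ minors of $\Theta$ is $J$, the cokernel of $\Theta$ is $R/J$ up to shift, and $\operatorname{Syz}(\Theta):=\ker\Theta\cong\operatorname{Syz}(J)$. The matrix $\Theta$ is locally free if $\operatorname{Syz}(\Theta)$ is locally free on the punctured spectrum, i.e. $\operatorname{Syz}(\Theta)_{\mathfrak p}$ is free for every prime $\mathfrak p\neq\mathfrak m$. Let $\nu\in\operatorname{Syz}(J)$ be a nonzero homogeneous syzygy of minimal degree $e$. The cokernel of $R(-e)\xrightarrow{\nu}\operatorname{Syz}(J)$ is torsion-free of rank one, hence isomorphic up to shift to an ideal $I_\nu\subseteq R$, called the Bourbaki ideal, which is either $R$ or of codimension two. The Bourbaki degree is $\operatorname{Bour}(J):=\operatorname{Bour}(\Theta):=\deg(R/I_\nu)$ (equal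 to $0$ when $I_\nu=R$); it does not depend on the choice of $\nu$. A linear prime is a prime ideal generated by linear forms. A codimension-two linear primary ideal of multiplicity two is an ideal $I$ that is $\mathfrak p$-primary for some height-two linear prime $\mathfrak p$, with $(R/I)_{\mathfrak p}$ of length $2$. A complete intersection of type $(1,2)$ is an ideal $(\ell,q)$ generated by a regular sequence consisting of a linear form $\ell$ and a quadratic form $q$. *)

(* Defs.v *)
From Stdlib Require Export ClassicalEpsilon.
From HB Require Import structures.
From mathcomp Require Export all_boot all_order all_algebra.
From mathcomp Require Export mpoly.
Set Implicit Arguments.
Unset Strict Implicit.
Unset Printing Implicit Defensive.
Import GRing.Theory.
Local Open Scope ring_scope.

(* Ideals are arbitrary subsets, hence Prop-valued predicates. *)
Section Ideals.
Variable A : comNzRingType.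
Implicit Types (I J p q : A -> Prop) (r h : nat).

Definition subideal I J := forall a, I a -> J a.
Definition eq_ideal I J := forall a, I a <-> J a.
Definition proper_sub I J := subideal I J /\ ~ subideal J I.

Definition is_ideal I :=
  I 0 /\ forall a u v, I u -> I v -> I (a * u + v).
Definition prime_ideal p :=
  [/\ is_ideal p, ~ p 1 & forall a b, p (a * b) -> p a \/ p b].
Definition maximal_ideal p :=
  [/\ is_ideal p, ~ p 1
    & forall q, is_ideal q -> subideal p q -> q 1 \/ eq_ideal q p].

Definition zero_ideal (a : A) := a = 0.
Definition unit_ideal (a : A) := True.
Definition cap_ideal I J (a : A) := I a /\ J a.

(* J + (x_j : j < i) *)
Definition add_prefix J r (x : 'I_r -> A) (i : nat) (a : A) :=
  exists (h : A) (c : 'I_r -> A),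
    J h /\ a = h + \sum_(j < r | (j < i)%N) c j * x j.

Definition ideal_gen r (x : 'I_r -> A) (a : A) :=
  exists c : 'I_r -> A, a = \sum_j c j * x j.

Definition generated_by I r := exists x : 'I_r -> A, eq_ideal I (ideal_gen x).
Definition min_generated_by I r :=
  generated_by I r /\ forall s, (s < r)%N -> ~ generated_by I s.

Definition strict_chain h (q : 'I_h.+1 -> A -> Prop) :=
  forall i j : 'I_h.+1, (i < j)%N -> proper_sub (q i) (q j).

Definition prime_chain I p h :=
  exists q : 'I_h.+1 -> A -> Prop,
    strict_chain q /\
    forall i, [/\ prime_ideal (q i), subideal I (q i) & subideal (q i) p].

(* dim (A/I)_p = h; for I = 0 this is the height of p. *)
Definition local_dim I p h := prime_chain I p h /\ ~ prime_chain I p h.+1.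

(* ht I = h, the minimum of the heights of the primes containing I; the unit
   ideal has no height. *)
Definition ideal_height I h :=
  (forall p, prime_ideal p -> subideal I p -> prime_chain zero_ideal p h) /\
  (exists p, [/\ prime_ideal p, subideal I p & local_dim zero_ideal p h]).

Definition complete_intersection I :=
  exists2 h, ideal_height I h & generated_by I h.
Definition almost_complete_intersection I :=
  exists2 h, ideal_height I h & min_generated_by I h.+1.

(* The preimage of I A_p under A -> A_p. *)
Definition loc_ideal p I (a : A) := exists2 s, ~ p s & I (s * a).

Definition regular_seq r (x : 'I_r -> A) :=
  ~ ideal_gen x 1 /\
  forall (i : 'I_r) a, add_prefix zero_ideal x i (x i * a) ->
    add_prefix zero_ideal x i a.

(* An (A/J)_p-regular sequence in the maximal ideal of (A/J)_p, where J is
   contained in p; up to units its terms come from p, and the quotient it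
   defines is nonzero since all its terms and J lie in p. *)
Definition local_regular_seq J p r (x : 'I_r -> A) :=
  (forall i, p (x i)) /\
  forall (i : 'I_r) a, loc_ideal p (add_prefix J x i) (x i * a) ->
    loc_ideal p (add_prefix J x i) a.

Definition local_depth J p r :=
  (exists x : 'I_r -> A, local_regular_seq J p x) /\
  ~ (exists x : 'I_r.+1 -> A, local_regular_seq J p x).

(* A/J is Cohen-Macaulay. *)
Definition perfect_ideal J :=
  forall p, maximal_ideal p -> subideal J p ->
    exists2 r, local_dim J p r & local_depth J p r.

Definition primary_to p I :=
  [/\ is_ideal I, ~ I 1,
      forall a b, I (a * b) -> I a \/ exists m, I (b ^+ m)
    & forall a, p a <-> exists m, I (a ^+ m)].

(* Ideals of (A/I)_p correspond to the ideals of A containing I that are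
   stable under division by elements outside p. *)
Definition local_chain I p r :=
  exists q : 'I_r.+1 -> A -> Prop,
    strict_chain q /\
    forall i, [/\ is_ideal (q i), subideal I (q i)
                & subideal (loc_ideal p (q i)) (q i)].

(* The length of (A/I)_p is r. *)
Definition local_length I p r := local_chain I p r /\ ~ local_chain I p r.+1.

Definition syz m l (T : 'M[A]_(m, l)) (u : 'cV[A]_l) := T *m u = 0.

End Ideals.

Section LocalFreeness.
Variable A : idomainType.
Implicit Types (p : A -> Prop) (m : nat).

(* A_p inside the fraction field K of A *)
Definition local_ring p (z : {fraction A}) :=
  exists a s, ~ p s /\ z = tofrac a / tofrac s.

(* For a submodule M of A^m, the localization M_p inside K^m. *)
Definition localize p m (M : 'cV[A]_m -> Prop) (z : 'cV[{fraction A}]_m) :=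
  exists v s, [/\ M v, ~ p s & z = (tofrac s)^-1 *: map_mx (@tofrac A) v].

Definition free_at p m (M : 'cV[A]_m -> Prop) :=
  exists (r : nat) (b : 'M[{fraction A}]_(m, r)),
    (forall j, localize p M (col j b)) /\
    forall z, localize p M z ->
      exists! c : 'cV[{fraction A}]_r,
        (forall i, local_ring p (c i 0)) /\ z = b *m c.

End LocalFreeness.

Section Graded.
Variables (k : closedFieldType) (n : nat).
Notation R := {mpoly k[n]}.
Implicit Types (I J : R -> Prop) (f : 'rV[R]_3) (nu : 'cV[R]_3).

Definition irrelevant_ideal : R -> Prop := ideal_gen (fun i : 'I_n => 'X_i).

Definition locally_free m (M : 'cV[R]_m -> Prop) :=
  forall p, prime_ideal p -> ~ eq_ideal p irrelevant_ideal -> free_at p M.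

(* J contains every element carried into it by a power of the irrelevant
   ideal. *)
Definition saturated J :=
  forall a, (exists N, forall m : 'X_{1..n}, mdeg m = N -> J ('X_[m] * a)) ->
    J a.

Definition ideal3 f : R -> Prop := ideal_gen (fun i => f 0 i).

Definition homog_vec m (e : nat) (u : 'cV[R]_m) :=
  forall i, u i 0 \is e.-homog.

(* The component of R of degree z, which vanishes for z < 0. *)
Definition homogz (z : int) (g : R) : Prop :=
  match z with Posz j => g \is j.-homog | Negz _ => g = 0 end.

(* The syzygies of degree e are those with entries in R_e, as the syzygy
   module is the kernel of R^3 -> R(d). *)
Definition is_indeg m (M : 'cV[R]_m -> Prop) (e : nat) :=
  (exists u, [/\ M u, u != 0 & homog_vec e u]) /\
  forall i u, M u -> u != 0 -> homog_vec i u -> (e <= i)%N.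

Definition min_syzygy f nu :=
  exists e, [/\ is_indeg (syz f) e, syz f nu, nu != 0 & homog_vec e nu].

(* I is a Bourbaki ideal for nu: phi induces an isomorphism, homogeneous of
   degree s, from the cokernel of nu onto I. *)
Definition bourbaki_ideal f nu I :=
  (exists (phi : 'cV[R]_3 -> R) (s : int),
    [/\ forall a u v, syz f u -> syz f v ->
          phi (a *: u + v) = a * phi u + phi v,
        forall (i : nat) u, syz f u -> homog_vec i u ->
          homogz (i%:Z + s) (phi u),
        forall u, syz f u -> (phi u = 0 <-> exists a, u = a *: nu)
      & forall g, I g <-> exists2 u, syz f u & phi u = g]) /\
  (eq_ideal I (@unit_ideal R) \/ ideal_height I 2).

(* h t = dim_k (R/I)_t: each (R/I)_t has a basis with h t elements. *)
Definition hilbert_function I (h : nat -> nat) :=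
  forall t, exists b : 'I_(h t) -> R,
    (forall i, b i \is t.-homog) /\
    forall g, g \is t.-homog ->
      exists! c : 'rV[k]_(h t), I (g - \sum_i c 0 i *: b i).

(* (deg P)! times the leading coefficient of the Hilbert polynomial P of R/I,
   or the length of R/I when P = 0. *)
Definition is_degree I (m : rat) :=
  exists (h : nat -> nat) (P : {poly rat}) (N : nat),
    [/\ hilbert_function I h,
        forall t, (N <= t)%N -> P.[t%:R] = (h t)%:R
      & m = if P == 0 then (\sum_(t < N) h t)%:R
            else lead_coef P * ((size P).-1`!)%:R].

Definition degree I : rat := epsilon (inhabits 0) (is_degree I).

(* deg(R/I) for any minimal syzygy nu and Bourbaki ideal I; it depends on
   neither choice. *)
Definition bour f : rat :=
  epsilon (inhabits 0) (fun b =>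
    exists nu I, [/\ min_syzygy f nu, bourbaki_ideal f nu I & b = degree I]).

(* The rows are (0 0 0 1) and (f_1 f_2 f_3 0). *)
Definition theta f : 'M[R]_(1 + 1, 3 + 1) := block_mx 0 1%:M f 0.

Definition coprime_forms f :=
  forall g, (forall i, exists h, f 0 i = g * h) -> g \is a GRing.unit.

Definition linear_prime I :=
  prime_ideal I /\
  exists (r : nat) (l : 'I_r -> R),
    (forall i, l i \is 1.-homog) /\ eq_ideal I (ideal_gen l).

Definition linear_ci2 I :=
  complete_intersection I /\
  exists l : 'I_2 -> R,
    [/\ forall i, l i \is 1.-homog,
        forall c : 'I_2 -> k, \sum_i c i *: l i = 0 -> forall i, c i = 0
      & eq_ideal I (ideal_gen l)].

Definition two_linear_primes I :=
  exists p q, [/\ linear_prime p /\ ideal_height p 2,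
                  linear_prime q /\ ideal_height q 2,
                  ~ eq_ideal p q
                & eq_ideal I (cap_ideal p q)].

Definition linear_primary2 I :=
  exists p, [/\ linear_prime p, ideal_height p 2, primary_to p I
              & local_length I p 2].

Definition ci_type12 I :=
  exists x : 'I_2 -> R,
    [/\ x ord0 \is 1.-homog, x ord_max \is 2.-homog, regular_seq x
      & eq_ideal I (ideal_gen x)].

End Graded.

(* Main.v *)
From Stdlib Require Import FunctionalExtensionality PropExtensionality.
Require Import Defs.
From mathcomp Require Import all_boot all_order all_algebra.
From mathcomp Require Import mpoly ring zify lra.
From mathcomp Require classical_sets.
Set Implicit Arguments.
Unset Strict Implicit.
Unset Printing Implicit Defensive.
Import Order.TTheory GRing.Theory Num.Theory.
Local Open Scope ring_scope.

(* Choose linear coordinates in which R = B[z, w] with B a polynomial ring in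
   n - 2 linear forms.  For an ideal I containing two coprime forms, in general
   coordinates, R/I is a finite graded B-module, and the coefficient of
   t^(n-3)/(n-3)! in its Hilbert polynomial is its B-rank.  Counting dimensions in
   0 -> Syz(J) -> R^3 -> J -> 0 and 0 -> R(-e) -> Syz(J) -> I_nu -> 0 makes this
   coefficient for R/J equal to d^2 + e^2 - ed - deg(R/I_nu), and I_nu contains
   two coprime combinations of the entries of nu, so deg(R/I_nu) <= e^2.
   The Bourbaki degree vanishes exactly when Syz(J) is free, and then J is
   perfect by Hilbert-Burch.  Conversely, if J is perfect then depth kills the
   Koszul homology of R/J from degree 3 on, hence H_1(x; I_nu): the minimal
   generators of I_nu have no relations, so I_nu is not of height two.
   R/I_nu is torsion-free over B, since I_nu is unmixed.  When its rank is one
   it equals B, so I_nu = (z - a, w - c) with a, c linear.  When it is two,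
   multiplication by z and w is triangularized, after completing the square,
   into z'^2 = b2^2 a, z'w' = -b1 b2 a, w'^2 = b1^2 a, b1 z' + b2 w' = 0 with
   b1, b2 coprime of degree t and 2t + deg a = 2; the cases a = 0, t = 1 and
   t = 0 are the three kinds of ideals in (3).
   For three quadrics with Bourbaki degree 2 one has e = 2 and R/J has rank 2.
   The same normal form, applied to J itself (it is torsion-free over B when J
   is saturated and Syz(J) is locally free) or, for n = 3, to its B-torsion
   closure, contradicts the absence of a linear syzygy or of a fourth quadric. *)

(** * Ideals and factorial rings *)

(** The cross product with nu identifies Syz(J)/R nu with a concrete ideal: all g such that g f = u
    x nu for some u. Koszul syzygies u show that it contains the entries of nu. Solving the three
    equations for u exhibits it as a colon ideal (h1, h2) : f', where h1, h2 are coprime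
    combinations of the entries of nu and f' is a combination of the f_i. The unmixedness of I_nu is
    used only as torsion-freeness over B, and the colon ideal inherits this from (h1, h2), so no
    primary decomposition occurs. For (h1, h2) it holds because h1 is monic in w up to a scalar,
    while the resultant of the pair, which lies in (h1, h2), is monic in z. Read modulo an arbitrary
    ideal of B, the same division argument yields the regular sequences needed for heights and for
    perfection. Degrees are defined by Hilbert functions, so a B-rank is never computed over the
    fraction field of B: forms independent over B bound the leading coefficient from below, and
    forms that generate up to B-torsion bound it from above. *)

Lemma choice_fun (X Y : Type) (P : X -> Y -> Prop) :
  (forall x, exists y, P x y) -> exists f, forall x, P x (f x).
Proof.
move=> h; exists (fun x => proj1_sig (constructive_indefinite_description _ (h x))) => x.
by case: constructive_indefinite_description.
Qed.

Section IdealTheory.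
Variable A : comNzRingType.
Implicit Types (I J L p q : A -> Prop).

Lemma ideal0 I : is_ideal I -> I 0. Proof. by case. Qed.

Lemma idealM I a u : is_ideal I -> I u -> I (a * u).
Proof. by case=> I0 IM Iu; rewrite -[a * u]addr0; exact: IM. Qed.

Lemma ideal_mulr I a u : is_ideal I -> I u -> I (u * a).
Proof. by rewrite mulrC; exact: idealM. Qed.

Lemma idealD I u v : is_ideal I -> I u -> I v -> I (u + v).
Proof. by case=> _ IM Iu Iv; rewrite -[u]mul1r; exact: IM. Qed.

Lemma idealN I u : is_ideal I -> I u -> I (- u).
Proof. by move=> hI; rewrite -mulN1r; exact: idealM. Qed.

Lemma idealB I u v : is_ideal I -> I u -> I v -> I (u - v).
Proof. by move=> hI Iu Iv; apply: idealD => //; exact: idealN. Qed.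

Lemma idealDl I u v : is_ideal I -> I u -> I (u + v) -> I v.
Proof. by move=> hI Iu Iuv; rewrite -[v](addKr u) addrC; apply: idealB. Qed.

Lemma ideal_sum I (T : Type) (r : seq T) (P : pred T) (F : T -> A) :
  is_ideal I -> (forall i, P i -> I (F i)) -> I (\sum_(i <- r | P i) F i).
Proof.
by move=> hI h; apply: (big_ind I) => //; [exact: ideal0 | move=> *; exact: idealD].
Qed.

Lemma ideal1 I a : is_ideal I -> I 1 -> I a.
Proof. by move=> hI I1; rewrite -[a]mulr1; exact: idealM. Qed.

Lemma ideal_gen_ideal r (x : 'I_r -> A) : is_ideal (ideal_gen x).
Proof.
split; first by exists (fun=> 0); rewrite big1 // => i _; rewrite mul0r.
move=> a _ _ [c ->] [c' ->]; exists (fun i => a * c i + c' i).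
by rewrite mulr_sumr -big_split; apply: eq_bigr => i _ /=; ring.
Qed.

Lemma ideal_gen_gen r (x : 'I_r -> A) i : ideal_gen x (x i).
Proof.
exists (fun j => (i == j)%:R); rewrite (bigD1 i) //= eqxx mul1r big1 ?addr0 // => j.
by rewrite eq_sym => /negbTE ->; rewrite mul0r.
Qed.

Lemma ideal_gen_sub r (x : 'I_r -> A) I :
  is_ideal I -> (forall i, I (x i)) -> subideal (ideal_gen x) I.
Proof. by move=> hI h _ [c ->]; apply: ideal_sum => // i _; exact: idealM. Qed.

Lemma add_prefix_ideal J r (x : 'I_r -> A) i :
  is_ideal J -> is_ideal (add_prefix J x i).
Proof.
move=> hJ; split.
  exists 0, (fun=> 0); split; first exact: ideal0.
  by rewrite add0r big1 // => j _; rewrite mul0r.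
move=> a _ _ [h [c [Jh ->]]] [h' [c' [Jh' ->]]].
exists (a * h + h'), (fun j => a * c j + c' j); split.
  by apply: idealD => //; exact: idealM.
rewrite mulrDr -!addrA; congr (_ + _); rewrite addrCA; congr (_ + _).
by rewrite mulr_sumr -big_split; apply: eq_bigr => j _ /=; ring.
Qed.

Lemma add_prefix_sub J r (x : 'I_r -> A) i : subideal J (add_prefix J x i).
Proof.
move=> a Ja; exists a, (fun=> 0); split=> //.
by rewrite big1 ?addr0 // => j _; rewrite mul0r.
Qed.

Lemma add_prefix_gen J r (x : 'I_r -> A) i (j : 'I_r) :
  is_ideal J -> (j < i)%N -> add_prefix J x i (x j).
Proof.
move=> hJ ji; exists 0, (fun l => (l == j)%:R); split; first exact: ideal0.
rewrite add0r (bigD1 j) //= eqxx mul1r big1 ?addr0 // => l /andP[_ /negbTE ->].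
by rewrite mul0r.
Qed.

Lemma add_prefix_least J r (x : 'I_r -> A) i I :
  is_ideal I -> subideal J I -> (forall j : 'I_r, (j < i)%N -> I (x j)) ->
  subideal (add_prefix J x i) I.
Proof.
move=> hI JI xI _ [h [c [/JI Ih ->]]]; apply: idealD => //.
by apply: ideal_sum => // j /xI; exact: idealM.
Qed.

Lemma primeM p a b : prime_ideal p -> ~ p a -> ~ p b -> ~ p (a * b).
Proof. by case=> _ _ h na nb /h[]. Qed.

Lemma primeX p a m : prime_ideal p -> p (a ^+ m) -> p a.
Proof.
case=> _ p1 pM; elim: m => [/p1 //|m IH]; rewrite exprS => /pM[//|]; exact: IH.
Qed.

Lemma loc_ideal_ideal p I :
  prime_ideal p -> is_ideal I -> is_ideal (loc_ideal p I).
Proof.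
move=> hp hI; split.
  by exists 1; [by case: hp | rewrite mulr0; exact: ideal0].
move=> a u v [s ps Iu] [t pt Iv]; exists (s * t); first exact: primeM.
have -> : s * t * (a * u + v) = a * t * (s * u) + s * (t * v) by ring.
by apply: idealD => //; exact: idealM.
Qed.

Lemma loc_ideal_sub p I : prime_ideal p -> subideal I (loc_ideal p I).
Proof. by case=> _ p1 _ a Ia; exists 1 => //; rewrite mul1r. Qed.

Lemma loc_ideal_in p I : prime_ideal p -> subideal I p -> subideal (loc_ideal p I) p.
Proof. by case=> _ _ pM Ip a [s ps /Ip /pM[]]. Qed.

Lemma loc_ideal_idem p I a :
  prime_ideal p -> loc_ideal p (loc_ideal p I) a -> loc_ideal p I a.
Proof.
move=> hp [s ps [t pt h]]; exists (t * s); first exact: primeM.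
by rewrite -mulrA.
Qed.

(** An ideal maximal among those that contain I and avoid the multiplicative set T is prime; Zorn's
    lemma provides one. *)
Lemma krull_prime I (T : A -> Prop) :
  is_ideal I -> T 1 -> (forall a b, T a -> T b -> T (a * b)) ->
  (forall a, I a -> ~ T a) ->
  exists p, [/\ prime_ideal p, subideal I p & forall a, p a -> ~ T a].
Proof.
move=> hI T1 TM dis.
pose good (X : A -> Prop) := is_ideal X /\ forall a, X a -> ~ T a.
(* [Zorn_bigcup] also asks for the union of the empty chain, which is the empty set; adjoining I to
   every member turns that case into I itself. *)
pose U (X : A -> Prop) a := I a \/ X a.
have [|X [[hX disX] Xmax]] := @classical_sets.Zorn_bigcup A (fun X => good (U X)).
  move=> F Fgood tot; split; last first.
    by move=> a [/dis //|[X FX Xa]]; apply: (Fgood X FX).2; right.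
  split; first by left; exact: ideal0.
  have key X a u v : F X -> U X u -> U X v ->
      U (classical_sets.bigcup F id) (a * u + v).
    move=> FX uX vX; case: (((Fgood _ FX).1).2 a u v uX vX) => [Iw|Xw].
      by left.
    by right; exists X.
  move=> a u v [Iu|[X FX Xu]] [Iv|[Y FY Yv]].
  - by left; apply: idealD => //; exact: idealM.
  - by apply: (key Y) => //; [left|right].
  - by apply: (key X) => //; [right|left].
  - have [XY|YX] := tot _ _ FX FY.
      by apply: (key Y) => //; right=> //; exact: XY.
    by apply: (key X) => //; right=> //; exact: YX.
exists (U X).
have hI' : subideal I (U X) by left.
(* If no s + t b met T, the ideal generated by U X and b would contradict maximality. *)
have ext b : ~ U X b -> exists s t, [/\ U X s, T (s + t * b) & True].
  move=> nb; apply: NNPP => none.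
  pose Y a := exists s t, U X s /\ a = s + t * b.
  have YX : forall a, X a -> Y a.
    by move=> a Xa; exists a, 0; split; [right | rewrite mul0r addr0].
  have IY : forall a, I a -> Y a.
    by move=> a Xa; exists a, 0; split; [left | rewrite mul0r addr0].
  have Yb : Y b by exists 0, 1; split; [left; exact: ideal0 | ring].
  apply: (Xmax Y).
    split=> [a /YX //|YsX]; apply: nb; right; exact: YsX.
  have UY a : U Y a -> Y a by case=> // /IY.
  split; last first.
    by move=> a /UY [s [t [Us ->]]] Ta; apply: none; exists s, t.
  split; first by left; exact: ideal0.
  move=> a _ _ /UY[s [t [Us ->]]] /UY[s' [t' [Us' ->]]]; right.
  exists (a * s + s'), (a * t + t'); split; last by ring.
  by apply: idealD => //; exact: idealM.
split=> //; split=> //; first by move=> /disX.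
move=> a b Uab; apply: NNPP => nab.
have [s [t [Us Tst _]]] : exists s t, [/\ U X s, T (s + t * a) & True].
  by apply: ext => Ua; apply: nab; left.
have [s' [t' [Us' Tst' _]]] : exists s t, [/\ U X s, T (s + t * b) & True].
  by apply: ext => Ua; apply: nab; right.
apply: (disX _ _ (TM _ _ Tst Tst')).
have -> : (s + t * a) * (s' + t' * b) =
  (s' + t' * b) * s + (t * a * s' + t * t' * (a * b)) by ring.
by apply: idealD => //; [exact: idealM | apply: idealD => //; exact: idealM].
Qed.

End IdealTheory.

Section UFD.
Variable A : idomainType.
Implicit Types (p a b : A).

Definition divides p a := exists b, a = b * p.

Lemma divides_refl p : divides p p.
Proof. by exists 1; rewrite mul1r. Qed.

Lemma divides_mull p a b : divides p b -> divides p (a * b).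
Proof. by case=> c ->; exists (a * c); rewrite mulrA. Qed.

Lemma divides_mulr p a b : divides p a -> divides p (a * b).
Proof. by rewrite mulrC; exact: divides_mull. Qed.

Lemma dividesD p a b : divides p a -> divides p b -> divides p (a + b).
Proof. by case=> c -> [d ->]; exists (c + d); rewrite mulrDl. Qed.

Lemma dividesN p a : divides p a -> divides p (- a).
Proof. by case=> c ->; exists (- c); rewrite mulNr. Qed.

Lemma divides0 p : divides p 0.
Proof. by exists 0; rewrite mul0r. Qed.

Lemma divides_ideal p : is_ideal (divides p).
Proof.
split; first exact: divides0.
by move=> a u v pu pv; apply: dividesD => //; exact: divides_mull.
Qed.

Lemma divides_unit p a : p \is a GRing.unit -> divides p a.
Proof. by move=> up; exists (a / p); rewrite divrK. Qed.

Lemma divides_unitl p u : divides p u -> u \is a GRing.unit -> p \is a GRing.unit.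
Proof. by case=> c ->; rewrite unitrM => /andP[]. Qed.

Definition prime_elt p :=
  [/\ p != 0, p \isn't a GRing.unit
    & forall a b, divides p (a * b) -> divides p a \/ divides p b].

Definition ufd := forall a, a != 0 ->
  exists u (s : seq A), [/\ u \is a GRing.unit, forall p, p \in s -> prime_elt p
                          & a = u * \prod_(p <- s) p].

Lemma prime_elt_ideal p : prime_elt p -> prime_ideal (divides p).
Proof.
case=> p0 up pM; split=> //; first exact: divides_ideal.
by case=> c e; move: up; rewrite (_ : p \is a GRing.unit) //; apply/unitrPr; exists c; rewrite mulrC.
Qed.

Lemma prime_elt_div_prod p (s : seq A) : prime_elt p ->
  divides p (\prod_(q <- s) q) -> exists2 q, q \in s & divides p q.
Proof.
case=> p0 up pM; elim: s => [|q s IH].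
  rewrite big_nil => h; move: up; rewrite (divides_unitl h) ?unitr1 //.
rewrite big_cons => /pM[h|/IH[r rs h]]; first by exists q; rewrite ?mem_head.
by exists r; rewrite // inE rs orbT.
Qed.

Hypothesis hufd : ufd.

Lemma ufd_prime_factor a : a != 0 -> a \isn't a GRing.unit ->
  exists2 p, prime_elt p & divides p a.
Proof.
move=> /hufd[u [s [uu sp ->]]]; case: s sp => [|p s] sp.
  by rewrite big_nil mulr1 uu.
move=> _; exists p; first by apply: sp; rewrite mem_head.
by rewrite big_cons mulrCA; apply: divides_mulr; exact: divides_refl.
Qed.

Lemma ufd_prime_list a : a != 0 ->
  exists s : seq A, (forall p, p \in s -> prime_elt p) /\
    forall p, prime_elt p -> divides p a -> exists2 q, q \in s & divides q p /\ divides p q.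
Proof.
move=> /hufd[u [s [uu sp ->]]]; exists s; split=> // p pp.
have [p0 up pM] := pp; case/pM => [h|h]; first by rewrite (divides_unitl h) in up.
have [q qs [c e]] := prime_elt_div_prod pp h; exists q => //; split; last by exists c.
have [q0 uq qM] := sp _ qs.
have [|[d ed]|//] := qM c p; first by rewrite -e; exact: divides_refl.
case/negP: up; apply/unitrPr; exists d; apply: (mulfI q0).
by rewrite mulr1 [RHS]e ed; ring.
Qed.

(** Coprimality of a family, tested on prime elements: in a factorial ring it says that every common
    divisor is a unit or the family has no prime common divisor. *)
Definition cop (T : Type) (b : T -> A) :=
  forall p, prime_elt p -> ~ forall i, divides p (b i).

(** The prime factors of y are removed one at a time: a prime of y that did not divide x would
    divide every [b i]. *)
Lemma cop_div (T : Type) (a b : T -> A) x y :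
  cop b -> y != 0 -> (forall i, x * b i = y * a i) -> divides y x.
Proof.
move=> cb /hufd[u [s [uu sp ->]]].
elim: s x sp => [|p s IH] x sp e.
  by apply: divides_unit; rewrite big_nil mulr1.
have pp : prime_elt p by apply: sp; rewrite mem_head.
have [p0 up pM] := pp.
have [c xc] : divides p x.
  apply: NNPP => npx; apply: (cb p pp) => i.
  have [||//] := pM x (b i) => //; rewrite e big_cons.
  by apply: divides_mulr; apply: divides_mull; apply: divides_mulr; exact: divides_refl.
have [|i|d cd] := IH c.
- by move=> q qs; apply: sp; rewrite inE qs orbT.
- apply: (mulfI p0); have := e i; rewrite big_cons xc => e'.
  by transitivity (c * p * b i); [ring | rewrite e'; ring].
by exists d; rewrite xc cd big_cons; ring.
Qed.

End UFD.

Lemma nat_least (P : nat -> Prop) :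
  (exists n, P n) -> exists n, P n /\ forall i, (i < n)%N -> ~ P i.
Proof.
case=> n Pn; apply: NNPP => none.
suff h i : ~ P i by exact: (h n).
have [m] := ubnP i; elim: m i => // m IH i im Pi.
by apply: none; exists i; split=> // j ji; apply: IH; lia.
Qed.

(** * Gauss's lemma: polynomials over a factorial ring *)

Section PolyUFD.
Variable A : idomainType.
Hypothesis hufd : ufd A.
Implicit Types (p c : A) (f g h : {poly A}).

Lemma divides_polyC p f : divides p%:P f <-> forall i, divides p f`_i.
Proof.
split=> [[g -> i]|h].
  by rewrite coefMC; exact/divides_mull/divides_refl.
have [F hF] := choice_fun h.
exists (\poly_(i < size f) F i); apply/polyP => i; rewrite coefMC coef_poly.
by case: ltnP => // hi; rewrite mul0r nth_default.
Qed.

Lemma assoc_prime p q : prime_elt p -> prime_elt q -> divides p q -> divides q p.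
Proof.
move=> [p0 up pM] [q0 uq qM] [c e].
have [|[d ed]|//] := qM c p; first by rewrite -e; exact: divides_refl.
case/negP: up; apply/unitrPr; exists d; apply: (mulfI q0).
by rewrite mulr1 [RHS]e ed; ring.
Qed.

Lemma prime_elt_polyC p : prime_elt p -> prime_elt p%:P.
Proof.
move=> pp; have [p0 up pM] := pp; split; first by rewrite polyC_eq0.
  apply: contra up; rewrite poly_unitE size_polyC p0 coefC eqxx.
  by case/andP.
move=> f g /divides_polyC hfg; apply: NNPP => none.
(* With i and j the least indices of coefficients of f and g not divisible by p, all terms of the
   coefficient of X^(i+j) in f g but one are divisible by p. *)
have [i [ni ltI]] : exists i, ~ divides p f`_i /\ forall j, (j < i)%N -> ~ ~ divides p f`_j.
  by apply: nat_least; apply: NNPP => hf; apply: none; left; apply/divides_polyC => i;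
     apply: NNPP => ?; apply: hf; exists i.
have [j [nj ltJ]] : exists i, ~ divides p g`_i /\ forall j, (j < i)%N -> ~ ~ divides p g`_j.
  by apply: nat_least; apply: NNPP => hf; apply: none; right; apply/divides_polyC => l;
     apply: NNPP => ?; apply: hf; exists l.
have := hfg (i + j)%N; rewrite coefM.
have hi : (i < (i + j).+1)%N by lia.
rewrite (bigD1 (Ordinal hi)) //= addKn addrC => h.
suff : divides p (f`_i * g`_j) by case/pM.
apply: (idealDl (divides_ideal p) _ h).
apply: ideal_sum; first exact: divides_ideal.
move=> l; rewrite -val_eqE /= => nl.
case: (ltnP l i) => hl; first by apply: divides_mulr; apply: NNPP; exact: ltI.
by apply: divides_mull; apply: NNPP; apply: ltJ; have := ltn_ord l; lia.
Qed.

Definition primitive f := forall p, prime_elt p -> ~ divides p%:P f.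

Lemma primitive_mul f g : primitive (f * g) -> primitive f.
Proof. by move=> h p pp pf; apply: (h p pp); exact: divides_mulr. Qed.

(** A prime constant dividing f divides its leading coefficient, so only the finitely many prime
    factors of [lead_coef f] have to be split off. *)
Lemma primitive_part f : f != 0 ->
  exists c g, [/\ c != 0, primitive g & f = c%:P * g].
Proof.
move=> f0.
(* s lists the primes still to be tried, r those already known not to divide f. *)
suff H : forall (s r : seq A) (u : A) f, f != 0 -> u \is a GRing.unit ->
   (forall p, p \in s ++ r -> prime_elt p) ->
   lead_coef f = u * \prod_(p <- s) p * \prod_(p <- r) p ->
   (forall p, p \in r -> ~ divides p%:P f) ->
   exists c g, [/\ c != 0, primitive g & f = c%:P * g].
  have [|u [s [uu sp e]]] := hufd (a := lead_coef f); first by rewrite lead_coef_eq0.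
  by apply: (H s [::] u) => //; [rewrite cats0 | rewrite big_nil mulr1].
elim=> [|q s IH] r u {}f {}f0 uu sp e nr.
  exists 1, f; split; rewrite ?oner_eq0 ?mul1r //.
  move=> p pp pf; have [_ up pM] := pp.
  have : divides p (lead_coef f) by rewrite lead_coefE; move/divides_polyC: pf; exact.
  rewrite e big_nil mulr1 => /pM[h|]; first by rewrite (divides_unitl h) in up.
  case/prime_elt_div_prod => // q qr pq; apply: (nr q qr).
  have [c ec] := assoc_prime pp (sp q qr) pq.
  by move: pf; case=> g ->; exists (g * c%:P); rewrite ec polyCM mulrA.
have pq : prime_elt q by apply: sp; rewrite mem_head.
have q0 : q != 0 by case: pq.
case: (excluded_middle_informative (divides q%:P f)) => [[f' ef]|nq].
  have f'0 : f' != 0 by apply: contraNneq f0 => h; rewrite ef h mul0r.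
  have [||p pr pf'|c [g [c0 pg eg]]] := IH r u f' f'0 uu.
  - by move=> p pp; apply: sp; rewrite inE pp orbT.
  - apply: (mulIf q0); move: e; rewrite ef lead_coefM lead_coefC big_cons => ->; ring.
  - by apply: (nr p pr); rewrite ef; exact: divides_mulr.
  by exists (c * q), g; split; rewrite ?mulf_neq0 // ef eg polyCM; ring.
apply: (IH (q :: r) u) => //.
- by move=> p; rewrite mem_cat inE => h; apply: sp; rewrite inE mem_cat orbCA.
- by rewrite e !big_cons; ring.
- by move=> p; rewrite inE => /predU1P[->|/nr].
Qed.

Lemma gauss_cancel c g h : c != 0 -> primitive g ->
  divides c%:P (g * h) -> divides c%:P h.
Proof.
move=> /hufd[u [s [uu sp ->]]] pg.
elim: s h sp => [|p s IH] h sp.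
  move=> _; apply: divides_unit; rewrite big_nil mulr1.
  exact: (rmorph_unit (@polyC A)).
rewrite big_cons => -[f e].
have pp : prime_elt p by apply: sp; rewrite mem_head.
have [p0 up pM] := prime_elt_polyC pp.
have : divides p%:P (g * h).
  by rewrite e !polyCM; do 2!apply: divides_mull; exact/divides_mulr/divides_refl.
case/pM => [/(pg _ pp) //|[h' eh]].
have sp' q : q \in s -> prime_elt q by move=> hq; apply: sp; rewrite inE hq orbT.
have [|q eq] := IH h' sp'.
  exists f; apply: (mulIf p0); transitivity (g * h); [rewrite eh; ring | rewrite e !polyCM; ring].
by exists q; rewrite eh eq !polyCM; ring.
Qed.

Lemma divides_primitive f g c : c != 0 -> primitive g ->
  divides g (c *: f) -> divides g f.
Proof.
move=> c0 pg [q e].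
have [|r er] := gauss_cancel (h := q) c0 pg.
  by rewrite mulrC -e -mul_polyC; exact/divides_mulr/divides_refl.
exists r; apply: (mulfI (x := c%:P)); first by rewrite polyC_eq0.
by rewrite mul_polyC e er; ring.
Qed.

Lemma primitive_const c : primitive c%:P -> c != 0 -> c \is a GRing.unit.
Proof.
move=> pc c0; apply/negPn/negP => nu.
have [p pp [d e]] := ufd_prime_factor hufd c0 nu.
by apply: (pc p pp); rewrite e polyCM; exact/divides_mull/divides_refl.
Qed.

(** The primitive part of the pseudo-gcd of g and a divides both of them by Gauss's lemma.
    Irreducibility leaves two cases: it is associated to g, or it is constant, and then g divides a
    constant multiple of b, hence b. *)
Lemma irreducible_prime g : primitive g -> (1 < size g)%N ->
  (forall a b, g = a * b -> (size a <= 1)%N \/ (size b <= 1)%N) -> prime_elt g.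
Proof.
move=> pg sg irr.
have g0 : g != 0 by rewrite -size_poly_gt0; exact: ltnW.
split=> //; first by rewrite poly_unitE negb_and; apply/orP; left; apply/eqP; lia.
move=> a b gab; set h := gcdp g a.
have h0 : h != 0 by rewrite gcdp_eq0 negb_and g0.
have [c' [h' [c'0 ph' eh]]] := primitive_part h0.
have dh f : h %| f -> divides h' f.
  move/Pdiv.Idomain.dvdpP=> [[c q] /= c0 e]; apply: (divides_primitive c0 ph').
  by rewrite e eh mulrA; exact/divides_mull/divides_refl.
have [q eq] := dh _ (dvdp_gcdl g a).
case: (irr _ _ eq) => hs.
  left; move: eq; rewrite (size1_polyC hs); set d := q`_0 => eq.
  have d0 : d != 0 by apply: contraNneq g0 => d0; rewrite eq d0 mul0r.
  have ud : d \is a GRing.unit.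
    by apply: primitive_const => //; apply: (@primitive_mul _ h'); rewrite -eq.
  have [r ->] := dh _ (dvdp_gcdr g a).
  exists (r * d^-1%:P); rewrite eq mulrA -[_ * _ * d%:P]mulrA -polyCM mulVr //.
  by rewrite mulr1.
right.
have cop : coprimep g a.
  rewrite /coprimep -/h eqn_leq size_poly_gt0 h0 andbT eh mul_polyC size_scale //.
have : g %| a * b.
  by apply/Pdiv.Idomain.dvdpP; case: gab => r er; exists (1, r); rewrite ?oner_eq0 //= scale1r.
rewrite Gauss_dvdpr // => /Pdiv.Idomain.dvdpP[[c r] /= c0 e].
by apply: (divides_primitive c0 pg); exists r.
Qed.

Lemma ufd_poly : ufd {poly A}.
Proof.
have H : forall g, g != 0 -> primitive g ->
   exists u (s : seq {poly A}), [/\ u \is a GRing.unit, forall q, q \in s -> prime_elt q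
                          & g = u * \prod_(q <- s) q].
  move=> g; have [m] := ubnP (size g); elim: m g => // m IH g sm g0 pg.
  case: (leqP (size g) 1) => sg.
    exists g, [::]; split => //; last by rewrite big_nil mulr1.
    rewrite (size1_polyC sg) in pg g0 *; apply: (rmorph_unit (@polyC A)).
    by apply: primitive_const => //; rewrite polyC_eq0 in g0.
  case: (excluded_middle_informative
     (forall a b, g = a * b -> (size a <= 1)%N \/ (size b <= 1)%N)) => [irr|].
    exists 1, [:: g]; split; rewrite ?unitr1 //; last by rewrite big_seq1 mul1r.
    by move=> p; rewrite inE => /eqP->; exact: irreducible_prime.
  move=> nirr; have [a [b [e sa sb]]] : exists a b, [/\ g = a * b, (1 < size a)%N & (1 < size b)%N].
    apply: NNPP => none; apply: nirr => a b e; apply: NNPP => /Classical_Prop.not_or_and[/negP h /negP h'].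
    by apply: none; exists a, b; split; rewrite // ltnNge.
  have a0 : a != 0 by rewrite -size_poly_gt0; lia.
  have b0 : b != 0 by rewrite -size_poly_gt0; lia.
  have se := size_mul a0 b0; rewrite -e in se.
  have [||u [s [uu sp ea]]] := IH a _ a0; [lia | by apply: (@primitive_mul _ b); rewrite -e |].
  have [||v [t [uv tp eb]]] := IH b _ b0; [lia | by apply: (@primitive_mul _ a); rewrite mulrC -e |].
  exists (u * v), (s ++ t); split.
  - by rewrite unitrM uu uv.
  - by move=> p; rewrite mem_cat => /orP[/sp|/tp].
  - by rewrite e ea eb big_cat /=; ring.
move=> f f0; have [c [g [c0 pg ef]]] := primitive_part f0.
have g0 : g != 0 by apply: contraNneq f0 => g0; rewrite ef g0 mulr0.
have [u [s [uu sp eg]]] := H g g0 pg.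
have [v [t [uv tp ec]]] := hufd c0.
exists (v%:P * u), ([seq p%:P | p <- t] ++ s); split.
- by rewrite unitrM uu andbT; exact: (rmorph_unit (@polyC A)).
- move=> p; rewrite mem_cat => /orP[/mapP[q /tp qp ->]|/sp //].
  exact: prime_elt_polyC.
- by rewrite ef eg ec big_cat big_map polyCM rmorph_prod /=; ring.
Qed.

End PolyUFD.

Lemma ufd_iso (A A' : idomainType) (f : {rmorphism A -> A'}) (g : {rmorphism A' -> A}) :
  cancel f g -> cancel g f -> ufd A' -> ufd A.
Proof.
move=> fK gK hu a a0.
have [|u [s [uu sp e]]] := hu (f a).
  by apply: contraNneq a0 => h; rewrite -(fK a) h rmorph0.
exists (g u), (map g s); split; first exact: rmorph_unit.
  move=> _ /mapP[p /sp [p0 up pM] ->]; split.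
  - by apply: contraNneq p0 => h; rewrite -(gK p) h rmorph0.
  - by apply: contra up => h; rewrite -(gK p); exact: rmorph_unit.
  - have tr x : divides p (f x) -> divides (g p) x.
      by case=> c ec; exists (g c); rewrite -rmorphM -ec fK.
    move=> x y [c ec]; have [|h|h] := pM (f x) (f y); [|by left; exact: tr|by right; exact: tr].
    by exists (f c); rewrite -rmorphM ec rmorphM gK.
by rewrite -(fK a) e rmorphM rmorph_prod big_map.
Qed.

Lemma mpoly_rmorph_ext (K : comNzRingType) (n : nat) (S : comNzRingType)
  (f g : {rmorphism {mpoly K[n]} -> S}) :
  (forall c, f c%:MP = g c%:MP) -> (forall i, f 'X_i = g 'X_i) -> f =1 g.
Proof.
move=> hC hX p; rewrite (mpolyE p) !rmorph_sum; apply: eq_bigr => m _.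
rewrite -mul_mpolyC !rmorphM hC; congr (_ * _).
rewrite mpolyXE_id !rmorph_prod; apply: eq_bigr => i _.
by rewrite !rmorphXn hX.
Qed.

Lemma poly_rmorph_ext (K S : nzRingType)
  (f g : {rmorphism {poly K} -> S}) :
  (forall c, f c%:P = g c%:P) -> f 'X = g 'X -> f =1 g.
Proof.
move=> hC hX p; rewrite -(coefK p) poly_def !rmorph_sum; apply: eq_bigr => i _.
by rewrite -mul_polyC !rmorphM hC !rmorphXn hX.
Qed.

(** * Graded polynomial rings and changes of coordinates *)

Section Graded.
Variables (K : comNzRingType) (n : nat) (S : comNzRingType).
Variables (f : {rmorphism K -> S}) (h : 'I_n -> S) (G : nat -> S -> Prop).
Hypotheses (G0 : forall t, G t 0) (GD : forall t x y, G t x -> G t y -> G t (x + y))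
  (GC : forall c, G 0 (f c)) (GX : forall i, G 1%N (h i))
  (GM : forall t u x y, G t x -> G u y -> G (t + u)%N (x * y)).

Lemma mmap_graded t p : p \is t.-homog -> G t (mmap f h p).
Proof.
move=> hp; rewrite /mmap big_seq_cond; apply: (big_ind (G t)) => //; first exact: GD.
move=> m /andP[mp _]; rewrite -[t]add0n; apply: GM => //.
rewrite -(dhomog_mf hp mp) [X in G X _]mdegE /mmap1.
have G1 : G 0 1 by rewrite -(rmorph1 f).
apply: (big_ind2 (fun (x : S) (u : nat) => G u x)) => // [x u y v gx gy|i _].
  exact: GM.
elim: (m i) => [|j IH]; first by rewrite expr0.
by rewrite exprS -add1n; exact: GM.
Qed.
End Graded.

Lemma poly_nonroot (k : closedFieldType) (p : {poly k}) : p != 0 ->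
  exists x, p.[x] != 0.
Proof.
move=> p0; apply: NNPP => none.
have r x : p.[x] = 0 by apply/eqP/negPn/negP => h; apply: none; exists x.
have sp : (1 < size p)%N.
  rewrite ltnNge; apply/negP => s1; move: p0 (r 0).
  by rewrite (size1_polyC s1) hornerC polyC_eq0 => /eqP.
(* If p vanished everywhere, p + 1 would be a nonconstant polynomial without a root. *)
have : size (p + 1) != 1 by rewrite size_polyDl ?size_poly1 //; lia.
by case/closed_rootP=> x; rewrite /root hornerD r add0r hornerC oner_eq0.
Qed.

Lemma fresh_scalar (k : closedFieldType) (s : seq k) : exists x, x \notin s.
Proof.
have [x hx] : exists x, (\prod_(c <- s) ('X - c%:P)).[x] != 0.
  by apply: poly_nonroot; rewrite monic_neq0 // monic_prod_XsubC.
exists x; apply: contra hx => xs.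
by rewrite -/(root _ x) root_prod_XsubC.
Qed.

Lemma mpolyC_homog (K : nzRingType) n (c : K) : (c%:MP : {mpoly K[n]}) \is 0.-homog.
Proof. by rewrite -[c%:MP]mulr1 mul_mpolyC; apply: dhomogZ; exact: dhomog1. Qed.

Section Iso.
Variables (k : closedFieldType) (n : nat).
Notation S := {mpoly k[n]}.
Notation R := {mpoly k[n.+1]}.

(** Homogeneity of total degree t in S[X], with X of degree 1. *)
Definition pgr (t : nat) (P : {poly S}) :=
  forall i, if (i <= t)%N then P`_i \is (t - i).-homog : Prop else P`_i = 0.

Lemma pgr0 t : pgr t 0.
Proof. by move=> i; rewrite coef0; case: ifP => // _; exact: rpred0. Qed.

Lemma pgrD t P Q : pgr t P -> pgr t Q -> pgr t (P + Q).
Proof.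
move=> hP hQ i; have := hP i; have := hQ i; rewrite coefD.
by case: ifP => _ h1 h2; [exact: rpredD | rewrite h1 h2 addr0].
Qed.

Lemma pgrM t u P Q : pgr t P -> pgr u Q -> pgr (t + u) (P * Q).
Proof.
move=> hP hQ i; rewrite coefM.
have key (j : 'I_i.+1) : if (i <= t + u)%N then P`_j * Q`_(i - j) \is (t + u - i).-homog : Prop
    else P`_j * Q`_(i - j) = 0.
  have := hP j; have := hQ (i - j)%N; have := ltn_ord j => ji.
  case: (leqP j t) => jt; last by move=> _ ->; rewrite mul0r; case: ifP => // _; exact: rpred0.
  case: (leqP (i - j) u) => iju; last first.
    by move=> ->; rewrite mulr0; case: ifP => // _; rewrite rpred0.
  move=> h1 h2; have -> : (i <= t + u)%N by lia.
  have -> : (t + u - i = (t - j) + (u - (i - j)))%N by lia.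
  exact: dhomogM.
case: ifP key => _ key; first by apply: rpred_sum.
by rewrite big1.
Qed.

Lemma pgrC t c : c \is t.-homog -> pgr t c%:P.
Proof.
move=> hc i; rewrite coefC; case: (i =P 0%N) => [->|_]; first by rewrite leq0n subn0.
by case: ifP => // _; exact: rpred0.
Qed.

Lemma pgrX : pgr 1 'X.
Proof.
move=> i; rewrite coefX; case: (i =P 1%N) => [->|_] /=; last first.
  by case: ifP => // _; exact: rpred0.
by rewrite subnn; exact: dhomog1.
Qed.

Section Theta.
Variables (a : 'I_n.+1 -> k).

(** The substitution x_j -> x_j + a_j X for the first n variables, and a_n X for the last one. It is
    an isomorphism R -> S[X] when a_n is nonzero; [psi] is the inverse and [wvar] the linear form
    that becomes X. *)
Definition theta_gen (i : 'I_n.+1) : {poly S} :=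
  (if unlift ord_max i is Some j then ('X_j)%:P else 0) + ((a i)%:MP)%:P * 'X.

Definition coord_poly : {rmorphism R -> {poly S}} :=
  (mmap (polyC \o @mpolyC n k) theta_gen : {rmorphism _ -> _}).

Definition emb_gen (j : 'I_n) : R :=
  'X_(lift ord_max j) - (a (lift ord_max j) / a ord_max) *: 'X_ord_max.
Definition emb : {rmorphism S -> R} :=
  (mmap (@mpolyC n.+1 k) emb_gen : {rmorphism _ -> _}).
Definition wvar : R := (a ord_max)^-1 *: 'X_ord_max.
Definition psi : {rmorphism {poly S} -> R} :=
  (horner_eval wvar \o map_poly emb : {rmorphism _ -> _}).

Arguments coord_poly : simpl never.
Arguments emb : simpl never.
Arguments psi : simpl never.

Lemma thetaC c : coord_poly c%:MP = (c%:MP)%:P. Proof. exact: mmapC. Qed.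
Lemma thetaX i : coord_poly 'X_i = theta_gen i.
Proof. by rewrite /coord_poly /= mmapX mmap1U. Qed.
Lemma embC c : emb c%:MP = c%:MP. Proof. exact: mmapC. Qed.
Lemma embX i : emb 'X_i = emb_gen i.
Proof. by rewrite /emb /= mmapX mmap1U. Qed.
Lemma psiC c : psi c%:P = emb c.
Proof. by rewrite /psi /= /horner_eval map_polyC hornerC. Qed.
Lemma psiX : psi 'X = wvar.
Proof. by rewrite /psi /= /horner_eval map_polyX hornerX. Qed.

Hypothesis a0 : a ord_max != 0.

Lemma thetaK : cancel coord_poly psi.
Proof.
move=> p; apply: (@mpoly_rmorph_ext _ _ _ (psi \o coord_poly : {rmorphism _ -> _}) (idfun : {rmorphism _ -> _})) => [c|i].
  by change (psi (coord_poly c%:MP) = c%:MP); rewrite thetaC psiC embC.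
change (psi (coord_poly 'X_i) = 'X_i); rewrite thetaX /theta_gen rmorphD rmorphM psiX psiC embC /wvar mul_mpolyC scalerA.
case: unliftP => [j ->|->].
  by rewrite psiC embX /emb_gen subrK.
by rewrite rmorph0 add0r divff // scale1r.
Qed.

Lemma psiK : cancel psi coord_poly.
Proof.
move=> p; apply: (@poly_rmorph_ext _ _ (coord_poly \o psi : {rmorphism _ -> _}) (idfun : {rmorphism _ -> _})) => [c|]; last first.
  change (coord_poly (psi 'X) = 'X).
  rewrite psiX /wvar -mul_mpolyC rmorphM thetaC thetaX /theta_gen unlift_none add0r mulrA -polyCM.
  by rewrite -mpolyCM mulVf // mul1r.
change (coord_poly (psi c%:P) = c%:P); rewrite psiC.
apply: (@mpoly_rmorph_ext _ _ _ (coord_poly \o emb : {rmorphism _ -> _}) (@polyC _ : {rmorphism _ -> _})) => [d|i].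
  by change (coord_poly (emb d%:MP) = d%:MP%:P); rewrite embC thetaC.
change (coord_poly (emb 'X_i) = ('X_i)%:P).
rewrite embX /emb_gen rmorphB -mul_mpolyC rmorphM !thetaX thetaC /theta_gen liftK unlift_none add0r.
by rewrite mulrA -polyCM -mpolyCM divfK //; ring.
Qed.

Lemma theta_graded t p : p \is t.-homog -> pgr t (coord_poly p).
Proof.
change (p \is t.-homog -> pgr t (mmap (polyC \o @mpolyC n k) theta_gen p)).
apply: (@mmap_graded k n.+1 {poly S} (polyC \o @mpolyC n k : {rmorphism k -> {poly S}}) theta_gen pgr pgr0 pgrD _ _ pgrM).
  by move=> c; apply: (@pgrC 0 c%:MP); exact: mpolyC_homog.
move=> i; rewrite /theta_gen; apply: pgrD.
  case: unliftP => [j _|_]; last exact: pgr0.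
  by apply: pgrC; rewrite dhomogX /= mdeg1.
rewrite -[1%N]add0n; apply: pgrM pgrX; apply: pgrC.
exact: mpolyC_homog.
Qed.

Lemma emb_graded t p : p \is t.-homog -> emb p \is t.-homog.
Proof.
change (p \is t.-homog -> mmap (@mpolyC n.+1 k) emb_gen p \is t.-homog).
apply: (@mmap_graded k n R (@mpolyC n.+1 k : {rmorphism k -> R}) emb_gen (fun t x => x \is t.-homog)).
- by move=> u; exact: rpred0.
- by move=> u x y; exact: rpredD.
- by move=> c; exact: mpolyC_homog.
- by move=> i; apply: rpredB; [|apply: dhomogZ]; rewrite dhomogX /= mdeg1.
- by move=> u v x y; exact: dhomogM.
Qed.

Lemma wvar_homog : wvar \is 1.-homog.
Proof. by apply: dhomogZ; rewrite dhomogX /= mdeg1. Qed.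

Lemma theta_eval b p (c : 'I_n -> k) :
  (map_poly (meval c) (coord_poly p)).[b] =
  p.@[fun i => (if unlift ord_max i is Some j then c j else 0) + a i * b].
Proof.
pose g := (horner_eval b \o map_poly (meval c) \o coord_poly : {rmorphism R -> k}).
apply: (@mpoly_rmorph_ext _ _ _ g (meval _ : {rmorphism _ -> _})) => [d|i] /=.
  by rewrite /horner_eval thetaC map_polyC hornerC mevalC /= mevalC.
change ((map_poly (meval c) (coord_poly 'X_i)).[b] = ('X_i).@[fun i => (if unlift ord_max i is Some j then c j else 0) + a i * b]).
rewrite thetaX mevalXU /theta_gen rmorphD rmorphM /= map_polyX map_polyC /= mevalC.
rewrite hornerD hornerM hornerC hornerX; congr (_ + _).
case: unlift => [j|]; last by rewrite rmorph0 horner0.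
by rewrite map_polyC hornerC /= mevalXU.
Qed.

End Theta.
End Iso.
Arguments coord_poly : simpl never.
Arguments emb : simpl never.
Arguments psi : simpl never.

Section MpolyFacts.
Variable (k : closedFieldType).

Lemma mpoly0_const (p : {mpoly k[0]}) : p = (p@_0)%:MP.
Proof. exact: nvar0_mpolyC. Qed.

Lemma mpolyC_unit n (c : k) : c != 0 -> (c%:MP : {mpoly k[n]}) \is a GRing.unit.
Proof. by move=> c0; apply: rmorph_unit; rewrite unitfE. Qed.

Lemma ufd_mpoly n : ufd {mpoly k[n]}.
Proof.
elim: n => [|n IH].
  move=> p p0; exists p, [::]; split=> //; last by rewrite big_nil mulr1.
  rewrite (mpoly0_const p) mpolyC_unit //; apply: contraNneq p0 => h.
  by rewrite (mpoly0_const p) h.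
pose a := (fun=> 1) : 'I_n.+1 -> k.
have a0 : a ord_max != 0 by rewrite oner_eq0.
exact: (@ufd_iso _ _ (coord_poly a) (psi a) (thetaK a0) (psiK a0) (ufd_poly IH)).
Qed.

Lemma mpoly_nonvanishing n (p : {mpoly k[n]}) : p != 0 -> exists a, p.@[a] != 0.
Proof.
elim: n p => [|n IH] p p0.
  exists (fun=> 0); rewrite (mpoly0_const p) mevalC; apply: contraNneq p0 => h.
  by rewrite (mpoly0_const p) h.
pose a := (fun i : 'I_n.+1 => (i == ord_max)%:R : k).
have a0 : a ord_max != 0 by rewrite /a eqxx oner_eq0.
have tp : coord_poly a p != 0.
  by apply: contraNneq p0 => h; rewrite -(thetaK a0 p) h rmorph0.
have [c hc] := IH (lead_coef (coord_poly a p)) (ltac:(by rewrite lead_coef_eq0)).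
have [|b hb] := @poly_nonroot k (map_poly (meval c) (coord_poly a p)).
  apply: contraNneq hc => h; rewrite lead_coefE.
  have := congr1 (fun q : {poly k} => q`_(size (coord_poly a p)).-1) h.
  by rewrite coef_map coef0 /= => ->.
by rewrite theta_eval in hb; eexists; exact: hb.
Qed.

Lemma homog0_const n (p : {mpoly k[n]}) : p \is 0.-homog -> p = (p@_0)%:MP.
Proof.
move=> hp; apply/mpolyP => m; rewrite mcoeffC.
case: (altP (m =P 0%MM)) => [->|m0]; first by rewrite mulr1.
by rewrite mulr0 (dhomog_nemf_coeff hp) // mdeg_eq0.
Qed.

Lemma meval0_homog n t (p : {mpoly k[n]}) : p \is t.-homog -> (0 < t)%N ->
  p.@[fun=> 0] = 0.
Proof.
move=> hp t0; rewrite mevalE big_seq big1 // => m mp.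
have : mdeg m != 0%N by rewrite (dhomog_mf hp mp) -lt0n.
rewrite mdeg_eq0 => /eqP hm.
have [i mi] : exists i, m i != 0%N.
  apply: NNPP => none; apply: hm; apply/mnmP => i; rewrite mnm0E.
  by apply/eqP/negPn/negP => h; apply: none; exists i.
by rewrite (bigD1 i) //= expr0n (negbTE mi) mul0r mulr0.
Qed.

(** Setting the variables of S to 0 and X to 1 turns the image of p into p(a). By homogeneity every
    coefficient other than that of X^t has positive degree and vanishes there. *)
Lemma theta_top n (a : 'I_n.+1 -> k) t (p : {mpoly k[n.+1]}) :
  p \is t.-homog -> (coord_poly a p)`_t = (p.@[a])%:MP.
Proof.
move=> hp; have hg := theta_graded a hp.
have := hg t; rewrite leqnn subnn => /homog0_const e; rewrite e; congr (_%:MP).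
have := theta_eval a 1 p (fun=> 0).
rewrite [in RHS](@meval_eq _ _ _ a); last by move=> i; case: unlift => [_|]; rewrite add0r mulr1.
move=> <-; rewrite (@horner_coef_wide _ t.+1); last first.
  apply/leq_sizeP => i ti; rewrite coef_map /=.
  by have := hg i; rewrite leqNgt ti /= => ->; rewrite meval0.
rewrite big_ord_recr big1 /= => [|i _].
  by rewrite add0r coef_map /= expr1n mulr1 e mevalC mcoeffC eqxx mulr1.
rewrite coef_map /= expr1n mulr1.
have := hg i; rewrite ltnW // => h; apply: (meval0_homog h); have := ltn_ord i; lia.
Qed.

Lemma pihomog_sum n (p : {mpoly k[n]}) :
  p = \sum_(t < msize p) pihomog mdeg t p.
Proof. by rewrite -pihomog_partitionE. Qed.

(** Any point a at which neither the top form of g nor the last variable vanishes will do: by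
    [theta_top] the value of the top form at a becomes the leading coefficient in X. *)
Lemma monic_coordinates n (g : {mpoly k[n.+1]}) : g != 0 ->
  exists (a : 'I_n.+1 -> k) (c : k), [/\ a ord_max != 0, c != 0,
    lead_coef (coord_poly a g) = c%:MP & size (coord_poly a g) = msize g].
Proof.
move=> g0; have sg : msize g = (msize g).-1.+1 by rewrite mpolySpred.
set D := (msize g).-1 in sg.
have e := pihomog_sum g; rewrite sg big_ord_recr /= in e.
have gD : pihomog mdeg D g != 0.
  apply/eqP => h; have := mlead_supp g0; rewrite mcoeff_msupp => /eqP; apply.
  have -> : g@_(mlead g) = (pihomog mdeg D g)@_(mlead g); last by rewrite h mcoeff0.
  rewrite [X in X@__ = _]e mcoeffD raddf_sum /= big1 ?add0r // => i _.
  apply: (dhomog_nemf_coeff (pihomogP _ _ _)).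
  have e2 : mdeg (mlead g) = D by have := mlead_deg g0; rewrite sg => -[].
  by rewrite /= e2; have := ltn_ord i; lia.
have [|a] := @mpoly_nonvanishing _ (pihomog mdeg D g * 'X_ord_max).
  by rewrite mulf_neq0 // -msize_poly_eq0 msizeX.
rewrite mevalM mevalXU mulf_eq0 negb_or => /andP[c0 a0].
exists a, ((pihomog mdeg D g).@[a]).
have cD : (coord_poly a g)`_D = ((pihomog mdeg D g).@[a])%:MP.
  rewrite [X in coord_poly a X]e rmorphD rmorph_sum coefD coef_sum big1 ?add0r.
    by rewrite theta_top //; exact: pihomogP.
  move=> i _; have := theta_graded a (pihomogP mdeg i g) D.
  by rewrite leqNgt ltn_ord /=.
have s1 : (size (coord_poly a g) <= D.+1)%N.
  apply/leq_sizeP => j Dj; rewrite (pihomog_sum g) sg rmorph_sum coef_sum big1 // => i _.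
  have := theta_graded a (pihomogP mdeg i g) j.
  by have -> : (j <= i)%N = false by have := ltn_ord i; lia.
have s2 : size (coord_poly a g) = D.+1.
  apply/eqP; rewrite eqn_leq s1 ltnNge; apply/negP => s.
  by move: cD; rewrite nth_default // => /esym/eqP; rewrite mpolyC_eq0 (negbTE c0).
by split; rewrite // ?lead_coefE s2 // -sg.
Qed.

End MpolyFacts.

(** Modulo I, a multiple of a polynomial H with unit leading coefficient cannot have degree below
    that of H unless the cofactor is 0; the coefficients of Q are treated from the top down. *)
Lemma coef_ideal_monic (A : comUnitRingType) (I : A -> Prop) (H Q : {poly A}) :
  is_ideal I -> lead_coef H \is a GRing.unit ->
  (forall i, ((size H).-1 <= i)%N -> I (H * Q)`_i) -> forall i, I Q`_i.
Proof.
move=> hI uH hHQ i; have [N] := ubnP (size Q - i); elim: N i => // N IH i hN.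
case: (leqP (size Q) i) => hi; first by rewrite nth_default //; exact: ideal0.
pose d := (size H).-1; rewrite -/d in hHQ.
have := hHQ (d + i)%N (leq_addr _ _); rewrite coefM.
have hd : (d < (d + i).+1)%N by lia.
rewrite (bigD1 (Ordinal hd)) //= addKn addrC => h.
suff : I (H`_d * Q`_i).
  move=> /(idealM ((lead_coef H)^-1) hI); rewrite mulrA lead_coefE -/d mulVr ?mul1r //.
apply: (idealDl hI _ h); apply: ideal_sum => // l; rewrite -val_eqE /= => ld.
case: (ltnP l d) => hl; first by apply: idealM => //; apply: IH; lia.
rewrite [H`_l]nth_default ?mul0r; first exact: ideal0.
have : (d < l)%N by rewrite ltn_neqAle eq_sym ld hl.
by apply: leq_trans; rewrite /d; exact: leqSpred.
Qed.

Lemma poly_unit_lead_div (A : idomainType) (H P : {poly A}) :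
  lead_coef H \is a GRing.unit ->
  exists Q r, P = Q * H + r /\ (size r < size H)%N.
Proof.
move=> uH; have H0 : H != 0 by rewrite -lead_coef_eq0; apply: contraTneq uH => ->; rewrite unitr0.
exists (P %/ H), (P %% H); split; last by rewrite ltn_modp.
exact: Pdiv.IdomainUnit.divp_eq.
Qed.

Lemma mulr_sub_split (A : comNzRingType) (z a x y : A) :
  z * x - a * y = x * (z - a) + a * (x - y).
Proof. ring. Qed.

Lemma remainder_split (A : comNzRingType) (P Q H r X T : A) :
  P * (Q * H + r) = X * H + T -> P * r = H * (X - P * Q) + T.
Proof.
move=> e; transitivity (P * (Q * H + r) - P * Q * H); first by ring.
by rewrite e; ring.
Qed.

Lemma bezout_shift (A : comNzRingType) (u v p q x : A) :
  u * p + v * (q + p * x) = (u + v * x) * p + v * q.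
Proof. ring. Qed.

(** * Coordinates R = B[z, w] adapted to a coprime pair *)

Section Frame.
Variables (k : closedFieldType) (m : nat).
Notation B := {mpoly k[m]}.
Notation S := {mpoly k[m.+1]}.
Notation R := {mpoly k[m.+2]}.
Variables (a1 : 'I_m.+2 -> k) (a2 : 'I_m.+1 -> k).
Hypotheses (a10 : a1 ord_max != 0) (a20 : a2 ord_max != 0).

(** Two successive coordinate changes, R = S[w] and S = B[z]. [point a c] is the map of B-algebras R
    -> B with z -> a and w -> c. *)
Definition base : {rmorphism B -> R} := (emb a1 \o emb a2 : {rmorphism _ -> _}).
Definition zfr : R := emb a1 (wvar a2).
Definition wfr : R := wvar a1.
Definition point (a c : B) : {rmorphism R -> B} :=
  (horner_eval c \o map_poly (horner_eval a \o coord_poly a2) \o coord_poly a1 : {rmorphism _ -> _}).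
Arguments base : simpl never.
Arguments point : simpl never.

Lemma baseC c : base c%:MP = c%:MP.
Proof. by change (emb a1 (emb a2 c%:MP) = c%:MP); rewrite !embC. Qed.

Lemma baseE b : base b = emb a1 (emb a2 b). Proof. by []. Qed.

Lemma base_graded t b : b \is t.-homog -> base b \is t.-homog.
Proof. by move=> hb; rewrite baseE; do 2!apply: emb_graded. Qed.

Lemma zfr_homog : zfr \is 1.-homog.
Proof. by apply: emb_graded; exact: wvar_homog. Qed.

Lemma wfr_homog : wfr \is 1.-homog. Proof. exact: wvar_homog. Qed.

Lemma theta_emb n (a : 'I_n.+1 -> k) b : a ord_max != 0 -> coord_poly a (emb a b) = b%:P.
Proof. by move=> a0; rewrite -psiC psiK. Qed.

Lemma theta_wvar n (a : 'I_n.+1 -> k) : a ord_max != 0 -> coord_poly a (wvar a) = 'X.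
Proof. by move=> a0; rewrite -psiX psiK. Qed.

Lemma pointE a c g : point a c g = (map_poly (horner_eval a \o coord_poly a2) (coord_poly a1 g)).[c].
Proof. by []. Qed.

Lemma point_base a c b : point a c (base b) = b.
Proof.
rewrite pointE baseE theta_emb // map_polyC hornerC /= theta_emb //.
by rewrite /horner_eval hornerC.
Qed.

Lemma point_z a c : point a c zfr = a.
Proof.
by rewrite pointE /zfr theta_emb // map_polyC hornerC /= theta_wvar // /horner_eval hornerX.
Qed.

Lemma point_w a c : point a c wfr = c.
Proof. by rewrite pointE /wfr theta_wvar // map_polyX hornerX. Qed.

Lemma base_inj : injective base.
Proof. by move=> b c h; rewrite -(point_base 0 0 b) h point_base. Qed.

Lemma base_eq0 b : base b = 0 -> b = 0.
Proof. by move=> h; apply: base_inj; rewrite h rmorph0. Qed.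

Lemma psiE n (a : 'I_n.+1 -> k) P : psi a P = \sum_(i < size P) emb a P`_i * wvar a ^+ i.
Proof.
rewrite /psi /= /horner_eval.
change ((map_poly (emb a) P).[wvar a] = \sum_(i < size P) emb a P`_i * wvar a ^+ i).
rewrite horner_poly.
by apply: eq_bigr => i _.
Qed.

Lemma frame_expand g : g = \sum_(i < size (coord_poly a1 g))
  \sum_(j < size (coord_poly a2 (coord_poly a1 g)`_i))
    base (coord_poly a2 (coord_poly a1 g)`_i)`_j * zfr ^+ j * wfr ^+ i.
Proof.
rewrite -[LHS](thetaK a10) psiE; apply: eq_bigr => i _.
rewrite -{1}[(coord_poly a1 g)`_i](thetaK a20) psiE rmorph_sum mulr_suml.
by apply: eq_bigr => j _; rewrite rmorphM rmorphXn.
Qed.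

Lemma frame_ind (P : R -> Prop) :
  (forall b, P (base b)) -> (forall x y, P x -> P y -> P (x + y)) ->
  (forall x, P x -> P (zfr * x)) -> (forall x, P x -> P (wfr * x)) -> forall g, P g.
Proof.
move=> PB PD Pz Pw g; rewrite (frame_expand g).
have P0 : P 0 by rewrite -(rmorph0 base).
have key b (i j : nat) : P (base b * zfr ^+ j * wfr ^+ i).
  rewrite mulrC; elim: i => [|l IH].
    rewrite expr0 mul1r mulrC; elim: j => [|l IH]; first by rewrite expr0 mul1r.
    by rewrite exprS -mulrA; exact: Pz.
  by rewrite exprS -mulrA; exact: Pw.
by apply: (big_ind P) => // i _; apply: (big_ind P) => // j _.
Qed.

Section Pair.
Variables (h1 h2 u v : R) (rho : S) (c1 c2 : k).
Hypotheses (c10 : c1 != 0) (c20 : c2 != 0).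
Hypotheses (lh1 : lead_coef (coord_poly a1 h1) = c1%:MP) (lrho : lead_coef (coord_poly a2 rho) = c2%:MP).
Hypothesis (erho : emb a1 rho = u * h1 + v * h2).

Definition pairI (g : R) := exists x y, g = x * h1 + y * h2.

Lemma pairI_ideal : is_ideal pairI.
Proof.
split; first by exists 0, 0; rewrite !mul0r addr0.
move=> a _ _ [x [y ->]] [x' [y' ->]]; exists (a * x + x'), (a * y + y'); ring.
Qed.

Lemma pairI1 : pairI h1. Proof. by exists 1, 0; ring. Qed.
Lemma pairI2 : pairI h2. Proof. by exists 0, 1; ring. Qed.

(* The extension to R of an ideal of B, read off the coordinates over B. *)
Definition ext (b : B -> Prop) (g : R) := forall i j, b (coord_poly a2 (coord_poly a1 g)`_i)`_j.
Definition ext1 (b : B -> Prop) (s : S) := forall j, b (coord_poly a2 s)`_j.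

Lemma ext1_ideal b : is_ideal b -> is_ideal (ext1 b).
Proof.
move=> hb; split=> [j|a s t hs ht j]; first by rewrite rmorph0 coef0; exact: ideal0.
rewrite rmorphD rmorphM coefD; apply: (idealD hb _ (ht j)); rewrite coefM.
by apply: (ideal_sum _ hb) => i _; exact: (idealM _ hb (hs _)).
Qed.

Lemma ext_ideal b : is_ideal b -> is_ideal (ext b).
Proof.
move=> hb; have hb1 := ext1_ideal hb.
have E g : ext b g <-> forall i, ext1 b (coord_poly a1 g)`_i by [].
split=> [|a s t /E hs /E ht]; apply/E => i; first by rewrite rmorph0 coef0; exact: ideal0.
rewrite rmorphD rmorphM coefD; apply: (idealD hb1 _ (ht i)); rewrite coefM.
by apply: (ideal_sum _ hb1) => j _; exact: (idealM _ hb1 (hs _)).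
Qed.

Lemma ext_base b c : is_ideal b -> b c -> ext b (base c).
Proof.
move=> hb bc i j; rewrite baseE theta_emb // coefC; case: eqP => _.
  by rewrite theta_emb // coefC; case: eqP => // _; exact: ideal0.
by rewrite rmorph0 coef0; exact: ideal0.
Qed.

Lemma ext_base_mul c g i j :
  (coord_poly a2 (coord_poly a1 (base c * g))`_i)`_j = c * (coord_poly a2 (coord_poly a1 g)`_i)`_j.
Proof.
by rewrite rmorphM baseE theta_emb // coefCM rmorphM theta_emb // coefCM.
Qed.

(** h1 is monic in w up to a scalar, so it can be cancelled modulo the extension of any ideal of
    B. *)
Lemma pair_reg1 b g : is_ideal b -> ext b (h1 * g) -> ext b g.
Proof.
move=> hb h; apply: (coef_ideal_monic (ext1_ideal hb) (H := coord_poly a1 h1)) => [|i _].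
  by rewrite lh1 mpolyC_unit.
by rewrite -rmorphM; exact: h.
Qed.

Lemma rho_reg b s : is_ideal b -> ext1 b (rho * s) -> ext1 b s.
Proof.
move=> hb h; apply: (coef_ideal_monic hb (H := coord_poly a2 rho)) => [|i _].
  by rewrite lrho mpolyC_unit.
by rewrite -rmorphM; exact: h.
Qed.

(** h2 is regular modulo h1 and the extension of b. With r the remainder of g by h1 in w, [rho * r]
    is a multiple of h1 modulo b R and has smaller degree in w, so it is 0 modulo b R; rho is monic
    in z up to a scalar and can be cancelled. *)
Lemma pair_reg2 b q t g : is_ideal b -> ext b t -> h2 * g = q * h1 + t ->
  exists q' t', ext b t' /\ g = q' * h1 + t'.
Proof.
move=> hb ht e; have hb1 := ext1_ideal hb.
have uH : lead_coef (coord_poly a1 h1) \is a GRing.unit by rewrite lh1 mpolyC_unit.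
have [Q [r [eQ sr]]] := poly_unit_lead_div (coord_poly a1 g) uH.
exists (psi a1 Q), (psi a1 r); split; last first.
  by rewrite -[g](thetaK a10) eQ rmorphD rmorphM thetaK.
have e2 : rho%:P * r = coord_poly a1 h1 * (coord_poly a1 (u * g + v * q) - rho%:P * Q) + coord_poly a1 (v * t).
  have : emb a1 rho * g = (u * g + v * q) * h1 + v * t.
    rewrite erho; transitivity (u * g * h1 + v * (h2 * g)); first ring.
    by rewrite e; ring.
  move/(congr1 (coord_poly a1)); rewrite rmorphM theta_emb // eQ rmorphD rmorphM => e3.
  exact: remainder_split e3.
set Q2 := (_ - _) in e2.
have hvt : forall i, ext1 b (coord_poly a1 (v * t))`_i.
  by move=> i j; apply: (idealM _ (ext_ideal hb) ht).
have hQ2 : forall i, ext1 b Q2`_i.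
  apply: (coef_ideal_monic hb1 uH) => i hi.
  have -> : (coord_poly a1 h1 * Q2)`_i = - (coord_poly a1 (v * t))`_i.
    have := congr1 (fun P : {poly S} => P`_i) e2; rewrite /= coefCM coefD.
    rewrite nth_default ?mulr0; first by move/esym/eqP; rewrite addr_eq0 => /eqP.
    by apply: leq_trans hi; move: sr; case: (size (coord_poly a1 h1)) => [|s]; rewrite ?ltn0 ?ltnS.
  exact: (idealN hb1 (hvt i)).
move=> i; rewrite psiK //; apply: rho_reg => //.
have := congr1 (fun P : {poly S} => P`_i) e2; rewrite /= coefCM coefD => ->.
apply: (idealD hb1 _ (hvt i)); rewrite coefM.
by apply: (ideal_sum _ hb1) => l _; exact: (idealM _ hb1 (hQ2 _)).
Qed.

Lemma ext_divides b t : ext (divides b) t -> exists t', t = base b * t'.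
Proof.
move=> h; suff [Q eQ] : divides (emb a2 b)%:P (coord_poly a1 t).
  exists (psi a1 Q); rewrite -[t](thetaK a10) eQ rmorphM psiC mulrC; by [].
apply/divides_polyC => i; suff [Q eQ] : divides b%:P (coord_poly a2 (coord_poly a1 t)`_i).
  by exists (psi a2 Q); rewrite -[LHS](thetaK a20) eQ rmorphM psiC.
by apply/divides_polyC => j; exact: h.
Qed.

Lemma base_ext_divides b t : ext (divides b) (base b * t).
Proof.
by move=> i j; rewrite ext_base_mul; exists (coord_poly a2 (coord_poly a1 t)`_i)`_j; rewrite mulrC.
Qed.

(** The two regularity lemmas, applied to the ideal generated by b, change x h1 + y h2 = b g by a
    Koszul relation into one whose coefficients are divisible by b. *)
Lemma pair_torsion_free b g : b != 0 -> pairI (base b * g) -> pairI g.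
Proof.
move=> b0 [x [y e]]; have hb := divides_ideal b.
have base0 : base b != 0 by apply/eqP => /base_eq0 /eqP; rewrite (negbTE b0).
have e1 : h2 * y = (- x) * h1 + base b * g by rewrite e; ring.
have [q [t [ht ey]]] := pair_reg2 hb (base_ext_divides b g) e1.
have [t' et] := ext_divides ht.
have e2 : h1 * (x + q * h2) = base b * (g - t' * h2).
  rewrite mulrBr e ey et; ring.
have [s es] : exists s, x + q * h2 = base b * s.
  by apply: ext_divides; apply: (pair_reg1 hb); rewrite e2; exact: base_ext_divides.
exists s, t'; apply: (mulfI base0).
transitivity (h1 * (x + q * h2) + base b * (t' * h2)); first by rewrite e2; ring.
by rewrite es; ring.
Qed.

(** Division by h1 in w, then of each coefficient by rho in z. *)
Lemma pair_finite g : exists b : nat -> nat -> B,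
  pairI (g - \sum_(i < size (coord_poly a1 h1)) \sum_(j < size (coord_poly a2 rho))
                base (b i j) * (zfr ^+ j * wfr ^+ i)).
Proof.
have hI := pairI_ideal.
have uH : lead_coef (coord_poly a1 h1) \is a GRing.unit by rewrite lh1 mpolyC_unit.
have uR : lead_coef (coord_poly a2 rho) \is a GRing.unit by rewrite lrho mpolyC_unit.
have [Q [r [eQ sr]]] := poly_unit_lead_div (coord_poly a1 g) uH.
have [q hq] : exists q : nat -> {poly B}, forall i, (size (q i) < size (coord_poly a2 rho))%N /\
    exists s, r`_i = s * rho + psi a2 (q i).
  apply: (@choice_fun nat {poly B} (fun i q => (size q < size (coord_poly a2 rho))%N /\
    exists s, r`_i = s * rho + psi a2 q)) => i.
  have [Q' [r' [e' s']]] := poly_unit_lead_div (coord_poly a2 r`_i) uR.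
  by exists r'; split=> //; exists (psi a2 Q'); rewrite -[LHS](thetaK a20) e' rmorphD rmorphM thetaK.
exists (fun i j => (q i)`_j).
have -> : g = psi a1 Q * h1 + psi a1 r by rewrite -[LHS](thetaK a10) eQ rmorphD rmorphM thetaK.
rewrite -addrA; apply: (idealD hI (idealM _ hI pairI1)).
rewrite (_ : psi a1 r = \sum_(i < size (coord_poly a1 h1)) emb a1 r`_i * wfr ^+ i); last first.
  rewrite psiE (big_ord_widen _ (fun i => emb a1 r`_i * wvar a1 ^+ i) (ltnW sr)).
  rewrite big_mkcond; apply: eq_bigr => i _; case: ltnP => // hi.
  by rewrite nth_default // rmorph0 mul0r.
rewrite -sumrB; apply: (ideal_sum _ hI) => i _; have [sq [s ->]] := hq i.
rewrite rmorphD rmorphM erho mulrDl -addrA; apply: (idealD hI).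
  have h : pairI (u * h1 + v * h2) by exists u, v.
  exact: (ideal_mulr _ hI (idealM _ hI h)).
have -> : \sum_(j < size (coord_poly a2 rho)) base (q i)`_j * (zfr ^+ j * wfr ^+ i) =
    emb a1 (psi a2 (q i)) * wfr ^+ i.
  rewrite (psiE a2) rmorph_sum mulr_suml.
  rewrite [RHS](big_ord_widen _ (fun j => emb a1 (emb a2 (q i)`_j * wvar a2 ^+ j) * wfr ^+ i) (ltnW sq)).
  rewrite [RHS]big_mkcond; apply: eq_bigr => j _; case: ltnP => hj.
    by rewrite rmorphM rmorphXn mulrA.
  by rewrite nth_default // rmorph0 mul0r.
rewrite subrr; exact: ideal0.
Qed.

End Pair.
End Frame.

(** Coprimality makes the resultant of h1 and h2 with respect to w nonzero. It lies in (h1, h2), and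
    a second change of coordinates makes it monic in z up to a scalar. *)
Lemma pair_frame (k : closedFieldType) m (h1 h2 : {mpoly k[m.+2]}) :
  h1 != 0 -> (1 < msize h1)%N -> cop (fun b : bool => if b then h1 else h2) ->
  exists (a1 : 'I_m.+2 -> k) (a2 : 'I_m.+1 -> k) u v rho (c1 c2 : k), [/\ a1 ord_max != 0, a2 ord_max != 0, c1 != 0 & c2 != 0] /\
    [/\ lead_coef (coord_poly a1 h1) = c1%:MP, lead_coef (coord_poly a2 rho) = c2%:MP
      & emb a1 rho = u * h1 + v * h2].
Proof.
move=> h10 sh1 cop12.
have [a1 [c1 [a10 c10 lh1 sth]]] := monic_coordinates h10.
(* Adding a multiple of p leaves the ideal unchanged and makes q nonconstant in X even when h2 is
   not, as [resultant_in_ideal] demands. *)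
set p := coord_poly a1 h1 in lh1 sth; set q := coord_poly a1 h2 + p * 'X^(size (coord_poly a1 h2)).
have p0 : p != 0 by rewrite -size_poly_gt0 sth; exact: ltnW.
have ufdS := @ufd_mpoly k m.+1; have ufdR := @ufd_mpoly k m.+2.
have gpq : (size (gcdp p q) <= 1)%N.
  rewrite leqNgt; apply/negP => sg; set g := gcdp p q in sg.
  have g0 : g != 0 by rewrite gcdp_eq0 negb_and p0.
  have [c [g' [c0 pg eg]]] := primitive_part ufdS g0.
  have dv f : g %| f -> divides g' f.
    move/Pdiv.Idomain.dvdpP=> [[c' r] /= c'0 e]; apply: (divides_primitive ufdS c'0 pg).
    by rewrite e eg mulrA; exact/divides_mull/divides_refl.
  have dp := dv _ (dvdp_gcdl p q).
  have dq : divides g' (coord_poly a1 h2).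
    have := dv _ (dvdp_gcdr p q); rewrite /q addrC => h.
    by apply: (idealDl (divides_ideal g') _ h); exact: divides_mulr.
  have sg' : (1 < size g')%N by move: sg; rewrite eg mul_polyC size_scale.
  have g'0 : g' != 0 by rewrite -size_poly_gt0; exact: ltnW.
  have [||pi ppi dpi] := @ufd_prime_factor _ ufdR (psi a1 g').
  - by apply: contraNneq g'0 => h; rewrite -(psiK a10 g') h rmorph0.
  - apply/negP => /(rmorph_unit (coord_poly a1)); rewrite psiK // poly_unitE => /andP[/eqP s1 _]; by rewrite s1 in sg'.
  have dR f : divides g' (coord_poly a1 f) -> divides pi f.
    case=> r er; rewrite -[f](thetaK a10) er rmorphM; exact: divides_mull.
  by apply: (cop12 pi ppi) => -[]; [exact: (dR _ dp) | exact: (dR _ dq)].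
have res0 : resultant p q != 0 by rewrite resultant_eq0 ltnNge gpq.
have sp : (1 < size p)%N by rewrite sth.
have sq : (1 < size q)%N.
  have sX : size (p * 'X^(size (coord_poly a1 h2))) = (size (coord_poly a1 h2) + size p)%N.
    exact: size_mulXn.
  by rewrite /q addrC size_polyDl sX; lia.
have [[uu vv] /= _ e] := resultant_in_ideal sp sq.
have [a2 [c2 [a20 c20 lr _]]] := monic_coordinates res0.
exists a1, a2, (psi a1 (uu + vv * 'X^(size (coord_poly a1 h2)))), (psi a1 vv), (resultant p q), c1, c2.
split=> //; split=> //.
transitivity (psi a1 ((uu + vv * 'X^(size (coord_poly a1 h2))) * p + vv * coord_poly a1 h2)).
  by rewrite -psiC e /q; congr (psi a1 _); exact: bezout_shift.
rewrite [LHS](rmorphD (psi a1)); congr (_ + _); rewrite [LHS](rmorphM (psi a1));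
  congr (_ * _); exact: thetaK.
Qed.

Notation hpart t p := (pihomog mdeg t p).

Section Hpart.
Variables (k : closedFieldType) (n : nat).
Notation R := {mpoly k[n]}.
Implicit Types (g h x : R) (I : R -> Prop).

Lemma hpart_homog t g : hpart t g \is t.-homog. Proof. exact: pihomogP. Qed.

Lemma hpart_id t g : g \is t.-homog -> hpart t g = g. Proof. exact: pihomog_dE. Qed.

Lemma hpart_ne t u g : g \is u.-homog -> u != t -> hpart t g = 0.
Proof. by move=> hg ut; apply: (pihomog_ne0 ut hg). Qed.

Lemma hpart_large t g : (msize g <= t)%N -> hpart t g = 0.
Proof.
move=> gt; rewrite pihomogE big_seq_cond big1 // => m /andP[mg /eqP mt].
by have := msize_mdeg_lt mg; rewrite mt ltnNge gt.
Qed.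

Lemma hpart_sumw N g : (msize g <= N)%N -> g = \sum_(t < N) hpart t g.
Proof.
move=> gN; rewrite {1}(pihomog_sum g).
rewrite (big_ord_widen _ (fun t => hpart t g) gN) big_mkcond; apply: eq_bigr => i _.
by case: ltnP => // h; rewrite hpart_large.
Qed.

Lemma hpart_sum t (T : Type) (r : seq T) (P : pred T) (F : T -> R) :
  hpart t (\sum_(i <- r | P i) F i) = \sum_(i <- r | P i) hpart t (F i).
Proof. exact: raddf_sum. Qed.

Lemma hpart_mul j t g h : h \is j.-homog ->
  hpart t (h * g) = if (j <= t)%N then h * hpart (t - j) g else 0.
Proof.
move=> hh; rewrite {1}(pihomog_sum g) mulr_sumr hpart_sum.
have key i : hpart t (h * hpart i g) = if (j + i == t)%N then h * hpart i g else 0.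
  have hi := dhomogM hh (hpart_homog i g).
  case: eqP => [<-|/eqP ne]; [exact: hpart_id | exact: (hpart_ne hi)].
under eq_bigr => i _ do rewrite key.
case: leqP => jt; last by rewrite big1 // => i _; case: eqP => //; lia.
have [lt|ge] := ltnP (t - j) (msize g); last first.
  rewrite hpart_large // mulr0 big1 // => i _; case: eqP => // e; have := ltn_ord i; lia.
rewrite (bigD1 (Ordinal lt)) //= subnKC // eqxx big1 ?addr0 // => i.
by rewrite -val_eqE /= => ne; case: eqP => //; lia.
Qed.

Lemma homog_factor j t g h : h != 0 -> h \is j.-homog -> h * g \is t.-homog ->
  if (j <= t)%N then g \is (t - j).-homog : Prop else g = 0.
Proof.
move=> h0 hh hgh.
have : hpart t (h * g) = h * g by exact: hpart_id.
rewrite (hpart_mul _ _ hh); case: leqP => jt.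
  by move/(mulfI h0) => <-; exact: hpart_homog.
by move/esym/eqP; rewrite mulf_eq0 (negbTE h0) => /eqP.
Qed.

Lemma homog_eq0 t u g : g \is t.-homog -> g \is u.-homog -> t != u -> g = 0.
Proof. by move=> ht hu tu; rewrite -(hpart_id hu) (hpart_ne ht). Qed.

(** In a domain the product of the lowest parts and the product of the highest parts both survive in
    g h; as g h is homogeneous, lowest and highest degrees agree in each factor. *)
Lemma homog_prod_factor t g h : g != 0 -> h != 0 -> g * h \is t.-homog ->
  exists i j, [/\ g \is i.-homog, h \is j.-homog & (i + j = t)%N].
Proof.
move=> g0 h0 hgh.
have low x : x != 0 -> exists i, hpart i x != 0 /\ forall l, (l < i)%N -> hpart l x = 0.
  move=> x0; have [|i [ei li]] := @nat_least (fun i => hpart i x != 0).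
    apply: NNPP => none; case/eqP: x0; rewrite (pihomog_sum x) big1 // => i _.
    by apply/eqP/negPn/negP => hi; apply: none; exists i.
  by exists i; split=> // l /li; move/negP/negPn/eqP.
have high x : x != 0 -> exists i, hpart i x != 0 /\ forall l, (i < l)%N -> hpart l x = 0.
  move=> x0; have [|i [ei li]] := @nat_least (fun i => hpart (msize x - i) x != 0).
    apply: NNPP => none; case/eqP: x0; rewrite (pihomog_sum x) big1 // => i _.
    apply/eqP/negPn/negP => hi; apply: none; exists (msize x - i)%N.
    by rewrite subKn // ltnW.
  exists (msize x - i)%N; split=> // l il.
  case: (leqP (msize x) l) => xl; first exact: hpart_large.
  have /li : (msize x - l < i)%N by lia.
  by rewrite subKn ?(ltnW xl) // => /negP/negPn/eqP.
have part x y t' : hpart t' (x * y) =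
    \sum_(i < (msize x)) if (i <= t')%N then hpart i x * hpart (t' - i) y else 0.
  rewrite {1}(pihomog_sum x) mulr_suml hpart_sum; apply: eq_bigr => i _.
  by rewrite (hpart_mul _ _ (hpart_homog i x)).
have ltms i x : hpart i x != 0 -> (i < msize x)%N.
  by move=> h'; rewrite ltnNge; apply: contra h' => /hpart_large ->.
have mulE i j : hpart i g != 0 -> hpart j h != 0 ->
    (forall l, (l < msize g)%N -> l != i -> (l <= i + j)%N -> hpart l g * hpart (i + j - l) h = 0) -> (i + j = t)%N.
  move=> gi hj z; have : hpart (i + j) (g * h) != 0.
    rewrite part (bigD1 (Ordinal (ltms _ _ gi))) //= leq_addr addKn big1 ?addr0 ?mulf_neq0 //.
    by move=> l; rewrite -val_eqE /= => li; case: leqP => // lij; apply: z.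
  by move=> nz; apply/eqP; rewrite eq_sym; apply: contraNT nz => ne; rewrite (hpart_ne hgh) // eq_sym.
have [i [gi li]] := low g g0; have [j [hj lj]] := low h h0.
have [i' [gi' ui]] := high g g0; have [j' [hj' uj]] := high h h0.
have e1 : (i + j = t)%N.
  apply: mulE => // l _ ne lij; case: (ltnP l i) => h'; first by rewrite li ?mul0r.
  by rewrite lj ?mulr0 //; lia.
have e2 : (i' + j' = t)%N.
  apply: mulE => // l _ ne lij; case: (ltnP i' l) => h'; first by rewrite ui ?mul0r.
  by rewrite uj ?mulr0 //; lia.
have ii' : (i <= i')%N by rewrite leqNgt; apply/negP => /ui /eqP; rewrite (negbTE gi).
have jj' : (j <= j')%N by rewrite leqNgt; apply/negP => /uj /eqP; rewrite (negbTE hj).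
have one x l : (forall s, (s < l)%N -> hpart s x = 0) -> (forall s, (l < s)%N -> hpart s x = 0) ->
    x \is l.-homog.
  move=> a b; rewrite (pihomog_sum x); apply: rpred_sum => s _.
  case: (ltngtP s l) => [h'|h'|<-]; last exact: hpart_homog.
    by rewrite a //; exact: rpred0.
  by rewrite b //; exact: rpred0.
exists i, j; split=> //; apply: one => // s h'; [apply: ui | apply: uj]; lia.
Qed.

Definition homog_ideal I := is_ideal I /\ forall t g, I g -> I (hpart t g).

Lemma ideal_gen_homog r (x : 'I_r -> R) (d : 'I_r -> nat) :
  (forall i, x i \is (d i).-homog) -> homog_ideal (ideal_gen x).
Proof.
move=> hx; split; first exact: ideal_gen_ideal.
move=> t _ [c ->]; rewrite hpart_sum.
apply: (ideal_sum _ (ideal_gen_ideal x)) => i _.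
rewrite mulrC (hpart_mul _ _ (hx i)); case: ifP => _; last exact: (ideal0 (ideal_gen_ideal x)).
by rewrite mulrC; apply: idealM (ideal_gen_gen x i); exact: ideal_gen_ideal.
Qed.

Lemma X_homog (i : 'I_n) : ('X_i : R) \is 1.-homog.
Proof. by rewrite dhomogX /= mdeg1. Qed.

Lemma scale_homog t (c : k) g : g \is t.-homog -> c *: g \is t.-homog.
Proof. exact: dhomogZ. Qed.

Lemma ideal_scale I (c : k) g : is_ideal I -> I g -> I (c *: g).
Proof. by move=> hI; rewrite -mul_mpolyC; exact: idealM. Qed.

Lemma hpart0_meval g : hpart 0 g = (g.@[fun=> 0])%:MP.
Proof.
pose v := (fun=> 0) : 'I_n -> k; rewrite -/v.
have e := homog0_const (hpart_homog 0 g).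
have -> : g.@[v] = \sum_(t < (msize g).+1) (hpart t g).@[v].
  by rewrite {1}(hpart_sumw (leqnSn (msize g))) (big_morph _ (mevalD v) (meval0 v)).
rewrite big_ord_recl big1 => [|i _]; last exact: (meval0_homog (hpart_homog _ _)).
by rewrite addr0 {1}e; congr (_%:MP); rewrite e mevalC mcoeffC eqxx mulr1.
Qed.

End Hpart.

(** * Polynomial rings over a coordinate subring *)

Section FrameDef.
Variables (k : closedFieldType) (m : nat).
Notation B := {mpoly k[m]}.
Notation R := {mpoly k[m.+2]}.

(** The ideal generated by the image of b, as the intersection of all ideals containing it, so that
    no coordinates enter. *)
Definition ext_gen (f : B -> R) (b : B -> Prop) (g : R) :=
  forall L, is_ideal L -> (forall c, b c -> L (f c)) -> L g.

(* R presented as a polynomial ring in the linear forms fz and fw over the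
   subring fb(B) generated by m further linear forms. *)
Record frame := Frame {
  fb : {rmorphism B -> R}; fz : R; fw : R; fpt : B -> B -> {rmorphism R -> B};
  fbC : forall c, fb c%:MP = c%:MP;
  fb_homog : forall t b, b \is t.-homog -> fb b \is t.-homog;
  fz_homog : fz \is 1.-homog;
  fw_homog : fw \is 1.-homog;
  fpt_base : forall a c b, fpt a c (fb b) = b;
  fpt_z : forall a c, fpt a c fz = a;
  fpt_w : forall a c, fpt a c fw = c;
  fr_ind : forall P : R -> Prop,
    (forall b, P (fb b)) -> (forall x y, P x -> P y -> P (x + y)) ->
    (forall x, P x -> P (fz * x)) -> (forall x, P x -> P (fw * x)) -> forall g, P g;
  fext_reg : forall (b : B -> Prop) c g, is_ideal b -> (forall x, b (c * x) -> b x) ->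
    ext_gen fb b (fb c * g) -> ext_gen fb b g }.

Definition fext (F : frame) := ext_gen (fb F).

(** What the monic polynomials h1 and rho give, recorded without coordinates: h1, h2 is regular
    modulo the extension of every ideal of B, and R/(h1, h2) is torsion-free and finite over B. *)
Definition ci_frame (F : frame) (h1 h2 : R) :=
  [/\ forall b g, is_ideal b -> fext F b (h1 * g) -> fext F b g,
      forall b q t g, is_ideal b -> fext F b t -> h2 * g = q * h1 + t ->
        exists q' t', fext F b t' /\ g = q' * h1 + t',
      forall b g, b != 0 -> pairI h1 h2 (fb F b * g) -> pairI h1 h2 g
    & exists d1 d2, forall g, exists b : nat -> nat -> B,
        pairI h1 h2 (g - \sum_(i < d1) \sum_(j < d2)
                           fb F (b i j) * (fz F ^+ j * fw F ^+ i))].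

Section Build.
Variables (a1 : 'I_m.+2 -> k) (a2 : 'I_m.+1 -> k).
Hypotheses (a10 : a1 ord_max != 0) (a20 : a2 ord_max != 0).

Lemma ext_genE b g : is_ideal b -> ext_gen (base a1 a2) b g <-> ext a1 a2 b g.
Proof.
move=> hb; split=> [h|h L hL hbL].
  by apply: h; [exact: ext_ideal | move=> c; exact: ext_base].
rewrite (frame_expand a10 a20 g); apply: (ideal_sum _ hL) => i _.
apply: (ideal_sum _ hL) => j _; apply: (ideal_mulr _ hL); apply: (ideal_mulr _ hL).
by apply: hbL; exact: h.
Qed.

Lemma ext_gen_reg (b : B -> Prop) c g : is_ideal b -> (forall x, b (c * x) -> b x) ->
  ext_gen (base a1 a2) b (base a1 a2 c * g) -> ext_gen (base a1 a2) b g.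
Proof.
move=> hb hc /(ext_genE _ hb) h; apply/(ext_genE _ hb) => i j.
by apply: hc; rewrite -(ext_base_mul a10 a20); exact: h.
Qed.

Definition mkframe : frame :=
  Frame (baseC a1 a2) (@base_graded _ _ a1 a2) (zfr_homog a1 a2) (wfr_homog a1)
    (point_base a10 a20) (point_z a10 a20) (point_w a2 a10) (frame_ind a10 a20)
    ext_gen_reg.
End Build.

Lemma ci_frame_exists (h1 h2 : R) :
  h1 != 0 -> (1 < msize h1)%N -> cop (fun b : bool => if b then h1 else h2) ->
  exists F, ci_frame F h1 h2.
Proof.
move=> h10 sh1 /(pair_frame h10 sh1)[a1 [a2 [u [v [rho [c1 [c2 [[a10 a20 c10 c20] [lh1 lr e]]]]]]]]].
exists (mkframe a10 a20); split.
- move=> b g hb /(ext_genE a10 a20 _ hb) h; apply/(ext_genE a10 a20 _ hb).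
  exact: (pair_reg1 c10 lh1 hb h).
- move=> b q t g hb /(ext_genE a10 a20 _ hb) h eg.
  have [q' [t' [ht' eq']]] := pair_reg2 a10 c10 c20 lh1 lr e hb h eg.
  by exists q', t'; split=> //; apply/(ext_genE a10 a20 _ hb).
- move=> b g b0 h; exact: (pair_torsion_free a10 a20 c10 c20 lh1 lr e b0 h).
- exists (size (coord_poly a1 h1)), (size (coord_poly a2 rho)) => g.
  exact: (pair_finite a10 a20 c10 c20 lh1 lr e g).
Qed.

End FrameDef.

Definition eventually (P : nat -> Prop) := exists N, forall t, (N <= t)%N -> P t.

Lemma ev_and P Q : eventually P -> eventually Q -> eventually (fun t => P t /\ Q t).
Proof. by case=> N hN [M hM]; exists (maxn N M) => t ht; split; [apply: hN|apply: hM]; lia. Qed.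

Lemma ev_impl (P Q : nat -> Prop) : (forall t, P t -> Q t) -> eventually P -> eventually Q.
Proof. by move=> h [N hN]; exists N => t /hN /h. Qed.

Lemma ev_ge M : eventually (fun t => (M <= t)%N). Proof. by exists M. Qed.

Lemma ev_shift P j : eventually P -> eventually (fun t => P (t - j)%N).
Proof. by case=> N hN; exists (N + j)%N => t ht; apply: hN; lia. Qed.

Lemma ev_shiftD P j : eventually P -> eventually (fun t => P (t + j)%N).
Proof. by case=> N hN; exists N => t ht; apply: hN; lia. Qed.

(** * Hilbert functions and multiplicities *)

Section EventualPolynomials.
Implicit Types (F G : nat -> rat) (r : nat) (c : rat) (a : nat -> rat).

(** In the binomial basis the difference operator is a shift of indices ([binsumS]), and the top
    coefficient is already the degree-th factorial times the ordinary one. *)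
Definition binsum r a (t : nat) : rat := \sum_(i < r) a i * 'C(t, i)%:R.

Definition epol r F := exists a, eventually (fun t => F t = binsum r a t).

(* Eventually polynomial of degree at most r, with r! times the coefficient
   of degree r equal to c. *)
Definition epolc r F c := exists a, a r = c /\ eventually (fun t => F t = binsum r.+1 a t).

Lemma epolcW r F c : epolc r F c -> epol r.+1 F.
Proof. by case=> a [_ h]; exists a. Qed.

Lemma epol_epolc r F : epol r.+1 F -> exists c, epolc r F c.
Proof. by case=> a h; exists (a r), a. Qed.

Lemma epol_epolc0 r F : epol r F -> epolc r F 0.
Proof.
case=> a h; exists (fun i => if (i < r)%N then a i else 0); split; first by rewrite ltnn.
apply: ev_impl h => t ->; rewrite /binsum big_ord_recr /= ltnn mul0r addr0.
by apply: eq_bigr => i _; rewrite ltn_ord.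
Qed.

Lemma epolc0_epol r F : epolc r F 0 -> epol r F.
Proof.
case=> a [a0 h]; exists a; apply: ev_impl h => t ->.
by rewrite /binsum big_ord_recr /= a0 mul0r addr0.
Qed.

Lemma eq_epolc r F G c : eventually (fun t => F t = G t) -> epolc r F c -> epolc r G c.
Proof.
move=> e [a [ac h]]; exists a; split=> //.
by apply: ev_impl (ev_and e h) => t [<- <-].
Qed.

Lemma epolcD r F G c c' : epolc r F c -> epolc r G c' -> epolc r (fun t => F t + G t) (c + c').
Proof.
move=> [a [ac h]] [b [bc h']]; exists (fun i => a i + b i); split; first by rewrite ac bc.
apply: ev_impl (ev_and h h') => t [-> ->]; rewrite /binsum -big_split /=.
by apply: eq_bigr => i _; rewrite mulrDl.
Qed.

Lemma epolcZ r F c x : epolc r F c -> epolc r (fun t => x * F t) (x * c).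
Proof.
move=> [a [ac h]]; exists (fun i => x * a i); split; first by rewrite ac.
apply: ev_impl h => t ->; rewrite /binsum mulr_sumr.
by apply: eq_bigr => i _; rewrite mulrA.
Qed.

Lemma epolcN r F c : epolc r F c -> epolc r (fun t => - F t) (- c).
Proof.
move/(@epolcZ _ _ _ (-1)); rewrite mulN1r; apply: eq_epolc.
by exists 0%N => t _; rewrite mulN1r.
Qed.

Lemma epolcB r F G c c' : epolc r F c -> epolc r G c' -> epolc r (fun t => F t - G t) (c - c').
Proof. by move=> hF hG; apply: epolcD => //; exact: epolcN. Qed.

Lemma binsumS r a t : binsum r a t.+1 = binsum r a t + binsum r.-1 (fun i => a i.+1) t.
Proof.
case: r => [|r]; first by rewrite /binsum !big_ord0 addr0.
rewrite /binsum !big_ord_recl !bin0 /= -addrA; congr (_ + _).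
rewrite -big_split; apply: eq_bigr => i _ /=.
by rewrite /bump leq0n add1n binS natrD mulrDr addrC.
Qed.

Lemma epolc_delta r F c : epolc r.+1 F c -> epolc r (fun t => F t.+1 - F t) c.
Proof.
move=> [a [ac h]]; exists (fun i => a i.+1); split=> //.
apply: ev_impl (ev_and h (ev_shiftD 1 h)) => t []; rewrite addn1 => -> ->.
by rewrite binsumS addrAC subrr add0r.
Qed.

Lemma epolc_antidelta r F G c : epolc r F c ->
  eventually (fun t => G t.+1 - G t = F t) -> epolc r.+1 G c.
Proof.
move=> [a [ac [N h]]] [M h'].
pose b i := if i is i'.+1 then a i' else 0 : rat.
(* Both hypotheses hold from K on; d is the constant of summation, fixed by the value of G at K. *)
pose K := maxn N M; pose d := G K - binsum r.+2 b K.
exists (fun i => if i is i'.+1 then a i' else d); split=> //.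
exists K => t; elim: t => [|t IH].
  rewrite leqn0 => /eqP K0; have -> : 0%N = K by rewrite K0.
  by rewrite /binsum big_ord_recl /= bin0 mulr1 /d /binsum big_ord_recl /= mul0r add0r subrK.
rewrite leq_eqVlt => /predU1P[<-|Kt].
  by rewrite /binsum big_ord_recl /= bin0 mulr1 /d /binsum big_ord_recl /= mul0r add0r subrK.
have := h' t; rewrite h; last by lia.
move/(_ ltac:(lia))/eqP; rewrite subr_eq => /eqP ->; rewrite IH //.
by rewrite [RHS]binsumS addrC.
Qed.

(** The rule C(t, r) = C(t+1, r) - C(t, r-1), applied from the top coefficient down, rewrites a
    binomial sum at t as one at t + 1 with the same top coefficient. *)
Lemma epolc_shift1 r F c : epolc r F c -> epolc r (fun t => F t.-1) c.
Proof.
move=> [a [ac h]].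
have key : forall r a, exists b, (forall i, (r <= i)%N -> b i = 0) /\
    (forall i, (i.+1 = r)%N -> b i = a i) /\ forall t, binsum r b t.+1 = binsum r a t.
  move=> {ac h} {}r; elim: r => [|r IH] {}a.
    by exists (fun=> 0); split=> //; split=> // t; rewrite /binsum !big_ord0.
  have [b [b0 [_ hb]]] := IH (fun i => if i.+1 == r then a i - a r else a i).
  exists (fun i => if i == r then a r else b i); split.
    by move=> i ri; case: eqP => // [ir|_]; [lia | apply: b0; lia].
  split=> [i [->]|t]; first by rewrite eqxx.
  rewrite [LHS]big_ord_recr /= eqxx.
  transitivity (binsum r b t.+1 + a r * 'C(t.+1, r)%:R).
    by congr (_ + _); apply: eq_bigr => i _; rewrite /= ltn_eqF.
  rewrite hb [RHS]big_ord_recr /=; case: {b b0 hb IH} r => [|r].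
    by rewrite !bin0 /binsum !big_ord0.
  rewrite binS natrD /binsum !big_ord_recr /= eqxx.
  under eq_bigr => i _ do rewrite eqSS ltn_eqF //.
  ring.
have [b [_ [hb e]]] := key r.+1 a; exists b; split; first by rewrite hb.
apply: ev_impl (ev_and (ev_shift 1 h) (ev_ge 1)) => -[|t] [] //.
by rewrite subn1 /= => -> _; rewrite e.
Qed.

Lemma epolc_shift r F c j : epolc r F c -> epolc r (fun t => F (t - j)%N) c.
Proof.
move=> h; elim: j => [|j IH].
  by apply: eq_epolc h; exists 0%N => t _; rewrite subn0.
apply: eq_epolc (epolc_shift1 IH); exists 0%N => t _.
by congr F; lia.
Qed.

Lemma epolc_diff r F c j : epolc r.+1 F c -> epolc r (fun t => F t - F (t - j)%N) (j%:R * c).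
Proof.
move=> h; elim: j => [|j IH].
  rewrite mul0r; apply: epol_epolc0; exists (fun=> 0); exists 0%N => t _.
  by rewrite subn0 subrr /binsum big1 // => i _; rewrite mul0r.
have h1 := epolc_shift j.+1 (epolc_delta h).
rewrite -natr1 mulrDl mul1r; apply: eq_epolc (epolcD IH h1).
exists j.+1 => t jt; rewrite (_ : (t - j.+1).+1 = t - j)%N; last by lia.
ring.
Qed.

Lemma epolc_sum r F c : epolc r F c -> epolc r.+1 (fun t => \sum_(i < t.+1) F i) c.
Proof.
move=> h; have h1 : epolc r (fun t => F t.+1) c.
  case: r h => [|r] h.
    case: h => a [ac h]; exists a; split=> //; apply: ev_impl (ev_shiftD 1 h) => t.
    by rewrite addn1 => ->; rewrite /binsum !big_ord1 !bin0.
  have := epolcD (epol_epolc0 (epolcW (epolc_delta h))) h; rewrite add0r.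
  by apply: eq_epolc; exists 0%N => t _; rewrite subrK.
apply: epolc_antidelta h1 _; exists 0%N => t _.
by rewrite big_ord_recr /= addrAC subrr add0r.
Qed.

Lemma epol_sum r F : epol r F -> exists c, epolc r (fun t => \sum_(i < t.+1) F i) c.
Proof.
case: r => [|r] h; last by have [c hc] := epol_epolc h; exists c; exact: epolc_sum.
have [a [N hN]] := h; exists (\sum_(i < N) F i); exists (fun=> \sum_(i < N) F i); split=> //.
exists N => t Nt; rewrite /binsum big_ord1 bin0 mulr1.
rewrite (big_ord_widen _ F (leq_trans Nt (leqnSn t))) [RHS]big_mkcond.
apply: eq_bigr => i _; case: ltnP => // /hN ->.
by rewrite /binsum big_ord0.
Qed.

(** The induction needs a uniform gap eps: differences bounded by -eps push the function below every
    bound, whereas differences that are merely negative might not. *)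
Lemma epolc_neg r F c : epolc r F c -> c < 0 ->
  exists2 eps : rat, 0 < eps & eventually (fun t => F t <= - eps).
Proof.
elim: r F c => [|r IH] F c h c0.
  exists (- c); first by rewrite oppr_gt0.
  case: h => a [ac h]; apply: ev_impl h => t ->.
  by rewrite opprK /binsum big_ord1 /= bin0 mulr1 ac.
have [eps eps0 [N hN]] := IH _ _ (epolc_delta h) c0.
have step j : F (N + j)%N <= F N - eps * j%:R.
  elim: j => [|j IHj]; first by rewrite addn0 mulr0 subr0.
  have := hN (N + j)%N (leq_addr _ _); rewrite addnS -natr1; lra.
exists 1 => //; pose M := Num.bound ((F N + 1) / eps).
exists (N + M)%N => t Mt; rewrite -(subnKC (n := t) (m := N)); last by lia.
apply: le_trans (step _) _.
have h1 : (F N + 1) / eps <= (t - N)%:R.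
  case: (leP 0 ((F N + 1) / eps)) => h0.
    have := archi_boundP h0 => /ltW /le_trans; apply; rewrite ler_nat; lia.
  by apply: le_trans (ltW h0) _; exact: ler0n.
by move: h1; rewrite ler_pdivrMr // mulrC; lra.
Qed.

Lemma epolc_le r F G c c' : epolc r F c -> epolc r G c' ->
  eventually (fun t => F t <= G t) -> c <= c'.
Proof.
move=> hF hG h; rewrite leNgt; apply/negP => cc'.
have [eps eps0 h'] := epolc_neg (epolcB hG hF) (ltac:(by rewrite subr_lt0)).
have [N hN] := ev_and h h'; have [] := hN N (leqnn _); lra.
Qed.

Lemma epolc_uniq r F c c' : epolc r F c -> epolc r F c' -> c = c'.
Proof.
by move=> h h'; apply/eqP; rewrite eq_le !(epolc_le (F := F) (G := F) (r := r)) //; exists 0%N.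
Qed.

(** As long as the presumed degree exceeds that of the bound, the leading coefficient is squeezed
    between 0 and 0, and the degree drops. *)
Lemma epol_bounded r s F G : epol s F -> epol r G -> (forall t, 0 <= F t) ->
  eventually (fun t => F t <= G t) -> epol r F.
Proof.
move=> hF hG F0 FG; have up j : epol (r + j) F -> epol r F; last first.
  apply: (up s); have {}up i : epol (s + i) F; last by rewrite addnC; exact: up.
  by elim: i => [|i IH]; rewrite ?addn0 // addnS; exact: epolcW (epol_epolc0 IH).
elim: j => [|j IH]; first by rewrite addn0.
rewrite addnS => /epol_epolc[c hc].
have hG' : epolc (r + j) G 0.
  apply: epol_epolc0; elim: (j) => [|i IHi]; rewrite ?addn0 // addnS.
  exact: epolcW (epol_epolc0 IHi).
apply: IH; apply: epolc0_epol; suff -> : 0 = c by [].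
apply/eqP; rewrite eq_le (epolc_le hc hG' FG) andbT.
have h0 : epolc (r + j) (fun=> 0) 0.
  by exists (fun=> 0); split=> //; exists 0%N => t _; rewrite /binsum big1 // => i _; rewrite mul0r.
by apply: (epolc_le h0 hc); exists 0%N => t _.
Qed.

Definition binpoly (i : nat) : {poly rat} := (i`!%:R)^-1 *: \prod_(j < i) ('X - j%:R%:P).

Lemma fact_neq0 i : (i`!%:R : rat) != 0.
Proof. by rewrite pnatr_eq0 -lt0n fact_gt0. Qed.

Lemma binpoly_eval i t : (binpoly i).[t%:R] = 'C(t, i)%:R.
Proof.
rewrite /binpoly hornerZ horner_prod; apply: (mulfI (fact_neq0 i)).
rewrite mulrA divff ?fact_neq0 // mul1r -natrM mulnC bin_ffact.
elim: i => [|i IH]; first by rewrite big_ord0 ffactn0.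
rewrite big_ord_recr /= IH hornerXsubC ffactnSr natrM.
case: (leqP i t) => it; first by rewrite natrB.
by rewrite ffact_small // !mul0r.
Qed.

Lemma binpoly_monic_part i : \prod_(j < i) ('X - j%:R%:P : {poly rat}) \is monic.
Proof. by apply: monic_prod => j _; exact: monicXsubC. Qed.

Lemma size_binpoly i : size (binpoly i) = i.+1.
Proof.
rewrite size_scale ?invr_eq0 ?fact_neq0 //.
elim: i => [|i IH]; first by rewrite big_ord0 size_poly1.
by rewrite big_ord_recr /= size_Mmonic ?monicXsubC ?monic_neq0 ?binpoly_monic_part // size_XsubC IH addn2.
Qed.

Lemma lead_binpoly i : lead_coef (binpoly i) = (i`!%:R)^-1.
Proof. by rewrite lead_coefZ (monicP (binpoly_monic_part i)) mulr1. Qed.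

Lemma epolc_poly r F c : epolc r F c -> exists P : {poly rat},
  [/\ (size P <= r.+1)%N, P`_r = c / r`!%:R & eventually (fun t => P.[t%:R] = F t)].
Proof.
case=> a [ac h]; exists (\sum_(i < r.+1) a i *: binpoly i); split.
- apply: (leq_trans (size_sum _ _ _)); apply/bigmax_leqP => i _.
  by apply: leq_trans (size_scale_leq _ _) _; rewrite size_binpoly.
- rewrite coef_sum big_ord_recr /= coefZ big1 ?add0r => [|i _].
    by rewrite -lead_binpoly lead_coefE size_binpoly ac.
  by rewrite coefZ [(binpoly i)`_r]nth_default ?mulr0 // size_binpoly.
- apply: ev_impl h => t ->; rewrite horner_sum; apply: eq_bigr => i _.
  by rewrite hornerZ binpoly_eval.
Qed.

End EventualPolynomials.

(** * Counting monomials outside an up-closed set *)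

Section Monomials.

Fixpoint comps (n t : nat) : seq (seq nat) :=
  if n is n'.+1 then flatten [seq [seq j :: s | s <- comps n' (t - j)] | j <- iota 0 t.+1]
  else if t is 0 then [:: [::]] else [::].

Arguments comps : simpl never.

Lemma compsS n t :
  comps n.+1 t = flatten [seq [seq j :: s | s <- comps n (t - j)] | j <- iota 0 t.+1].
Proof. by []. Qed.

Lemma mem_comps n t s : (s \in comps n t) = (size s == n) && (sumn s == t).
Proof.
elim: n t s => [|n IH] t s.
  by case: t s => [|t] [|x s].
rewrite compsS; apply/idP/idP.
  case/flattenP=> l /mapP[j]; rewrite mem_iota add0n => /andP[_ jt] -> /mapP[s' ].
  rewrite IH => /andP[/eqP ss' /eqP e] -> /=; rewrite ss' e eqxx /=; lia.
case: s => // j s; rewrite [size _]/= [sumn _]/= eqSS => /andP[sn /eqP <-].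
apply/flattenP; exists [seq j :: s | s <- comps n (j + sumn s - j)].
  by apply/mapP; exists j => //; rewrite mem_iota; lia.
by apply/mapP; exists s => //; rewrite IH sn addKn eqxx.
Qed.

Lemma uniq_comps n t : uniq (comps n t).
Proof.
elim: n t => [|n IH] t; first by case: t.
rewrite compsS; have : uniq (iota 0 t.+1) := iota_uniq _ _.
elim: (iota 0 t.+1) => //= j l IHl /andP[jl ul]; rewrite cat_uniq IHl // andbT.
rewrite map_inj_uniq ?IH //=; last by move=> x y [].
apply/hasPn => s /flattenP[l' /mapP[i il ->]] /mapP[s' _ ->].
by apply/negP => /mapP[s'' _ [ij _]]; rewrite -ij il in jl.
Qed.

Definition cnt n (U : pred (seq nat)) t := count (predC U) (comps n t).

Lemma cnt_rec n U t : cnt n.+1 U t = (\sum_(j < t.+1) cnt n (fun s => U (nat_of_ord j :: s)) (t - j))%N.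
Proof.
rewrite /cnt compsS -[X in _ = X](big_mkord xpredT (fun j => count (predC (fun s => U (j :: s))) (comps n (t - j)))).
rewrite /index_iota subn0; elim: (iota 0 t.+1) => [|j l IH] /=; first by rewrite big_nil.
by rewrite count_cat IH big_cons count_map.
Qed.

Definition upclosed n (U : pred (seq nat)) := forall s s', size s = n -> size s' = n ->
  (forall i, (nth 0 s i <= nth 0 s' i)%N) -> U s -> U s'.

(** Dickson's lemma, for an ascending chain of up-closed sets. By induction on n the diagonal
    sections V i (i :: _) stabilize at some r, which settles all first exponents j >= r; the
    finitely many j < r are settled one at a time. *)
Lemma upclosed_stable n (V : nat -> pred (seq nat)) :
  (forall i, upclosed n (V i)) -> (forall i s, size s = n -> V i s -> V i.+1 s) ->
  exists r, forall i s, (r <= i)%N -> size s = n -> V i s = V r s.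
Proof.
have mono : forall (W : nat -> pred (seq nat)) n, (forall i s, size s = n -> W i s -> W i.+1 s) ->
    forall i j s, (i <= j)%N -> size s = n -> W i s -> W j s.
  move=> W {}n hW i j s ij sn; rewrite -(subnKC ij); elim: (j - i)%N => [|l IH]; first by rewrite addn0.
  by move=> /IH; rewrite addnS; exact: hW.
elim: n V => [|n IH] V upV incV.
  case: (excluded_middle_informative (exists i, V i [::])) => [[r Vr]|none].
    by exists r => i s ri /size0nil->; rewrite Vr (mono _ _ incV r).
  exists 0%N => i s _ /size0nil->; apply/idP/idP => h; case: none; by [exists i|exists 0%N].
have upc i j : upclosed n (fun s => V i (j :: s)).
  move=> s s' ss ss' le; apply: (upV i); rewrite /= ?ss ?ss' //.
  by case=> [|l] /=.
have incj i j j' s : (j <= j')%N -> size s = n -> V i (j :: s) -> V i (j' :: s).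
  move=> jj ss; apply: (upV i); rewrite /= ?ss // => -[|l] //=.
have [r hr] : exists r, forall i s, (r <= i)%N -> size s = n -> V i (i :: s) = V r (r :: s).
  apply: (IH (fun i s => V i (i :: s))) => [i|i s ss h]; first exact: upc.
  by apply: (incj _ i) => //; apply: incV; rewrite //= ss.
have hj j : exists r, forall i s, (r <= i)%N -> size s = n -> V i (j :: s) = V r (j :: s).
  by apply: (IH (fun i s => V i (j :: s))) => [i|i s ss]; [exact: upc | apply: incV; rewrite /= ss].
have [rj hrj] := choice_fun hj.
pose M := (r + \sum_(j < r) rj j)%N.
have rM : (r <= M)%N by rewrite leq_addr.
have stab i j s : (r <= i)%N -> (r <= j)%N -> size s = n -> V i (j :: s) = V r (r :: s).
  move=> ri rj' ss; apply/idP/idP => h.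
    rewrite -(hr (maxn i j)) ?(leq_trans ri) ?leq_maxl //.
    apply: (incj _ j) => //; first by rewrite leq_maxr.
    by apply: (mono _ _ incV i) => //=; rewrite ?ss // leq_maxl.
  apply: (incj _ r) => //; apply: (mono _ _ incV r) => //=; by rewrite ss.
exists M => i [|j s] // Mi [ss].
case: (ltnP j r) => jr; last by rewrite !stab //; lia.
have rjM : (rj j <= M)%N.
  by rewrite /M (bigD1 (Ordinal jr)) //=; lia.
by rewrite !(hrj j _ _ _ ss) //; lia.
Qed.

(** Slicing by the first exponent: the slices agree from some r on, so the count is a finite sum of
    shifted slice counts plus a running sum of the r-th one. *)
Lemma cnt_epol n U : upclosed n U -> epol n (fun t => (cnt n U t)%:R).
Proof.
elim: n U => [|n IH] U upU.
  exists (fun=> 0); exists 1%N => -[|t] // _.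
  by rewrite /binsum big_ord0.
have upj j : upclosed n (fun s => U (j :: s)).
  by move=> s s' ss ss' le; apply: upU; rewrite /= ?ss ?ss' // => -[|l] /=.
have incj j s : size s = n -> U (j :: s) -> U (j.+1 :: s).
  by move=> ss; apply: upU; rewrite /= ?ss // => -[|l] /=.
have [r hr] := upclosed_stable upj incj.
pose c j t := (cnt n (fun s => U (j :: s)) t)%:R : rat.
have cE j t : (r <= j)%N -> c j t = c r t.
  move=> rj; congr (_%:R); apply: eq_in_count => s; rewrite mem_comps => /andP[/eqP ss _] /=.
  by rewrite hr.
have e j : exists x, epolc n (c j) x by exists 0; exact: epol_epolc0 (IH _ (upj j)).
have main : exists x, epolc n (fun t => \sum_(j < r) c j (t - j)%N + \sum_(i < (t - r).+1) c r i) x.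
  have [x hx] : exists x, epolc n (fun t => \sum_(j < r) c j (t - j)%N) x.
    elim: (r) => [|l [x hx]].
      exists 0; exists (fun=> 0); split=> //; exists 0%N => t _.
      by rewrite big_ord0 /binsum big1 // => i _; rewrite mul0r.
    have [y hy] := e l; exists (x + y); apply: eq_epolc (epolcD hx (epolc_shift l hy)).
    by exists 0%N => t _; rewrite big_ord_recr.
  have [y hy] : exists y, epolc n (fun t => \sum_(i < t.+1) c r i) y.
    exact: epol_sum (IH _ (upj r)).
  by exists (x + y); apply: epolcD hx (epolc_shift r hy).
case: main => x hx; apply: (epolcW (c := x)); apply: eq_epolc hx; exists r => t rt.
rewrite cnt_rec natr_sum -/c.
have -> : (t.+1 = r + (t - r).+1)%N by lia.
rewrite big_split_ord /=; congr (_ + _).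
rewrite (reindex_inj rev_ord_inj) /=; apply: eq_bigr => i _.
rewrite -(cE (r + i)%N) ?leq_addr // /c.
by congr ((cnt _ _ _)%:R); have := ltn_ord i; lia.
Qed.

Lemma cnt0_epolc n : epolc n (fun t => (cnt n.+1 pred0 t)%:R) 1.
Proof.
elim: n => [|n IH].
  exists (fun=> 1); split=> //; exists 0%N => t _; rewrite /binsum big_ord1 bin0 mulr1.
  rewrite cnt_rec (bigD1 ord_max) //= subnn /cnt /= big1 // => i.
  rewrite -val_eqE /= => it; case E: (t - i)%N => //=; have := ltn_ord i; lia.
apply: eq_epolc (epolc_sum IH); exists 0%N => t _.
rewrite [in RHS]cnt_rec natr_sum (reindex_inj rev_ord_inj) /=; apply: eq_bigr => i _.
by congr ((cnt _ _ _)%:R); have := ltn_ord i; lia.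
Qed.

End Monomials.

(** * Dimensions of subquotients *)

Section Dimension.
Variables (k : fieldType).

Definition lincomb (V : lmodType k) (T : finType) (b : T -> V) (c : T -> k) : V :=
  \sum_i c i *: b i.

Definition subspace (V : lmodType k) (Z : V -> Prop) :=
  Z 0 /\ forall a u v, Z u -> Z v -> Z (a *: u + v).

(** W is read modulo Z even when Z does not lie in W, so that an ideal can serve as Z for a single
    graded component W. *)
Definition basis_mod (V : lmodType k) (Z W : V -> Prop) (T : finType) (b : T -> V) :=
  [/\ forall i, W (b i), forall v, W v -> exists c, Z (v - lincomb b c)
    & forall c, Z (lincomb b c) -> forall i, c i = 0].

Definition dim_mod (V : lmodType k) (Z W : V -> Prop) (N : nat) :=
  exists (T : finType) (b : T -> V), #|T| = N /\ basis_mod Z W b.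

Section OneSpace.
Variable V : lmodType k.
Implicit Types (Z W : V -> Prop).

Lemma subspaceD Z u v : subspace Z -> Z u -> Z v -> Z (u + v).
Proof. by case=> _ h Zu Zv; rewrite -[u]scale1r; exact: h. Qed.

Lemma subspaceZ Z a u : subspace Z -> Z u -> Z (a *: u).
Proof. by case=> Z0 h Zu; rewrite -[_ *: _]addr0; exact: h. Qed.

Lemma subspaceN Z u : subspace Z -> Z u -> Z (- u).
Proof. by move=> hZ; rewrite -scaleN1r; exact: subspaceZ. Qed.

Lemma subspaceB Z u v : subspace Z -> Z u -> Z v -> Z (u - v).
Proof. by move=> hZ Zu Zv; apply: subspaceD => //; exact: subspaceN. Qed.

Lemma subspace_sum Z (T : Type) (r : seq T) (P : pred T) (F : T -> V) :
  subspace Z -> (forall i, P i -> Z (F i)) -> Z (\sum_(i <- r | P i) F i).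
Proof. by move=> hZ h; apply: big_ind => //; [case: hZ | move=> *; exact: subspaceD]. Qed.

Lemma subspace_lincomb Z (T : finType) (b : T -> V) c :
  subspace Z -> (forall i, Z (b i)) -> Z (lincomb b c).
Proof. by move=> hZ h; apply: subspace_sum => // i _; exact: subspaceZ. Qed.

(** With more vectors than spanning elements the coefficient matrix has a nonzero left kernel
    vector, which is a linear relation modulo Z. *)
Lemma indep_le_span Z (T T' : finType) (b : T -> V) (b' : T' -> V) :
  subspace Z -> (forall c, Z (lincomb b c) -> forall i, c i = 0) ->
  (forall i, exists c, Z (b i - lincomb b' c)) -> (#|T| <= #|T'|)%N.
Proof.
move=> hZ ind /choice_fun[M hM]; rewrite leqNgt; apply/negP => lt.
pose A := \matrix_(x < #|T|, y < #|T'|) M (enum_val x) (enum_val y).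
have kn : kermx A != 0.
  rewrite -mxrank_eq0 mxrank_ker -lt0n subn_gt0.
  exact: leq_ltn_trans (rank_leq_col A) lt.
have /rowV0Pn[v hv v0] := kn.
have vA : v *m A = 0 by apply/sub_kermxP.
pose c i := v 0 (enum_rank i).
case/negP: v0; apply/eqP/matrixP => i j; rewrite ord1 mxE.
rewrite -(enum_valK j); apply: (ind c).
have -> : lincomb b c = \sum_i c i *: (b i - lincomb b' (M i)).
  apply/eqP; rewrite -subr_eq0 -sumrB.
  under eq_bigr => l _ do rewrite scalerBr opprB addrC subrK.
  under eq_bigr => l _ do rewrite scaler_sumr.
  rewrite exchange_big big1 //= => l _.
  under eq_bigr => x _ do rewrite scalerA.
  rewrite -scaler_suml (_ : \sum_x _ = 0) ?scale0r //.
  have := congr1 (fun w : 'rV_ _ => w 0 (enum_rank l)) vA; rewrite !mxE => {2}<-.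
  rewrite (reindex (@enum_rank T)) /=; last by exists enum_val => x _; rewrite ?enum_rankK ?enum_valK.
  by apply: eq_bigr => x _; rewrite mxE !enum_rankK.
by apply: subspace_sum => // l _; apply: subspaceZ.
Qed.

Lemma dim_mod_uniq Z W N N' : subspace Z -> dim_mod Z W N -> dim_mod Z W N' -> N = N'.
Proof.
move=> hZ [T [b [<- [Wb sb ib]]]] [T' [b' [<- [Wb' sb' ib']]]]; apply/eqP; rewrite eqn_leq.
apply/andP; split; [apply: (indep_le_span hZ ib) | apply: (indep_le_span hZ ib')] => i; auto.
Qed.

Lemma dim_mod_tower Z Y W N1 N2 : subspace Z -> subspace Y ->
  (forall v, Z v -> Y v) -> (forall v, Y v -> W v) ->
  dim_mod Z Y N1 -> dim_mod Y W N2 -> dim_mod Z W (N1 + N2).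
Proof.
move=> hZ hY ZY YW [T1 [b1 [<- [Wb1 sb1 ib1]]]] [T2 [b2 [<- [Wb2 sb2 ib2]]]].
pose b (x : T1 + T2) := match x with inl x => b1 x | inr x => b2 x end.
have lcE c : lincomb b c = lincomb b1 (c \o inl) + lincomb b2 (c \o inr).
  by rewrite /lincomb big_sumType.
exists (T1 + T2)%type, b; rewrite card_sum; split=> //; split.
- by case=> x; [apply: YW; exact: Wb1 | exact: Wb2].
- move=> v /sb2[c2 /sb1[c1 h]].
  exists (fun x => match x with inl x => c1 x | inr x => c2 x end).
  by rewrite lcE opprD addrA addrAC; exact: h.
- move=> c; rewrite lcE => h.
  have Y1 : Y (lincomb b1 (c \o inl)) by exact: subspace_lincomb.
  have c2 : forall i, c (inr i) = 0.
    apply: (ib2 (c \o inr)); have := subspaceB hY (ZY _ h) Y1.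
    by rewrite addrAC subrr add0r.
  have e2 : lincomb b2 (c \o inr) = 0 by apply: big1 => i _; rewrite /= c2 scale0r.
  have c1 : forall i, c (inl i) = 0 by apply: (ib1 (c \o inl)); rewrite e2 addr0 in h.
  by case.
Qed.

Lemma dim_mod_sub Z Y W N : subspace Z -> subspace Y -> (forall v, Y v -> W v) ->
  dim_mod Z W N -> exists N', dim_mod Z Y N'.
Proof.
move=> hZ hY YW [T [b [cT [Wb sb ib]]]].
pose P N' := exists b2 : 'I_N' -> V, (forall i, Y (b2 i)) /\
   forall c, Z (lincomb b2 c) -> forall i, c i = 0.
have Pb N' : P N' -> (N' <= N)%N.
  case=> b2 [Yb2 ib2]; rewrite -cT -[N']card_ord; apply: (indep_le_span hZ ib2) => i.
  exact/sb/YW.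
have [M [PM maxM]] : exists M, P (N - M)%N /\ forall i, (i < M)%N -> ~ P (N - i)%N.
  apply: nat_least; exists N; rewrite subnn.
  by exists (fun=> 0); split=> [[]//|c _ []//].
set N' := (N - M)%N in PM; have [b2 [Yb2 ib2]] := PM.
exists N', 'I_N', b2; split; first exact: card_ord.
split=> // v Yv; apply: NNPP => nspan.
have PS : P N'.+1.
  exists (fun i => oapp b2 v (unlift ord0 i)); split.
    by move=> i; case: unlift => [j|] //=.
  move=> c; rewrite /lincomb big_ord_recl unlift_none /=.
  under eq_bigr => i _ do rewrite liftK /=.
  move=> h; have c0 : c ord0 = 0.
    apply: NNPP => /eqP c0; apply: nspan.
    exists (fun i => - (c ord0)^-1 * c (lift ord0 i)).
    have := subspaceZ (c ord0)^-1 hZ h; rewrite scalerDr scalerA mulVf // scale1r.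
    congr (Z (_ + _)); rewrite scaler_sumr /lincomb -sumrN; apply: eq_bigr => i _.
    by rewrite scalerA mulNr scaleNr opprK.
  have cl : forall i, c (lift ord0 i) = 0.
    by apply: (ib2 (c \o lift ord0)); rewrite c0 scale0r add0r in h.
  by move=> i; case: (unliftP ord0 i) => [j ->|->].
have leN := Pb _ PS; case: M @N' PM maxM {b2 Yb2 ib2 nspan} PS leN => [|M] N' PM maxM PS leN.
  by move: leN; rewrite /N' subn0 ltnn.
case: (ltnP M N) => MN; last first.
  apply: (maxM N); rewrite ?ltnS // subnn.
  by exists (fun=> 0); split=> [[]//|c _ []//].
apply: (maxM M (ltnSn M)); rewrite (_ : N - M = N'.+1)%N //; rewrite /N'; lia.
Qed.

Lemma dim_mod_eq Z Z' W N : (forall v, W v -> (Z v <-> Z' v)) -> subspace W ->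
  dim_mod Z W N -> dim_mod Z' W N.
Proof.
move=> h hW [T [b [cT [Wb sb ib]]]]; exists T, b; split=> //; split=> //.
- move=> v Wv; have [c hc] := sb v Wv; exists c; apply/h => //.
  by apply: subspaceB => //; exact: subspace_lincomb.
- by move=> c /h hc; apply: ib; apply: hc; exact: subspace_lincomb.
Qed.

End OneSpace.

Section TwoSpaces.
Variables (V V' : lmodType k) (f : V -> V') (Z W : V -> Prop) (Z' W' : V' -> Prop).
Hypotheses (hW : subspace W)
  (fL : forall a u v, W u -> W v -> f (a *: u + v) = a *: f u + f v)
  (fZ : forall u, W u -> (Z u <-> Z' (f u))) (fW : forall y, W' y <-> exists2 u, W u & f u = y).

Lemma map_lincomb (T : finType) (b : T -> V) c : (forall i, W (b i)) ->
  f (lincomb b c) = lincomb (f \o b) c.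
Proof.
move=> Wb.
have f0 : f 0 = 0.
  have W0 := hW.1.
  by have := fL (-1) W0 W0; rewrite scaler0 addr0 scaleN1r addNr.
suff : W (lincomb b c) /\ f (lincomb b c) = lincomb (f \o b) c by case.
rewrite /lincomb; elim: (index_enum T) => [|i l [Wl IH]].
  by rewrite !big_nil; split=> //; case: hW.
by rewrite !big_cons; split; [apply: hW.2 | rewrite fL // IH].
Qed.

Lemma dim_mod_img N : dim_mod Z W N -> dim_mod Z' W' N.
Proof.
case=> T [b [cT [Wb sb ib]]]; exists T, (f \o b); split=> //; split.
- by move=> i; apply/fW; exists (b i).
- move=> _ /fW[u Wu <-]; have [c hc] := sb u Wu; exists c.
  have Wl := subspace_lincomb c hW Wb.
  rewrite -map_lincomb // addrC -scaleN1r -fL // scaleN1r addrC.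
  exact: (fZ (subspaceB hW Wu Wl)).1 hc.
- move=> c; rewrite -map_lincomb // => h; apply: ib.
  exact: (fZ (subspace_lincomb c hW Wb)).2 h.
Qed.

Lemma dim_mod_lift N : dim_mod Z' W' N -> dim_mod Z W N.
Proof.
case=> T [b' [cT [Wb sb ib]]].
have [b hb] : exists b : T -> V, forall i, W (b i) /\ f (b i) = b' i.
  apply: (@choice_fun T V (fun i v => W v /\ f v = b' i)) => i.
  by have /fW[u Wu e] := Wb i; exists u.
have Wb1 i : W (b i) by case: (hb i).
have e c : f (lincomb b c) = lincomb b' c.
  by rewrite map_lincomb //; apply: eq_bigr => i _; case: (hb i) => _ /= ->.
exists T, b; split=> //; split=> //.
- move=> u Wu; have /sb[c hc] : W' (f u) by apply/fW; exists u.
  have Wl := subspace_lincomb c hW Wb1.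
  exists c; apply: (fZ (subspaceB hW Wu Wl)).2.
  by rewrite addrC -scaleN1r fL // e scaleN1r addrC.
- move=> c h; apply: ib; rewrite -e; exact: (fZ (subspace_lincomb c hW Wb1)).1 h.
Qed.

End TwoSpaces.
End Dimension.

Definition pbool (P : Prop) : bool := if excluded_middle_informative P then true else false.
Lemma pboolP P : reflect P (pbool P).
Proof. by rewrite /pbool; case: excluded_middle_informative => h; constructor. Qed.

(** * Hilbert functions and initial monomials *)

Section Hilbert.
Variables (k : closedFieldType) (n : nat).
Notation R := {mpoly k[n]}.
Implicit Types (I J : R -> Prop) (t : nat) (g : R).

Definition mnm_of (s : seq nat) : 'X_{1..n} := [multinom nth 0%N s i | i < n].

Lemma mnm_of_val (m : 'X_{1..n}) : mnm_of (val m) = m.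
Proof. by apply/mnmP => i; rewrite mnmE -mnm_nth. Qed.

Lemma val_mnm_of s : size s = n -> val (mnm_of s) = s :> seq nat.
Proof.
move=> ss; apply: (@eq_from_nth _ 0%N) => [|i]; rewrite size_tuple ?ss // => ni.
by rewrite -[i]/(val (Ordinal ni)) -mnm_nth mnmE.
Qed.

Lemma mdeg_val (m : 'X_{1..n}) : mdeg m = sumn (val m).
Proof. by rewrite sumnE. Qed.

Lemma comps_val t (m : 'X_{1..n}) : mdeg m = t -> (val m : seq nat) \in comps n t.
Proof. by move=> <-; rewrite mem_comps size_tuple mdeg_val !eqxx. Qed.

Definition lead_of I (s : seq nat) : bool :=
  pbool (exists g, [/\ I g, g != 0, exists t, g \is t.-homog & mlead g = mnm_of s]).

(** Macaulay's theorem taken as a definition: the monomials of degree t that lead no form of I are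
    counted. [std_basis] shows that they are a basis of R_t modulo I. *)
Definition HF I t : nat := cnt n (lead_of I) t.
Definition hfr I t : rat := (HF I t)%:R.

Definition hcomp t (g : R) : Prop := g \is t.-homog.

Lemma hcomp_subspace t : subspace (hcomp t).
Proof.
split; first exact: rpred0.
by move=> a u v hu hv; apply: rpredD => //; exact: dhomogZ.
Qed.

Lemma ideal_subspace I : is_ideal I -> subspace I.
Proof.
move=> hI; split; first exact: ideal0.
by move=> a u v Iu Iv; rewrite -mul_mpolyC; apply: hI.2.
Qed.

Lemma lead_of_upclosed I : is_ideal I -> upclosed n (lead_of I).
Proof.
move=> hI s s' ss ss' le /pboolP[g [Ig g0 [t hg] eg]]; apply/pboolP.
exists ('X_[mnm_of s' - mnm_of s] * g); split.
- exact: idealM.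
- by rewrite mulf_neq0 // -msize_poly_eq0 msizeX.
- exists (mdeg (mnm_of s' - mnm_of s)%MM + t)%N; apply: dhomogM => //.
  by rewrite dhomogX.
- rewrite mleadM ?mleadXm ?eg ?submK // -?msize_poly_eq0 ?msizeX ?msize_poly_eq0 //.
  by apply/mnm_lepP => i; rewrite !mnmE.
Qed.

Lemma hfr_epol I : is_ideal I -> epol n (hfr I).
Proof. by move=> hI; exact/cnt_epol/lead_of_upclosed. Qed.

Lemma homog_mlead t g : g != 0 -> g \is t.-homog -> mdeg (mlead g) = t.
Proof. by move=> g0 hg; apply: (dhomog_mf hg); exact: mlead_supp. Qed.

(** Spanning is an induction on the leading monomial, which is cancelled either by an element of I
    or by a standard monomial. A nontrivial combination of standard monomials lying in I would be
    led by one of them. *)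
Lemma std_basis I t : is_ideal I -> exists b : 'I_(HF I t) -> R,
  basis_mod I (hcomp t) b.
Proof.
move=> hI; pose l := [seq s <- comps n t | predC (lead_of I) s].
have sl : size l = HF I t by rewrite size_filter.
pose s i := nth [::] l i.
have hs (i : 'I_(HF I t)) : [/\ size (s i) = n, sumn (s i) = t & ~~ lead_of I (s i)].
  have : s i \in l by apply: mem_nth; rewrite sl.
  by rewrite mem_filter mem_comps => /andP[/= -> /andP[/eqP -> /eqP ->]].
pose b (i : 'I_(HF I t)) : R := 'X_[mnm_of (s i)].
have mb (i : 'I_(HF I t)) : mdeg (mnm_of (s i)) = t.
  by have [h1 h2 _] := hs i; rewrite mdeg_val val_mnm_of.
have sinj (i j : 'I_(HF I t)) : mnm_of (s i) = mnm_of (s j) -> i = j.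
  have [hi _ _] := hs i; have [hj _ _] := hs j.
  move=> e0; have := val_mnm_of hi; rewrite e0 (val_mnm_of hj) => e.
  have ul : uniq l by rewrite filter_uniq // uniq_comps.
  have li (x : 'I_(HF I t)) : (x < size l)%N by rewrite sl.
  by apply/val_inj/eqP; rewrite -(nth_uniq [::] (li i) (li j) ul) -/(s i) -/(s j) e.
have ht i : hcomp t (b i) by rewrite /hcomp dhomogX /= mb.
have hS := ideal_subspace hI.
have zero g : g = 0 -> exists c, I (g - lincomb b c).
  move=> ->; exists (fun=> 0); rewrite /lincomb big1 ?subr0; first by case: hS.
  by move=> i _; rewrite scale0r.
exists b; split=> //.
- have key : forall m g, mlead g = m -> hcomp t g -> exists c, I (g - lincomb b c).
    move=> m; elim/(well_founded_induction (@ltom_wf n)): m => m IH g em hg.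
    have [/zero //|g0] := eqVneq g 0.
    have mt : mdeg m = t by rewrite -em; exact: homog_mlead.
    have step g1 : hcomp t g1 -> g1@_m = g@_m -> (forall m', (m < m')%O -> g1@_m' = 0) ->
        exists c, I (g - g1 - lincomb b c).
      move=> hg1 e1 z1; have hgg : hcomp t (g - g1) by apply: subspaceB => //; exact: hcomp_subspace.
      have [/zero //|n0] := eqVneq (g - g1) 0.
      apply: (IH _ _ _ erefl) => //.
      have := mlead_supp n0; rewrite mcoeff_msupp mcoeffB => nz.
      rewrite ltNge; apply/negP; rewrite le_eqVlt => /predU1P[ml|lt].
        by move: nz; rewrite -ml e1 subrr eqxx.
      by move: nz; rewrite z1 // mcoeff_gt_mlead ?em // subrr eqxx.
    case: (boolP (lead_of I (val m))) => [/pboolP[h [Ih h0 [u hu]]]|nl].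
      rewrite mnm_of_val => eh; have ch : h@_m != 0 by rewrite -eh mleadc_eq0.
      have ut : u = t by rewrite -mt -eh (homog_mlead h0 hu).
      have [|||c hc] := step ((g@_m / h@_m) *: h).
      - by apply: scale_homog; rewrite -ut.
      - by rewrite mcoeffZ divfK.
      - by move=> m' mm'; rewrite mcoeffZ [h@_m']mcoeff_gt_mlead ?mulr0 // eh.
      exists c; have := idealD hI hc (ideal_scale (g@_m / h@_m) hI Ih).
      by congr (I _); rewrite addrAC subrK.
    have [i ei] : exists i : 'I_(HF I t), s i = val m.
      have ml : (val m : seq nat) \in l by rewrite mem_filter /= nl comps_val.
      have hi : (index (val m : seq nat) l < HF I t)%N by rewrite -sl index_mem.
      by exists (Ordinal hi); rewrite /s nth_index.
    have bi : b i = 'X_[m] by rewrite /b ei mnm_of_val.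
    have [|||c hc] := step (g@_m *: 'X_[m]).
    - by rewrite -bi; exact: (scale_homog _ (ht i)).
    - by rewrite mcoeffZ mcoeffX eqxx mulr1.
    - by move=> m' mm'; rewrite mcoeffZ mcoeffX (lt_eqF mm') mulr0.
    exists (fun j => c j + g@_m * (j == i)%:R); move: hc; congr (I _).
    rewrite -addrA -opprD; congr (_ - _); rewrite /lincomb addrC.
    under [RHS]eq_bigr => j _ do rewrite scalerDl.
    rewrite big_split /=; congr (_ + _); rewrite (bigD1 i) //= eqxx mulr1 bi big1 ?addr0 //.
    by move=> j /negbTE ->; rewrite mulr0 scale0r.
  by move=> g hg; exact: key erefl hg.
move=> c hc i; apply/eqP/negPn/negP => ci.
have cE m : (lincomb b c)@_m = \sum_j c j * (mnm_of (s j) == m)%:R.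
  by rewrite /lincomb raddf_sum; apply: eq_bigr => j _; rewrite /= mcoeffZ mcoeffX.
have g0 : lincomb b c != 0.
  apply: contraNneq ci => g0; have := cE (mnm_of (s i)).
  rewrite g0 mcoeff0 (bigD1 i) //= eqxx mulr1 big1 ?addr0 => [<- //|j ji].
  by case: eqP => [/sinj e|_]; [rewrite e eqxx in ji | rewrite mulr0].
have [j ej] : exists j : 'I_(HF I t), mlead (lincomb b c) = mnm_of (s j).
  apply: NNPP => none; have := mleadc_eq0 (lincomb b c); rewrite (negbTE g0) cE big1 ?eqxx // => j _.
  by case: eqP => [e|_]; [case: none; exists j | rewrite mulr0].
have [_ _ /pboolP[]] := hs j; exists (lincomb b c); split=> //; exists t.
exact: (subspace_lincomb c (hcomp_subspace t) ht).
Qed.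

Lemma HF_dim I t : is_ideal I -> dim_mod I (hcomp t) (HF I t).
Proof. by move=> hI; have [b hb] := std_basis t hI; exists 'I_(HF I t), b; rewrite card_ord. Qed.

Lemma HF_hilbert I : is_ideal I -> hilbert_function I (HF I).
Proof.
move=> hI t; have [b [hb sb ib]] := std_basis t hI; exists b; split=> // g hg.
have [c hc] := sb g hg; exists (\row_i c i); split.
  by move: hc; congr (I (_ - _)); apply: eq_bigr => i _; rewrite mxE.
move=> c' hc'; apply/rowP => i; rewrite mxE; apply/eqP; rewrite -subr_eq0; apply/eqP.
apply: (ib (fun i => c i - c' 0 i)); have := idealB hI hc' hc; congr (I _).
rewrite opprD opprK addrACA subrr add0r addrC /lincomb -sumrB.
by apply: eq_bigr => j _; rewrite scalerBl.
Qed.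

Lemma hilbert_function_uniq I h : is_ideal I -> hilbert_function I h -> h =1 HF I.
Proof.
move=> hI hh t; have [b [hb ub]] := hh t.
apply: (dim_mod_uniq (ideal_subspace hI) _ (HF_dim t hI)).
exists 'I_(h t), b; rewrite card_ord; split=> //; split=> //.
- move=> g /ub[c [hc _]]; exists (c 0); exact: hc.
- move=> c hc; have h0 : hcomp t 0 by exact: rpred0.
  have [c0 [hc0 u0]] := ub 0 h0.
  have e1 : c0 = 0.
    by apply: u0; rewrite big1 ?subr0 => [|i _]; [exact: ideal0 | rewrite mxE scale0r].
  have e2 : c0 = \row_i c i.
    apply: u0; rewrite sub0r; apply: idealN => //; move: hc; congr (I _).
    by apply: eq_bigr => i _; rewrite mxE.
  by move=> i; have := congr1 (fun r : 'rV_ _ => r 0 i) e2; rewrite e1 !mxE.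
Qed.

Lemma poly_ev_eq (P Q : {poly rat}) :
  eventually (fun t => P.[t%:R] = Q.[t%:R]) -> P = Q.
Proof.
case=> N hN; apply/eqP; rewrite -subr_eq0; apply/negPn/negP => D0.
pose rs : seq rat := [seq (N + i)%:R | i <- iota 0 (size (P - Q))].
have h1 : all (root (P - Q)) rs.
  by apply/allP => _ /mapP[i _ ->]; rewrite /root hornerD hornerN hN ?subrr ?leq_addr.
have h2 : uniq rs.
  rewrite map_inj_uniq ?iota_uniq // => i j /eqP; rewrite eqr_nat eqn_add2l; exact: eqP.
by have := max_poly_roots D0 h1 h2; rewrite size_map size_iota ltnn.
Qed.

(** Since c is nonzero the Hilbert polynomial has degree exactly r. Polynomials that agree at all
    large integers coincide, so every witness chosen by [epsilon] yields c. *)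
Lemma degree_eq I r c : is_ideal I -> epolc r (hfr I) c -> c != 0 -> degree I = c.
Proof.
move=> hI hc c0; have [P [sP cP [N hN]]] := epolc_poly hc.
have cP0 : P`_r != 0 by rewrite cP mulf_neq0 // invr_eq0 fact_neq0.
have sP1 : size P = r.+1.
  by apply/eqP; rewrite eqn_leq sP ltnNge; apply: contra cP0 => h; rewrite nth_default.
have P0 : P != 0 by rewrite -size_poly_gt0 sP1.
have val Q M : (forall t, (M <= t)%N -> Q.[t%:R] = (HF I t)%:R) -> Q = P.
  by move=> hQ; apply: poly_ev_eq; exists (maxn M N) => t ht; rewrite hQ ?hN //; lia.
have ex : exists m, is_degree I m.
  by eexists; exists (HF I), P, N; split=> //; exact: HF_hilbert.
rewrite /degree; have [h [Q [M [hh hQ ->]]]] := epsilon_spec (inhabits 0) _ ex.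
have eQ : Q = P by apply: (val Q M) => t Mt; rewrite hQ // (hilbert_function_uniq hI hh).
by rewrite eQ (negbTE P0) lead_coefE sP1 /= cP divfK // fact_neq0.
Qed.

Lemma degree_unit I : is_ideal I -> I 1 -> degree I = 0.
Proof.
move=> hI I1; have HF0 t : HF I t = 0%N.
  apply: (dim_mod_uniq (ideal_subspace hI) (HF_dim t hI)).
  exists 'I_0, (fun=> 0); rewrite card_ord; split=> //; split=> [[]//|v _|c _ []//].
  by exists (fun=> 0); exact: ideal1.
have ex : exists m, is_degree I m.
  eexists; exists (HF I), 0, 0%N; split=> // [|t _]; first exact: HF_hilbert.
  by rewrite horner0 HF0.
rewrite /degree; have [h [Q [M [hh hQ ->]]]] := epsilon_spec (inhabits 0) _ ex.
have eQ : Q = 0.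
  by apply: poly_ev_eq; exists M => t Mt; rewrite hQ // (hilbert_function_uniq hI hh) HF0 horner0.
by rewrite eQ eqxx big1 // => t _; rewrite (hilbert_function_uniq hI hh) HF0.
Qed.

Lemma zero_ideal_ideal : is_ideal (@zero_ideal R).
Proof. by split=> // a u v -> ->; rewrite mulr0 addr0. Qed.

Definition dimR t : nat := cnt n pred0 t.

Lemma dimR_dim t : dim_mod (@zero_ideal R) (hcomp t) (dimR t).
Proof.
suff -> : dimR t = HF (@zero_ideal R) t by exact/HF_dim/zero_ideal_ideal.
apply: eq_count => s /=; apply/esym/negP => /pboolP[g [h /negP[]]].
by apply/eqP.
Qed.

Lemma HF_codim I t : is_ideal I -> exists N, [/\ (N <= dimR t)%N,
  dim_mod (@zero_ideal R) (fun g => I g /\ hcomp t g) N & HF I t = (dimR t - N)%N].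
Proof.
move=> hI; pose It g := I g /\ hcomp t g.
have hIt : subspace It.
  have h1 := ideal_subspace hI; have h2 := hcomp_subspace t.
  split; first by split; [case: h1 | case: h2].
  by move=> a u v [? ?] [? ?]; split; [apply: h1.2 | apply: h2.2].
have hZ := ideal_subspace zero_ideal_ideal.
have [N hN] := dim_mod_sub hZ hIt (fun v => @proj2 _ _) (dimR_dim t).
have h : dim_mod It (hcomp t) (HF I t).
  apply: dim_mod_eq (HF_dim t hI); last exact: hcomp_subspace.
  by move=> v hv; split=> [|[]].
have := dim_mod_uniq hZ (dimR_dim t) (dim_mod_tower hZ hIt _ (fun v => @proj2 _ _) hN h).
have zz v : zero_ideal v -> It v by move=> ->; case: hIt.
by move/(_ zz) => e; exists N; split=> //; rewrite e ?leq_addr // addKn.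
Qed.

Lemma HF_indep I t (T : finType) (b : T -> R) : is_ideal I -> (forall i, hcomp t (b i)) ->
  (forall c, I (lincomb b c) -> forall i, c i = 0) -> (#|T| <= HF I t)%N.
Proof.
move=> hI hb ib; have [T' [b' [<- [_ sb _]]]] := HF_dim t hI.
by apply: (indep_le_span (ideal_subspace hI) ib) => i; exact/sb/hb.
Qed.

Lemma HF_span I t (T : finType) (b : T -> R) : is_ideal I ->
  (forall g, hcomp t g -> exists c, I (g - lincomb b c)) -> (HF I t <= #|T|)%N.
Proof.
move=> hI sb; have [T' [b' [<- [hb' _ ib]]]] := HF_dim t hI.
by apply: (indep_le_span (ideal_subspace hI) ib) => i; exact/sb/hb'.
Qed.

Lemma HF_sub I J t : is_ideal I -> is_ideal J -> subideal I J -> (HF J t <= HF I t)%N.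
Proof.
move=> hI hJ IJ; have [T [b [<- [hb sb _]]]] := HF_dim t hI.
by apply: (HF_span (b := b) hJ) => g /sb[c hc]; exists c; exact: IJ.
Qed.

End Hilbert.

(** * Ranks over B as leading coefficients of Hilbert functions *)

Section RankBounds.
Variables (k : closedFieldType) (m : nat).
Notation B := {mpoly k[m.+1]}.
Notation R := {mpoly k[m.+3]}.
Variable F : frame k m.+1.
Implicit Types (I : R -> Prop) (b : B).
Notation fb := (fb F).

Lemma fb_scale (c : k) b : fb (c *: b) = c *: fb b.
Proof. by rewrite -!mul_mpolyC rmorphM fbC. Qed.

Lemma fb_inj : injective fb.
Proof. by move=> b c h; rewrite -(fpt_base F 0 0 b) h fpt_base. Qed.

Lemma fb_eq0 b : fb b = 0 -> b = 0.
Proof. by move=> h; apply: fb_inj; rewrite h rmorph0. Qed.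

Lemma fb_hpart t b : hpart t (fb b) = fb (hpart t b).
Proof.
have -> : fb b = \sum_(j < msize b) fb (hpart j b) by rewrite {1}(pihomog_sum b) rmorph_sum.
rewrite hpart_sum; have [tb|tb] := ltnP t (msize b).
  rewrite (bigD1 (Ordinal tb)) //= hpart_id; last exact/fb_homog/hpart_homog.
  rewrite big1 ?addr0 // => j; rewrite -val_eqE /= => jt.
  exact: (hpart_ne (fb_homog F (hpart_homog j b))).
rewrite [hpart t b]hpart_large // rmorph0 big1 // => j _.
apply: (hpart_ne (fb_homog F (hpart_homog j b))); have := ltn_ord j; lia.
Qed.

Lemma hpart_fb_mul t d b v : v \is d.-homog ->
  hpart t (fb b * v) = if (d <= t)%N then fb (hpart (t - d) b) * v else 0.
Proof. by move=> hv; rewrite mulrC (hpart_mul _ _ hv) fb_hpart mulrC. Qed.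

Definition dimB t : nat := @dimR m.+1 t.

Lemma dimB_epolc d : epolc m (fun t => (dimB (t - d))%:R) 1.
Proof. exact: (epolc_shift d (cnt0_epolc m)). Qed.

Lemma epolc_sum_fin (T : finType) r (G : T -> nat -> rat) (c : T -> rat) :
  (forall i, epolc r (G i) (c i)) -> epolc r (fun t => \sum_i G i t) (\sum_i c i).
Proof.
move=> h; elim: (index_enum T) => [|i l IH].
  rewrite big_nil; apply: epol_epolc0; exists (fun=> 0); exists 0%N => t _.
  by rewrite big_nil /binsum big1 // => i _; rewrite mul0r.
rewrite big_cons; apply: eq_epolc (epolcD (h i) IH).
by exists 0%N => t _; rewrite big_cons.
Qed.

Lemma card_sigma (T : finType) (N : T -> nat) : #|{: {i : T & 'I_(N i)}}| = (\sum_i N i)%N.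
Proof.
by rewrite card_tagged sumnE big_map big_enum /=; apply: eq_bigr => i _; rewrite card_ord.
Qed.

Lemma sum_sigma (V : nmodType) (T : finType) (N : T -> nat) (G : forall i, 'I_(N i) -> V) :
  \sum_(p : {i : T & 'I_(N i)}) G (tag p) (tagged p) = \sum_i \sum_j G i j.
Proof. exact: esym (@sig_big_dep _ _ _ _ _ predT (fun _ => predT) G). Qed.

Lemma dimB_basis t : exists bs : 'I_(dimB t) -> B, (forall j, bs j \is t.-homog) /\
  (forall b, b \is t.-homog -> exists c, b = lincomb bs c) /\
  (forall c, lincomb bs c = 0 -> forall j, c j = 0).
Proof.
have hZ : is_ideal (@zero_ideal B) := zero_ideal_ideal _ _.
have e : HF (@zero_ideal B) t = dimB t.
  apply: (dim_mod_uniq (ideal_subspace hZ)); [exact: HF_dim | exact: dimR_dim].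
have [bs [hb sb ib]] := std_basis t hZ; rewrite e in bs hb sb ib.
exists bs; split=> //; split=> // b /sb[c hc]; exists c.
by apply/eqP; rewrite -subr_eq0; apply/eqP.
Qed.

(** Independence embeds the direct sum of the shifted copies B(-d_i) in R/I, and each copy
    contributes 1 to the leading coefficient. *)
Lemma rank_lower I (T : finType) (v : T -> R) (d : T -> nat) c : is_ideal I ->
  (forall i, v i \is (d i).-homog) ->
  (forall b : T -> B, I (\sum_i fb (b i) * v i) -> forall i, b i = 0) ->
  epolc m (hfr I) c -> #|T|%:R <= c.
Proof.
move=> hI hv iv hc.
have -> : #|T|%:R = \sum_(i : T) (1 : rat).
  by rewrite sumr_const.
apply: (epolc_le (epolc_sum_fin (fun i => dimB_epolc (d i))) hc).
exists (\sum_i d i)%N => t dt; rewrite -natr_sum ler_nat -card_sigma.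
have [bs hbs] : exists bs : forall i, 'I_(dimB (t - d i)) -> B, forall i,
    (forall j, bs i j \is (t - d i).-homog) /\
    (forall b, b \is (t - d i).-homog -> exists c, b = lincomb (bs i) c) /\
    (forall c, lincomb (bs i) c = 0 -> forall j, c j = 0).
  exists (fun i => proj1_sig (constructive_indefinite_description _ (dimB_basis (t - d i)))) => i.
  by case: constructive_indefinite_description.
apply: (@HF_indep _ _ I t _ (fun p : {i : T & 'I_(dimB (t - d i))} => fb (bs (tag p) (tagged p)) * v (tag p)) hI).
  move=> [i j] /=; have [h1 _] := hbs i.
  have dit : (d i <= t)%N by apply: leq_trans dt; rewrite (bigD1 i) //= leq_addr.
  by have := dhomogM (fb_homog F (h1 j)) (hv i); rewrite subnK.
move=> c'; pose tg i j : {i : T & 'I_(dimB (t - d i))} := existT _ i j.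
have -> : lincomb (fun p => fb (bs (tag p) (tagged p)) * v (tag p)) c' =
    \sum_i fb (lincomb (bs i) (fun j => c' (tg i j))) * v i.
  transitivity (\sum_i \sum_j c' (tg i j) *: (fb (bs i j) * v i)).
    rewrite -(sum_sigma (fun i j => c' (tg i j) *: (fb (bs i j) * v i))).
    by apply: eq_bigr => -[i j] _.
  apply: eq_bigr => i _; rewrite /lincomb rmorph_sum mulr_suml; apply: eq_bigr => j _.
  by rewrite fb_scale scalerAl.
by move=> h [i j]; have [_ [_ h2]] := hbs i; apply: (h2 (fun j => c' (tg i j))); exact: iv h i.
Qed.

Lemma HF_divides_epolc b be : b != 0 -> b \is be.-homog ->
  epolc m (fun t => (HF (divides b) t)%:R : rat) 0.
Proof.
move=> b0 hb; have hQ : is_ideal (divides b) := divides_ideal b.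
have hZ := ideal_subspace (zero_ideal_ideal k m.+1).
have QE t : (HF (divides b) (t + be))%:R = (dimB (t + be))%:R - (dimB t)%:R :> rat.
  have [N [le hN ->]] := HF_codim (t + be) hQ; suff <- : N = dimB t by rewrite natrB.
  apply: (dim_mod_uniq hZ hN).
  apply: (@dim_mod_img k B B (fun q : B => b * q) (@zero_ideal B) (hcomp t) (@zero_ideal B)
    (fun g => divides b g /\ hcomp (t + be) g) (hcomp_subspace k m.+1 t) _ _ _ _ (dimR_dim k m.+1 t)).
  - by move=> a q r _ _; rewrite mulrDr scalerAr.
  - move=> q _; rewrite /zero_ideal; split=> [->|/eqP]; first by rewrite mulr0.
    by rewrite mulf_eq0 (negbTE b0) => /eqP.
  - move=> y; split=> [[[q ->] hy]|[x hx <-]].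
      exists q; last by rewrite mulrC.
      by have := homog_factor b0 hb (t := t + be) (g := q); rewrite leq_addl addnK mulrC; apply.
    by split; [exists x; rewrite mulrC | rewrite /hcomp addnC; apply: dhomogM].
have := epolcB (dimB_epolc 0) (dimB_epolc be); rewrite subrr.
apply: eq_epolc; exists be => t bt; rewrite subn0.
by rewrite -{1}(subnK bt) -QE subnK.
Qed.

(** Modulo the span of the v i, R/I is a quotient of a sum of shifted copies of B/(b), whose Hilbert
    functions have smaller degree and contribute 0. *)
Lemma rank_upper I (T L : finType) (v : T -> R) (d : T -> nat) (g : L -> R) (e : L -> nat) b be c :
  homog_ideal I -> (forall i, v i \is (d i).-homog) -> (forall l, g l \is (e l).-homog) ->
  b != 0 -> b \is be.-homog ->
  (forall x, exists bl : L -> B, I (x - \sum_l fb (bl l) * g l)) ->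
  (forall l, exists bi : T -> B, I (fb b * g l - \sum_i fb (bi i) * v i)) ->
  epolc m (hfr I) c -> c <= #|T|%:R.
Proof.
move=> hhI hv hg b0 hb gen dep hc; have [hI hIh] := hhI.
pose Q := divides b; have hQ : is_ideal Q := divides_ideal b.
have -> : #|T|%:R = \sum_(i : T) (1 : rat) + \sum_(l : L) 0.
  by rewrite sumr_const big1 ?addr0.
apply: (epolc_le hc (epolcD (epolc_sum_fin (fun i => dimB_epolc (d i)))
   (epolc_sum_fin (fun l => epolc_shift (e l) (HF_divides_epolc b0 hb))))).
exists (\sum_i d i + \sum_l e l)%N => t dt; rewrite -!natr_sum -natrD ler_nat.
have dit i : (d i <= t)%N.
  by apply: leq_trans dt; rewrite (bigD1 i) //= -addnA leq_addr.
have elt l : (e l <= t)%N.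
  by apply: leq_trans dt; rewrite [X in (_ <= _ + X)%N](bigD1 l) //= addnCA leq_addr.
rewrite -!card_sigma -card_sum.
have [bs hbs] : exists bs : forall i, 'I_(dimB (t - d i)) -> B, forall i,
    forall b, b \is (t - d i).-homog -> exists c, b = lincomb (bs i) c.
  exists (fun i => proj1_sig (constructive_indefinite_description _ (dimB_basis (t - d i)))) => i.
  by case: constructive_indefinite_description => ? [? []].
have [bq hbq] : exists bq : forall l, 'I_(HF Q (t - e l)) -> B, forall l,
    basis_mod Q (hcomp (t - e l)) (bq l).
  exists (fun l => proj1_sig (constructive_indefinite_description _ (std_basis (t - e l) hQ))) => l.
  by case: constructive_indefinite_description.
pose w (p : {i : T & 'I_(dimB (t - d i))} + {l : L & 'I_(HF Q (t - e l))}) : R :=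
  match p with inl p => fb (bs (tag p) (tagged p)) * v (tag p)
             | inr p => fb (bq (tag p) (tagged p)) * g (tag p) end.
apply: (@HF_span _ _ I t _ w hI) => x hx.
have [bl hbl] := gen x.
have {}hbl : I (x - \sum_l fb (hpart (t - e l) (bl l)) * g l).
  have := hIh t _ hbl; rewrite raddfB /= hpart_id // hpart_sum; congr (I (_ - _)).
  by apply: eq_bigr => l _; rewrite (hpart_fb_mul _ _ (hg l)) elt.
(* Each coefficient is reduced modulo b; the multiples of b split off here are carried over to the v
   i in [hyI]. *)
have [cq hcq] : exists cq : forall l, 'I_(HF Q (t - e l)) -> k,
    forall l, Q (hpart (t - e l) (bl l) - lincomb (bq l) (cq l)).
  have h l : exists cl, Q (hpart (t - e l) (bl l) - lincomb (bq l) cl).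
    by have [_ sb _] := hbq l; apply: sb; exact: hpart_homog.
  exists (fun l => proj1_sig (constructive_indefinite_description _ (h l))) => l.
  by case: constructive_indefinite_description.
have [q hq] := choice_fun hcq.
have [bi hbi] := choice_fun dep.
pose y := x - \sum_l fb (lincomb (bq l) (cq l)) * g l.
have hy : y \is t.-homog.
  apply: rpredB => //; apply: rpred_sum => l _.
  have [hbl' _ _] := hbq l.
  have := dhomogM (fb_homog F (subspace_lincomb (cq l) (hcomp_subspace _ _ _) hbl')) (hg l).
  by rewrite subnK.
have hyI : I (y - \sum_i fb (\sum_l q l * bi l i) * v i).
  have h1 : I (\sum_l fb (q l) * (fb b * g l - \sum_i fb (bi l i) * v i)).
    by apply: (ideal_sum _ hI) => l _; apply: (idealM _ hI); exact: hbi.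
  have := idealD hI hbl h1; congr (I _).
  have e1 : \sum_l fb (hpart (t - e l) (bl l)) * g l =
     \sum_l fb (lincomb (bq l) (cq l)) * g l + \sum_l fb (q l) * (fb b * g l).
    rewrite -big_split /=; apply: eq_bigr => l _.
    rewrite mulrA -rmorphM -mulrDl -rmorphD; congr (fb _ * _).
    by apply/eqP; rewrite addrC -subr_eq; apply/eqP; exact: hq.
  have e2 : \sum_i fb (\sum_l q l * bi l i) * v i =
     \sum_l fb (q l) * (\sum_i fb (bi l i) * v i).
    under eq_bigr => i _ do rewrite rmorph_sum mulr_suml.
    rewrite exchange_big /=; apply: eq_bigr => l _; rewrite mulr_sumr.
    by apply: eq_bigr => i _; rewrite rmorphM mulrA.
  under [X in _ + X]eq_bigr => l _ do rewrite mulrBr.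
  rewrite sumrB e1 e2 /y opprD addrA.
  by rewrite addrA subrK.
have {}hyI : I (y - \sum_i fb (hpart (t - d i) (\sum_l q l * bi l i)) * v i).
  have := hIh t _ hyI; rewrite raddfB /= hpart_id // hpart_sum; congr (I (_ - _)).
  by apply: eq_bigr => i _; rewrite (hpart_fb_mul _ _ (hv i)) dit.
have [ci hci] : exists ci : forall i, 'I_(dimB (t - d i)) -> k,
    forall i, hpart (t - d i) (\sum_l q l * bi l i) = lincomb (bs i) (ci i).
  have h i : exists cl, hpart (t - d i) (\sum_l q l * bi l i) = lincomb (bs i) cl.
    by apply: hbs; exact: hpart_homog.
  exists (fun i => proj1_sig (constructive_indefinite_description _ (h i))) => i.
  by case: constructive_indefinite_description.
exists (fun p => match p with inl p => ci (tag p) (tagged p) | inr p => cq (tag p) (tagged p) end).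
move: hyI; congr (I _); rewrite /y -addrA -opprD; congr (_ - _).
rewrite /lincomb big_sumType /= [LHS]addrC.
congr (_ + _).
  transitivity (\sum_i \sum_j ci i j *: (fb (bs i j) * v i)); last first.
    rewrite -(sum_sigma (fun i j => ci i j *: (fb (bs i j) * v i))).
    by apply: eq_bigr => -[i j] _.
  apply: eq_bigr => i _; rewrite hci rmorph_sum mulr_suml; apply: eq_bigr => j _.
  by rewrite fb_scale scalerAl.
transitivity (\sum_l \sum_j cq l j *: (fb (bq l j) * g l)); last first.
  rewrite -(sum_sigma (fun l j => cq l j *: (fb (bq l j) * g l))).
  by apply: eq_bigr => -[i j] _.
apply: eq_bigr => l _; rewrite rmorph_sum mulr_suml; apply: eq_bigr => j _.
by rewrite fb_scale scalerAl.
Qed.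

End RankBounds.

(** * Complete intersections of codimension two *)

Section CompleteIntersection.
Variables (k : closedFieldType) (m : nat).
Notation R := {mpoly k[m.+3]}.
Variables (h1 h2 : R) (da db : nat).
Hypotheses (h10 : h1 != 0) (hh1 : h1 \is da.-homog) (hh2 : h2 \is db.-homog)
  (cop12 : cop (fun i : bool => if i then h1 else h2)).

Lemma cop_regular x g : h2 * g = x * h1 -> exists y, g = y * h1.
Proof.
move=> e; apply: (@cop_div _ (@ufd_mpoly k m.+3) bool (fun i => if i then g else x) _ g h1 cop12 h10).
by case; rewrite mulrC // e mulrC.
Qed.

Lemma pairI_homog : homog_ideal (pairI h1 h2).
Proof.
have hI := pairI_ideal h1 h2; split=> // t _ [x [y ->]].
rewrite raddfD /= [x * h1]mulrC (hpart_mul _ _ hh1) [y * h2]mulrC (hpart_mul _ _ hh2).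
apply: (idealD hI); case: ifP => _; try exact: (ideal0 hI).
  by apply: (ideal_mulr _ hI); exact: pairI1.
by apply: (ideal_mulr _ hI); exact: pairI2.
Qed.

Lemma pair_lin (c : k) (x y x' y' : R) :
  c *: ((x, y) : R * R) + (x', y') = (c *: x + x', c *: y + y').
Proof. by []. Qed.

(** The Koszul complex 0 -> R(-da-db) -> R(-da) + R(-db) -> (h1, h2) -> 0 is exact because h1 and h2
    are coprime; K is the image of its first map. *)
Lemma HF_pairI t : (da + db <= t)%N -> (HF (pairI h1 h2) t)%:R =
  (@dimR m.+3 t)%:R - (@dimR m.+3 (t - da))%:R - (@dimR m.+3 (t - db))%:R
   + (@dimR m.+3 (t - da - db))%:R :> rat.
Proof.
move=> abt; have hI := pairI_ideal h1 h2.
have [N [le hN ->]] := HF_codim t hI; rewrite natrB //.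
suff h : (dimR m.+3 (t - da - db) + N = dimR m.+3 (t - da) + dimR m.+3 (t - db))%N.
  by have := congr1 (fun i => i%:R : rat) h; rewrite !natrD; lra.
pose V := (R * R)%type.
pose W (p : V) := hcomp (t - da) p.1 /\ hcomp (t - db) p.2.
pose W1 (p : V) := hcomp (t - da) p.1 /\ p.2 = 0.
pose Z (p : V) := p = 0.
have hZ : subspace Z by split=> // c u v -> ->; rewrite scaler0 addr0.
have s1 := hcomp_subspace k m.+3 (t - da); have s2 := hcomp_subspace k m.+3 (t - db).
have hW : subspace W.
  split; first by split; [case: s1 | case: s2].
  by move=> c u v [? ?] [? ?]; split; [apply: s1.2 | apply: s2.2].
have hW1 : subspace W1.
  split; first by split=> //; case: s1.
  by move=> c u v [? u2] [? v2]; split; [apply: s1.2 | rewrite /= u2 v2 scaler0 addr0].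
have ZW1 v : Z v -> W1 v by move=> ->; case: hW1.
have W1W v : W1 v -> W v by case=> h1' h2'; split; rewrite // h2'; exact: rpred0.
have d1 : dim_mod Z W1 (dimR m.+3 (t - da)).
  apply: (dim_mod_img (f := fun x => (x, 0) : V) s1 _ _ _ (dimR_dim k m.+3 (t - da))).
  - by move=> c x y _ _; rewrite pair_lin; congr (_, _); rewrite scaler0 addr0.
  - by move=> x _; split=> [->|[]].
  - by move=> [y1 y2]; split=> [[/= hy ->]|[x hx [<- <-]]]; [exists y1 | split].
have d2 : dim_mod W1 W (dimR m.+3 (t - db)).
  apply: (dim_mod_lift (f := fun p : V => p.2) (Z' := @zero_ideal R) (W' := hcomp (t - db)) hW _ _ _ (dimR_dim k m.+3 (t - db))).
  - by [].
  - by move=> u [hu1 hu2]; split=> [[]|].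
  - by move=> y; split=> [hy|[[u1 u2] [_ /= hu] <-]//]; exists (0, y) => //; split=> //; exact: rpred0.
have dW := dim_mod_tower hZ hW1 ZW1 W1W d1 d2.
pose K (p : V) := exists2 r, hcomp (t - da - db) r & p = (h2 * r, - (h1 * r)).
have hK : subspace K.
  have s3 := hcomp_subspace k m.+3 (t - da - db); split.
    by exists 0; [case: s3 | rewrite !mulr0 oppr0].
  move=> c _ _ [x hx ->] [y hy ->]; exists (c *: x + y); first exact: s3.2.
  rewrite pair_lin; congr (_, _).
    by rewrite mulrDr scalerAr.
  by rewrite mulrDr opprD scalerN scalerAr.
have KW v : K v -> W v.
  case=> r hr ->; split; rewrite /hcomp /=.
    by have := dhomogM hh2 hr; rewrite (_ : db + (t - da - db) = t - da)%N //; lia.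
  rewrite rpredN; have := dhomogM hh1 hr; rewrite (_ : da + (t - da - db) = t - db)%N //; lia.
have ZK v : Z v -> K v by move=> ->; case: hK.
have dK : dim_mod Z K (dimR m.+3 (t - da - db)).
  apply: (dim_mod_img (f := fun r => (h2 * r, - (h1 * r)) : V) (hcomp_subspace _ _ _) _ _ _ (dimR_dim k m.+3 (t - da - db))).
  - move=> c x y _ _; rewrite pair_lin; congr (_, _).
      by rewrite mulrDr scalerAr.
    by rewrite mulrDr opprD scalerN scalerAr.
  - move=> x _; split=> [->|e]; first by rewrite !mulr0 oppr0.
    have : - (h1 * x) == 0 by apply/eqP; exact: (congr1 snd e).
    by rewrite oppr_eq0 mulf_eq0 (negbTE h10) => /eqP.
  - by move=> y; split=> [[r hr ->]|[r hr <-]]; exists r.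
have dKW : dim_mod K W N.
  apply: (dim_mod_lift (f := fun p : V => p.1 * h1 + p.2 * h2) hW _ _ _ hN).
  - by move=> c u v _ _ /=; rewrite !mulrDl -!scalerAl scalerDr addrACA.
  - move=> u [hu1 hu2]; rewrite /zero_ideal; split=> [[r _ ->] /=|e]; first by ring.
    have e1 : h2 * u.2 = (- u.1) * h1.
      by rewrite mulNr mulrC; apply/eqP; rewrite -addr_eq0 addrC; apply/eqP.
    have [y ey] := cop_regular e1; exists (- y).
      rewrite /hcomp rpredN; have := homog_factor h10 hh1 (t := t - db) (g := y).
      rewrite mulrC -ey => /(_ hu2); rewrite (_ : (da <= t - db)%N); last by lia.
      by rewrite (_ : t - db - da = t - da - db)%N //; lia.
    case: u hu1 hu2 e e1 ey => u1 u2 /= _ _ _ e1 ey; congr (_, _); last by rewrite ey; ring.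
    by apply: (mulIf h10); move: e1; rewrite ey mulNr => /eqP; rewrite -eqr_oppLR => /eqP <-; ring.
  - move=> y; split=> [[[x [z ->]] hy]|[u [hu1 hu2] <-]].
      exists (hpart (t - da) x, hpart (t - db) z).
        by split; exact: hpart_homog.
      rewrite /= -[RHS](hpart_id hy) raddfD /= [x * h1]mulrC (hpart_mul _ _ hh1).
      rewrite [z * h2]mulrC (hpart_mul _ _ hh2).
      have -> : (da <= t)%N by lia.
      have -> : (db <= t)%N by lia.
      by rewrite ![_ * hpart _ _]mulrC.
    split; first by exists u.1, u.2.
    apply: rpredD; rewrite /hcomp.
      by have := dhomogM hu1 hh1; rewrite subnK //; lia.
    by have := dhomogM hu2 hh2; rewrite subnK //; lia.
exact: (dim_mod_uniq hZ (dim_mod_tower hZ hK ZK KW dK dKW) dW).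
Qed.

Lemma pairI_epolc : epolc m (hfr (pairI h1 h2)) (da%:R * db%:R).
Proof.
have h := epolc_diff da (cnt0_epolc m.+2); rewrite mulr1 in h.
have := epolc_diff db h; rewrite mulrC; apply: eq_epolc.
exists (da + db)%N => t abt; rewrite /hfr HF_pairI // /dimR.
rewrite (_ : t - db - da = t - da - db)%N; last by lia.
by ring.
Qed.

Lemma sub_pairI_epolc I : is_ideal I -> subideal (pairI h1 h2) I ->
  exists2 c, epolc m (hfr I) c & 0 <= c <= da%:R * db%:R.
Proof.
move=> hI hs.
have le t : hfr I t <= hfr (pairI h1 h2) t.
  by rewrite /hfr ler_nat; apply: HF_sub => //; exact: pairI_ideal.
have [c hc] : exists c, epolc m (hfr I) c.
  apply: epol_epolc; apply: epol_bounded (hfr_epol hI) (epolcW pairI_epolc) _ _.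
    by move=> t; exact: ler0n.
  by exists 0%N.
exists c => //; apply/andP; split.
  have h0 : epolc m (fun=> 0) 0.
    by apply: epol_epolc0; exists (fun=> 0); exists 0%N => t _; rewrite /binsum big1 // => i _; rewrite mul0r.
  by apply: (epolc_le h0 hc); exists 0%N => t _; exact: ler0n.
by apply: (epolc_le hc pairI_epolc); exists 0%N.
Qed.

End CompleteIntersection.

(** * Chains of primes and heights *)

Section AlgebraicIndependence.
Variables (k : closedFieldType) (n : nat).
Notation R := {mpoly k[n]}.

Lemma msize_mul_le (x y : R) : (msize (x * y) <= (msize x + msize y).-1)%N.
Proof.
have [->|x0] := eqVneq x 0; first by rewrite mul0r msize0.
have [->|y0] := eqVneq y 0; first by rewrite mulr0 msize0.
by rewrite msizeM.
Qed.

Lemma mdeg_ge (m : 'X_{1..n}) i : (m i <= mdeg m)%N.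
Proof. by rewrite mdegE (bigD1 i) //= leq_addr. Qed.

(** A dimension count: monomials in N variables with exponents below t have independent images in a
    space of polynomials with exponents below a constant multiple of t, and t^N outgrows t^n when N
    > n. *)
Lemma injective_nvars N (f : {rmorphism {mpoly k[N]} -> R}) :
  (forall c, f c%:MP = c%:MP) -> (forall p, f p = 0 -> p = 0) -> (N <= n)%N.
Proof.
move=> fC finj; rewrite leqNgt; apply/negP => nN.
(* D bounds the size of every image of a variable, so monomials with exponents below t are sent to
   polynomials with exponents below M. As M <= C t, the choice t = C^n + 1 gives t^(n+1) > (C t)^n
   >= M^n. *)
pose D := (\sum_i msize (f 'X_i)).+1.
pose C := (N * D + 1)%N; pose t := (C ^ n).+1; pose M := (N * t * D).+1.
pose mon (s : nat) l (g : {ffun 'I_l -> 'I_s}) : 'X_{1..l} := [multinom (g i : nat) | i < l].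
have monI s l : injective (@mon s l).
  move=> g g' /mnmP e; apply/ffunP => i; apply/val_inj.
  by have := e i; rewrite !mnmE.
have sumE s l (c : {ffun 'I_l -> 'I_s} -> k) g : (lincomb (fun g => 'X_[mon s l g] : {mpoly k[l]}) c)@_(mon s l g) = c g.
  rewrite /lincomb raddf_sum (bigD1 g) //= mcoeffZ mcoeffX eqxx mulr1 big1 ?addr0 // => g' ne.
  rewrite mcoeffZ mcoeffX; case: eqP => [/monI e|]; last by rewrite mulr0.
  by rewrite e eqxx in ne.
have : (#|{ffun 'I_N -> 'I_t}| <= #|{ffun 'I_n -> 'I_M}|)%N.
  apply: (@indep_le_span k R (@zero_ideal R) _ _ (fun g => f 'X_[mon t N g]) (fun g => 'X_[mon M n g])).
  - exact: ideal_subspace (zero_ideal_ideal _ _).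
  - move=> c hc g; rewrite -(sumE t N c g) (finj (lincomb _ c)) ?mcoeff0 //.
    rewrite -[RHS]hc /lincomb rmorph_sum; apply: eq_bigr => g' _.
    by rewrite -mul_mpolyC rmorphM fC mul_mpolyC.
  - move=> g; set h := f _; exists (fun g' => h@_(mon M n g')).
    suff e : h = lincomb (fun g' => 'X_[mon M n g']) (fun g' => h@_(mon M n g')).
      by rewrite /zero_ideal -e subrr.
    apply/mpolyP => m.
    have [lt|] := boolP [forall i, m i < M]%N.
      have -> : m = mon M n [ffun i => Ordinal (forallP lt i)].
        by apply/mnmP => i; rewrite mnmE ffunE.
      by rewrite sumE.
    rewrite negb_forall => /existsP[i]; rewrite -leqNgt => Mm.
    rewrite [RHS]raddf_sum /= big1 => [|g' _]; last first.
      rewrite mcoeffZ mcoeffX; case: eqP => [e|]; last by rewrite mulr0.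
      by move: Mm; rewrite -e mnmE leqNgt ltn_ord.
    apply: memN_msupp_eq0; apply: msize_mdeg_ge; apply: leq_trans (mdeg_ge m i).
    apply: leq_trans Mm; rewrite /h mpolyXE_id rmorph_prod.
    have pw x j : (msize (x ^+ j : R) <= (j * msize x).+1)%N.
      elim: j => [|j IH]; first by rewrite expr0 msize1.
      rewrite exprS; apply: leq_trans (msize_mul_le _ _) _; rewrite mulSn.
      by move: IH; set u := (j * _)%N; set w := msize (x ^+ j); set w' := msize x; lia.
    have pr (T : finType) (x : T -> R) (e : T -> nat) : (forall i, (msize (x i) <= (e i).+1)%N) ->
        (msize (\prod_i x i) <= (\sum_i e i).+1)%N.
      move=> h'; apply: (big_ind2 (fun (y : R) s => (msize y <= s.+1)%N)) => //.
        by rewrite msize1.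
      by move=> y s y' s' h1 h2; apply: leq_trans (msize_mul_le _ _) _; lia.
    apply: leq_trans (pr _ _ (fun i => t * D)%N _) _ => [l|].
      rewrite rmorphXn; apply: leq_trans (pw _ _) _; rewrite ltnS.
      apply: leq_mul; first by rewrite mnmE ltnW.
      by rewrite /D (bigD1 l) //= -addSn leqW // leq_addr.
    by rewrite sum_nat_const card_ord /M mulnA.
rewrite !card_ffun !card_ord => le.
have h1 : (t ^ n.+1 <= t ^ N)%N by rewrite leq_pexp2l.
have h2 : (M ^ n <= (C * t) ^ n)%N.
  by case: (n) => // n'; rewrite leq_exp2r // /M /C mulnDl mul1n -addn1 mulnAC leq_add2l.
have := leq_trans h1 (leq_trans le h2); rewrite expnMn expnS leq_pmul2r ?expn_gt0 //.
by rewrite /t ltnn.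
Qed.

(** The images of the N variables are algebraically independent modulo p. *)
Definition trivial_mod N (f : {rmorphism {mpoly k[N]} -> R}) (p : R -> Prop) :=
  (forall c, f c%:MP = c%:MP) /\ forall x, p (f x) -> x = 0.

(** An element a of p outside q is independent of the given family modulo q: the constant term of a
    relation lies in p, so it is 0, and then the relation can be divided by a. *)
Lemma trivial_mod_step N (f : {rmorphism {mpoly k[N]} -> R}) (p q : R -> Prop) a :
  is_ideal p -> prime_ideal q -> subideal q p -> p a -> ~ q a -> trivial_mod f p ->
  exists f' : {rmorphism {mpoly k[N.+1]} -> R}, trivial_mod f' q.
Proof.
move=> hp hq qp pa qa [fC ft]; pose e := (fun=> 1) : 'I_N.+1 -> k.
have e0 : e ord_max != 0 by rewrite oner_eq0.
exists (horner_eval a \o map_poly f \o coord_poly e : {rmorphism _ -> _}); split=> [c|x].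
  change ((map_poly f (coord_poly e c%:MP)).[a] = c%:MP).
  by rewrite thetaC map_polyC hornerC /= fC.
change (q (map_poly f (coord_poly e x)).[a] -> x = 0).
suff H : forall P, q (map_poly f P).[a] -> P = 0.
  by move/H => h; rewrite -(thetaK e0 x) h rmorph0.
elim/poly_ind => [//|P c IH].
rewrite rmorphD rmorphM /= map_polyX map_polyC /= hornerMXaddC => h.
have c0 : c = 0.
  apply: ft; apply: (idealDl hp _ (qp _ h)); exact: idealM.
rewrite c0 rmorph0 addr0 in h *; rewrite (IH _) ?mul0r ?addr0 //.
by case: hq => _ _ /(_ _ _ h)[].
Qed.

Lemma prime_chain_trivial_mod I p h N (f : {rmorphism {mpoly k[N]} -> R}) :
  prime_chain I p h -> trivial_mod f p ->
  exists q, [/\ prime_ideal q, subideal I q &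
    exists f' : {rmorphism {mpoly k[h + N]} -> R}, trivial_mod f' q].
Proof.
case=> q [sc hq] [fC ft].
have H : forall i, (i <= h)%N -> exists f' : {rmorphism {mpoly k[i + N]} -> R}, trivial_mod f' (q (inord (h - i))).
  elim=> [_|i IH ih].
    exists f; split=> // x; have [_ _ sp] := hq (inord (h - 0)); by move/sp/ft.
  have [f' hf'] := IH (ltnW ih).
  have lt : ((inord (h - i.+1) : 'I_h.+1) < (inord (h - i) : 'I_h.+1))%N by rewrite !inordK; lia.
  have [sub nsub] := sc _ _ lt.
  have [a [pa qa]] : exists a, q (inord (h - i)) a /\ ~ q (inord (h - i.+1)) a.
    apply: NNPP => none; apply: nsub => a qa; apply: NNPP => na; apply: none; by exists a.
  have [[[hp _ _] _ _] [hq' _ _]] := (hq (inord (h - i)), hq (inord (h - i.+1))).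
  exact: (trivial_mod_step hp hq' sub pa qa hf').
have [f' hf'] := H h (leqnn _); exists (q (inord (h - h))).
by have [? ? _] := hq (inord (h - h)); split=> //; exists f'.
Qed.

Lemma prime_chain_bound p h N (f : {rmorphism {mpoly k[N]} -> R}) :
  prime_chain (@zero_ideal R) p h -> trivial_mod f p -> (h + N <= n)%N.
Proof.
move=> hc /(prime_chain_trivial_mod hc)[q [[hq _ _] _ [f' [fC ft]]]].
by apply: (injective_nvars fC) => x fx; apply: ft; rewrite fx; exact: ideal0.
Qed.

End AlgebraicIndependence.

Section Chains.
Variable A : comNzRingType.
Implicit Types (J p q : A -> Prop).

Lemma nat_chain J p h (c : nat -> A -> Prop) :
  (forall j, (j <= h)%N -> [/\ prime_ideal (c j), subideal J (c j) & subideal (c j) p]) ->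
  (forall j, (j < h)%N -> Defs.proper_sub (c j) (c j.+1)) -> prime_chain J p h.
Proof.
move=> hc sc; exists (fun i : 'I_h.+1 => c i); split; last by move=> i; apply: hc; rewrite -ltnS.
have H : forall i j, (i + j.+1 <= h)%N -> Defs.proper_sub (c i) (c (i + j.+1)%N).
  move=> i; elim=> [|j IH] ijh; first by rewrite addn1; apply: sc; lia.
  have [s1 n1] := IH ltac:(lia); rewrite addnS; have [s2 n2] := sc (i + j.+1)%N ltac:(lia).
  by split=> [a /s1 /s2 //|s3]; apply: n1 => a /s2 /s3.
by move=> i j ij; have := H i (j - i.+1)%N; rewrite addnS -addSn subnKC //; apply; have := ltn_ord j; lia.
Qed.

(** Depth is at most dimension. Since x_i is a nonzerodivisor modulo its predecessors, the products
    s x_i^j with s outside q avoid their localized ideal; a prime over that ideal avoiding these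
    products lies properly inside q, and the construction is repeated below it. *)
Lemma prime_chain_regular J p q r (x : 'I_r -> A) : is_ideal J -> prime_ideal p ->
  local_regular_seq J p x -> prime_ideal q -> subideal q p ->
  subideal (loc_ideal p (add_prefix J x r)) q ->
  exists c : nat -> A -> Prop,
   (forall j, (j <= r)%N -> [/\ prime_ideal (c j), subideal J (c j) & subideal (c j) q]) /\
   (forall j, (j < r)%N -> Defs.proper_sub (c j) (c j.+1)).
Proof.
move=> hJ hp [px reg].
have H : forall i q, (i <= r)%N -> prime_ideal q -> subideal q p ->
    subideal (loc_ideal p (add_prefix J x i)) q -> exists c : nat -> A -> Prop,
   [/\ forall j, (j <= i)%N -> [/\ prime_ideal (c j), subideal J (c j) & subideal (c j) q],
   forall j, (j < i)%N -> Defs.proper_sub (c j) (c j.+1) & c i = q].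
  elim=> [|i IH] {}q ir hq qp Lq.
    exists (fun=> q); split=> // j _; split=> // a Ja; apply: Lq.
    by apply: (loc_ideal_sub hp); exact: add_prefix_sub.
  pose xi := x (Ordinal ir); pose L j := loc_ideal p (add_prefix J x j).
  have hL j : is_ideal (L j) by apply: (loc_ideal_ideal hp); exact: add_prefix_ideal.
  have LL : subideal (L i) (L i.+1).
    move=> a [s ps h]; exists s => //; apply: (add_prefix_least _ _ _ h).
    - exact: add_prefix_ideal.
    - exact: add_prefix_sub.
    - by move=> j ji; exact: (@add_prefix_gen A J r x i.+1 j hJ (leqW ji)).
  have qxi : q xi.
    apply: Lq; apply: (loc_ideal_sub hp); exact: (@add_prefix_gen A J r x i.+1 (Ordinal ir) hJ (ltnSn i)).
  have nz j s : L i (s * xi ^+ j) -> L i s.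
    elim: j => [|j IHj]; first by rewrite expr0 mulr1.
    by rewrite exprS mulrCA => /(reg (Ordinal ir)) /IHj.
  pose T a := exists s j, ~ q s /\ a = s * xi ^+ j.
  have [||a La [s [j [nq ea]]]|q' [hq' Lq' disj]] := @krull_prime A (L i) T (hL i).
  - by exists 1, 0%N; rewrite mulr1; split=> //; case: hq.
  - move=> _ _ [s [j [nq ->]]] [s' [j' [nq' ->]]]; exists (s * s'), (j + j')%N.
    split; first exact: primeM.
    by rewrite exprD; ring.
  - by apply: nq; apply: Lq; apply: LL; apply: (nz j); rewrite -ea.
  have q'q : subideal q' q.
    by move=> a qa; apply: NNPP => na; apply: (disj a qa); exists a, 0%N; rewrite mulr1.
  have nxi : ~ q' xi.
    by move=> h; apply: (disj _ h); exists 1, 1%N; rewrite mul1r expr1; split=> //; case: hq.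
  have [c [hc sc ci]] := IH q' (ltnW ir) hq' (fun a h => qp _ (q'q _ h)) Lq'.
  exists (fun j => if (j <= i)%N then c j else q); split.
  - move=> j ji; case: leqP => jle; last first.
      split=> // a Ja; apply: Lq; apply: (loc_ideal_sub hp); exact: add_prefix_sub.
    by have [? ? s] := hc j jle; split=> // a /s /q'q.
  - move=> j ji; have jle : (j <= i)%N by rewrite -ltnS.
    rewrite jle; case: (leqP j.+1 i) => jlt; first exact: sc.
    have -> : j = i by lia.
    by rewrite ci; split=> // h; apply: nxi; exact: h.
  - by rewrite ltnn.
by move=> hq qp Lq; have [c [h1 h2 _]] := H r q (leqnn _) hq qp Lq; exists c.
Qed.

Lemma maximal_inverse p x : maximal_ideal p -> ~ p x -> exists y, p (1 - y * x).
Proof.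
move=> [hp p1 pmax] nx; pose q a := exists y, p (a - y * x).
have hq : is_ideal q.
  split; first by exists 0; rewrite mul0r subr0; exact: ideal0.
  move=> a u v [y hy] [z hz]; exists (a * y + z).
  have -> : a * u + v - (a * y + z) * x = a * (u - y * x) + (v - z * x) by ring.
  exact: (idealD hp (idealM _ hp hy) hz).
have [|//|e] := pmax q hq; first by move=> a pa; exists 0; rewrite mul0r subr0.
by case: nx; apply/e; exists 1; rewrite mul1r subrr; exact: ideal0.
Qed.

Lemma maximal_prime p : maximal_ideal p -> prime_ideal p.
Proof.
move=> mp; have [hp p1 _] := mp; split=> // a b pab; apply: NNPP => none.
have [|y hy] := @maximal_inverse p a mp; first by move=> h; apply: none; left.
apply: none; right; have -> : b = b * (1 - y * a) + y * (a * b) by ring.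
exact: (idealD hp (idealM _ hp hy) (idealM _ hp pab)).
Qed.

(** The determinant trick: the characteristic matrix of multiplication by y, evaluated at y,
    annihilates the generators modulo I. So does its determinant, which therefore lies in I because
    1 is a combination of the generators. *)
Lemma cayley_hamilton (B : comNzRingType) (f : {rmorphism B -> A}) I (T : finType) (g : T -> A) y :
  is_ideal I -> (forall x, exists a : T -> B, I (x - \sum_i f (a i) * g i)) ->
  exists2 P : {poly B}, P \is monic & I (map_poly f P).[y].
Proof.
move=> hI gen; pose N := #|T|; pose g' (i : 'I_N) := g (enum_val i).
have gen' x : exists a : 'I_N -> B, I (x - \sum_i f (a i) * g' i).
  have [a ha] := gen x; exists (fun i => a (enum_val i)); move: ha; congr (I (_ - _)).
  by rewrite (reindex (@enum_val T T)) //; exists enum_rank => i _; rewrite ?enum_valK ?enum_rankK.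
have [a ha] := choice_fun (fun i => gen' (y * g' i)).
pose M := \matrix_(i, j) a i j; exists (char_poly M); first exact: char_poly_monic.
pose ev : {rmorphism {poly B} -> A} := (horner_eval y \o map_poly f : {rmorphism _ -> _}).
pose D := map_mx ev (char_poly_mx M).
have DE i j : D i j = y *+ (i == j) - f (a i j).
  rewrite !mxE; change ((map_poly f ('X *+ (i == j) - (a i j)%:P)).[y] = y *+ (i == j) - f (a i j)).
  by rewrite rmorphB rmorphMn /= map_polyX map_polyC hornerD hornerN hornerC hornerMn hornerX.
have ID i : I (\sum_j D i j * g' j).
  have := ha i; congr (I _).
  under [RHS]eq_bigr => j _ do rewrite DE mulrBl.
  rewrite sumrB; congr (_ - _); rewrite (bigD1 i) //= eqxx mulr1n big1 ?addr0 // => j.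
  by rewrite eq_sym => /negbTE ->; rewrite mulr0n mul0r.
have Idet i : I (\det D * g' i).
  have : I (\sum_l \adj D i l * \sum_j D l j * g' j).
    by apply: (ideal_sum _ hI) => l _; exact: (idealM _ hI (ID l)).
  congr (I _); transitivity (\sum_j (\adj D *m D) i j * g' j).
    under eq_bigr => l _ do rewrite mulr_sumr.
    rewrite exchange_big /=; apply: eq_bigr => j _; rewrite mxE mulr_suml.
    by apply: eq_bigr => l _; rewrite mulrA.
  rewrite mul_adj_mx (bigD1 i) //= !mxE eqxx mulr1n big1 ?addr0 // => j.
  by rewrite !mxE eq_sym => /negbTE ->; rewrite mulr0n mul0r.
have [c hc] := gen' 1.
have -> : (map_poly f (char_poly M)).[y] = \det D by rewrite /D det_map_mx.
have h1 : I (\sum_i f (c i) * (\det D * g' i)).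
  by apply: (ideal_sum _ hI) => l _; exact: (idealM _ hI (Idet l)).
have := idealD hI (idealM (\det D) hI hc) h1; congr (I _).
rewrite mulrBr mulr1 mulr_sumr -addrA -[RHS]addr0; congr (_ + _).
by rewrite addrC -sumrB big1 // => i _; rewrite mulrCA subrr.
Qed.

End Chains.

(** * The Nullstellensatz *)

Lemma reverse_term (A : comNzRingType) (a x y z : A) :
  y * x * (a * z) + a * y * (1 - z * x) = a * y.
Proof. by ring. Qed.

Section Nullstellensatz.
Variables (k : closedFieldType) (n : nat).
Notation R := {mpoly k[n]}.
Variable p : R -> Prop.
Hypothesis mp : maximal_ideal p.

(* Noether normalization by induction on the number j of variables: R/p is
   finite over the image of k[X_1..X_j]. *)
Lemma residue_field_scalar j (f : {rmorphism {mpoly k[j]} -> R}) (T : finType) (g : T -> R) :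
  (forall c, f c%:MP = c%:MP) ->
  (forall x, exists a : T -> {mpoly k[j]}, p (x - \sum_i f (a i) * g i)) ->
  forall y, exists c, p (y - c%:MP).
Proof.
have hpr := maximal_prime mp; have [hp p1 pM] := hpr.
elim: j f T g => [|j IH] f T g fC gen y.
  have [P monP rP] := cayley_hamilton y hp gen.
  pose P' := map_poly (mcoeff 0%MM) P.
  have eP : map_poly f P = map_poly (@mpolyC n k) P'.
    rewrite -map_poly_comp; apply: eq_map_poly => c /=.
    by rewrite {1}(mpoly0_const c) fC.
  have monP' : P' \is monic by exact: monic_map.
  have [s es] := closed_field_poly_normal P'.
  rewrite (monicP monP') scale1r in es.
  move: rP; rewrite eP es rmorph_prod /= horner_prod.
  elim: s {es} => [|c s IHs]; first by rewrite big_nil => /p1.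
  rewrite big_cons => /pM[|//]; rewrite rmorphB /= map_polyX map_polyC hornerXsubC => h.
  by exists c.
(* A relation a among the images becomes monic in one variable after a change of coordinates, and
   R/p is then finite over the image of a polynomial ring in one variable less. *)
case: (excluded_middle_informative (exists2 a, a != 0 & p (f a))) => [[a a0 pa]|none].
  have [co [c [co0 c0 lc _]]] := monic_coordinates a0.
  set H := coord_poly co a in lc.
  have uH : lead_coef H \is a GRing.unit by rewrite lc mpolyC_unit.
  pose f' : {rmorphism {mpoly k[j]} -> R} := (f \o emb co : {rmorphism _ -> _}).
  apply: (IH f' (T * 'I_(size H))%type (fun q => g q.1 * f (wvar co) ^+ q.2)) => [d|x].
    by change (f (emb co d%:MP) = d%:MP); rewrite embC fC.
  have [b hb] := gen x.
  have [r hr] : exists r : T -> {poly {mpoly k[j]}}, forall i,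
      (size (r i) < size H)%N /\ exists Q, b i = Q * a + psi co (r i).
    apply: (@choice_fun T {poly {mpoly k[j]}} (fun i r => (size r < size H)%N /\ exists Q, b i = Q * a + psi co r)) => i.
    have [Q [r [e s]]] := poly_unit_lead_div (coord_poly co (b i)) uH.
    exists r; split=> //; exists (psi co Q).
    by rewrite -[LHS](thetaK co0) e (rmorphD (psi co)) (rmorphM (psi co)) thetaK.
  exists (fun q : T * 'I_(size H) => (r q.1)`_q.2).
  have e2 i : \sum_(l < size H) f' (r i)`_l * f (wvar co) ^+ l = f (psi co (r i)).
    have [/ltnW sr _] := hr i.
    rewrite (psiE co) rmorph_sum /=.
    rewrite [RHS](big_ord_widen _ (fun l => f (emb co (r i)`_l * wvar co ^+ l)) sr) [RHS]big_mkcond.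
    apply: eq_bigr => l _; case: ltnP => hl; first by rewrite rmorphM rmorphXn.
    rewrite nth_default //; have h0 : f' 0 = 0 by exact: (rmorph0 f').
    by transitivity (f' 0 * f (wvar co) ^+ l); [|rewrite h0 mul0r].
  have e1 : \sum_(q : T * 'I_(size H)) f' (r q.1)`_q.2 * (g q.1 * f (wvar co) ^+ q.2) =
      \sum_i f (psi co (r i)) * g i.
    rewrite -(pair_big xpredT xpredT (fun i (l : 'I_(size H)) => f' (r i)`_l * (g i * f (wvar co) ^+ l))) /=.
    apply: eq_bigr => i _; rewrite -e2 mulr_suml; apply: eq_bigr => l _.
    by rewrite [g i * _]mulrC mulrA.
  rewrite e1; have h1 : p (\sum_i (f (b i) - f (psi co (r i))) * g i).
    apply: (ideal_sum _ hp) => i _; have [_ [Q ->]] := hr i; apply: (ideal_mulr _ hp).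
    rewrite rmorphD addrK rmorphM; exact: (idealM _ hp pa).
  have := idealD hp hb h1; congr (p _).
  under [X in _ + X = _]eq_bigr => i _ do rewrite mulrBl.
  by rewrite sumrB addrA subrK.
(* In the remaining case the polynomial ring embeds in the field R/p. The inverse z of the image of
   X0 satisfies a monic equation P; multiplied by X0^s it gives an element E of the kernel, whose
   value at the origin is the leading coefficient 1 of P. *)
pose X0 : {mpoly k[j.+1]} := 'X_ord0.
have nX : ~ p (f X0).
  move=> h; apply: none; exists X0 => //; by rewrite -msize_poly_eq0 msizeX.
have [z hz] := maximal_inverse mp nX.
have [P monP rP] := cayley_hamilton z hp gen.
have [s sP] : exists s, size P = s.+1.
  by exists (size P).-1; rewrite prednK // size_poly_gt0 monic_neq0.
pose E := \sum_(i < s.+1) P`_i * X0 ^+ (s - i).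
have zX i : p (1 - (z * f X0) ^+ i).
  elim: i => [|i IHi]; first by rewrite expr0 subrr; exact: ideal0.
  have -> : 1 - (z * f X0) ^+ i.+1 = (1 - z * f X0) + (z * f X0) * (1 - (z * f X0) ^+ i).
    by rewrite exprS; ring.
  exact: (idealD hp hz (idealM _ hp IHi)).
have pE : p (f E).
  have h1 := idealM (f X0 ^+ s) hp rP.
  have h2 : p (\sum_(i < s.+1) f P`_i * f X0 ^+ (s - i) * (1 - (z * f X0) ^+ i)).
    by apply: (ideal_sum _ hp) => i _; exact: (idealM _ hp (zX i)).
  have := idealD hp h1 h2; congr (p _).
  rewrite (horner_coef_wide _ (size_poly _ _)) sP mulr_sumr -big_split rmorph_sum /=.
  apply: eq_bigr => i _; rewrite coef_poly ltn_ord (rmorphM f) rmorphXn /= exprMn.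
  have -> : f X0 ^+ s = f X0 ^+ (s - i) * f X0 ^+ i by rewrite -exprD subnK // -ltnS.
  exact: reverse_term.
have E0 : E = 0 by apply: NNPP => /eqP E0; apply: none; exists E.
have := congr1 (meval (fun=> 0 : k)) E0; rewrite /E big_ord_recr /= subnn expr0 mulr1.
rewrite rmorphD rmorph_sum big1 => [|i _].
  rewrite add0r; have -> : P`_s = 1 by move/monicP: monP; rewrite lead_coefE sP.
  by rewrite (rmorph1 (meval (fun=> 0 : k))) (rmorph0 (meval (fun=> 0 : k))) => /eqP; rewrite oner_eq0.
rewrite rmorphM rmorphXn /= mevalXU expr0n subn_eq0 leqNgt ltn_ord /= mulr0 //.
Qed.

Lemma nullstellensatz y : exists c, p (y - c%:MP).
Proof.
apply: (@residue_field_scalar n (idfun : {rmorphism _ -> _}) unit (fun=> 1)) => // x.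
exists (fun=> x); rewrite big_const card_unit /= mulr1 addr0 subrr.
by case: mp => hp _ _; exact: ideal0.
Qed.

End Nullstellensatz.

(** * Koszul relations and syzygies *)

Section Koszul.
Variables (A : comNzRingType) (n : nat) (x : 'I_n -> A).
Notation chain := ({set 'I_n} -> A).
Implicit Types (S : {set 'I_n}) (c : chain) (L : A -> Prop) (j l : 'I_n).

Definition eps j S : A := (-1) ^+ #|[set l in S | (l < j)%N]|.

Lemma eps_sq j S : eps j S * eps j S = 1.
Proof. by rewrite /eps -exprD -signr_odd oddD addbb. Qed.

Lemma eps_setU j l S : l \notin S -> eps j (l |: S) = (if (l < j)%N then -1 else 1) * eps j S.
Proof.
move=> lS; rewrite /eps; case: ifP => lj.
  rewrite -exprS; congr (_ ^+ _).
  have -> : [set i in l |: S | (i < j)%N] = l |: [set i in S | (i < j)%N].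
    by apply/setP => i; rewrite !inE andb_orl; case: eqP => [->|]; rewrite ?lj.
  by rewrite cardsU1 inE (negbTE lS).
rewrite mul1r; congr (_ ^+ #|pred_of_set _|); apply/setP => i; rewrite !inE andb_orl.
by case: eqP => [->|]; rewrite ?lj ?(negbTE lS).
Qed.

Lemma eps_swap j l S : j != l -> j \notin S -> l \notin S ->
  eps j S * eps l (j |: S) = - (eps l S * eps j (l |: S)).
Proof.
move=> jl jS lS; rewrite !eps_setU //.
case: (ltngtP j l) => [h|h|/val_inj e]; last by rewrite e eqxx in jl.
  by ring.
by ring.
Qed.

(** Chains of all degrees are kept in one function on subsets, the Koszul degree being [#|S|]. [dK]
    is the differential and [eK j] the wedge product with the j-th basis vector. *)
Definition dK c S : A := \sum_(j | j \notin S) eps j S * x j * c (j |: S).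
Definition eK j c S : A := if j \in S then eps j (S :\ j) * c (S :\ j) else 0.

Lemma antisym_sum0 (T : 'I_n -> 'I_n -> A) :
  (forall j l, T j l = - T l j) -> (forall j, T j j = 0) -> \sum_j \sum_l T j l = 0.
Proof.
move=> h h0.
have split3 j : \sum_l T j l = \sum_(l : 'I_n | (j < l)%N) T j l + \sum_(l : 'I_n | (l < j)%N) T j l.
  rewrite (bigID (fun l : 'I_n => (j < l)%N)) /=; congr (_ + _).
  rewrite (bigID (fun l : 'I_n => (l < j)%N)) /= [X in _ + X]big1 ?addr0.
    by apply: eq_bigl => l; rewrite -leqNgt andbC; case: ltnP => // /ltnW ->.
  move=> l; rewrite -leqNgt -leqNgt => /andP[a b].
  by have -> : l = j by apply/val_inj/eqP; rewrite eqn_leq a b.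
under eq_bigr => j _ do rewrite split3.
rewrite big_split /= [X in _ + X](exchange_big_dep xpredT) //=.
rewrite -big_split big1 //= => j _; rewrite -big_split big1 //= => l _.
by rewrite h addNr.
Qed.

Lemma dK_dK c S : dK (dK c) S = 0.
Proof.
rewrite /dK; pose T j l := if (j \notin S) && (l \notin j |: S) then
   eps j S * x j * (eps l (j |: S) * x l * c (l |: (j |: S))) else 0.
transitivity (\sum_j \sum_l T j l).
  rewrite big_mkcond; apply: eq_bigr => j _; case: ifP => jS.
    rewrite mulr_sumr [LHS]big_mkcond; apply: eq_bigr => l _; rewrite /T jS /=.
    by case: ifP.
  by rewrite big1 // => l _; rewrite /T jS.
apply: antisym_sum0 => [j l|j]; last by rewrite /T !inE eqxx /= andbF.
rewrite /T !inE !negb_or [l == j]eq_sym.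
have [->|jl] := eqVneq j l; first by rewrite andbF oppr0.
case jS: (j \in S) => /=; first by rewrite andbF oppr0.
case lS: (l \in S) => /=; first by rewrite oppr0.
have e : l |: (j |: S) = j |: (l |: S) by rewrite !setUA [[set l] :|: _]setUC.
rewrite e.
have := @eps_swap j l S jl (negbT jS) (negbT lS) => h.
transitivity (eps j S * eps l (j |: S) * (x j * x l * c (j |: (l |: S)))); first by ring.
by rewrite h; ring.
Qed.

Lemma eK_homotopy j c S : dK (eK j c) S + eK j (dK c) S = x j * c S.
Proof.
rewrite /dK /eK; case: ifP => jS.
  have jS' : j \notin S :\ j by rewrite !inE eqxx.
  rewrite [X in _ + _ * X](bigD1 j) //= setD1K // mulrDr.
  have -> : eps j (S :\ j) * (eps j (S :\ j) * x j * c S) = x j * c S.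
    by rewrite !mulrA eps_sq mul1r.
  rewrite addrCA -[RHS]addr0; congr (_ + _).
  rewrite mulr_sumr [X in _ + X](eq_bigl (fun l => l \notin S)); last first.
    by move=> l; rewrite !inE negb_and negbK; case: eqP => [->|] //=; rewrite ?jS ?andbF ?andbT.
  rewrite -big_split big1 //= => l lS.
  have lj : l != j by apply: contraNneq lS => ->.
  rewrite inE jS orbT.
  have e : (l |: S) :\ j = l |: (S :\ j).
    by apply/setP => i; rewrite !inE; case: (i =P l) => [->|]; rewrite ?lj //= ?andbT ?andbF.
  rewrite e; have eS : S = j |: (S :\ j) by rewrite setD1K.
  have lS' : l \notin S :\ j by rewrite !inE negb_and lS orbT.
  have h := @eps_swap j l (S :\ j) (ltac:(by rewrite eq_sym)) jS' lS'.
  have h2 : eps l (j |: S :\ j) = eps l S by rewrite setD1K.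
  rewrite h2 in h.
  have h3 : eps l S = (if (j < l)%N then -1 else 1) * eps l (S :\ j) by rewrite -h2 eps_setU.
  have h4 := @eps_setU j l (S :\ j) lS'.
  move: h3 h4; case: (ltngtP j l) => [jl|jl|/val_inj e0].
  - move=> -> ->; ring.
  - move=> -> ->; ring.
  - by rewrite e0 eqxx in lj.
rewrite addr0 (bigD1 j) ?jS //= !inE eqxx /=.
have -> : (j |: S) :\ j = S by rewrite setU1K // jS.
rewrite big1 ?addr0 => [|l /andP[lS lj]].
  by transitivity (eps j S * eps j S * (x j * c S)); [ring | rewrite eps_sq mul1r].
by rewrite !inE eq_sym (negbTE lj) jS /= mulr0.
Qed.

(* Vanishing of the Koszul homology H_i(x; A/L). *)
Definition acyclic L i := forall c, (forall S, (i <= #|S|.+1)%N -> L (dK c S)) ->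
  exists c', forall S, (i <= #|S|)%N -> L (c S - dK c' S).

Lemma acyclic_top L i : (n < i)%N -> acyclic L i.
Proof.
move=> ni c _; exists (fun=> 0) => S iS.
by have := max_card (mem S); rewrite card_ord leqNgt (leq_trans ni iS).
Qed.

Definition add_elt L (a u : A) := exists (g l : A), L l /\ u = a * g + l.

Lemma dK_sub L c c' S : is_ideal L -> (forall j, j \notin S -> L (c (j |: S) - c' (j |: S))) ->
  L (dK c S - dK c' S).
Proof.
move=> hL h; rewrite /dK -sumrB; apply: (ideal_sum _ hL) => j jS.
by rewrite -mulrBr; apply: (idealM _ hL); exact: h.
Qed.

Lemma dK_addM c g a S : dK (fun S => c S + a * g S) S = dK c S + a * dK g S.
Proof. by rewrite /dK mulr_sumr -big_split; apply: eq_bigr => j _ /=; ring. Qed.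

Lemma dK_lin (T : finType) (b : T -> A) (c : T -> chain) S :
  dK (fun S => \sum_t b t * c t S) S = \sum_t b t * dK (c t) S.
Proof.
rewrite /dK; under eq_bigr => j _ do rewrite mulr_sumr.
rewrite exchange_big /=; apply: eq_bigr => t _; rewrite mulr_sumr.
by apply: eq_bigr => j _; ring.
Qed.

(** Multiplication by a, a combination of the x_j, is null-homotopic on the Koszul complex via the
    [eK j]. In the long exact sequence of multiplication by a on A/L, the group H_i(A/L) therefore
    embeds in the quotient side H_(i+1)(A/L'), which vanishes. *)
Lemma acyclic_descent L L' i a (b : 'I_n -> A) : is_ideal L -> (0 < i)%N ->
  L' a -> a = \sum_j b j * x j -> (forall u, L (a * u) -> L u) ->
  subideal L L' -> is_ideal L' -> (forall u, L' u -> add_elt L a u) ->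
  acyclic L' i.+1 -> acyclic L i.
Proof.
move=> hL i0 L'a ea nz LL' hL' L'E ac c hc.
pose c1 S := \sum_j b j * eK j c S.
have e1 S : a * c S = dK c1 S + \sum_j b j * eK j (dK c) S.
  rewrite /c1 dK_lin -big_split ea mulr_suml; apply: eq_bigr => j _ /=.
  by rewrite -mulrDr eK_homotopy mulrA.
have L2 S : (i <= #|S|)%N -> L (\sum_j b j * eK j (dK c) S).
  move=> iS; apply: (ideal_sum _ hL) => j _; apply: (idealM _ hL); rewrite /eK.
  case: ifP => jS; last exact: ideal0.
  apply: (idealM _ hL); apply: hc; apply: leq_trans iS _.
  by rewrite (cardsD1 j S) jS.
have [c2 hc2] : exists c', forall S, (i.+1 <= #|S|)%N -> L' (c1 S - dK c' S).
  apply: ac => S iS; rewrite ltnS in iS.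
  have -> : dK c1 S = a * c S - \sum_j b j * eK j (dK c) S by rewrite e1 addrK.
  exact: (idealB hL' (ideal_mulr _ hL' L'a) (LL' _ (L2 S iS))).
have [g hg] : exists g : chain, forall S, (i.+1 <= #|S|)%N -> L (c1 S - dK c2 S - a * g S).
  apply: (@choice_fun _ A (fun S g => (i.+1 <= #|S|)%N -> L (c1 S - dK c2 S - a * g))) => S.
  case: (leqP i.+1 #|S|) => iS; last by exists 0.
  have [g [l [Ll e]]] := L'E _ (hc2 S iS); exists g => _; by rewrite e addrAC subrr add0r.
exists g => S iS; apply: nz.
have h3 : L (dK c1 S - dK (fun S => dK c2 S + a * g S) S).
  apply: (dK_sub hL) => j jS; rewrite opprD addrA; apply: hg.
  by rewrite cardsU1 jS.
have e3 : dK (fun S => dK c2 S + a * g S) S = a * dK g S.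
  by rewrite dK_addM dK_dK add0r.
have := idealD hL h3 (L2 S iS); congr (L _).
by rewrite e3 mulrBr e1 addrAC.
Qed.

End Koszul.

Definition i0 : 'I_3 := @Ordinal 3 0 isT.
Definition i1 : 'I_3 := @Ordinal 3 1 isT.
Definition i2 : 'I_3 := @Ordinal 3 2 isT.

Lemma all3 (P : 'I_3 -> Prop) : P i0 -> P i1 -> P i2 -> forall i, P i.
Proof.
move=> h0 h1 h2 [[|[|[|//]]] h].
- by have -> : Ordinal h = i0 by exact: val_inj.
- by have -> : Ordinal h = i1 by exact: val_inj.
- by have -> : Ordinal h = i2 by exact: val_inj.
Qed.

Lemma sum3 (V : nmodType) (F : 'I_3 -> V) : \sum_i F i = F i0 + F i1 + F i2.
Proof.
rewrite !big_ord_recl big_ord0 addr0 addrA.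
by congr (F _ + F _ + F _); exact: val_inj.
Qed.

(** * Cross products and the Bourbaki ideal *)

Section Cross.
Variable A : comNzRingType.
Implicit Types (u v w f : 'I_3 -> A).

Definition dot u v : A := u i0 * v i0 + u i1 * v i1 + u i2 * v i2.
Definition cross u v (i : 'I_3) : A := match val i with
  | 0 => u i1 * v i2 - u i2 * v i1
  | 1 => u i2 * v i0 - u i0 * v i2
  | _ => u i0 * v i1 - u i1 * v i0 end.
Definition unitv (j i : 'I_3) : A := (i == j)%:R.

Lemma cross_cross u v w i : cross (cross u v) w i = v i * dot u w - u i * dot v w.
Proof. by move: i; apply: all3; rewrite /cross /dot /=; ring. Qed.

Lemma dot_crossl u v : dot (cross u v) u = 0.
Proof. by rewrite /cross /dot /=; ring. Qed.

Lemma dot_crossr u v : dot (cross u v) v = 0.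
Proof. by rewrite /cross /dot /=; ring. Qed.

Lemma dotC u v : dot u v = dot v u.
Proof. by rewrite /dot; ring. Qed.

Lemma dot_unitv j v : dot (unitv j) v = v j.
Proof. by move: j; apply: all3; rewrite /dot /unitv /=; ring. Qed.

Lemma eq_dot u u' v v' : u =1 u' -> v =1 v' -> dot u v = dot u' v'.
Proof. by move=> h h'; rewrite /dot !h !h'. Qed.

Lemma dotZl c u v : dot (fun i => c * u i) v = c * dot u v.
Proof. by rewrite /dot; ring. Qed.

Lemma crossZl c u v i : cross (fun i => c * u i) v i = c * cross u v i.
Proof. by move: i; apply: all3; rewrite /cross /=; ring. Qed.

Lemma cross_lin c u v w i : cross (fun i => c * u i + v i) w i = c * cross u w i + cross v w i.
Proof. by move: i; apply: all3; rewrite /cross /=; ring. Qed.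

Lemma cross_swap u v i j : cross u v =1 (fun=> 0) -> u i * v j = u j * v i.
Proof.
move=> h; have := h i0; have := h i1; have := h i2; rewrite /cross /=.
move=> /eqP; rewrite subr_eq0 => /eqP h2 /eqP; rewrite subr_eq0 => /eqP h1 /eqP; rewrite subr_eq0 => /eqP h0.
by move: i; apply: all3; move: j; apply: all3.
Qed.

Lemma eq_cross u u' v v' i : u =1 u' -> v =1 v' -> cross u v i = cross u' v' i.
Proof. by move=> h h'; rewrite /cross !h !h'. Qed.

Lemma eval_pair (l m n0 n1 n2 u0 u1 u2 : A) :
  u0 * n1 - u1 * n0 - l * (u1 * n2 - u2 * n1) - m * (u2 * n0 - u0 * n2) =
  - (u1 + m * u2) * (n0 + l * n2) + (u0 + l * u2) * (n1 + m * n2).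
Proof. by ring. Qed.

End Cross.

Section CoprimeVectors.
Variable A : idomainType.
Hypothesis hufd : ufd A.
Implicit Types (u v f nu : 'I_3 -> A) (g : A).

(** A vector parallel to a coprime vector is a multiple of it in the ring itself, not only over the
    fraction field. *)
Lemma parallel_multiple u v j : cop v -> v j != 0 -> cross u v =1 (fun=> 0) ->
  exists c, forall i, u i = c * v i.
Proof.
move=> cv vj h.
have [c ec] : divides (v j) (u j).
  by apply: (@cop_div A hufd _ u v) => // i; rewrite (cross_swap j i h) mulrC.
exists c => i; apply: (mulfI vj); rewrite mulrC (cross_swap i j h) ec; ring.
Qed.

Variables f nu : 'I_3 -> A.
Hypotheses (cf : cop f) (cn : cop nu) (nuf : dot nu f = 0).
Variables (jf jn : 'I_3).
Hypotheses (fj : f jf != 0) (nj : nu jn != 0).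

(** For a syzygy u, the vector u x nu is parallel to f, and the factor g depends linearly on u and
    vanishes exactly on R nu: this is the quotient of Syz(J) by nu as an ideal of R. *)
Definition I0 g := exists u, forall i, cross u nu i = g * f i.

Lemma I0_ideal : is_ideal I0.
Proof.
split; first by exists (fun=> 0) => i; move: i; apply: all3; rewrite /cross /=; ring.
by move=> a g g' [u hu] [v hv]; exists (fun i => a * u i + v i) => i; rewrite cross_lin hu hv; ring.
Qed.

Lemma kernel_nu u : cross u nu =1 (fun=> 0) -> exists c, forall i, u i = c * nu i.
Proof. by move=> h; exact: (parallel_multiple cn nj h). Qed.

Lemma I0_syz u g : (forall i, cross u nu i = g * f i) -> dot u f = 0.
Proof.
move=> h; have [g0|g0] := eqVneq g 0.
  have [c hc] := kernel_nu (fun i => etrans (h i) (ltac:(by rewrite g0 mul0r))).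
  by rewrite (eq_dot (u' := fun i => c * nu i) (v' := f)) // dotZl nuf mulr0.
apply: (mulfI g0); rewrite mulr0 dotC -dotZl -(dot_crossl u nu).
by apply: eq_dot => // i; rewrite h.
Qed.

Lemma phi_exists u : dot u f = 0 -> exists g, forall i, cross u nu i = g * f i.
Proof.
move=> hu; apply: (@parallel_multiple _ f jf cf fj) => i.
by rewrite cross_cross hu nuf !mulr0 subrr.
Qed.

Lemma phi_unitv i j : cross (cross (unitv A j) f) nu i = nu j * f i.
Proof.
by rewrite cross_cross dot_unitv [dot f nu]dotC nuf mulr0 subr0 mulrC.
Qed.

Lemma I0_nu j : I0 (nu j).
Proof. by exists (cross (unitv A j) f) => i; exact: phi_unitv. Qed.

Variables l m : A.
Notation h1 := (nu i0 + l * nu i2).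
Notation h2 := (nu i1 + m * nu i2).
Hypotheses (h10 : h1 != 0) (cop12 : cop (fun b : bool => if b then h1 else h2)).
Notation f' := (f i2 - l * f i0 - m * f i1).

Lemma pair_div x y : x * h1 = y * h2 -> exists c, x = c * h2 /\ y = c * h1.
Proof.
move=> e; have [c ec] : divides h1 y.
  apply: (@cop_div A hufd _ (fun b : bool => if b then y else x) _ y h1 cop12 h10).
  by case; [rewrite mulrC | rewrite -e mulrC].
exists c; split=> //; apply: (mulIf h10); rewrite e ec; ring.
Qed.

(** The relation nu.f = 0 reads h1 f_0 + h2 f_1 + nu_2 f' = 0, so the ideal is linked to f' through
    the pair. Conversely, from g f' = a h1 + b h2 coprimality produces a single c by which f_0, f_1,
    f_2 times g are all expressed, and u is read off. *)
Lemma I0_colon g : I0 g <-> exists x y, g * f' = x * h1 + y * h2.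
Proof.
split=> [[u hu]|[a [b e]]].
  exists (- (u i1 + m * u i2)), (u i0 + l * u i2).
  have := hu i0; have := hu i1; have := hu i2; rewrite /cross /= => e2 e1 e0.
  by rewrite -eval_pair e0 e1 e2; ring.
have ea : (g * f i0 + a * nu i2) * h1 = (- (g * f i1 + b * nu i2)) * h2.
  have d0 : nu i0 * f i0 + nu i1 * f i1 + nu i2 * f i2 = 0 by exact: nuf.
  have : (g * f i0 + a * nu i2) * h1 - (- (g * f i1 + b * nu i2)) * h2 =
    g * (nu i0 * f i0 + nu i1 * f i1 + nu i2 * f i2) + nu i2 * ((a * h1 + b * h2) - g * f') by ring.
  by rewrite d0 e subrr !mulr0 addr0 => /eqP; rewrite subr_eq0 => /eqP.
have [c [ec1 ec2]] := pair_div ea.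
have e0 : g * f i0 = c * h2 - a * nu i2 by rewrite -ec1; ring.
have e1 : g * f i1 = - c * h1 - b * nu i2 by rewrite mulNr -ec2; ring.
have e2 : g * f i2 = a * h1 + b * h2 + l * (g * f i0) + m * (g * f i1) by rewrite -e; ring.
pose u (i : 'I_3) := match val i with 0 => b + l * c | 1 => - a + m * c | _ => - c end.
exists u; apply: all3; rewrite /cross /u /= ?e2 ?e0 ?e1; ring.
Qed.

End CoprimeVectors.

(** * Generic combinations and heights of primes *)

Section PrimeChains.
Variables (k : closedFieldType) (n : nat).
Notation R := {mpoly k[n]}.
Implicit Types (g h : R).

Lemma scalar_divides (p h : R) (c : k) : c != 0 -> divides p (c%:MP * h) -> divides p h.
Proof.
move=> c0 [b e]; exists ((c^-1)%:MP * b).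
by rewrite -mulrA -e mulrA -mpolyCM mulVf // mpolyC1 mul1r.
Qed.

Lemma bad_scalars (x y : R) : exists bad : R -> k, forall q (m : k),
  divides q (x + m%:MP * y) -> divides q y \/ m = bad q.
Proof.
apply: (@choice_fun R k (fun q b => forall m : k, divides q (x + m%:MP * y) ->
  divides q y \/ m = b)) => q.
case: (classic (exists m : k, divides q (x + m%:MP * y))) => [[b hb]|nb]; last first.
  by exists 0 => m hm; case: nb; exists m.
exists b => m hm; have [->|mb] := eqVneq m b; [by right | left].
apply: (@scalar_divides q _ (m - b)); first by rewrite subr_eq0.
have := dividesD hm (dividesN hb); congr (divides _ _).
by rewrite mpolyCB; ring.
Qed.

(** For each of the finitely many primes q of the first combination at most one scalar m makes q
    divide the second, unless q divides the third entry; but then q would divide all three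
    entries. *)
Lemma generic_pair (v : 'I_3 -> R) : cop v -> v i0 != 0 \/ v i2 != 0 ->
  exists l m : k, v i0 + l%:MP * v i2 != 0 /\
    cop (fun b : bool => if b then v i0 + l%:MP * v i2 else v i1 + m%:MP * v i2).
Proof.
move=> cv v02.
have [l hl] : exists l : k, v i0 + l%:MP * v i2 != 0.
  have [v0|v0] := eqVneq (v i0) 0; last by exists 0; rewrite mpolyC0 mul0r addr0.
  by exists 1; rewrite mpolyC1 mul1r v0 add0r; case: v02; rewrite // v0 eqxx.
have [s [sP hs]] := ufd_prime_list (@ufd_mpoly k n) hl.
have [bad hbad] := bad_scalars (v i1) (v i2).
have [m hm] := fresh_scalar [seq bad q | q <- s].
exists l, m; split=> // p pp h.
have [q qs [qp pq]] := hs _ pp (h true).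
have tr x : divides p x -> divides q x by case: qp => c -> [b ->]; exists (b * c); rewrite mulrA.
have [q2|e] := hbad q m (tr _ (h false)); last by case/negP: hm; rewrite e map_f.
apply: (cv q (sP _ qs)); apply: all3 => //.
  have := dividesD (tr _ (h true)) (dividesN (divides_mull l%:MP q2)); by rewrite addrK.
have := dividesD (tr _ (h false)) (dividesN (divides_mull m%:MP q2)); by rewrite addrK.
Qed.

Lemma prime_factor_in (p : R -> Prop) g : prime_ideal p -> p g -> g != 0 ->
  exists q, [/\ prime_elt q, divides q g & p q].
Proof.
move=> pp pg g0; have [u [s [uu sP e]]] := @ufd_mpoly k n g g0.
have [hp p1 pM] := pp.
have : p (\prod_(q <- s) q).
  by case: (pM _ _ (eq_ind _ p pg _ e)) => // pu; case: p1; rewrite -(mulVr uu); exact: (idealM _ hp pu).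
rewrite e; elim: s sP {e} => [|q s IH] sP; first by rewrite big_nil => /p1.
rewrite big_cons => /pM[h|h]; first by exists q; split=> //; [exact: sP (mem_head _ _) | apply: divides_mull; apply: divides_mulr; exact: divides_refl].
have [r rs|q' [a b c]] := IH _ h; first by apply: sP; rewrite inE rs orbT.
by exists q'; split=> //; rewrite mulrCA; apply: divides_mull.
Qed.

Lemma zero_prime : prime_ideal (@zero_ideal R).
Proof.
split; first exact: zero_ideal_ideal.
  by move=> /eqP; rewrite oner_eq0.
by move=> a b /eqP; rewrite mulf_eq0 => /orP[] /eqP; [left | right].
Qed.

(** A nonzero prime ideal inside (q) contains a prime element, which is divisible by q and hence
    associated to it. *)
Lemma principal_prime_chain (q : R) : prime_elt q -> ~ prime_chain (@zero_ideal R) (divides q) 2.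
Proof.
move=> pq [c [sc hc]].
pose o0 : 'I_3 := i0; have [_ n01] := sc i0 i1 isT; have [_ n12] := sc i1 i2 isT.
have [p0 _ _] := hc i0; have [p1 _ p1q] := hc i1; have [_ _ p2q] := hc i2.
have [x [c1x c0x]] : exists x, c i1 x /\ ~ c i0 x.
  by apply: NNPP => h; apply: n01 => x hx; apply: NNPP => nx; apply: h; exists x.
have x0 : x != 0 by apply/eqP => e; apply: c0x; rewrite e; case: p0 => h _ _; exact: ideal0.
have [s [ps _ c1s]] := prime_factor_in p1 c1x x0.
have [u eu] := p1q _ c1s.
apply: n12 => y /p2q[b ->]; have [hp1 _ _] := p1; apply: (idealM _ hp1).
have [s0 _ sM] := ps; have [q0 nq _] := pq.
case: (sM u q); first by rewrite -eu; exact: divides_refl.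
  move=> [w ew]; case/negP: nq; apply/unitrP; exists w.
  have e1 : w * q = 1.
    by apply: (mulIf s0); rewrite mul1r [RHS]eu ew; ring.
  by split; rewrite // mulrC.
by move=> [w ->]; exact: (idealM _ hp1 c1s).
Qed.

Lemma cop2_chain (p : R -> Prop) (h1 h2 : R) : prime_ideal p -> h1 != 0 ->
  cop (fun b : bool => if b then h1 else h2) -> p h1 -> p h2 ->
  exists q, [/\ prime_elt q, divides q h1 & subideal (divides q) p] /\ ~ divides q h2.
Proof.
move=> pp h10 c12 ph1 ph2; have [q [pq qh1 pq']] := prime_factor_in pp ph1 h10.
exists q; split; first by split=> // x [b ->]; case: pp => hp _ _; exact: (idealM _ hp).
by move=> qh2; apply: (c12 q pq); case.
Qed.

Lemma cop2_height (p : R -> Prop) (h1 h2 : R) : prime_ideal p -> h1 != 0 ->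
  cop (fun b : bool => if b then h1 else h2) -> p h1 -> p h2 ->
  prime_chain (@zero_ideal R) p 2.
Proof.
move=> pp h10 c12 ph1 ph2; have [q [[pq qh1 sq] nq]] := cop2_chain pp h10 c12 ph1 ph2.
have [hp _ _] := pp; have [q0 _ _] := pq.
pose c (j : nat) : R -> Prop := match j with 0 => @zero_ideal R | 1 => divides q | _ => p end.
apply: (@nat_chain _ _ _ _ c) => [[|[|j]]|[|[|//]]] _ /=.
- by split=> [||x ->]; [exact: zero_prime | | exact: ideal0].
- by split=> [|x ->|]; [exact: prime_elt_ideal | exact: divides0 | ].
- by split=> // x ->; exact: ideal0.
- split=> [x ->|h]; first exact: divides0.
  by have := h q (divides_refl q); move/eqP: q0.
- by split=> // h; apply: nq; apply: h.
Qed.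

End PrimeChains.

Section HeightTwo.
Variables (k : closedFieldType) (m : nat).
Notation B := {mpoly k[m.+1]}.
Notation R := {mpoly k[m.+3]}.
Variable F : frame k m.+1.

Lemma frame_prime (I : R -> Prop) : is_ideal I -> (forall b, I (fb F b) -> b = 0) ->
  exists p, [/\ prime_ideal p, subideal I p & trivial_mod (fb F) p].
Proof.
move=> hI h; have [p [pp sp hp]] := @krull_prime _ I (fun x => exists2 b, b != 0 & fb F b = x) hI
  (ex_intro2 _ _ 1 (oner_neq0 _) (rmorph1 _))
  (fun x y '(ex_intro2 a a0 ea) '(ex_intro2 c c0 ec) =>
     ex_intro2 _ _ (a * c) (mulf_neq0 a0 c0) (eq_trans (rmorphM _ a c) (f_equal2 *%R ea ec)))
  (fun x Ix '(ex_intro2 b b0 e) => elimN eqP b0 (h b (eq_ind_r I Ix e))).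
exists p; split=> //; split; first exact: fbC.
by move=> b pb; apply/eqP/negP => /negP b0; apply: (hp _ pb); exists b.
Qed.

Lemma trivial_mod_height (p : R -> Prop) h : trivial_mod (fb F) p -> (2 < h)%N ->
  ~ prime_chain (@zero_ideal R) p h.
Proof. by move=> tp h2 /prime_chain_bound => /(_ _ _ tp); rewrite -[(m.+3)]addn2 -addSnnS; lia. Qed.

(** Coprime elements force height at least 2 on every prime over I. A prime over I that meets B in 0
    has height at most n - (n - 2) by algebraic independence. *)
Lemma ideal_height2 (I : R -> Prop) h1 h2 : is_ideal I -> h1 != 0 ->
  cop (fun b : bool => if b then h1 else h2) -> I h1 -> I h2 ->
  (forall b, I (fb F b) -> b = 0) -> ideal_height I 2.
Proof.
move=> hI h10 c12 I1 I2 h; have ch p : prime_ideal p -> subideal I p -> prime_chain (@zero_ideal R) p 2.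
  by move=> pp sp; exact: (cop2_height pp h10 c12 (sp _ I1) (sp _ I2)).
split=> //; have [p [pp sp tp]] := frame_prime hI h.
exists p; split=> //; split; first exact: ch.
exact: (trivial_mod_height tp).
Qed.

End HeightTwo.

(** [generic_pair] perturbs entries 0 and 1 by entry 2, so the vector must not be concentrated in
    entry 1; in positive degree coprimality excludes this. *)
Lemma cop_ends (k : closedFieldType) (n t : nat) (v : 'I_3 -> {mpoly k[n]}) : cop v ->
  (forall i, v i \is t.-homog) -> (0 < t)%N -> (exists j, v j != 0) ->
  v i0 != 0 \/ v i2 != 0.
Proof.
move=> cv hv t0 ex.
have [z0|] := eqVneq (v i0) 0; last by left.
have [z2|] := eqVneq (v i2) 0; last by right.
have z1 : v i1 != 0.
  by have [j] := ex; move: j; apply: all3 => //; rewrite ?z0 ?z2 eqxx.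
case u1 : (v i1 \is a GRing.unit).
  have v0 : (v i1)^-1 != 0 by rewrite invr_eq0.
  have h1 : v i1 * (v i1)^-1 \is 0.-homog by rewrite mulrV //; exact: (mpolyC_homog n 1).
  have [s [r [hs _ /eqP]]] := homog_prod_factor z1 v0 h1; rewrite addn_eq0 => /andP[/eqP s0 _].
  have en : t != s by rewrite s0 -lt0n.
  by case/eqP: z1; exact: (homog_eq0 (hv i1) hs en).
have [q pq qn] := ufd_prime_factor (@ufd_mpoly k n) z1 (negbT u1).
by case: (cv q pq); apply: all3 => //; rewrite ?z0 ?z2; exact: divides0.
Qed.

(** * Bourbaki ideals and the degree formula *)

Section Bourbaki.
Variables (k : closedFieldType) (n d e : nat) (f : 'rV[{mpoly k[n]}]_3).
Notation R := {mpoly k[n]}.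
Hypotheses (hf : forall i, f 0 i \is d.-homog) (hgcd : coprime_forms f) (he : is_indeg (syz f) e).
Implicit Types (u v nu : 'cV[R]_3) (I : R -> Prop).

Definition fv (i : 'I_3) : R := f 0 i.
Definition cvec u (i : 'I_3) : R := u i 0.
Definition colv (w : 'I_3 -> R) : 'cV[R]_3 := \col_i w i.

Lemma colvE w : cvec (colv w) =1 w. Proof. by move=> i; rewrite /cvec mxE. Qed.

Lemma syzE u : syz f u <-> dot (cvec u) fv = 0.
Proof.
have e1 : (f *m u) 0 0 = dot (cvec u) fv by rewrite mxE sum3 /dot /cvec /fv; ring.
split=> [h|h]; first by rewrite -e1 h mxE.
by apply/matrixP => i j; rewrite !ord1 e1 h mxE.
Qed.

Lemma fv_cop : cop fv.
Proof.
move=> p [p0 np _] h; case/negP: np; apply: hgcd => i.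
by have [b e1] := h i; exists b; rewrite mulrC.
Qed.

Lemma fv_neq0 : exists j, fv j != 0.
Proof.
apply: NNPP => h; have : (0 : R) \is a GRing.unit.
  apply: hgcd => i; exists 0; rewrite mul0r; apply: NNPP => /eqP nz.
  by apply: h; exists i.
by rewrite unitr0.
Qed.

(** Some Koszul syzygy is nonzero, and it has degree d. *)
Lemma indeg_le : (e <= d)%N.
Proof.
have [j fj] := fv_neq0; have [_ mine] := he.
have hk l : syz f (colv (cross (unitv _ l) fv)).
  by apply/syzE; rewrite (eq_dot (colvE _) (fun=> erefl)) dot_crossr.
have hh l : homog_vec d (colv (cross (unitv _ l) fv)).
  have hb (b : bool) (x : R) : x \is d.-homog -> b%:R * x \is d.-homog.
    by move=> hx; case: b; rewrite ?mul1r // mul0r rpred0.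
  by move=> i; rewrite mxE; move: i; apply: all3; rewrite /cross /= /unitv; apply: rpredB; apply: hb; exact: hf.
have [l [i nz]] : exists l i, cross (unitv R l) fv i != 0.
  case: (j =P i0) fj => [-> fj|].
    by exists i1, i2; rewrite /cross /unitv /= mul0r mul1r sub0r oppr_eq0.
  move=> j0; have {j0} := j0; case: (j =P i1) => [-> _ fj|].
    by exists i0, i2; rewrite /cross /unitv /= mul0r mul1r subr0.
  move: j; apply: all3 => // _ _ fj.
  by exists i0, i1; rewrite /cross /unitv /= mul0r mul1r sub0r oppr_eq0.
apply: (mine d _ (hk l)); last exact: hh.
by apply/eqP => /matrixP/(_ i 0); rewrite !mxE => /eqP; apply/negP.
Qed.

Section MinimalSyzygy.
Variable nu : 'cV[R]_3.
Hypothesis hnu : min_syzygy f nu.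

Lemma min_syzygyP : [/\ dot (cvec nu) fv = 0, nu != 0 & homog_vec e nu].
Proof.
have [e' [[_ min'] /[dup] hs /syzE sn n0 hn]] := hnu; have [[u [su u0 hu]] mine] := he.
have -> : e = e' by apply/eqP; rewrite eqn_leq (mine _ _ hs n0 hn) (min' _ _ su u0 hu).
by split.
Qed.

Lemma nu_neq0 : exists j, cvec nu j != 0.
Proof.
have [_ n0 _] := min_syzygyP; apply: NNPP => h; case/eqP: n0.
apply/matrixP => i j; rewrite ord1 [RHS]mxE; apply: NNPP => /eqP nz; apply: h; by exists i.
Qed.

(** A common prime factor would have positive degree, and dividing by it would give a syzygy of
    degree below e. *)
Lemma nu_cop : cop (cvec nu).
Proof.
have [sn n0 hn] := min_syzygyP; have [j nj] := nu_neq0; have [_ mine] := he.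
move=> p [p0 np _] /choice_fun [w hw].
have wj : w j != 0 by apply: contraNneq nj => wj; rewrite hw wj mul0r.
have [a [b [ha hb eab]]] : exists t r, [/\ p \is t.-homog, w j \is r.-homog & (t + r = e)%N].
  by apply: homog_prod_factor => //; rewrite mulrC -hw; exact: hn.
have a0 : (0 < a)%N.
  rewrite lt0n; apply: contra np => /eqP a0; rewrite a0 in ha.
  rewrite (homog0_const ha); apply: mpolyC_unit.
  by apply: contra p0 => /eqP c0; rewrite (homog0_const ha) c0 mpolyC0.
have sw : syz f (colv w).
  apply/syzE; rewrite (eq_dot (colvE _) (fun=> erefl)); apply: (mulfI p0).
  by rewrite mulr0 -dotZl -sn; apply: eq_dot => // i; rewrite hw mulrC.
have : (e <= b)%N.
  apply: (mine _ _ sw).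
    by apply/eqP => /matrixP/(_ j 0); rewrite !mxE => /eqP; apply/negP.
  move=> i; rewrite mxE.
  have h1 : p * w i \is e.-homog by rewrite mulrC -hw; exact: hn.
  by have := homog_factor p0 ha h1; rewrite -eab leq_addr addKn.
by rewrite -eab; move: a0; clear; lia.
Qed.

Definition bourb : R -> Prop := I0 fv (cvec nu).

Lemma bourb_ideal : is_ideal bourb.
Proof. exact: I0_ideal. Qed.

Lemma bourb_nu j : bourb (cvec nu j).
Proof. by have [sn _ _] := min_syzygyP; exact: I0_nu. Qed.

(** Comparison on Koszul syzygies shows that phi is a fixed g times the cross product map, so I = g
    [bourb]. A nonunit g would put I inside a principal prime, against height 2. *)
Lemma bourbaki_unique I : bourbaki_ideal f nu I -> eq_ideal I bourb.
Proof.
move=> [[phi [s [phL _ phK phI]]] hI].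
have [sn n0 hn] := min_syzygyP; have [j nj] := nu_neq0; have [jf fj] := fv_neq0.
have cf := fv_cop; have cn := nu_cop.
pose uu l := colv (cross (unitv R l) fv).
have su l : syz f (uu l) by apply/syzE; rewrite (eq_dot (colvE _) (fun=> erefl)) dot_crossr.
have eu l i : cross (cvec (uu l)) (cvec nu) i = cvec nu l * fv i.
  by rewrite (eq_cross _ (colvE _) (fun=> erefl)) (phi_unitv sn).
have ph0 : phi 0 = 0.
  have s0 : syz f 0 by rewrite /syz mulmx0.
  have := phL 1 0 0 s0 s0; rewrite scale1r addr0 mul1r => /esym/eqP.
  by rewrite -subr_eq0 addrK => /eqP.
have phZ a u : syz f u -> phi (a *: u) = a * phi u.
  by move=> hu; have := phL a u 0 hu (mulmx0 _ _); rewrite addr0 ph0 addr0.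
(* The cross product map kills b u - a v, which is therefore a multiple of nu and killed by phi. *)
have ratio u v a b : syz f u -> syz f v -> (forall i, cross (cvec u) (cvec nu) i = a * fv i) ->
   (forall i, cross (cvec v) (cvec nu) i = b * fv i) -> b * phi u = a * phi v.
  move=> hsu hsv hu hv.
  have sv' : syz f (- a *: v) by rewrite /syz -scalemxAr hsv scaler0.
  have sd : syz f (b *: u + - a *: v) by rewrite /syz mulmxDr sv' addr0 -scalemxAr hsu scaler0.
  have e1 : phi (b *: u + - a *: v) = b * phi u - a * phi v by rewrite phL // phZ // mulNr.
  have [c hc] : exists c, forall i, cvec (b *: u + - a *: v) i = c * cvec nu i.
    apply: (kernel_nu (@ufd_mpoly k n) cn nj) => i.
    transitivity (b * cross (cvec u) (cvec nu) i - a * cross (cvec v) (cvec nu) i).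
      by move: i; apply: all3; rewrite /cross /cvec /= !mxE; ring.
    by rewrite hu hv; ring.
  apply/eqP; rewrite -subr_eq0 -e1; apply/eqP/(phK _ sd); exists c.
  by apply/matrixP => i l; have := hc i; rewrite /cvec !ord1 => ->; rewrite mxE.
have [g eg] : divides (cvec nu j) (phi (uu j)).
  apply: (@cop_div R (@ufd_mpoly k n) _ (fun l => phi (uu l)) (cvec nu) _ _ cn nj) => l.
  by rewrite mulrC (ratio _ _ _ _ (su j) (su l) (eu j) (eu l)).
have phg u a : syz f u -> (forall i, cross (cvec u) (cvec nu) i = a * fv i) -> phi u = g * a.
  move=> hu ha; apply: (mulfI nj); rewrite (ratio _ _ _ _ hu (su j) ha (eu j)) eg; ring.
have g0 : g != 0.
  apply/eqP => g0; have /(phK _ (su j))[a ea] : phi (uu j) = 0 by rewrite eg g0 mul0r.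
  have := eu j jf; rewrite (eq_cross (u' := fun i => a * cvec nu i) (v' := cvec nu) jf); last 2 first.
  - by move=> i; rewrite ea /cvec mxE.
  - by [].
  rewrite crossZl (_ : cross _ _ jf = 0); last by move: (jf); apply: all3; rewrite /cross /=; ring.
  by rewrite mulr0 => /esym/eqP; rewrite mulf_eq0 (negbTE nj) (negbTE fj).
have IE x : I x <-> exists2 a, bourb a & x = g * a.
  rewrite phI; split=> [[u hu <-]|[a [u hu] ->]].
    have /syzE hu' := hu; have [a ha] := phi_exists (@ufd_mpoly k n) cf sn fj hu'.
    by exists a; [exists (cvec u) | exact: phg].
  have h1 := I0_syz (@ufd_mpoly k n) cn sn nj hu.
  have hc : syz f (colv u) by apply/syzE; rewrite (eq_dot (colvE _) (fun=> erefl)).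
  by exists (colv u) => //; apply: phg => // i; rewrite (eq_cross _ (colvE _) (fun=> erefl)).
have gu : g \is a GRing.unit.
  case: hI => [h1|[h1 _]].
    have /IE[a _ e1] : I 1 by apply/h1.
    by apply/unitrP; exists a; rewrite mulrC -e1.
  apply/negPn/negP => ng; have [q pq [b eb]] := ufd_prime_factor (@ufd_mpoly k n) g0 ng.
  apply: (principal_prime_chain pq); apply: h1; first exact: prime_elt_ideal.
  by move=> x /IE[a _ ->]; exists (b * a); rewrite eb; ring.
move=> x; rewrite IE; split=> [[a ha ->]|hx]; first exact: (idealM _ bourb_ideal ha).
by exists (g^-1 * x); [exact: (idealM _ bourb_ideal hx) | rewrite mulrA mulrV // mul1r].
Qed.

Lemma bourbaki_exists : bourb 1 \/ ideal_height bourb 2 -> bourbaki_ideal f nu bourb.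
Proof.
move=> hI; have [sn n0 hn] := min_syzygyP; have [j nj] := nu_neq0; have [jf fj] := fv_neq0.
have cf := fv_cop; have cn := nu_cop.
have [phi hphi] : exists phi : 'cV[R]_3 -> R, forall u, syz f u ->
    forall i, cross (cvec u) (cvec nu) i = phi u * fv i.
  apply: (@choice_fun _ R (fun u a => syz f u -> forall i, cross (cvec u) (cvec nu) i = a * fv i)) => u.
  case: (classic (syz f u)) => hu; last by exists 0.
  have [a ha] := phi_exists (@ufd_mpoly k n) cf sn fj (proj1 (syzE _) hu).
  by exists a.
split; last by case: hI => h; [left=> x; split=> // _; exact: (ideal1 _ bourb_ideal h) | right].
have uniq u a : syz f u -> cross (cvec u) (cvec nu) jf = a * fv jf -> phi u = a.
  by move=> hu ha; apply: (mulIf fj); rewrite -ha hphi.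
(* The product with nu raises the degree by e, and dividing by f lowers it by d. *)
exists phi, (e%:Z - d%:Z); split.
- move=> a u v hu hv; apply: uniq.
    by rewrite /syz mulmxDr -scalemxAr hu hv scaler0 addr0.
  rewrite mulrDl -mulrA -!hphi // -cross_lin; apply: eq_cross => // i.
  by rewrite /cvec !mxE.
- move=> i u hu hhu.
  have hc : fv jf * phi u \is (i + e).-homog.
    rewrite mulrC -hphi //; move: (jf); apply: all3; rewrite /cross /=;
    by apply: rpredB; (apply: dhomogM; [exact: hhu | exact: hn]).
  have := homog_factor fj (hf jf) hc; case: leqP => h.
    by have -> : (i%:Z + (e%:Z - d%:Z)) = (i + e - d)%N :> int by lia.
  move=> ->; case E: (i%:Z + (e%:Z - d%:Z)) => [t|t] //=; exact: rpred0.
- move=> u hu; split=> [h0|[a ->]].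
    have [c hc] := kernel_nu (@ufd_mpoly k n) cn nj (fun i => etrans (hphi u hu i) (ltac:(by rewrite h0 mul0r))).
    by exists c; apply/matrixP => i l; rewrite ord1 mxE; exact: hc.
  apply: uniq; first by rewrite /syz -scalemxAr (proj2 (syzE _) sn) scaler0.
  rewrite mul0r (eq_cross (u' := fun i => a * cvec nu i) (v' := cvec nu) jf) //; last first.
    by move=> i; rewrite /cvec mxE.
  by rewrite crossZl; move: (jf); apply: all3; rewrite /cross /=; ring.
move=> g; split=> [[u hu]|[u hu <-]]; last by exists (cvec u) => i; exact: hphi.
have h1 := I0_syz (@ufd_mpoly k n) cn sn nj hu.
have hc : syz f (colv u) by apply/syzE; rewrite (eq_dot (colvE _) (fun=> erefl)).
by exists (colv u) => //; apply: uniq => //; rewrite (eq_cross _ (colvE _) (fun=> erefl)).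
Qed.

Lemma bourb_indeg0 : e = 0%N -> bourb 1.
Proof.
move=> e0; have [sn n0 hn] := min_syzygyP; have [j nj] := nu_neq0.
have := hn j; rewrite e0 => /homog0_const ec.
have u : cvec nu j \is a GRing.unit.
  rewrite /cvec ec; apply: mpolyC_unit; apply: contra nj => /eqP c0.
  by rewrite /cvec ec c0 mpolyC0.
by rewrite -(mulVr u); exact: (idealM _ bourb_ideal (bourb_nu j)).
Qed.

End MinimalSyzygy.
End Bourbaki.

Section ProductDimension.
Variables (k : fieldType) (V1 V2 : lmodType k).

Lemma zero_subspace (V : lmodType k) : subspace (fun v : V => v = 0).
Proof. by split=> // c u v -> ->; rewrite scaler0 addr0. Qed.

Lemma dim_mod_prod (W1 : V1 -> Prop) (W2 : V2 -> Prop) N1 N2 : subspace W1 -> subspace W2 ->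
  dim_mod (fun v => v = 0) W1 N1 -> dim_mod (fun v => v = 0) W2 N2 ->
  dim_mod (fun v : V1 * V2 => v = 0) (fun v => W1 v.1 /\ W2 v.2) (N1 + N2).
Proof.
move=> s1 s2 h1 h2.
pose Y (p : (V1 * V2)%type) := W1 p.1 /\ p.2 = 0.
have hW : subspace (fun v : (V1 * V2)%type => W1 v.1 /\ W2 v.2).
  split; first by split; [case: s1 | case: s2].
  by move=> c u v [? ?] [? ?]; split; [apply: s1.2 | apply: s2.2].
have hY : subspace Y.
  split; first by split=> //; case: s1.
  by move=> c u v [? u2] [? v2]; split; [apply: s1.2 | rewrite /= u2 v2 scaler0 addr0].
apply: (dim_mod_tower (zero_subspace _) hY) => [v ->|v [h ->]||]; first by case: hY.
- by split=> //; case: s2.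
- apply: (dim_mod_img (f := fun x => (x, 0) : (V1 * V2)%type) s1 _ _ _ h1).
  + move=> c x y _ _; rewrite -[RHS]/((c *: x + y, c *: 0 + 0) : (V1 * V2)%type).
    by rewrite scaler0 addr0.
  + by move=> x _; split=> [->|[]].
  + by move=> [y1 y2]; split=> [[/= hy ->]|[x hx [<- <-]]]; [exists y1 | split].
apply: (dim_mod_lift (f := fun p : (V1 * V2)%type => p.2) hW _ _ _ h2).
- by [].
- by move=> u [hu1 hu2]; split=> [[]|].
- by move=> y; split=> [hy|[[u1 u2] [_ /= hu] <-]//]; exists (0, y) => //; split=> //; case: s1.
Qed.

End ProductDimension.

(** * Dimension count for the two exact sequences *)

Section HilbertFormula.
Variables (k : closedFieldType) (n d e : nat) (f nu : 'I_3 -> {mpoly k[n]}).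
Notation R := {mpoly k[n]}.
Hypotheses (hf : forall i, f i \is d.-homog) (hn : forall i, nu i \is e.-homog).
Hypotheses (cf : cop f) (cn : cop nu) (nuf : dot nu f = 0) (ed : (e <= d)%N).
Variables (jf jn : 'I_3).
Hypotheses (fj : f jf != 0) (nj : nu jn != 0).
Notation hufd := (@ufd_mpoly k n).
Notation I := (I0 f nu).
Notation J := (ideal_gen f).

Definition tri (p : R * R * R) (i : 'I_3) : R :=
  match val i with 0 => p.1.1 | 1 => p.1.2 | _ => p.2 end.

Lemma tri_lin (c : k) p q i : tri (c *: p + q) i = c%:MP * tri p i + tri q i.
Proof. by move: i; apply: all3; rewrite /tri /= -mul_mpolyC. Qed.

Lemma tri_inj p q : tri p =1 tri q -> p = q.
Proof.
case: p => [[a b] c]; case: q => [[a' b'] c'] h.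
by have := h i0; have := h i1; have := h i2; rewrite /tri /= => -> -> ->.
Qed.

(** Elements of degree t in J come from vectors of degree s = t - d, and a syzygy of degree s maps
    to an element of I of degree r = s + e - d; these are the shifts in the two sequences. *)
Lemma HF_syzygy t : (d + d <= t)%N -> (HF J t)%:R = (@dimR n t)%:R - 3 * (@dimR n (t - d))%:R
  + (@dimR n (t - d - e))%:R + (@dimR n (t - d - (d - e)))%:R - (HF I (t - d - (d - e)))%:R :> rat.
Proof.
move=> ddt; set s := (t - d)%N; set r := (s - (d - e))%N.
have hI := I0_ideal f nu; have hJ := ideal_gen_ideal f.
have [NJ [leJ dJ ->]] := HF_codim t hJ; have [NI [leI dI ->]] := HF_codim r hI.
suff h : (dimR n (s - e) + NI + NJ = dimR n s + dimR n s + dimR n s)%N.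
  by rewrite !natrB //; have := congr1 (fun i => i%:R : rat) h; rewrite !natrD; lra.
pose V := (R * R * R)%type.
have ss := hcomp_subspace k n s.
pose W (p : V) := (hcomp s p.1.1 /\ hcomp s p.1.2) /\ hcomp s p.2.
have dW : dim_mod (fun v : V => v = 0) W (dimR n s + dimR n s + dimR n s).
  apply: (dim_mod_prod (W1 := fun v : R * R => hcomp s v.1 /\ hcomp s v.2) (W2 := hcomp s) _ ss).
  - split; first by split; case: ss.
    by move=> c u v [? ?] [? ?]; split; apply: ss.2.
  - exact: (dim_mod_prod ss ss (dimR_dim k n s) (dimR_dim k n s)).
  - exact: dimR_dim.
have hW : subspace W.
  split; first by do ![split | case: ss].
  by move=> c u v [[? ?] ?] [[? ?] ?]; do ![split | apply: ss.2].
have Wtri p : W p <-> forall i, hcomp s (tri p i).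
  split=> [[[a b] c]|h]; first exact: all3.
  by split; [split; [exact: (h i0) | exact: (h i1)] | exact: (h i2)].
pose ev (p : V) := dot (tri p) f.
have evL c p q : ev (c *: p + q) = c *: ev p + ev q.
  by rewrite /ev /dot !tri_lin -mul_mpolyC; ring.
pose S (p : V) := W p /\ ev p = 0.
have hS : subspace S.
  split; first by split; [case: hW | rewrite /ev /dot /tri /=; ring].
  by move=> c u v [? eu] [? ev']; split; [apply: hW.2 | rewrite evL eu ev' scaler0 addr0].
have dS : dim_mod S W NJ.
  apply: (dim_mod_lift (f := ev) hW _ _ _ dJ).
  - by move=> c u v _ _; exact: evL.
  - by move=> u hu; split=> [[]|h] //; split.
  - move=> y; split=> [[[c hc] hy]|[p /Wtri hp <-]].
      exists (hpart s (c i0), hpart s (c i1), hpart s (c i2)).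
        by do ![split | exact: hpart_homog].
      rewrite -[RHS](hpart_id hy) hc sum3 !raddfD /= ![c _ * _]mulrC !(hpart_mul _ _ (hf _)).
      have -> : (d <= t)%N by lia.
      by rewrite /ev /dot /tri /= ![hpart s _ * _]mulrC.
    split.
      by exists (tri p); rewrite sum3.
    have hm i : (tri p i * f i) \is t.-homog.
      have := dhomogM (hp i) (hf i); rewrite /s subnK //; lia.
    by rewrite /ev /dot /hcomp; do ![apply: rpredD | exact: hm].
pose Z (p : V) := p = 0.
have hZ : subspace Z by exact: zero_subspace.
have ZS v : Z v -> S v by move=> ->; case: hS.
have SW v : S v -> W v by case.
suff dZS : dim_mod Z S (dimR n (s - e) + NI).
  exact: (dim_mod_uniq hZ (dim_mod_tower hZ hS ZS SW dZS dS) dW).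
have [phi hphi] : exists phi : V -> R, forall p, S p -> forall i, cross (tri p) nu i = phi p * f i.
  apply: (@choice_fun V R (fun p a => S p -> forall i, cross (tri p) nu i = a * f i)) => p.
  case: (classic (S p)) => [[_ hp]|]; last by exists 0.
  by have [a ha] := phi_exists hufd cf nuf fj hp; exists a.
have uniq p a : S p -> cross (tri p) nu jf = a * f jf -> phi p = a.
  by move=> hp ha; apply: (mulIf fj); rewrite -ha hphi.
have phL (c : k) p q : S p -> S q -> phi (c *: p + q) = c *: phi p + phi q.
  move=> hp hq; apply: uniq; first exact: hS.2.
  rewrite -mul_mpolyC mulrDl -mulrA -!hphi // -cross_lin; apply: eq_cross => // i.
  exact: tri_lin.
pose K (p : V) := exists2 a, hcomp (s - e) a & p = (a * nu i0, a * nu i1, a * nu i2).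
have kap (c : k) x y : ((c *: x + y) * nu i0, (c *: x + y) * nu i1, (c *: x + y) * nu i2)
    = c *: ((x * nu i0, x * nu i1, x * nu i2) : V) + (y * nu i0, y * nu i1, y * nu i2).
  by apply: tri_inj; apply: all3; rewrite /tri /= mulrDl scalerAl.
have triKn a i : tri (a * nu i0, a * nu i1, a * nu i2) i = a * nu i.
  by move: i; apply: all3.
have sub0 (x y : R) : x * y - x * y = 0 by rewrite subrr.
have nuK a : cross (tri (a * nu i0, a * nu i1, a * nu i2)) nu jf = 0 * f jf.
  by rewrite (eq_cross (u' := fun i => a * nu i) (v' := nu) jf) // crossZl; move: (jf); apply: all3; rewrite /cross /=; ring.
have se : (e <= s)%N by rewrite /s; lia.
have KS v : K v -> S v.
  move=> [a ha ->]; split.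
    apply/Wtri => i; rewrite triKn; have := dhomogM ha (hn i); rewrite subnK //.
  by rewrite /ev (eq_dot (u' := fun i => a * nu i) (v' := f)) // dotZl nuf mulr0.
have hK : subspace K.
  split.
    by exists 0; [case: (hcomp_subspace k n (s - e)) | rewrite !mul0r].
  move=> c _ _ [x hx ->] [y hy ->]; exists (c *: x + y); last by rewrite kap.
  exact: (hcomp_subspace k n (s - e)).2.
have ZK v : Z v -> K v by move=> ->; case: hK.
have dK : dim_mod Z K (dimR n (s - e)).
  apply: (dim_mod_img (f := fun a => (a * nu i0, a * nu i1, a * nu i2) : V) (hcomp_subspace k n (s - e)) _ _ _ (dimR_dim k n (s - e))).
  - by move=> c x y _ _; exact: kap.
  - move=> x _; split=> [->|h]; first by rewrite /Z !mul0r.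
    have := triKn x jn; rewrite h => /esym/eqP.
    rewrite (_ : tri 0 jn = 0); last by move: (jn); apply: all3.
    by rewrite mulf_eq0 (negbTE nj) orbF => /eqP.
  - by move=> y; split=> [[a ha ->]|[a ha <-]]; exists a.
have dKS : dim_mod K S NI.
  apply: (dim_mod_lift (f := phi) hS _ _ _ dI).
  - exact: phL.
  - move=> u hu; split=> [hk|h].
      have [a ha eu] := hk; apply: uniq => //; rewrite {1}eu; exact: nuK.
    have [c hc] := kernel_nu hufd cn nj (fun i => etrans (hphi u hu i) (ltac:(by rewrite [phi u]h mul0r))).
    have hW' := proj1 (Wtri u) hu.1.
    have hcs : hcomp (s - e) c.
      have := homog_factor (g := c) nj (hn jn) (t := s); rewrite mulrC -hc se; apply; exact: hW'.
    by exists c => //; apply: tri_inj => i; rewrite hc triKn.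
  - have rE : (s + e = r + d)%N by rewrite /r; move: se ddt; rewrite /s; lia.
    move=> y; split=> [[[u hu] hy]|[u hu <-]].
      pose p : V := (hpart s (u i0), hpart s (u i1), hpart s (u i2)).
      have cp i : cross (tri p) nu i = y * f i.
        have := congr1 (fun x => hpart (s + e) x) (hu i).
        have -> : hpart (s + e) (y * f i) = y * f i.
          by rewrite hpart_id // rE; exact: (dhomogM hy (hf i)).
        move=> <-; have hm a l : hpart (s + e) (a * nu l) = hpart s a * nu l.
          by rewrite mulrC (hpart_mul _ _ (hn l)) leq_addl addnK mulrC.
        by move: i; apply: all3; rewrite /cross /= raddfB /= !hm.
      have Sp : S p.
        split; first by do ![split | exact: hpart_homog].
        exact: (I0_syz hufd cn nuf nj cp).
      by exists p => //; exact: uniq.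
    split; first by exists (tri u) => i; exact: hphi.
    have hW' := proj1 (Wtri u) hu.1.
    have hc : f jf * phi u \is (s + e).-homog.
      rewrite mulrC -hphi //; move: (jf); apply: all3; rewrite /cross /=;
      by apply: rpredB; (apply: dhomogM; [exact: hW' | exact: hn]).
    have := homog_factor fj (hf jf) hc; rewrite rE leq_addl addnK; exact: id.
exact: (dim_mod_tower hZ hK ZK KS dK dKS).
Qed.

End HilbertFormula.

Section FormulaCoefficient.
Variables (k : closedFieldType) (m : nat).
Notation D t := ((@dimR m.+3 t)%:R : rat).

Lemma second_difference i j : epolc m (fun t => D t - D (t - i) - D (t - j) + D (t - i - j)) (i%:R * j%:R).
Proof.
have h := epolc_diff i (cnt0_epolc m.+2); rewrite mulr1 in h.
have := epolc_diff j h; rewrite mulrC; apply: eq_epolc.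
exists 0%N => t _; rewrite /dimR (_ : t - j - i = t - i - j)%N; last by lia.
by ring.
Qed.

(** The dimension terms are the second difference with steps d, d at t minus the one with steps e, d
    - e at t - d, whence d^2 - e(d - e). *)
Lemma syzygy_epolc (d e : nat) (G H : nat -> rat) c : (e <= d)%N -> epolc m G c ->
  (forall t, (d + d <= t)%N -> H t = D t - 3 * D (t - d) + D (t - d - e) + D (t - d - (d - e)) - G (t - d - (d - e))%N) ->
  epolc m H (d%:R ^+ 2 + e%:R ^+ 2 - e%:R * d%:R - c).
Proof.
move=> ed hG hH.
have h1 := epolcB (epolcB (second_difference d d) (epolc_shift d (second_difference e (d - e))))
  (epolc_shift d (epolc_shift (d - e) hG)).
have -> : (d%:R ^+ 2 + e%:R ^+ 2 - e%:R * d%:R - c : rat) = d%:R * d%:R - e%:R * (d - e)%:R - c.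
  by rewrite natrB //; ring.
apply: eq_epolc h1; exists (d + d)%N => t /hH ->.
rewrite (_ : t - d - e - (d - e) = t - d - d)%N; last by lia.
ring.
Qed.

End FormulaCoefficient.

Lemma eq_ideal_eq (A : comNzRingType) (I J : A -> Prop) : eq_ideal I J -> I = J.
Proof. by move=> h; apply: functional_extensionality => x; exact: propositional_extensionality. Qed.

Lemma prime_chain_le (A : comNzRingType) (I p : A -> Prop) h h' :
  prime_chain I p h -> (h' <= h)%N -> prime_chain I p h'.
Proof.
move=> [q [sq hq]] le; have w (i : 'I_h'.+1) : (i < h.+1)%N by apply: leq_trans (ltn_ord i) _.
exists (fun i => q (Ordinal (w i))); split=> [i j ij|i]; last exact: hq.
exact: sq.
Qed.

Lemma hfr_unit (k : closedFieldType) n (I : {mpoly k[n]} -> Prop) r : is_ideal I -> I 1 -> epolc r (hfr I) 0.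
Proof.
move=> hI I1; apply: epol_epolc0; exists (fun=> 0); exists 0%N => t _.
rewrite /binsum big1 => [|i _]; last by rewrite mul0r.
have := @HF_span k n I t 'I_0 (fun=> 0) hI; rewrite card_ord leqn0 => h.
rewrite /hfr; have /eqP -> // : HF I t == 0%N; apply: h => g _; exists (fun=> 0).
exact: (ideal1 _ hI I1).
Qed.

Lemma homog_exp (k : closedFieldType) n (x : {mpoly k[n]}) d j :
  x \is d.-homog -> x ^+ j \is (d * j).-homog.
Proof.
move=> hx; elim: j => [|j IH]; first by rewrite muln0 expr0; exact: (mpolyC_homog n 1).
by rewrite exprS mulnS; exact: dhomogM.
Qed.

Section FrameIdeals.
Variables (k : closedFieldType) (m : nat).
Notation B := {mpoly k[m.+1]}.
Notation R := {mpoly k[m.+3]}.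
Variables (F : frame k m.+1) (h1 h2 : R) (da db : nat).
Hypotheses (h10 : h1 != 0) (hh1 : h1 \is da.-homog) (hh2 : h2 \is db.-homog)
  (cop12 : cop (fun i : bool => if i then h1 else h2)) (ci : ci_frame F h1 h2).
Variable I : R -> Prop.
Hypotheses (hI : homog_ideal I) (I1 : I h1) (I2 : I h2).

Lemma pair_sub : subideal (pairI h1 h2) I.
Proof. by case: hI => hi _ _ [x [y ->]]; exact: (idealD hi (idealM _ hi I1) (idealM _ hi I2)). Qed.

Lemma frame_finite : exists L : finType, exists (g : L -> R) (e : L -> nat),
  (forall l, g l \is (e l).-homog) /\
  forall x, exists bl : L -> B, I (x - \sum_l fb F (bl l) * g l).
Proof.
have [_ _ _ [d1 [d2 fin]]] := ci.
exists ('I_d1 * 'I_d2)%type, (fun l : 'I_d1 * 'I_d2 => fz F ^+ l.2 * fw F ^+ l.1), (fun l : 'I_d1 * 'I_d2 => (1 * l.2 + 1 * l.1)%N).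
split=> [l|x]; first by apply: dhomogM; apply: homog_exp; [exact: fz_homog | exact: fw_homog].
have [b hb] := fin x; exists (fun l : 'I_d1 * 'I_d2 => b l.1 l.2).
rewrite (_ : \sum_l _ = \sum_(i < d1) \sum_(j < d2) fb F (b i j) * (fz F ^+ j * fw F ^+ i)).
  exact: (pair_sub hb).
by rewrite -(pair_big xpredT xpredT (fun (i : 'I_d1) (j : 'I_d2) => fb F (b i j) * (fz F ^+ j * fw F ^+ i))).
Qed.

Lemma meet_homog b : b != 0 -> I (fb F b) -> exists c t, [/\ c != 0, c \is t.-homog & I (fb F c)].
Proof.
move=> b0 Ib; apply: NNPP => no; case/eqP: b0.
rewrite (hpart_sumw (leqnn (msize b))) big1 // => i _; apply: NNPP => /eqP nz; apply: no.
by exists (hpart i b), i; split=> //; [exact: hpart_homog | rewrite -fb_hpart; exact: hI.2].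
Qed.

(** A nonzero form of B in I annihilates the finite B-module R/I, so [rank_upper] applies with no
    independent elements at all. *)
Lemma meet_epolc b : b != 0 -> I (fb F b) -> epolc m (hfr I) 0.
Proof.
move=> b0 Ib; have [c [t [c0 hc Ic]]] := meet_homog b0 Ib; have [hi _] := hI.
have [x hx /andP[x0 _]] := sub_pairI_epolc h10 hh1 hh2 cop12 hi pair_sub.
have [L [g [e [hg gen]]]] := frame_finite.
have := @rank_upper k m F I 'I_0 L (fun=> 0) (fun=> 0%N) g e c t x hI.
rewrite card_ord => /(_ _ hg c0 hc gen _ hx) xle.
have -> : 0 = x; last by [].
apply/eqP; rewrite eq_le x0 xle //; first by case.
by move=> l; exists (fun=> 0); rewrite big_ord0 subr0; exact: (ideal_mulr _ hi Ic).
Qed.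

Lemma no_meet_epolc c : (forall b, I (fb F b) -> b = 0) -> epolc m (hfr I) c -> 1 <= c.
Proof.
move=> no hc; have [hi _] := hI.
have := @rank_lower k m F I 'I_1 (fun=> 1) (fun=> 0%N) c hi; rewrite card_ord; apply=> //.
  by move=> _; exact: (mpolyC_homog _ 1).
by move=> b; rewrite big_ord1 mulr1 => /no e i; rewrite ord1.
Qed.

(** As R/(h1, h2) is torsion-free over B, some prime Q over (h1, h2) inside p meets B in 0. It has
    height at least 2 and misses b, so it lies strictly below p. *)
Lemma meet_chain3 b p : b != 0 -> I (fb F b) -> prime_ideal p -> subideal I p ->
  prime_chain (@zero_ideal R) p 3.
Proof.
move=> b0 Ib pp sp; have [hi _] := hI; have [hp p1 _] := pp; have [_ _ tf _] := ci.
have hq := pairI_ideal h1 h2.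
have [Q [pQ sQ nQ]] := @krull_prime _ (pairI h1 h2)
  (fun x => exists a s, [/\ a != 0, ~ p s & x = fb F a * s]) hq
  (ltac:(by exists 1, 1; rewrite oner_neq0 rmorph1 mulr1))
  (ltac:(move=> _ _ [a [s [a0 ns ->]]] [a' [s' [a'0 ns' ->]]]; exists (a * a'), (s * s'); split;
     [by rewrite mulf_neq0 | exact: (primeM pp ns ns') | by rewrite rmorphM mulrACA]))
  (ltac:(by move=> x hx [a [s [a0 ns e]]]; apply: ns; apply: sp; apply: pair_sub; apply: (tf a s a0); rewrite -e)).
have Qp : subideal Q p.
  by move=> x Qx; apply: NNPP => nx; apply: (nQ x Qx); exists 1, x; rewrite oner_neq0 rmorph1 mul1r.
have QB : ~ Q (fb F b) by move=> /nQ; apply; exists b, 1; rewrite mulr1.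
have [q [[pq qh1 sq] nq]] := cop2_chain pQ h10 cop12 (sQ _ (pairI1 _ _)) (sQ _ (pairI2 _ _)).
have [hQ _ _] := pQ; have [q0 _ _] := pq.
pose c (j : nat) : R -> Prop := match j with 0 => @zero_ideal R | 1 => divides q | 2 => Q | _ => p end.
apply: (@nat_chain _ _ _ _ c) => [[|[|[|j]]]|[|[|[|//]]]] _ /=.
- by split=> [||x ->]; [exact: zero_prime | | exact: ideal0].
- by split=> [|x ->|x /sq/Qp]; [exact: prime_elt_ideal | exact: divides0 | ].
- by split=> // x ->; exact: ideal0.
- by split=> // x ->; exact: ideal0.
- split=> [x ->|h]; first exact: divides0.
  by have := h q (divides_refl q); move/eqP: q0.
- split=> // h; apply: nq; apply: h; apply: sQ; exact: pairI2.
- by split=> // h; apply: QB; apply: h; exact: sp.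
Qed.

End FrameIdeals.

Lemma const_factor (A : idomainType) (c : A) (P Q : {poly A}) :
  c%:P = P * Q -> (1 < size Q)%N -> c = 0.
Proof.
move=> e s1; have Q0 : Q != 0 by rewrite -size_poly_gt0 (leq_trans _ s1).
have [P0|P0] := eqVneq P 0; first by apply/eqP; rewrite -polyC_eq0 e P0 mul0r.
apply/eqP; apply: contraLR s1 => c0; rewrite -leqNgt.
have := congr1 (fun u : {poly A} => size u) e; rewrite size_mul // size_polyC c0.
have : (0 < size P)%N by rewrite size_poly_gt0.
by move: (size P) (size Q) => a b; lia.
Qed.

Section CoprimeElements.
Variables (k : closedFieldType) (n : nat).
Notation A := {mpoly k[n]}.
Variable I : A -> Prop.
Hypotheses (hI : is_ideal I) (nodiv : forall q, prime_elt q -> exists a, I a /\ ~ divides q a).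

(** The element b found for the tail is corrected to b + t a with a outside (r); each prime of the
    list excludes at most one scalar t. *)
Lemma prime_avoidance (s : seq A) : (forall q, q \in s -> prime_elt q) ->
  exists b, I b /\ forall q, q \in s -> ~ divides q b.
Proof.
elim: s => [|r s IH] sP; first by exists 0; split; [exact: ideal0 | ].
have [q qs|b [Ib hb]] := IH; first by apply: sP; rewrite inE qs orbT.
have [a [Ia ha]] := nodiv (sP r (mem_head _ _)).
have [bad hbad] := bad_scalars b a.
have [t ht] := fresh_scalar [seq bad q | q <- r :: s].
exists (b + t%:MP * a); split; first exact: (idealD hI Ib (idealM _ hI Ia)).
move=> q qs dq; case: (hbad q t dq) => [qa|e]; last by case/negP: ht; rewrite e map_f.
move: qs; rewrite inE => /orP[/eqP e|qs]; first by case: ha; rewrite -e.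
by apply: (hb q qs); have := dividesD dq (dividesN (divides_mull t%:MP qa)); rewrite addrK.
Qed.

Lemma coprime_elements b : b != 0 -> I b ->
  exists b', I b' /\ cop (fun i : bool => if i then b else b').
Proof.
move=> b0 Ib; have [s [sP hs]] := ufd_prime_list (@ufd_mpoly k n) b0.
have [b' [Ib' hb']] := prime_avoidance sP; exists b'; split=> // q pq h.
have [r rs [[c rq] _]] := hs q pq (h true); apply: (hb' r rs).
by have [c' ->] := h false; rewrite rq mulrA; exists (c' * c).
Qed.

End CoprimeElements.

(** * Primes of height three over J *)

Section Exchange.
Variables (k : closedFieldType) (m : nat).
Notation B := {mpoly k[m.+1]}.
Notation R := {mpoly k[m.+3]}.
Variables (F : frame k m.+1) (h1 h2 h3 : R).
Hypothesis ci : ci_frame F h1 h2.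
Notation fb := (fb F).
Notation P := (pairI h1 h2).
Implicit Types (b : B).

Definition pairB b1 b2 b := exists s t, b = s * b1 + t * b2.

Lemma pairB_ideal b1 b2 : is_ideal (pairB b1 b2).
Proof.
split; first by exists 0, 0; ring.
by move=> a _ _ [s [t ->]] [s' [t' ->]]; exists (a * s + s'), (a * t + t'); ring.
Qed.

Lemma fext_pair b1 b2 x : fext F (pairB b1 b2) x <-> exists u v, x = fb b1 * u + fb b2 * v.
Proof.
split=> [h|[u [v ->]] L hL hl].
  apply: (h (fun x => exists u v, x = fb b1 * u + fb b2 * v)); last by move=> c [s [t ->]]; exists (fb s), (fb t); rewrite (rmorphD fb) !(rmorphM fb) ![fb _ * fb b1]mulrC ![fb _ * fb b2]mulrC.
  split; first by exists 0, 0; rewrite !mulr0 addr0.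
  move=> a _ _ [u [v ->]] [u' [v' ->]]; exists (a * u + u'), (a * v + v').
  move: (fb b1) (fb b2) => c1 c2; ring.
apply: (idealD hL); apply: (ideal_mulr _ hL); apply: hl.
  by exists 1, 0; rewrite mul1r mul0r addr0.
by exists 0, 1; rewrite mul1r mul0r add0r.
Qed.

Lemma fext_divides b x : fext F (divides b) x <-> exists u, x = fb b * u.
Proof.
split=> [h|[u ->] L hL hl]; last by apply: (ideal_mulr _ hL); apply: hl; exact: divides_refl.
apply: (h (fun x => exists u, x = fb b * u)); last by move=> c [s ->]; exists (fb s); rewrite (rmorphM fb) mulrC.
split; first by exists 0; rewrite mulr0.
by move=> a _ _ [u ->] [u' ->]; exists (a * u + u'); move: (fb b) => c; ring.
Qed.

Lemma exch1 (c1 c2 x1 x2 g : R) : (c2 * x1 - c1 * x2) * g = c1 * (c2 - x2 * g) - c2 * (c1 - x1 * g).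
Proof. by ring. Qed.
Lemma exch2 (c1 x1 v g : R) : c1 * v = v * (c1 - x1 * g) + x1 * (v * g).
Proof. by ring. Qed.
Lemma exch3 (al be q t x y h h' : R) : x - y = al * h + be * h' -> be = q * h + t ->
  h * (al + q * h') = (x - y) - t * h'.
Proof. by move=> -> ->; ring. Qed.
Lemma exch4 (c1 c2 x1 x2 al q h h' a1 a2 d1 d2 : R) :
  al + q * h' = c1 * a1 + c2 * a2 -> c2 * x1 - c1 * x2 = al * h + (q * h + (c1 * d1 + c2 * d2)) * h' ->
  c1 * (x2 + a1 * h + d1 * h') = c2 * (x1 - a2 * h - d2 * h').
Proof.
move=> e1 e2; apply/eqP; rewrite -subr_eq0.
have -> : c1 * (x2 + a1 * h + d1 * h') - c2 * (x1 - a2 * h - d2 * h') =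
  - (c2 * x1 - c1 * x2) + h * (c1 * a1 + c2 * a2) + (c1 * d1 + c2 * d2) * h' by ring.
by rewrite e2 -e1; apply/eqP; ring.
Qed.
Lemma exch5 (c2 y x2 a d h h' g : R) : x2 + a * h + d * h' = c2 * y ->
  c2 * (1 - y * g) = (c2 - x2 * g) - g * (a * h + d * h').
Proof. by move=> e; rewrite mulrBr mulrA -e mulr1; ring. Qed.

(** Krull's principal ideal theorem in R/(h1, h2), where the coprime pair b1, b2 of B is regular.
    There b1 = x1 h3 and b2 = x2 h3; cancelling h3 gives b2 x1 = b1 x2, so x2 = b2 y, and b2 = b2 y
    h3 gives 1 = y h3. *)
Lemma exchange b1 b2 x1 x2 : cop (fun i : bool => if i then b1 else b2) -> b1 != 0 ->
  P (fb b1 - x1 * h3) -> P (fb b2 - x2 * h3) -> exists y, P (1 - y * h3).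
Proof.
move=> c12 b10 P1 P2; have [reg1 reg2 tf _] := ci; have hP := pairI_ideal h1 h2.
have [b20|b20] := eqVneq b2 0.
  have u : b1 \is a GRing.unit.
    apply/negPn/negP => nu; have [q pq qb] := ufd_prime_factor (@ufd_mpoly k _) b10 nu.
    by apply: (c12 q pq); case=> //; rewrite b20; exact: divides0.
  exists (fb b1^-1 * x1); have := idealM (fb b1^-1) hP P1; congr (P _).
  by rewrite mulrBr -(rmorphM fb) mulVr // (rmorph1 fb) mulrA.
have nzd v : P (v * h3) -> P v.
  by move=> hv; apply: (tf b1 v b10); rewrite (exch2 _ x1 _ h3); exact: (idealD hP (idealM _ hP P1) (idealM _ hP hv)).
have [al [be e]] : P (fb b2 * x1 - fb b1 * x2).
  by apply: nzd; rewrite exch1; exact: (idealB hP (idealM _ hP P2) (idealM _ hP P1)).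
have hb := pairB_ideal b1 b2.
have hE : is_ideal (fext F (pairB b1 b2)).
  by split=> [|a u v hu hv] L hL hl; [exact: ideal0 | exact: (hL.2 a _ _ (hu L hL hl) (hv L hL hl))].
have ht : fext F (pairB b1 b2) (fb b2 * x1 - fb b1 * x2).
  by apply/fext_pair; exists (- x2), x1; rewrite mulrN addrC.
(* The equality b2 x1 = b1 x2 holds only modulo (h1, h2). Regularity modulo (b1, b2) R moves the
   coefficients [al] and [be], up to a Koszul relation, into (b1, b2) R, and the error terms are
   absorbed into x1 and x2. *)
have [q [t [hq eb]]] : exists q' t', fext F (pairB b1 b2) t' /\ be = q' * h1 + t'.
  by apply: (reg2 _ (- al) _ _ hb ht); rewrite e mulNr addKr mulrC.
have /fext_pair[a1 [a2 ea]] : fext F (pairB b1 b2) (al + q * h2).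
  by apply: (reg1 _ _ hb); rewrite (exch3 e eb); exact: (idealB hE ht (ideal_mulr _ hE hq)).
have /fext_pair[d1 [d2 ed]] := hq.
rewrite eb ed in e; have e4 := exch4 ea e.
have /fext_divides[y ey] : fext F (divides b2) (x2 + a1 * h1 + d1 * h2).
  apply: (fext_reg (c := b1)); [exact: divides_ideal | | ].
    move=> x [z ez]; apply: (@cop_div _ (@ufd_mpoly k _) _ (fun i : bool => if i then z else x) _ x b2 c12 b20).
    by case; rewrite 1?mulrC // ez mulrC.
  by apply/fext_divides; eexists; exact: e4.
exists y; apply: (tf b2 _ b20); rewrite (exch5 h3 ey); apply: (idealB hP P2).
by apply: (idealM _ hP); exists a1, d1.
Qed.

(** If the trace of I on B lay in no principal prime, it would contain a coprime pair and [exchange]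
    would put 1 in I. So it lies in some (q), and a prime p over I can be chosen with trace inside
    (q). As q is monic in one variable, the other m variables of B stay independent modulo p, which
    bounds its height by n - m = 3. *)
Lemma height3_prime (I : R -> Prop) b : is_ideal I -> (forall x, I x <-> exists y, P (x - y * h3)) ->
  ~ I 1 -> b != 0 -> I (fb b) ->
  exists p, [/\ prime_ideal p, subideal I p & ~ prime_chain (@zero_ideal R) p 4].
Proof.
move=> hI IE I1 b0 Ib.
have hIB : is_ideal (fun b => I (fb b)).
  split; first by rewrite (rmorph0 fb); exact: ideal0.
  by move=> a u v hu hv; rewrite (rmorphD fb) (rmorphM fb); exact: hI.2.
have [q [pq hq]] : exists q, prime_elt q /\ forall c, I (fb c) -> divides q c.
  apply: NNPP => no.
  have nd q : prime_elt q -> exists a, I (fb a) /\ ~ divides q a.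
    move=> pq; apply: NNPP => no'; apply: no; exists q; split=> // c Ic; apply: NNPP => nc.
    by apply: no'; exists c.
  have [b' [Ib' c12]] := coprime_elements hIB nd b0 Ib.
  have /IE[x1 e1] := Ib; have /IE[x2 e2] := Ib'.
  by apply: I1; apply/IE; exact: (exchange c12 b0 e1 e2).
have pqi := prime_elt_ideal pq; have [hqi q1 _] := pqi.
have [p [pp sp np]] := @krull_prime _ I (fun x => exists c, ~ divides q c /\ x = fb c) hI
  (ltac:(by exists 1; rewrite (rmorph1 fb)))
  (ltac:(by move=> _ _ [c [nc ->]] [c' [nc' ->]]; exists (c * c'); rewrite (rmorphM fb); split=> //; exact: (primeM pqi nc nc')))
  (ltac:(by move=> x Ix [c [nc e]]; apply: nc; apply: hq; rewrite -e)).
exists p; split=> // ch.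
have [q0 nu _] := pq.
have [a [c [a0 c0 lc sz]]] := monic_coordinates q0.
pose f := (fb \o emb a : {rmorphism _ -> _}).
have tm : trivial_mod f p.
  split=> [d|x px]; first by change (fb (emb a d%:MP) = d%:MP); rewrite embC fbC.
  have [y ey] : divides q (emb a x).
    by apply: NNPP => nd; apply: (np _ px); exists (emb a x).
  have := congr1 (coord_poly a) ey; rewrite (theta_emb _ a0) (rmorphM (coord_poly a)) => e.
  apply: (const_factor e).
  rewrite sz ltnNge; apply/negP => s1; case/negP: nu.
  have [c' ec] : exists c', q = c'%:MP by have /msize1_polyC := s1; exists q@_0.
  by rewrite ec; apply: mpolyC_unit; apply: contraNneq q0 => c'0; rewrite ec c'0 mpolyC0.
have := prime_chain_bound ch tm; rewrite -[m.+3]addn3; lia.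
Qed.

End Exchange.

Section Framed.
Variables (k : closedFieldType) (m : nat).
Notation B := {mpoly k[m.+1]}.
Notation R := {mpoly k[m.+3]}.
Implicit Types (F : frame k m.+1) (I : R -> Prop).

Definition ci_data F (h1 h2 : R) t := [/\ h1 != 0, h1 \is t.-homog, h2 \is t.-homog,
  cop (fun i : bool => if i then h1 else h2) & ci_frame F h1 h2].

(** The last condition, torsion-freeness of R/I over B, stands for unmixedness of codimension
    two. *)
Definition framed F h1 h2 t I := ci_data F h1 h2 t /\
  [/\ homog_ideal I, I h1, I h2 & forall b g, b != 0 -> I (fb F b * g) -> I g].

Lemma msize_of_homog n t (g : {mpoly k[n]}) : g != 0 -> g \is t.-homog -> msize g = t.+1.
Proof. by move=> g0 hg; rewrite -mlead_deg // (homog_mlead g0 hg). Qed.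

Lemma generic_frame (v : 'I_3 -> R) t : cop v -> (forall i, v i \is t.-homog) -> (0 < t)%N ->
  (exists j, v j != 0) -> exists (l mu : k) F,
    ci_data F (v i0 + l%:MP * v i2) (v i1 + mu%:MP * v i2) t.
Proof.
move=> cv hv t0 ex; have [l [mu [h0 c12]]] := generic_pair cv (cop_ends cv hv t0 ex).
have hh (x : k) i j : v i + x%:MP * v j \is t.-homog.
  by apply: rpredD => //; have := dhomogM (mpolyC_homog _ x) (hv j); rewrite add0n.
have [F hF] := ci_frame_exists h0 (ltac:(by rewrite (msize_of_homog h0 (hh _ _ _)) ltnS)) c12.
by exists l, mu, F.
Qed.

Lemma framed_epolc F h1 h2 t I : framed F h1 h2 t I ->
  exists2 c, epolc m (hfr I) c & 0 <= c <= t%:R ^+ 2.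
Proof.
move=> [[h10 hh1 hh2 c12 ci] [hI I1 I2 _]].
exact: (sub_pairI_epolc h10 hh1 hh2 c12 hI.1 (pair_sub hI I1 I2)).
Qed.

Lemma framed_height F h1 h2 t I : framed F h1 h2 t I -> ~ I 1 -> ideal_height I 2.
Proof.
move=> [[h10 hh1 hh2 c12 ci] [hI I1 I2 tf]] n1.
apply: (@ideal_height2 k m F I h1 h2 hI.1 h10 c12 I1 I2) => b Ib; apply/eqP/negP => /negP b0.
by apply: n1; apply: (tf b 1 b0); rewrite mulr1.
Qed.

Lemma framed_degree F h1 h2 t I c : framed F h1 h2 t I -> epolc m (hfr I) c ->
  degree I = c /\ (c = 0 <-> I 1).
Proof.
move=> [[h10 hh1 hh2 c12 ci] [hI I1 I2 tf]] hc.
have [J1|n1] := classic (I 1).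
  by have c0 := epolc_uniq hc (hfr_unit m hI.1 J1); rewrite c0 (degree_unit hI.1 J1).
have c1 : 1 <= c.
  apply: (no_meet_epolc (F := F) hI) hc => b Ib; apply/eqP/negP => /negP b0.
  by apply: n1; apply: (tf b 1 b0); rewrite mulr1.
have c0 : c != 0 by apply/eqP => c0; rewrite c0 in c1.
by split; [exact: (degree_eq hI.1 hc) | split=> // c0'; rewrite c0' eqxx in c0].
Qed.

End Framed.

Section Main.
Variables (k : closedFieldType) (m d e : nat) (f : 'rV[{mpoly k[m.+3]}]_3).
Notation R := {mpoly k[m.+3]}.
Hypotheses (hf : forall i, f 0 i \is d.-homog) (hgcd : coprime_forms f) (he : is_indeg (syz f) e).
Notation J := (ideal3 f).
Notation ed := (indeg_le hf hgcd he).

Lemma J_homog : homog_ideal J.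
Proof. exact: (ideal_gen_homog (d := fun=> d) hf). Qed.

Lemma J_gen i : J (fv f i).
Proof. exact: (ideal_gen_gen (fv f) i). Qed.

Lemma J_frame : (0 < d)%N -> exists F h1 h2, [/\ ci_data F h1 h2 d, J h1, J h2 &
  forall x, J x <-> exists y, pairI h1 h2 (x - y * fv f i2)].
Proof.
move=> d0; have [l [mu [F cd]]] := generic_frame (fv_cop hgcd) hf d0 (fv_neq0 hgcd).
have [hJ _] := J_homog.
set g1 := fv f i0 + _ in cd; set g2 := fv f i1 + _ in cd.
have j1 : J g1 by exact: (idealD hJ (J_gen _) (idealM _ hJ (J_gen _))).
have j2 : J g2 by exact: (idealD hJ (J_gen _) (idealM _ hJ (J_gen _))).
exists F, g1, g2; split=> // x; split=> [[c ->]|[y [a [b e1]]]].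
  exists (c i2 - c i0 * l%:MP - c i1 * mu%:MP), (c i0), (c i1).
  rewrite sum3 /g1 /g2 /fv; move: (f 0 i0) (f 0 i1) (f 0 i2) (l%:MP) (mu%:MP) (c i0) (c i1) (c i2) => *.
  ring.
rewrite -(subrK (y * fv f i2) x) e1.
exact: (idealD hJ (idealD hJ (idealM _ hJ j1) (idealM _ hJ j2)) (idealM _ hJ (J_gen _))).
Qed.

(** A syzygy of degree 0 has a nonzero constant entry and eliminates the corresponding generator. *)
Lemma min_gen_indeg : min_generated_by J 3 -> (0 < e)%N.
Proof.
move=> [_ hmin]; rewrite lt0n; apply/negP => /eqP e0; apply: (hmin 2%N isT).
have [[u [/syzE su u0 hu]] _] := he; rewrite e0 in hu.
have [j uj] : exists j, cvec u j != 0.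
  apply: NNPP => no; case/eqP: u0; apply/matrixP => i l; rewrite ord1 [RHS]mxE.
  by apply: NNPP => /eqP nz; apply: no; exists i.
have uu : cvec u j \is a GRing.unit.
  rewrite /cvec (homog0_const (hu j)); apply: mpolyC_unit; apply: contraNneq uj => c0.
  by rewrite /cvec (homog0_const (hu j)) c0 mpolyC0.
have [hJ _] := J_homog; have hx := ideal_gen_ideal (fun l : 'I_2 => fv f (lift j l)).
exists (fun l => fv f (lift j l)) => x; split; last first.
  by apply: (ideal_gen_sub hJ) => i; exact: J_gen.
apply: (ideal_gen_sub hx) => i.
have [l ->|->] := unliftP j i; first exact: (ideal_gen_gen (fun l : 'I_2 => fv f (lift j l))).
exists (fun l => - (cvec u j)^-1 * cvec u (lift j l)).
have : \sum_i cvec u i * fv f i = 0 by rewrite sum3; exact: su.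
rewrite (bigD1_ord j) //= => /eqP; rewrite addr_eq0 => /eqP h.
transitivity ((cvec u j)^-1 * (cvec u j * fv f j)); first by rewrite mulKr.
by rewrite h mulrN -mulNr mulr_sumr; apply: eq_bigr => l _; rewrite mulrA.
Qed.

Lemma ex_min_syzygy : exists nu, min_syzygy f nu.
Proof. by have [[u [su u0 hu]] _] := he; exists u, e. Qed.

(** Homogeneity and torsion-freeness pass from (h1, h2) to the colon ideal of [I0_colon]. *)
Lemma bourb_frame nu (hnu : min_syzygy f nu) : (0 < e)%N ->
  exists F h1 h2, framed F h1 h2 e (bourb f nu).
Proof.
move=> e0; have [sn n0 hn] := min_syzygyP he hnu.
have [j nj] := nu_neq0 he hnu; have [jf fj] := fv_neq0 hgcd.
have [l [mu [F cd]]] := generic_frame (nu_cop he hnu) hn e0 (nu_neq0 he hnu).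
have [h10 hh1 hh2 c12 ci] := cd.
have col := I0_colon (@ufd_mpoly k _) sn h10 c12.
have hI := bourb_ideal f nu.
exists F, (cvec nu i0 + l%:MP * cvec nu i2), (cvec nu i1 + mu%:MP * cvec nu i2); split=> //.
have bn := bourb_nu he hnu; split.
- split=> // t g /col h; apply/col.
  have hf' : fv f i2 - l%:MP * fv f i0 - mu%:MP * fv f i1 \is d.-homog.
    have hh (x : k) i : x%:MP * fv f i \is d.-homog.
      by have := dhomogM (mpolyC_homog _ x) (hf i); rewrite add0n.
    by do ![apply: rpredB => //]; exact: hf.
  have := (pairI_homog hh1 hh2).2 (d + t)%N _ h.
  by rewrite [g * _]mulrC (hpart_mul _ _ hf') leq_addr addKn [_ * hpart _ _]mulrC.
- exact: (idealD hI (bn _) (idealM _ hI (bn _))).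
- exact: (idealD hI (bn _) (idealM _ hI (bn _))).
- move=> b g b0 /col h; apply/col; have [_ _ tf _] := ci.
  by apply: (tf b _ b0); rewrite /pairI mulrA.
Qed.

Lemma bourb_indeg1 nu (hnu : min_syzygy f nu) : ~ bourb f nu 1 -> (0 < e)%N.
Proof. by move=> n1; rewrite lt0n; apply/negP => /eqP e0; apply: n1; exact: (bourb_indeg0 he hnu). Qed.

Lemma bourb_bourbaki nu (hnu : min_syzygy f nu) : bourbaki_ideal f nu (bourb f nu).
Proof.
apply: (bourbaki_exists hf hgcd he hnu).
have [h|h] := classic (bourb f nu 1); [by left | right].
have [F [h1 [h2 fr]]] := bourb_frame hnu (bourb_indeg1 hnu h).
exact: (framed_height fr h).
Qed.

Lemma bourb_epolc nu (hnu : min_syzygy f nu) : exists c, [/\ epolc m (hfr (bourb f nu)) c,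
  0 <= c <= e%:R ^+ 2, degree (bourb f nu) = c, c = 0 <-> bourb f nu 1 &
  epolc m (hfr J) (d%:R ^+ 2 + e%:R ^+ 2 - e%:R * d%:R - c)].
Proof.
have hI := bourb_ideal f nu.
suff [c [hc c0 dc iff]] : exists c, [/\ epolc m (hfr (bourb f nu)) c,
  0 <= c <= e%:R ^+ 2, degree (bourb f nu) = c & c = 0 <-> bourb f nu 1].
  exists c; split=> //; apply: (syzygy_epolc ed hc) => t ddt.
  have [sn n0 hn] := min_syzygyP he hnu.
  have [j nj] := nu_neq0 he hnu; have [jf fj] := fv_neq0 hgcd.
  exact: (HF_syzygy hf hn (fv_cop hgcd) (nu_cop he hnu) sn ed fj nj ddt).
have [h|h] := classic (bourb f nu 1).
  exists 0; split; [exact: (hfr_unit m hI h) | by rewrite lexx sqr_ge0 | exact: (degree_unit hI h) | by []].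
have [F [h1 [h2 fr]]] := bourb_frame hnu (bourb_indeg1 hnu h).
have [c hc c0] := framed_epolc fr; have [dc iff] := framed_degree fr hc.
by exists c.
Qed.

(** The leading coefficient of R/J does not involve nu, so the formula itself shows that the degree
    of the Bourbaki ideal is the same for every choice made by [epsilon]. *)
Lemma bour_eq c : epolc m (hfr J) (d%:R ^+ 2 + e%:R ^+ 2 - e%:R * d%:R - c) -> bour f = c.
Proof.
move=> hc; have [nu hnu] := ex_min_syzygy.
have [nu' [I [hnu' hI ->]]] : exists nu' I, [/\ min_syzygy f nu', bourbaki_ideal f nu' I & bour f = degree I].
  apply: (epsilon_spec (inhabits 0) (fun b => exists nu I,
    [/\ min_syzygy f nu, bourbaki_ideal f nu I & b = degree I])).
  by exists (degree (bourb f nu)), nu, (bourb f nu); split=> //; exact: bourb_bourbaki.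
rewrite (eq_ideal_eq (bourbaki_unique hgcd he hnu' hI)).
have [c' [_ _ -> _ hc']] := bourb_epolc hnu'.
by have /addrI/oppr_inj := epolc_uniq hc' hc.
Qed.

Lemma bour_spec : [/\ epolc m (hfr J) (d%:R ^+ 2 + e%:R ^+ 2 - e%:R * d%:R - bour f),
  0 <= bour f <= e%:R ^+ 2 &
  forall nu I, min_syzygy f nu -> bourbaki_ideal f nu I -> [/\ I = bourb f nu,
    epolc m (hfr I) (bour f), bour f = 0 <-> I 1 &
    I 1 \/ ~ I 1 /\ exists F h1 h2, framed F h1 h2 e I]].
Proof.
have [nu hnu] := ex_min_syzygy; have [c [_ cc _ _ hJ]] := bourb_epolc hnu.
rewrite (bour_eq hJ); split=> // {}nu I {}hnu hI.
rewrite (eq_ideal_eq (bourbaki_unique hgcd he hnu hI)).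
have [c' [hc' _ _ iff hJ']] := bourb_epolc hnu.
have /addrI/oppr_inj e1 := epolc_uniq hJ' hJ; rewrite -e1; split=> //.
have [h|h] := classic (bourb f nu 1); [by left | right; split=> //].
exact: (bourb_frame hnu (bourb_indeg1 hnu h)).
Qed.

End Main.

Lemma ideal_height_uniq (A : comNzRingType) (I : A -> Prop) h h' :
  ideal_height I h -> ideal_height I h' -> h = h'.
Proof.
move=> [c [p [pp sp [_ nc]]]] [c' [p' [pp' sp' [_ nc']]]].
apply/eqP; rewrite eqn_leq; apply/andP; split; rewrite leqNgt; apply/negP => lt.
  by apply: nc'; exact: (prime_chain_le (c _ pp' sp') lt).
by apply: nc; exact: (prime_chain_le (c' _ pp sp) lt).
Qed.

Section Heights.
Variables (k : closedFieldType) (m d e : nat) (f : 'rV[{mpoly k[m.+3]}]_3).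
Notation R := {mpoly k[m.+3]}.
Hypotheses (hf : forall i, f 0 i \is d.-homog) (hgcd : coprime_forms f) (he : is_indeg (syz f) e).
Notation J := (ideal3 f).
Notation ed := (indeg_le hf hgcd he).
Notation D := (d%:R : rat).
Notation E := (e%:R : rat).

Lemma J_proper : (0 < d)%N -> ~ J 1.
Proof.
move=> d0 [c e1]; have := congr1 (fun x : R => x.@[fun=> 0]) e1.
rewrite /= rmorph1 rmorph_sum big1 => [/eqP|i _]; first by rewrite oner_eq0.
by rewrite rmorphM /= (meval0_homog (hf i) d0) mulr0.
Qed.

(** The cases are whether or not J meets B in 0 only: either R/J has positive rank over B, or it is
    torsion and J has height 3. *)
Lemma J_alternative : (0 < d)%N ->
  (ideal_height J 2 /\ forall c, epolc m (hfr J) c -> 1 <= c) \/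
  (ideal_height J 3 /\ epolc m (hfr J) 0).
Proof.
move=> d0; have [F [h1 [h2 [[h10 hh1 hh2 c12 ci] J1 J2 JE]]]] := J_frame hf hgcd d0.
have hJ := J_homog hf; have [hJi _] := hJ.
have [no|ex] := classic (forall b, J (fb F b) -> b = 0).
  left; split; first exact: (@ideal_height2 k m F J h1 h2 hJi h10 c12 J1 J2 no).
  by move=> c; apply: (no_meet_epolc hJ no).
have [b [Jb b0]] : exists b, J (fb F b) /\ b != 0.
  by apply: NNPP => h; apply: ex => b Jb; apply: NNPP => /eqP b0; apply: h; exists b.
right; split; last exact: (meet_epolc h10 hh1 hh2 c12 ci hJ J1 J2 b0 Jb).
have c3 p : prime_ideal p -> subideal J p -> prime_chain (@zero_ideal R) p 3.
  by move=> pp sp; exact: (meet_chain3 h10 c12 ci hJ J1 J2 b0 Jb pp sp).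
split=> //; have [p [pp sp nc]] := height3_prime ci hJi JE (J_proper d0) b0 Jb.
by exists p; split=> //; split; [exact: c3 |].
Qed.

Lemma J_prime : (0 < d)%N -> exists h, ideal_height J h /\ (1 < h <= 3)%N.
Proof. by move=> /J_alternative[[h _]|[h _]]; eexists; split; eauto. Qed.

Lemma generated_J : generated_by J 3.
Proof. by exists (fun i => f 0 i). Qed.

Lemma mingen_d : min_generated_by J 3 -> (0 < e)%N /\ (0 < d)%N.
Proof. by move=> /(min_gen_indeg hf he) e0; split=> //; apply: leq_trans e0 ed. Qed.

Lemma height_d h : ideal_height J h -> (0 < d)%N.
Proof.
move=> [_ [p [[hp p1 _] sp _]]]; rewrite lt0n; apply/negP => /eqP d0; apply: p1.
have [j fj] := fv_neq0 hgcd; have := hf j; rewrite d0 => /homog0_const h0.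
have u : fv f j \is a GRing.unit.
  by rewrite /fv h0; apply: mpolyC_unit; apply: contraNneq fj => c0; rewrite /fv h0 c0 mpolyC0.
by rewrite -(mulVr u); apply: (idealM _ hp); apply: sp; exact: J_gen.
Qed.

Lemma aci_height : almost_complete_intersection J -> ideal_height J 2 /\ min_generated_by J 3.
Proof.
move=> [h hh mg]; have d0 := height_d hh.
have [h' [hh' /andP[h1 _]]] := J_prime d0; rewrite -(ideal_height_uniq hh hh') in h1.
suff e2 : h = 2%N by rewrite -e2.
apply/eqP; rewrite eqn_leq h1 andbT leqNgt; apply/negP => h3.
exact: (mg.2 3%N h3 generated_J).
Qed.

Lemma height2_degree : ideal_height J 2 ->
  degree J = D ^+ 2 + E ^+ 2 - E * D - bour f /\ 1 <= degree J.
Proof.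
move=> hh; have d0 := height_d hh; have [hc _ _] := bour_spec hf hgcd he.
have [[_ /(_ _ hc) c1]|[h3 _]] := J_alternative d0; last by have := ideal_height_uniq hh h3.
have [hJi _] := J_homog hf.
rewrite (degree_eq hJi hc) //; apply/eqP => c0; by rewrite c0 in c1.
Qed.

Lemma degree_formula : almost_complete_intersection J ->
  degree J + bour f = D ^+ 2 + E ^+ 2 - E * D.
Proof. by move=> /aci_height[/height2_degree[-> _] _]; rewrite subrK. Qed.

Lemma bour_le : bour f <= E ^+ 2.
Proof. by have [_ /andP[_]] := bour_spec hf hgcd he. Qed.

Lemma bour_ge : 0 <= bour f.
Proof. by have [_ /andP[]] := bour_spec hf hgcd he. Qed.

Lemma ED : E <= D. Proof. by rewrite ler_nat ed. Qed.

Lemma bour_almost_max : almost_complete_intersection J ->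
  (bour f = D ^+ 2 - 1 <-> (e = d /\ degree J = 1)).
Proof.
move=> aci; have [hh mg] := aci_height aci; have [e0 d0] := mingen_d mg.
have fo := degree_formula aci; have [_ d1] := height2_degree hh.
split=> [b|[e1 dJ]]; last by move: fo; rewrite dJ e1 => fo; nra.
have E1 : 1 <= E by rewrite ler1n.
(* The formula with [1 <= degree J] gives e^2 >= e d. *)
have le := ED; have e1 : E = D by nra.
split; first by apply/eqP; rewrite -(eqr_nat rat) e1.
by move: fo; rewrite b e1 => fo; nra.
Qed.

Lemma degree_bounds : almost_complete_intersection J ->
  D * (D - E) <= degree J <= D ^+ 2 + E ^+ 2 - E * D.
Proof.
move=> /degree_formula fo; have b1 := bour_le; have b0 := bour_ge.
by apply/andP; split; nra.
Qed.

Lemma bour_max : min_generated_by J 3 -> (bour f = D ^+ 2 <-> complete_intersection J).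
Proof.
move=> mg; have [e0 d0] := mingen_d mg; have [hc _ _] := bour_spec hf hgcd he.
have E1 : 1 <= E by rewrite ler1n.
have le := ED; have b1 := bour_le.
split=> [b|[h hh gh]].
  (* In height 2 the leading coefficient is at least 1, but here it equals e^2 - e d, which is at
     most 0. *)
  have [[_ /(_ _ hc)]|[h3 _]] := J_alternative d0; last by exists 3%N => //; exact: generated_J.
  by rewrite b; nra.
have [[h2 _]|[_ hc0]] := J_alternative d0.
  have e2 := ideal_height_uniq hh h2; rewrite e2 in gh.
  by case: (mg.2 2%N isT gh).
have := epolc_uniq hc hc0; nra.
Qed.

End Heights.

(** * Perfect ideals *)

Section HilbertBurch.
Variables (A : comNzRingType) (E : A -> Prop) (u nu : 'I_3 -> A).
Hypothesis hE : is_ideal E.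
Notation f := (cross u nu).
Variable S : A -> Prop.
Hypotheses (SM : forall x y, S x -> S y -> S (x * y)).
Hypotheses (r1 : forall g, E (f i0 * g) -> E g)
  (r2 : forall g q, E (f i1 * g - q * f i0) -> exists s q', S s /\ E (s * g - q' * f i0)).

(** S is a set of admissible denominators: it will be {1} for the regular sequences and the
    complement of a prime for locally free syzygies. A vector parallel to f modulo E is a multiple
    of f up to such a denominator, since f_0, f_1 is regular modulo E. *)
Lemma parallel_mod (v : 'I_3 -> A) : (forall i, E (cross v f i)) ->
  exists s a, S s /\ forall i, E (s * v i - a * f i).
Proof.
move=> h; have [s [a [Ss ha]]] : exists s q', S s /\ E (s * v i0 - q' * f i0).
  apply: (r2 (q := v i1)); have := h i2; congr (E _).
  by rewrite /cross /=; ring.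
exists s, a; split=> //; apply: all3 => //; apply: r1.
  have := idealB hE (idealM (f i1) hE ha) (idealM s hE (h i2)); congr (E _).
  by rewrite /cross /=; ring.
have := idealD hE (idealM (f i2) hE ha) (idealM s hE (h i1)); congr (E _).
by rewrite /cross /=; ring.
Qed.

(** Exactness of the Hilbert-Burch complex modulo E. Both w x u and w x nu are multiples a f and b f
    modulo E, and expanding w x f-type products by Cramer's rule recovers w as b u - a nu. *)
Lemma kernel_mod (w : 'I_3 -> A) : E (dot w f) ->
  exists s a b, S s /\ forall i, E (s * w i - (b * u i - a * nu i)).
Proof.
move=> hw.
have par v : dot v f = 0 -> exists s a, S s /\ forall i, E (s * cross w v i - a * f i).
  move=> hv; apply: parallel_mod => i; rewrite cross_cross hv mulr0 subr0.
  exact: (idealM _ hE hw).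
have [s [a [Ss ha]]] : exists s a, S s /\ forall i, E (s * cross w u i - a * f i).
  by apply: par; rewrite dotC dot_crossl.
have [t [b [St hb]]] : exists t b, S t /\ forall i, E (t * cross w nu i - b * f i).
  by apply: par; rewrite dotC dot_crossr.
have {}ha i := idealM t hE (ha i); have {}hb i := idealM s hE (hb i).
exists (s * t), (t * a), (s * b); split; first exact: SM.
apply: all3; apply: r1.
- have := idealD hE (idealM (u i0) hE (hb i0)) (idealD hE (idealM (nu i2) hE (ha i2)) (idealM (nu i1) hE (ha i1))).
  by congr (E _); rewrite /cross /=; ring.
- have := idealB hE (idealM (u i1) hE (hb i0)) (idealM (nu i1) hE (ha i0)).
  by congr (E _); rewrite /cross /=; ring.
have := idealB hE (idealM (u i2) hE (hb i0)) (idealM (nu i2) hE (ha i0)).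
by congr (E _); rewrite /cross /=; ring.
Qed.

(** c stays regular modulo the minors. If c g = a.f modulo E0, then a is a syzygy of f modulo E,
    hence a combination of u and nu plus, up to denominators, a multiple of c; u and nu are
    orthogonal to f, so c can be cancelled. *)
Lemma regular_mod (E0 : A -> Prop) c g a : is_ideal E0 ->
  (forall x, E x -> exists s y, S s /\ E0 (s * x - c * y)) -> (forall x, E0 (c * x) -> E0 x) ->
  E c -> subideal E0 E -> E0 (c * g - dot a f) -> exists s a', S s /\ E0 (s * g - dot a' f).
Proof.
move=> h0 EE reg Ec sub hg.
have [s [al [be [Ss hab]]]] : exists s al be, S s /\ forall i, E (s * a i - (be * u i - al * nu i)).
  apply: kernel_mod; have := idealB hE (ideal_mulr g hE Ec) (sub _ hg); congr (E _).
  by move: (dot a f) => x; ring.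
have [ta [ya ha]] : exists ta (ya : 'I_3 -> A), forall i, S (ta i) /\ E0 (ta i * (s * a i - (be * u i - al * nu i)) - c * ya i).
  have [ty hty] : exists ty : 'I_3 -> A * A, forall i, S (ty i).1 /\ E0 ((ty i).1 * (s * a i - (be * u i - al * nu i)) - c * (ty i).2).
    apply: (@choice_fun 'I_3 (A * A)%type (fun i ty => S ty.1 /\ E0 (ty.1 * (s * a i - (be * u i - al * nu i)) - c * ty.2))) => i.
    by have [t [y h]] := EE _ (hab i); exists (t, y).
  by exists (fun i => (ty i).1), (fun i => (ty i).2).
(* The product of the other two denominators, so that [co i * ta i] is the common one. *)
pose co (i : 'I_3) := match val i with 0 => ta i1 * ta i2 | 1 => ta i0 * ta i2 | _ => ta i0 * ta i1 end.
exists (ta i0 * ta i1 * ta i2 * s), (fun i => co i * ya i); split.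
  by apply: (SM _ Ss); apply: (SM _ (ha i2).1); exact: (SM (ha i0).1 (ha i1).1).
apply: reg.
have h3 : E0 (dot (fun i => co i * (ta i * (s * a i - (be * u i - al * nu i)) - c * ya i)) f).
  by apply: (idealD h0 (idealD h0 _ _)); apply: (ideal_mulr _ h0); apply: (idealM _ h0); exact: (ha _).2.
have := idealD h0 (idealM (ta i0 * ta i1 * ta i2 * s) h0 hg) h3; congr (E0 _).
rewrite /dot /cross /co /=; ring.
Qed.

End HilbertBurch.

Lemma mpoly_ring_ind (k : comNzRingType) (n : nat) (P : {mpoly k[n]} -> Prop) :
  (forall c, P c%:MP) -> (forall i, P 'X_i) -> (forall x y, P x -> P y -> P (x + y)) ->
  (forall x y, P x -> P y -> P (x * y)) -> forall x, P x.
Proof.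
move=> hC hX hD hM x.
have sumP (T : Type) (r : seq T) (Q : pred T) F : (forall i, P (F i)) -> P (\sum_(i <- r | Q i) F i).
  by move=> h; apply: (big_ind P) => [|y z hy hz|i _]; [rewrite -mpolyC0 | exact: hD | exact: h].
rewrite (mpolyE x); apply: sumP => mm; rewrite -mul_mpolyC; apply: (hM) => //.
rewrite mpolyXE_id; apply: (big_ind P) => [|y z hy hz|i _]; [by rewrite -mpolyC1 | exact: hM | ].
by elim: (mm i) => [|j IH]; [rewrite expr0 -mpolyC1 | rewrite exprS; exact: hM].
Qed.

Section Substitution.
Variables (k : closedFieldType) (n : nat) (c : 'I_n -> k).
Notation B := {mpoly k[n]}.

Definition subst_gen (i : nat) (j : 'I_n) : B := if (j < i)%N then (c j)%:MP else 'X_j.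
Lemma subst_exists : exists S : nat -> {rmorphism B -> B},
  (forall i (x : k), S i x%:MP = x%:MP) /\ forall i j, S i 'X_j = subst_gen i j.
Proof.
exists (fun i => (mmap (@mpolyC n k) (subst_gen i) : {rmorphism B -> B})).
by split=> [i x|i j] /=; [exact: mmapC | rewrite mmapX mmap1U].
Qed.

Variable subst : nat -> {rmorphism B -> B}.
Hypotheses (substC : forall i (x : k), subst i x%:MP = x%:MP)
  (substX : forall i j, subst i 'X_j = subst_gen i j).

Lemma subst_step i (j : 'I_n) x : i = j :> nat -> subst i.+1 x = 0 ->
  exists y, subst i (x - ('X_j - (c j)%:MP) * y) = 0.
Proof.
move=> ij; suff [y hy] : exists y, subst i x - subst i.+1 x = subst i (('X_j - (c j)%:MP) * y).
  by move=> x0; exists y; rewrite (rmorphB (subst i)) -hy x0 subr0 subrr.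
have eX : subst i ('X_j - (c j)%:MP) = 'X_j - (c j)%:MP.
  by rewrite (rmorphB (subst i)) substC substX /subst_gen ij ltnn.
move: x; apply: mpoly_ring_ind => [a|l|x y [a ha] [b hb]|x y [a ha] [b hb]].
- by exists 0; rewrite !substC subrr mulr0 rmorph0.
- have [lj|lj] := eqVneq l j.
    by exists 1; rewrite mulr1 eX !substX /subst_gen lj ij ltnn ltnSn.
  exists 0; rewrite mulr0 rmorph0 !substX /subst_gen ltnS [(l <= i)%N]leq_eqVlt ij.
  by have -> : (nat_of_ord l == j) = false; [exact: (negbTE lj) | rewrite subrr].
- exists (a + b); rewrite mulrDr (rmorphD (subst i) (_ * a)) -ha -hb.
  by rewrite (rmorphD (subst i)) (rmorphD (subst i.+1)); move: (subst i x) (subst i y) (subst i.+1 x) (subst i.+1 y) => *; ring.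
set L := 'X_j - (c j)%:MP in ha hb *.
exists (a * y + (x - L * a) * b).
have -> : L * (a * y + (x - L * a) * b) = (L * a) * y + (x - L * a) * (L * b) by ring.
have -> : subst i (L * a * y + (x - L * a) * (L * b)) =
    subst i (L * a) * subst i y + (subst i x - subst i (L * a)) * subst i (L * b).
  by rewrite (rmorphD (subst i)) (rmorphM (subst i) (L * a)) (rmorphM (subst i) (x - L * a)) (rmorphB (subst i)).
rewrite -ha -hb (rmorphM (subst i) x y) (rmorphM (subst i.+1) x y).
by move: (subst i x) (subst i y) (subst i.+1 x) (subst i.+1 y) => *; ring.
Qed.

(** The ideal of the X_j - c_j with j < i, presented as the kernel of a substitution; this makes it
    plainly prime and the next X_i - c_i plainly regular modulo it. *)
Definition subst_ker i (x : B) := subst i x = 0.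

Lemma subst_ker_ideal i : is_ideal (subst_ker i).
Proof.
split; first exact: (rmorph0 (subst i)).
by move=> a x y hx hy; rewrite /subst_ker (rmorphD (subst i)) (rmorphM (subst i)) hx hy mulr0 addr0.
Qed.

Lemma subst_ker_mono i j : (i <= j)%N -> subideal (subst_ker i) (subst_ker j).
Proof.
move=> ij x hx; rewrite /subst_ker.
have h : subst j =1 (subst j \o subst i : {rmorphism B -> B}).
  apply: mpoly_rmorph_ext => [a|l] /=; rewrite ?substC // substX.
  rewrite [X in _ = subst j X]substX /subst_gen; case: (ltnP l i) => li; last by rewrite substX.
  by rewrite (leq_trans li ij) substC.
by rewrite h /= hx (rmorph0 (subst j)).
Qed.

Lemma subst_ker_lin i (j : 'I_n) : (j < i)%N -> subst_ker i ('X_j - (c j)%:MP).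
Proof. by move=> ji; rewrite /subst_ker (rmorphB (subst i)) substC substX /subst_gen ji subrr. Qed.

Lemma subst_ker_reg i (j : 'I_n) x : i = j :> nat ->
  subst_ker i (('X_j - (c j)%:MP) * x) -> subst_ker i x.
Proof.
move=> ij; rewrite /subst_ker (rmorphM (subst i)) (rmorphB (subst i)) substC substX /subst_gen ij ltnn.
move=> /eqP; rewrite mulf_eq0 => /orP[|/eqP //] /eqP /(congr1 (fun p : B => p@_U_(j))).
rewrite mcoeffB mcoeffX eqxx mcoeffC (_ : (U_(j)%MM == 0%MM) = false) ?mulr0 ?subr0 ?mcoeff0.
  by move/eqP; rewrite oner_eq0.
by apply/negP => /eqP/(congr1 mdeg); rewrite mdeg1 mdeg0.
Qed.

Lemma subst_ker_gen (R : comNzRingType) (fb : {rmorphism B -> R}) (L : R -> Prop) i x : is_ideal L ->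
  (forall j : 'I_n, (j < i)%N -> L (fb ('X_j - (c j)%:MP))) -> subst_ker i x -> L (fb x).
Proof.
move=> hL h hx; suff : L (fb (x - subst i x)) by rewrite hx subr0.
clear hx; move: x; apply: mpoly_ring_ind => [a|j|x y hx hy|x y hx hy].
- by rewrite substC subrr (rmorph0 fb); exact: ideal0.
- rewrite substX /subst_gen; case: ifP => ji; first exact: h.
  by rewrite subrr (rmorph0 fb); exact: ideal0.
- rewrite (rmorphD (subst i)) opprD addrACA (rmorphD fb); exact: (idealD hL hx hy).
rewrite (rmorphM (subst i)).
have -> : x * y - subst i x * subst i y = y * (x - subst i x) + subst i x * (y - subst i y).
  by move: (subst i x) (subst i y) => *; ring.
by rewrite (rmorphD fb) !(rmorphM fb); exact: (idealD hL (idealM _ hL hx) (idealM _ hL hy)).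
Qed.

End Substitution.

Section RegularSequence.
Variables (k : closedFieldType) (m : nat).
Notation B := {mpoly k[m.+1]}.
Notation R := {mpoly k[m.+3]}.
Variables (F : frame k m.+1) (u nu : 'I_3 -> R).
Notation f := (cross u nu).
Hypothesis ci : ci_frame F (f i0) (f i1).
Variables (J p : R -> Prop).
Hypotheses (JE : forall x, J x <-> exists a, x = dot a f) (pp : prime_ideal p) (Jp : subideal J p).
Variables (c : 'I_m.+1 -> k) (subst : nat -> {rmorphism B -> B}).
Hypotheses (substC : forall i (x : k), subst i x%:MP = x%:MP)
  (substX : forall i j, subst i 'X_j = subst_gen c i j).
Hypothesis pc : forall i, p (fb F ('X_i - (c i)%:MP)).
Notation fb := (fb F).
Notation x i := (fb ('X_i - (c i)%:MP)).

Lemma fext_ideal b : is_ideal (fext F b).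
Proof.
by split=> [|a y z hu hv] L hL hl; [exact: ideal0 | exact: (hL.2 a _ _ (hu L hL hl) (hv L hL hl))].
Qed.

Lemma J_ideal : is_ideal J.
Proof.
split; first by apply/JE; exists (fun=> 0); rewrite /dot !mul0r !addr0.
move=> a y z /JE[b ->] /JE[b' ->]; apply/JE; exists (fun i => a * b i + b' i).
by rewrite /dot; ring.
Qed.

Lemma prefix_fext i y : add_prefix J (fun i => x i) i y <->
  exists a, fext F (subst_ker subst i) (y - dot a f).
Proof.
have hJ := J_ideal; have hE := fext_ideal (subst_ker subst i).
split.
  move: y; apply: (@add_prefix_least _ J _ (fun i => x i) i (fun y => exists a, fext F (subst_ker subst i) (y - dot a f))).
  - split; first by exists (fun=> 0); rewrite /dot !mul0r !addr0 subrr; exact: ideal0.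
    move=> a y z [b hb] [b' hb']; exists (fun i => a * b i + b' i).
    by have := hE.2 a _ _ hb hb'; congr (fext _ _ _); rewrite /dot; ring.
  - by move=> y /JE[a ->]; exists a; rewrite subrr; exact: ideal0.
  - move=> j ji; exists (fun=> 0); rewrite /dot !mul0r !addr0 subr0 => L hL hl.
    by apply: hl; exact: (subst_ker_lin substC substX).
move=> [a ha]; have hp := add_prefix_ideal (fun i => x i) i hJ.
have h1 : add_prefix J (fun i => x i) i (dot a f).
  by apply: add_prefix_sub; apply/JE; exists a.
have h2 : add_prefix J (fun i => x i) i (y - dot a f).
  apply: (ha _ hp) => b; apply: (subst_ker_gen substC substX hp) => j ji.
  exact: (@add_prefix_gen _ J _ (fun i => x i) i j hJ ji).
by have := idealD hp h2 h1; rewrite subrK.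
Qed.

(** J is generated by the minors of (u, nu), and the m + 1 elements X_i - c_i stay regular on R/J by
    [regular_mod], with E0 and E extended from the ideals of the first i and i + 1 of them and with
    1 as only denominator. *)
Lemma frame_regular : local_regular_seq J p (fun i => x i).
Proof.
split=> // i a [s ns h]; exists s => //; move: h; rewrite mulrCA => /prefix_fext[w hw]; apply/prefix_fext.
have [reg1 reg2 _ _] := ci; have hk := subst_ker_ideal subst.
have hE := fext_ideal (subst_ker subst i.+1); have hE0 := fext_ideal (subst_ker subst i).
suff [s1 [a' [-> h]]] : exists s1 a', s1 = 1 /\ fext F (subst_ker subst i) (s1 * (s * a) - dot a' f).
  by exists a'; rewrite mul1r in h.
apply: (regular_mod (S := fun s => s = 1) hE _ _ _ hE0 _ _ _ _ hw) => [g g' -> ->|g|g q|y|y||y].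
- by rewrite mul1r.
- exact: reg1.
- move=> h; have [q' [t' [ht ->]]] : exists q' t', fext F (subst_ker subst i.+1) t' /\ g = q' * f i0 + t'.
    by apply: (reg2 _ q _ _ (hk _) h); rewrite addrC subrK.
  by exists 1, q'; split=> //; rewrite mul1r addrC addKr.
- suff H : fext F (subst_ker subst i.+1) y -> exists v, fext F (subst_ker subst i) (y - x i * v).
    by move=> /H[v hv]; exists 1, v; rewrite mul1r.
  move=> hy; apply: (hy (fun z => exists v, fext F (subst_ker subst i) (z - x i * v))).
    split; first by exists 0; rewrite mulr0 subrr; exact: ideal0.
    move=> b z z' [v hv] [v' hv']; exists (b * v + v').
    by have := hE0.2 b _ _ hv hv'; congr (fext _ _ _); move: (x i) => *; ring.
  move=> b hb; have [v hv] := subst_step substC substX (erefl (i : nat)) hb.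
  by exists (fb v); rewrite -(rmorphM fb) -(rmorphB fb) => L hL hl; exact: hl.
- by apply: fext_reg => [|z]; [exact: hk | exact: (subst_ker_reg substC substX)].
- by move=> L hL hl; apply: hl; exact: (subst_ker_lin substC substX).
- by move=> hy L hL hl; apply: (hy L hL) => z hz; apply: hl; exact: (subst_ker_mono substC substX (leqnSn i) hz).
Qed.

End RegularSequence.

(** * Homogeneous primes and lying over *)

Section HomogeneousPrimes.
Variables (k : closedFieldType) (n : nat).
Notation R := {mpoly k[n]}.
Implicit Types (p I : R -> Prop).

(** For an ideal p, the largest homogeneous ideal inside p. *)
Definition core p (x : R) := forall t, p (hpart t x).

Lemma hpart_prod t N (a b : R) : (msize a <= N)%N ->
  hpart t (a * b) = \sum_(j < N) (if (j <= t)%N then hpart j a * hpart (t - j) b else 0).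
Proof.
move=> aN; rewrite {1}(hpart_sumw aN) mulr_suml hpart_sum; apply: eq_bigr => j _.
exact: (hpart_mul _ _ (hpart_homog _ _)).
Qed.

Lemma core_sub p : is_ideal p -> subideal (core p) p.
Proof. by move=> hp x h; rewrite (hpart_sumw (leqnn (msize x))); apply: (ideal_sum _ hp) => i _; exact: h. Qed.

Lemma core_homog p : is_ideal p -> homog_ideal (core p).
Proof.
move=> hp; split; [split|].
- by move=> t; rewrite raddf0; exact: ideal0.
- move=> a u v hu hv t; rewrite raddfD /=; apply: (idealD hp _ (hv t)).
  rewrite (hpart_prod t u (leqnn (msize a))); apply: (ideal_sum _ hp) => j _.
  by case: ifP => _; [exact: (idealM _ hp (hu _)) | exact: ideal0].
move=> t g hg s; have [->|st] := eqVneq s t; first by rewrite (hpart_id (hpart_homog t g)).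
by rewrite (hpart_ne (hpart_homog t g)) 1?eq_sym //; exact: ideal0.
Qed.

(** If neither a nor b lies in the core, their lowest homogeneous parts outside p multiply to the
    only term outside p in one degree of a b. *)
Lemma core_prime p : prime_ideal p -> prime_ideal (core p).
Proof.
move=> [hp p1 pM]; have [hc _] := core_homog hp; split=> // [h|a b hab].
  by apply: p1; exact: (core_sub hp h).
apply: NNPP => /not_or_and[na nb].
have [t [nt mt]] := nat_least (P := fun t => ~ p (hpart t a)) (not_all_ex_not _ _ na).
have [u [nu mu]] := nat_least (P := fun t => ~ p (hpart t b)) (not_all_ex_not _ _ nb).
have aN : (msize a <= msize a + t.+1)%N by rewrite leq_addr.
have tN : (t < msize a + t.+1)%N by rewrite addnS ltnS leq_addl.
have := hab (t + u)%N; rewrite (hpart_prod _ _ aN) (bigD1 (Ordinal tN)) //= leq_addr addKn addrC => h.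
case: (pM _ _ (idealDl hp _ h)) => //.
apply: (ideal_sum _ hp) => j; rewrite -val_eqE /= => jt; case: ifP => jtu; last exact: ideal0.
case: (ltngtP j t) jt => // jt _.
  exact: (ideal_mulr _ hp (NNPP _ (mt j jt))).
have lu : (t + u - j < u)%N by move: jt jtu; clear; lia.
exact: (idealM _ hp (NNPP _ (mu _ lu))).
Qed.

Lemma core_least p I : homog_ideal I -> subideal I p -> subideal I (core p).
Proof. by move=> [_ h] s x Ix t; apply: s; exact: h. Qed.

(** The irrelevant ideal ([origin_gen]), as the kernel of evaluation at 0. *)
Definition origin (x : R) : Prop := x.@[fun=> 0] = 0.

Lemma homog_origin I : homog_ideal I -> ~ I 1 -> subideal I origin.
Proof.
move=> [hI h] n1 x Ix; apply: NNPP => /eqP nx; apply: n1.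
have := h 0%N x Ix; rewrite hpart0_meval => hc.
by rewrite -(mulVr (mpolyC_unit n nx)); exact: (idealM _ hI hc).
Qed.

Lemma origin_ideal : is_ideal origin.
Proof.
split; first exact: meval0.
by move=> a u v hu hv; rewrite /origin mevalD mevalM hu hv mulr0 addr0.
Qed.

Lemma origin1 : ~ origin 1.
Proof. by rewrite /origin meval1 => /eqP; rewrite oner_eq0. Qed.

Lemma origin_sub (x : R) : origin (x - (x.@[fun=> 0])%:MP).
Proof. by rewrite /origin mevalB mevalC subrr. Qed.

Lemma origin_maximal : maximal_ideal origin.
Proof.
have ho := origin_ideal; split=> //; first exact: origin1.
move=> q hq sq; case: (classic (subideal q origin)) => [h|h].
  by right => x; split; [exact: h | exact: sq].
left; have [x [qx nx]] : exists x, q x /\ ~ origin x.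
  by apply: NNPP => no; apply: h => x qx; apply: NNPP => nx; apply: no; exists x.
have qc : q (x.@[fun=> 0])%:MP.
  by have := idealB hq qx (sq _ (origin_sub x)); rewrite subKr.
have u := mpolyC_unit n (introN eqP nx).
by rewrite -(mulVr u); exact: (idealM _ hq qc).
Qed.

Lemma origin_gen x : origin x <-> irrelevant_ideal x.
Proof.
have hI := ideal_gen_ideal (fun i : 'I_n => 'X_i : R).
split=> [hx|]; last first.
  move: x; apply: (ideal_gen_sub origin_ideal) => i; exact: (meval0_homog (X_homog k i)).
have := origin_sub x; rewrite hx => _.
suff : irrelevant_ideal (x - (x.@[fun=> 0])%:MP) by rewrite hx mpolyC0 subr0.
clear hx; move: x; apply: mpoly_ring_ind => [a|j|x y hx hy|x y hx hy].
- by rewrite mevalC subrr; exact: (ideal0 hI).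
- by rewrite (meval0_homog (X_homog k j)) // mpolyC0 subr0; exact: (ideal_gen_gen (fun i : 'I_n => 'X_i : R)).
- by rewrite mevalD mpolyCD opprD addrACA; exact: (idealD hI hx hy).
rewrite mevalM mpolyCM.
set a := (_.@[_])%:MP in hx *; set b := (y.@[_])%:MP in hy *.
have -> : x * y - a * b = y * (x - a) + a * (y - b).
  by move: a b {hx hy} => a b; ring.
exact: (idealD hI (idealM _ hI hx) (idealM _ hI hy)).
Qed.

End HomogeneousPrimes.

Section LyingOver.
Variables (k : closedFieldType) (m : nat).
Notation B := {mpoly k[m.+1]}.
Notation R := {mpoly k[m.+3]}.
Variables (F : frame k m.+1) (h1 h2 : R) (da db : nat).
Hypotheses (ci : ci_frame F h1 h2).
Variable subst : nat -> {rmorphism B -> B}.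
Notation c := (fun _ : 'I_m.+1 => 0 : k).
Hypotheses (substC : forall i (x : k), subst i x%:MP = x%:MP)
  (substX : forall i j, subst i 'X_j = subst_gen c i j).
Notation fb := (fb F).
Notation lin j := ('X_j - (0%:MP : B)).

Definition lies_over i (P : R -> Prop) := [/\ prime_ideal P, homog_ideal P, P h1, P h2 &
  forall b, P (fb b) <-> subst_ker subst i b].

(** K = P + X_j R has the expected trace on B because R/P is integral over B; a prime over K with
    that trace exists, and its core is homogeneous with the same trace. *)
Lemma lying_over_step i (j : 'I_m.+1) P : i = j :> nat -> lies_over i P ->
  exists P', lies_over i.+1 P' /\ Defs.proper_sub P P'.
Proof.
move=> ij [pP hP P1 P2 PB]; have [hPi _] := hP.
pose K x := exists y, P (x - fb (lin j) * y).
have hl : fb (lin j) \is 1.-homog by apply: fb_homog; rewrite mpolyC0 subr0; exact: X_homog.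
have hK : homog_ideal K.
  split; [split|].
  - by exists 0; rewrite mulr0 subrr; exact: ideal0.
  - move=> a u v [y hy] [z hz]; exists (a * y + z); have := idealD hPi (idealM a hPi hy) hz.
    by congr (P _); move: (fb (lin j)) => *; ring.
  move=> t x [y hy]; have := hP.2 t _ hy; rewrite raddfB /= (hpart_mul _ _ hl); case: ifP => _ h.
    by exists (hpart (t - 1) y).
  by exists 0; rewrite mulr0.
have hKi := hK.1.
have PK : subideal P K by move=> x hx; exists 0; rewrite mulr0 subr0.
have KB b : K (fb b) <-> subst_ker subst i.+1 b.
  split=> [[y hy]|hb]; last first.
    have [y hy] := subst_step substC substX ij hb.
    by exists (fb y); rewrite -(rmorphM fb) -(rmorphB fb); apply/PB.
  have [L [g [e [_ gen]]]] := frame_finite ci hP P1 P2.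
  have [Q monQ rQ] := cayley_hamilton y hPi gen.
  have [s sQ] : exists s, size Q = s.+1.
    by exists (size Q).-1; rewrite prednK // size_poly_gt0 monic_neq0.
  (* The monic equation of y multiplied by X_j^s, with b in place of X_j y. W lies in P and in B,
     and all its terms but b^s contain X_j. *)
  pose W := \sum_(l < s.+1) Q`_l * (lin j ^+ (s - l) * b ^+ l).
  have pw l : P ((fb (lin j) * y) ^+ l - fb b ^+ l).
    elim: l => [|l IH]; first by rewrite !expr0 subrr; exact: ideal0.
    have -> : (fb (lin j) * y) ^+ l.+1 - fb b ^+ l.+1 = (fb (lin j) * y) * ((fb (lin j) * y) ^+ l - fb b ^+ l) - fb b ^+ l * (fb b - fb (lin j) * y).
      by rewrite !exprS; move: (fb (lin j)) (fb b) => *; ring.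
    exact: (idealB hPi (idealM _ hPi IH) (idealM _ hPi hy)).
  have /PB hW : P (fb W).
    have h1' := idealM (fb (lin j) ^+ s) hPi rQ.
    have h2' : P (\sum_(l < s.+1) fb Q`_l * fb (lin j) ^+ (s - l) * ((fb (lin j) * y) ^+ l - fb b ^+ l)).
      by apply: (ideal_sum _ hPi) => l _; exact: (idealM _ hPi (pw l)).
    have := idealB hPi h1' h2'; congr (P _).
    rewrite (horner_coef_wide _ (size_poly _ _)) sQ mulr_sumr -sumrB (rmorph_sum fb) /=.
    apply: eq_bigr => l _; rewrite coef_poly ltn_ord (rmorphM fb) (rmorphM fb (_ ^+ _)) !(rmorphXn fb) exprMn.
    have -> : fb (lin j) ^+ s = fb (lin j) ^+ (s - l) * fb (lin j) ^+ l by rewrite -exprD subnK // -ltnS.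
    move: (fb Q`_l) (fb (lin j) ^+ (s - l)) (fb (lin j) ^+ l) (y ^+ l) (fb b ^+ l) => *; ring.
  have := subst_ker_mono substC substX (leqnSn i) hW; rewrite /subst_ker (rmorph_sum (subst _)) /=.
  have l0 : subst i.+1 (lin j) = 0 by apply: (subst_ker_lin substC substX); rewrite ij.
  rewrite big_ord_recr /= subnn expr0 mul1r big1 => [|l _].
    have -> : Q`_s = 1 by move/monicP: monQ; rewrite lead_coefE sQ.
    by rewrite add0r mul1r (rmorphXn (subst _)) => /eqP; rewrite expf_eq0 => /andP[_ /eqP].
  rewrite (rmorphM (subst _)) (rmorphM (subst _) (_ ^+ _)) (rmorphXn (subst _)) l0 expr0n subn_eq0.
  by rewrite leqNgt ltn_ord /= mul0r mulr0.
have kM : forall a b, ~ subst_ker subst i.+1 a -> ~ subst_ker subst i.+1 b -> ~ subst_ker subst i.+1 (a * b).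
  by move=> a b na nb; rewrite /subst_ker (rmorphM (subst _)) => /eqP; rewrite mulf_eq0 => /orP[] /eqP.
have [q [pq sq nq]] := @krull_prime _ K (fun x => exists b, ~ subst_ker subst i.+1 b /\ x = fb b) hKi
  (ltac:(by exists 1; rewrite (rmorph1 fb); split=> //; rewrite /subst_ker (rmorph1 (subst _)) => /eqP; rewrite oner_eq0))
  (ltac:(by move=> _ _ [a [na ->]] [b [nb ->]]; exists (a * b); rewrite (rmorphM fb); split=> //; exact: kM))
  (ltac:(by move=> x Kx [b [nb e]]; apply: nb; apply/KB; rewrite -e)).
have [hq _ _] := pq; have Kc := core_least hK sq.
exists (core q); split; [split|split].
- exact: core_prime.
- exact: core_homog.
- by apply: Kc; apply: PK.
- by apply: Kc; apply: PK.
- move=> b; split=> [h|/KB/Kc //]; apply: NNPP => nb; apply: (nq _ (core_sub hq h)).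
  by exists b.
- by move=> x /PK/Kc.
move=> h; have /h/PB : core q (fb (lin j)).
  by apply: Kc; apply/KB; apply: (subst_ker_lin substC substX); rewrite ij.
rewrite /subst_ker (rmorphB (subst i)) substC substX /subst_gen ij ltnn mpolyC0 subr0 => /eqP.
by rewrite -msize_poly_eq0 msizeX mdeg1.
Qed.

Lemma lying_over_chain P : lies_over 0 P -> prime_chain P (@origin k m.+3) m.+1.
Proof.
move=> h0.
have [c [hc sc]] : exists c : nat -> R -> Prop, (forall j, (j <= m.+1)%N -> lies_over j (c j) /\ subideal P (c j)) /\
    forall j, (j < m.+1)%N -> Defs.proper_sub (c j) (c j.+1).
  suff H h : (h <= m.+1)%N -> exists c : nat -> R -> Prop, (forall j, (j <= h)%N -> lies_over j (c j) /\ subideal P (c j)) /\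
    forall j, (j < h)%N -> Defs.proper_sub (c j) (c j.+1) by exact: H.
  elim: h => [|h IH] hm.
    by exists (fun=> P); split=> [j|//]; rewrite leqn0 => /eqP ->; split=> // x.
  have [c [hc sc]] := IH (ltnW hm); have [hh sh] := hc h (leqnn h).
  have [P' [hP' sP']] := @lying_over_step h (Ordinal hm) (c h) erefl hh.
  exists (fun j => if (j <= h)%N then c j else P'); split=> j.
    rewrite leq_eqVlt ltnS => /orP[/eqP ->|jh]; last by rewrite jh; exact: hc.
    by rewrite ltnn; split=> // x /sh; apply: sP'.1.
  rewrite ltnS => jh; rewrite jh; case: ltnP => jh'; first exact: sc.
  by have -> : j = h by apply/eqP; rewrite eqn_leq jh.
apply: (@nat_chain _ _ _ _ c) => // j /hc[[pj hj _ _ _] sj]; split=> //.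
by apply: homog_origin => //; case: pj.
Qed.

End LyingOver.

(** * Koszul homology with respect to the variables *)

Section KoszulVariables.
Variables (k : closedFieldType) (n : nat).
Notation R := {mpoly k[n]}.
Notation xv := (fun i : 'I_n => 'X_i : R).
Notation chain := ({set 'I_n} -> R).
Notation orig := (@origin k n).
Implicit Types (L J : R -> Prop) (c : chain) (S : {set 'I_n}).

Lemma common_multiplier p L (T : finType) (v : T -> R) : prime_ideal p -> is_ideal L ->
  (forall t, loc_ideal p L (v t)) -> exists2 s, ~ p s & forall t, L (s * v t).
Proof.
move=> pp hL h; have [_ p1 _] := pp.
have [s hs] : exists s : T -> R, forall t, ~ p (s t) /\ L (s t * v t).
  by apply: (@choice_fun T R (fun t s => ~ p s /\ L (s * v t))) => t; have [s ns hs] := h t; exists s.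
exists (\prod_t s t) => [|t].
  by apply: (big_ind (fun x => ~ p x)) => // [x y hx hy|t _]; [exact: (primeM pp hx hy) | case: (hs t)].
by rewrite (bigD1 t) //= mulrAC; apply: (ideal_mulr _ hL); case: (hs t).
Qed.

Lemma dK_comb a b c c' S :
  dK xv (fun S => a * c S + b * c' S) S = a * dK xv c S + b * dK xv c' S.
Proof.
rewrite /dK !mulr_sumr -big_split; apply: eq_bigr => j _ /=.
by move: (eps _ _ _) ('X_j : R) (c _) (c' _) => *; ring.
Qed.

(** An element s outside the irrelevant ideal is a nonzero scalar plus a combination of the
    variables, and these kill Koszul homology by the homotopies [eK j]; so s acts invertibly and
    denominators can be removed. *)
Lemma acyclic_loc L i : is_ideal L -> acyclic xv (loc_ideal orig L) i -> acyclic xv L i.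
Proof.
move=> hL ac c hc; have pp := maximal_prime (@origin_maximal k n).
have [c' hc'] := ac c (fun S iS => loc_ideal_sub pp (hc S iS)).
have [s ns hs] : exists2 s, ~ orig s & forall S : {set 'I_n}, L (s * (if (i <= #|S|)%N then c S - dK xv c' S else 0)).
  apply: (@common_multiplier orig L {set 'I_n} (fun S => if (i <= #|S|)%N then c S - dK xv c' S else 0) pp hL) => S; case: ifP => iS; first exact: hc'.
  exact: (loc_ideal_sub pp (ideal0 hL)).
have := origin_sub s; set s0 := s.@[_] => /origin_gen[b eb].
have s00 : s0 != 0 by apply/eqP.
pose si : R := (s0^-1)%:MP.
have e0 : si * s0%:MP = 1 by rewrite -mpolyCM mulVf // mpolyC1.
exists (fun S => (si * s) * c' S + (- si) * (\sum_j b j * eK j c S)) => S iS.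
rewrite dK_comb dK_lin; have := hs S; rewrite iS => h1.
have h2 : L (\sum_j b j * eK j (dK xv c) S).
  apply: (ideal_sum _ hL) => j _; apply: (idealM _ hL); rewrite /eK; case: ifP => jS; last exact: ideal0.
  by apply: (idealM _ hL); apply: hc; apply: leq_trans iS _; rewrite (cardsD1 j S) jS.
have h3 : (s - s0%:MP) * c S = \sum_j b j * dK xv (eK j c) S + \sum_j b j * eK j (dK xv c) S.
  rewrite eb mulr_suml -big_split; apply: eq_bigr => j _ /=.
  by rewrite -mulrDr eK_homotopy mulrA.
have := idealM si hL (idealB hL h1 h2); congr (L _).
move: h3 e0; move: (c S) (dK xv c' S) (\sum_j b j * dK xv (eK j c) S) (\sum_j b j * eK j (dK xv c) S) (s0%:MP) => x y z w t h3 e0.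
have -> : w = (s - t) * x - z by rewrite h3 addrC addKr.
have -> : x - (si * s * y + - si * z) = (si * t) * x - (si * s * y + - si * z) by rewrite e0 mul1r.
ring.
Qed.

Lemma add_elt_ideal L a : is_ideal L -> is_ideal (add_elt L a).
Proof.
move=> hL; split; first by exists 0, 0; split; [exact: ideal0 | ring].
move=> b _ _ [g [l [hl ->]]] [g' [l' [hl' ->]]]; exists (b * g + g'), (b * l + l').
by split; [exact: hL.2 | ring].
Qed.

(** No chains live in degrees above n, and each term of the regular sequence lowers the vanishing
    range by one. *)
Lemma acyclic_regular J r (a : 'I_r -> R) i : is_ideal J -> subideal J orig ->
  local_regular_seq J orig a -> (0 < i)%N -> (n < i + r)%N -> acyclic xv J i.
Proof.
move=> hJ sJ [pa rega] i0 nir; have pp := maximal_prime (@origin_maximal k n).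
have hP j := add_prefix_ideal a j hJ.
have hL j := loc_ideal_ideal pp (hP j).
have e0 : add_prefix J a 0 = J.
  apply: eq_ideal_eq => x; split=> [|h]; last exact: add_prefix_sub.
  exact: (add_prefix_least hJ).
apply: (acyclic_loc hJ); rewrite -e0.
suff H q : forall i j, (r - j)%N = q -> (0 < i)%N -> (j <= r)%N -> (n < i + q)%N ->
    acyclic xv (loc_ideal orig (add_prefix J a j)) i.
  by apply: (H r); rewrite ?subn0.
clear i i0 nir; elim: q => [|q IH] i j eq i0 jr nir.
  by apply: acyclic_top; rewrite addn0 in nir.
have jr' : (j < r)%N by rewrite ltn_neqAle jr andbT; apply/eqP => e; rewrite e subnn in eq.
pose aj := a (Ordinal jr'); set L := loc_ideal orig (add_prefix J a j).
have hL' := add_elt_ideal aj (hL j).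
have [b eb] := proj1 (origin_gen aj) (pa (Ordinal jr')).
have LL : subideal L (add_elt L aj) by move=> x hx; exists 0, x; split=> //; rewrite mulr0 add0r.
have L'a : add_elt L aj aj by exists 1, 0; split; [exact: (ideal0 (hL j)) | rewrite mulr1 addr0].
have ra u : L (aj * u) -> L u by exact: (rega (Ordinal jr') u).
refine (@acyclic_descent _ _ xv L (add_elt L aj) i aj b (hL j) i0 L'a eb ra LL hL' (fun u h => h) _).
apply: (acyclic_loc hL').
rewrite (_ : loc_ideal orig (add_elt L aj) = loc_ideal orig (add_prefix J a j.+1)).
  by apply: IH; [rewrite subnS eq | | | rewrite addSnnS].
apply: eq_ideal_eq => u; split=> [[s ns [g [l [[s' ns' hl] e1]]]]|[s ns h]].
  exists (s' * s); first exact: (primeM pp ns' ns).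
  rewrite -mulrA e1 mulrDr mulrCA.
  apply: (idealD (hP j.+1)).
    by apply: (ideal_mulr _ (hP j.+1)); exact: (@add_prefix_gen _ J _ a j.+1 (Ordinal jr') hJ (ltnSn j)).
  apply: (add_prefix_least (hP j.+1) _ _ hl); first exact: add_prefix_sub.
  by move=> l' hl'; apply: (add_prefix_gen _ hJ); apply: ltnW.
exists s => //; apply: (add_prefix_least hL' _ _ h) => [x Jx|l hl].
  by apply: LL; apply: (loc_ideal_sub pp); exact: add_prefix_sub.
move: hl; rewrite ltnS leq_eqVlt => /orP[/eqP lj|hl].
  have -> : l = Ordinal jr' by exact: val_inj.
  by exists 1, 0; split; [exact: (ideal0 (hL j)) | rewrite mulr1 addr0].
by apply: LL; apply: (loc_ideal_sub pp); exact: (add_prefix_gen _ hJ).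
Qed.

(** The same descent along the variables themselves, through the kernels of the substitutions x_l ->
    0 for l < j. *)
Lemma zero_acyclic i : (0 < i)%N -> acyclic xv (@zero_ideal R) i.
Proof.
move=> i0; have [sg [SC SX]] := subst_exists (fun _ : 'I_n => 0 : k).
have -> : @zero_ideal R = subst_ker sg 0.
  have h : sg 0%N =1 (idfun : {rmorphism R -> R}) by apply: mpoly_rmorph_ext => [a|j]; rewrite ?SC ?SX.
  by apply: eq_ideal_eq => x; rewrite /subst_ker h.
suff H q : forall i j, (n - j)%N = q -> (0 < i)%N -> (j <= n)%N -> (n < i + q)%N ->
    acyclic xv (subst_ker sg j) i.
  by apply: (H n); rewrite ?subn0 // -{1}[n]add0n ltn_add2r.
clear i i0; elim: q => [|q IH] i j eq i0 jn nir; first by apply: acyclic_top; rewrite addn0 in nir.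
have jn' : (j < n)%N by rewrite ltn_neqAle jn andbT; apply/eqP => e; rewrite -e subnn in eq.
pose jj := Ordinal jn'.
apply: (@acyclic_descent _ _ xv (subst_ker sg j) (subst_ker sg j.+1) i ('X_jj - (0 : k)%:MP) (fun l => (l == jj)%:R)) => //.
- exact: subst_ker_ideal.
- exact: (subst_ker_lin SC SX).
- rewrite (bigD1 jj) //= eqxx mul1r big1 => [|l /negbTE ->]; last by rewrite mul0r.
  by rewrite addr0 mpolyC0 subr0.
- by move=> u; exact: (@subst_ker_reg _ _ _ sg SC SX j jj u erefl).
- exact: (subst_ker_mono SC SX (leqnSn j)).
- exact: subst_ker_ideal.
- move=> u hu; have [y hy] := @subst_step _ _ _ sg SC SX j jj u erefl hu.
  by exists y, (u - ('X_jj - (0 : k)%:MP) * y); split=> //; rewrite addrC subrK.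
by apply: IH; [rewrite subnS eq | | | rewrite addSnnS].
Qed.

Lemma eq_dK c c' S : (forall j, j \notin S -> c (j |: S) = c' (j |: S)) -> dK xv c S = dK xv c' S.
Proof. by move=> h; apply: eq_bigr => j jS; rewrite h. Qed.

Lemma cycle_boundary c i : (0 < i)%N -> (forall S, (i <= #|S|.+1)%N -> dK xv c S = 0) ->
  exists c', forall S, (i <= #|S|)%N -> c S = dK xv c' S.
Proof.
move=> i0 h; have [c' hc'] := zero_acyclic i0 h; exists c' => S iS.
by apply/eqP; rewrite -subr_eq0; apply/eqP; exact: hc'.
Qed.

(** Homology of J in degree 2 sits between H_3(x; R/J) and H_2(x; R), both zero: a chain w bounding
    c in R is a cycle modulo J in degree 3, and subtracting a boundary moves it into J. *)
Lemma cycle_boundary_ideal J c : is_ideal J -> acyclic xv J 3 -> (forall S, J (c S)) ->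
  (forall S, (2 <= #|S|.+1)%N -> dK xv c S = 0) ->
  exists c', (forall S, J (c' S)) /\ forall S, (2 <= #|S|)%N -> c S = dK xv c' S.
Proof.
move=> hJ ac Jc hc; have [w hw] := cycle_boundary (i := 2) isT hc.
have [y hy] : exists y, forall S, (3 <= #|S|)%N -> J (w S - dK xv y S).
  by apply: ac => S S2; rewrite -hw.
exists (fun S => if (3 <= #|S|)%N then w S - dK xv y S else 0); split=> [S|S S2].
  by case: ifP => hS; [exact: hy | exact: ideal0].
rewrite hw // -[LHS]subr0 -(dK_dK xv y S) /dK -sumrB; apply: eq_bigr => j jS.
by rewrite cardsU1 jS add1n ltnS S2 mulrBr.
Qed.

Lemma cycle_boundary_syz (f : 'I_3 -> R) (u : 'I_3 -> chain) : acyclic xv (ideal_gen f) 3 ->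
  (forall S, (1 <= #|S|)%N -> \sum_i f i * u i S = 0) -> (forall i S, dK xv (u i) S = 0) ->
  exists v : 'I_3 -> chain, (forall S, \sum_i f i * v i S = 0) /\
    forall i S, (1 <= #|S|)%N -> u i S = dK xv (v i) S.
Proof.
move=> ac fu du.
have [v hv] : exists v : 'I_3 -> chain, forall i S, (1 <= #|S|)%N -> u i S = dK xv (v i) S.
  apply: (@choice_fun 'I_3 chain (fun i v => forall S, (1 <= #|S|)%N -> u i S = dK xv v S)) => i.
  exact: (cycle_boundary (i := 1)).
have hJ := ideal_gen_ideal f.
have [c' [Jc' hc']] : exists c', (forall S, ideal_gen f (c' S)) /\ forall S, (2 <= #|S|)%N -> \sum_i f i * v i S = dK xv c' S.
  apply: (cycle_boundary_ideal hJ ac) => [S|S S1].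
    by exists (fun i => v i S); apply: eq_bigr => i _; rewrite mulrC.
  by rewrite dK_lin -[RHS](fu S S1); apply: eq_bigr => i _; rewrite -hv.
have [z hz] : exists z : {set 'I_n} -> 'I_3 -> R, forall S, c' S = \sum_i z S i * f i.
  by apply: (@choice_fun _ ('I_3 -> R) (fun S z => c' S = \sum_i z i * f i)) => S; exact: Jc'.
pose z' i S := z S i.
exists (fun i S => if (2 <= #|S|)%N then 1 * v i S + (- 1) * dK xv (z' i) S else 0); split=> [S|i S S1].
  case: (leqP 2 #|S|) => hS; last by rewrite big1 // => i _; rewrite mulr0.
  have e1 : dK xv c' S = \sum_i f i * dK xv (z' i) S.
    rewrite -(dK_lin xv f z' S); apply: eq_dK => j _; rewrite hz; apply: eq_bigr => i _; exact: mulrC.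
  under eq_bigr => i _ do rewrite mul1r mulN1r mulrBr.
  by rewrite sumrB hc' // e1 subrr.
have -> : u i S = 1 * dK xv (v i) S + (- 1) * dK xv (dK xv (z' i)) S.
  by rewrite dK_dK mulr0 addr0 mul1r hv.
by rewrite -dK_comb; apply: eq_dK => j jS; rewrite cardsU1 jS add1n ltnS S1.
Qed.

End KoszulVariables.

Section BourbakiKoszul.
Variables (k : closedFieldType) (n e : nat) (f nu : 'I_3 -> {mpoly k[n]}).
Notation R := {mpoly k[n]}.
Notation xv := (fun i : 'I_n => 'X_i : R).
Notation chain := ({set 'I_n} -> R).
Implicit Types (S : {set 'I_n}) (c : chain).

Lemma eps_set0 j : eps R j (set0 : {set 'I_n}) = 1.
Proof. by rewrite /eps (_ : [set l in set0 | _] = set0) ?cards0 //; apply/setP => i; rewrite !inE. Qed.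

Lemma dK_set0 c : dK xv c set0 = \sum_j 'X_j * c [set j].
Proof.
rewrite /dK; apply: eq_big => [j|j _]; first by rewrite inE.
by rewrite eps_set0 mul1r setU0.
Qed.

Lemma eps_homog (j : 'I_n) S : eps R j S * 'X_j \is 1.-homog.
Proof. by rewrite /eps -signr_odd; case: odd; rewrite ?expr0 ?expr1 ?mul1r ?mulN1r ?rpredN; exact: X_homog. Qed.

Hypotheses (hn : forall i, nu i \is e.-homog).
Hypotheses (cf : cop f) (cn : cop nu) (nuf : dot nu f = 0) (e0 : (0 < e)%N).
Variables (d : nat) (jf jn : 'I_3).
Hypotheses (hf : forall i, f i \is d.-homog) (fj : f jf != 0) (nj : nu jn != 0).
Hypothesis mine : forall t (u : 'I_3 -> R), (t < e)%N -> (forall i, u i \is t.-homog) -> dot u f = 0 -> forall i, u i = 0.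
Hypothesis ac : acyclic xv (ideal_gen f) 3.
Notation hufd := (@ufd_mpoly k n).
Notation I := (I0 f nu).

(** H_1(x; I) = 0, from 0 -> R nu -> Syz(J) -> I -> 0 and the vanishing for Syz(J). The connecting
    map sends the cycle to the constant term of [al], which is 0 by minimality of the degree of
    nu. *)
Lemma cycle_boundary_I0 c : (forall S, I (c S)) -> (forall S, #|S| != 1%N -> c S = 0) ->
  dK xv c set0 = 0 -> exists c', (forall S, I (c' S)) /\ forall S, #|S| = 1%N -> c S = dK xv c' S.
Proof.
move=> Ic c1 dc.
have [u hu] : exists u : {set 'I_n} -> 'I_3 -> R, forall S,
    (forall i, cross (u S) nu i = c S * f i) /\ (#|S| != 1%N -> forall i, u S i = 0).
  apply: (@choice_fun _ ('I_3 -> R) (fun S u => (forall i, cross u nu i = c S * f i) /\ (#|S| != 1%N -> forall i, u i = 0))) => S.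
  have [S1|S1] := eqVneq #|S| 1%N; first by have [w hw] := Ic S; exists w.
  by exists (fun=> 0); split=> // i; rewrite c1 // mul0r; move: i; apply: all3; rewrite /cross /=; ring.
have su S : dot (u S) f = 0 by exact: (I0_syz hufd cn nuf nj (hu S).1).
pose W i := \sum_j 'X_j * u [set j] i.
have [al hal] : exists al, forall i, W i = al * nu i.
  apply: (kernel_nu hufd cn nj) => i; transitivity (dK xv c set0 * f i); last by rewrite dc mul0r.
  rewrite dK_set0 mulr_suml; transitivity (\sum_j 'X_j * cross (u [set j]) nu i); last first.
    by apply: eq_bigr => j _; rewrite (hu [set j]).1 mulrA.
  by move: i; apply: all3; rewrite /cross /W /= !mulr_suml -sumrB; apply: eq_bigr => j _; ring.
(* In degree e the sum W involves only syzygies of degree e - 1, and these vanish. *)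
have oal : origin al.
  have h0 : hpart e (W jn) = 0.
    rewrite /W hpart_sum big1 // => j _; rewrite (hpart_mul _ _ (X_homog k j)) e0.
    rewrite [X in _ * X](_ : _ = 0) ?mulr0 //.
    apply: (mine (u := fun i => hpart (e - 1) (u [set j] i)) (t := (e - 1)%N)); first by rewrite subn1 prednK.
      by move=> i; exact: hpart_homog.
    have := congr1 (fun x => hpart (d + (e - 1))%N x) (su [set j]); rewrite raddf0 /= => <-.
    rewrite /dot !raddfD /=; have hm i : hpart (d + (e - 1)) (u [set j] i * f i) = hpart (e - 1) (u [set j] i) * f i.
      by rewrite mulrC (hpart_mul _ _ (hf i)) leq_addr addKn mulrC.
    by rewrite !hm.
  move: h0; rewrite hal mulrC (hpart_mul _ _ (hn jn)) leqnn subnn => /eqP.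
  rewrite mulf_eq0 (negbTE nj) hpart0_meval /= mpolyC_eq0 => /eqP; exact: id.
have [b eb] := proj1 (origin_gen al) oal.
pose A S : R := \sum_j (S == [set j])%:R * b j.
have A1 j : A [set j] = b j.
  rewrite /A (bigD1 j) //= eqxx mul1r big1 ?addr0 // => l lj.
  by rewrite (inj_eq set1_inj) eq_sym (negbTE lj) mul0r.
have A0 S : #|S| != 1%N -> A S = 0.
  move=> S1; rewrite /A big1 // => j _; case: eqP => [eS|]; last by rewrite mul0r.
  by rewrite eS cards1 in S1.
(* [A] is a 1-chain with boundary [al]; subtracting nu times it turns the lift u of c into a cycle
   of syzygies. *)
pose u' i S := 1 * u S i + (- nu i) * A S.
have u'0 i S : #|S| != 1%N -> u' i S = 0 by move=> S1; rewrite /u' A0 // (hu S).2 // !mulr0 addr0.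
have [v [fv vu]] : exists v : 'I_3 -> chain, (forall S, \sum_i f i * v i S = 0) /\
    forall i S, (1 <= #|S|)%N -> u' i S = dK xv (v i) S.
  apply: (cycle_boundary_syz ac) => [S _|i S].
    rewrite sum3; have := su S; rewrite /dot => h1; have := nuf; rewrite /dot => h2.
    transitivity ((u S i0 * f i0 + u S i1 * f i1 + u S i2 * f i2) - A S * (nu i0 * f i0 + nu i1 * f i1 + nu i2 * f i2)).
      by rewrite /u'; ring.
    by rewrite h1 h2 mulr0 subr0.
  have [->|S0] := eqVneq S set0.
    rewrite /u' dK_comb !dK_set0 mul1r mulNr; have := hal i; rewrite /W => ->.
    rewrite eb mulr_suml mulr_sumr; apply/eqP; rewrite subr_eq0; apply/eqP; apply: eq_bigr => j _.
    by rewrite A1; ring.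
  rewrite /dK big1 // => j jS; rewrite u'0 ?mulr0 // cardsU1 jS add1n eqSS cards_eq0 //.
have sv S : dot (fun i => v i S) f = 0 by have := fv S; rewrite sum3 /dot => <-; ring.
have [c' hc'] : exists c', forall S, forall i, cross (fun i => v i S) nu i = c' S * f i.
  apply: (@choice_fun _ R (fun S g => forall i, cross (fun i => v i S) nu i = g * f i)) => S.
  exact: (phi_exists hufd cf nuf fj (sv S)).
exists c'; split=> [S|S S1]; first by exists (fun i => v i S) => i; exact: hc'.
apply: (mulIf fj); rewrite -(hu S).1; transitivity (cross (fun i => u' i S) nu jf).
  by move: (jf); apply: all3; rewrite /cross /u' /=; ring.
transitivity (cross (fun i => dK xv (v i) S) nu jf).
  by apply: eq_cross => // i; apply: vu; rewrite S1.
rewrite /dK mulr_suml; transitivity (\sum_(j | j \notin S) (eps R j S * 'X_j * cross (fun i => v i (j |: S)) nu jf)).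
  move: (jf); apply: all3; rewrite /cross /= !mulr_suml -sumrB; apply: eq_bigr => j _;
  by move: (eps _ _ _) ('X_j : R) => *; ring.
by apply: eq_bigr => j _; rewrite hc' mulrA.
Qed.

Hypothesis hI : homog_ideal I.

Section Relations.
Variables (D N : nat) (s : 'I_N -> R) (ds : 'I_N -> nat).
Hypotheses (Is : forall i, I (s i)) (hs : forall i, s i \is (ds i).-homog).
Hypothesis gen : forall t g, (t <= D)%N -> I g -> g \is t.-homog -> exists r, g = \sum_i r i * s i.
Hypothesis irr : forall i (c : 'I_N -> R), s i <> \sum_(j | j != i) c j * s j.

Definition homr (r : 'I_N -> R) t := forall i, if (ds i <= t)%N then r i \is (t - ds i).-homog : Prop else r i = 0.

Lemma gen_hom t g : (t <= D)%N -> I g -> g \is t.-homog -> exists2 r, homr r t & g = \sum_i r i * s i.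
Proof.
move=> tD Ig hg; have [r er] := gen tD Ig hg.
exists (fun i => if (ds i <= t)%N then hpart (t - ds i) (r i) else 0).
  by move=> i; case: (leqP (ds i) t) => // _; exact: hpart_homog.
rewrite -(hpart_id hg) er hpart_sum; apply: eq_bigr => i _.
by rewrite mulrC (hpart_mul _ _ (hs i)); case: ifP => _; rewrite ?mul0r // mulrC.
Qed.

(** Minimality of the generators leaves no constant terms, so r_l is the sum of the x_j q_(l,j), and
    the sums of the q_(l,j) s_l over l form a 1-cycle in I. It bounds a chain in I; writing that
    chain by generators gives tau such that q - [dK] tau is a relation of smaller degree, hence 0,
    and r = [dK] ([dK] tau) = 0. *)
Lemma no_relation t r : (t <= D)%N -> homr r t -> \sum_i r i * s i = 0 -> forall i, r i = 0.
Proof.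
have top t' r' : homr r' t' -> \sum_i r' i * s i = 0 -> forall i, (t' <= ds i)%N -> r' i = 0.
  move=> hr er i; rewrite leq_eqVlt => /orP[/eqP di|di]; last by have := hr i; rewrite leqNgt di.
  have := hr i; rewrite -di leqnn subnn => /homog0_const rc.
  apply: NNPP => /eqP ri; have ru : r' i \is a GRing.unit.
    by rewrite rc; apply: mpolyC_unit; apply: contraNneq ri => c0; rewrite rc c0 mpolyC0.
  apply: (irr (i := i) (c := fun j => - (r' i)^-1 * r' j)).
  move: er; rewrite (bigD1 i) //= => /eqP; rewrite addr_eq0 => /eqP er.
  transitivity ((r' i)^-1 * (r' i * s i)); first by rewrite mulKr.
  by rewrite er mulrN -mulNr mulr_sumr; apply: eq_bigr => j _; rewrite mulrA.
elim: t r => [|t IH] r tD hr er i; first exact: (top 0%N).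
have r0 l : origin (r l).
  case: (leqP t.+1 (ds l)) => dl; first by rewrite /origin (top _ _ hr er) // meval0.
  have := hr l; rewrite (ltnW dl) => h; apply: (meval0_homog h); rewrite subn_gt0 //.
have [a ha] : exists a : 'I_N -> 'I_n -> R, forall l, r l = \sum_j a l j * 'X_j.
  by apply: (@choice_fun _ ('I_n -> R) (fun l a => r l = \sum_j a j * 'X_j)) => l; apply/origin_gen.
pose q l j := if (ds l <= t)%N then hpart (t - ds l) (a l j) else 0.
have hq j : homr (fun l => q l j) t by move=> l; rewrite /q; case: (leqP (ds l) t) => // _; exact: hpart_homog.
have rq l : r l = \sum_j 'X_j * q l j.
  rewrite /q; case: (leqP (ds l) t) => dl; last first.
    by rewrite (top _ _ hr er) // big1 // => j _; rewrite mulr0.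
  have := hr l; rewrite (leqW dl) => h; rewrite -(hpart_id h) {1}ha hpart_sum; apply: eq_bigr => j _.
  by rewrite mulrC (hpart_mul _ _ (X_homog k j)) subn_gt0 ltnS dl subSn // subSS subn0.
pose Q l S : R := \sum_j (S == [set j])%:R * q l j.
have Q1 l j : Q l [set j] = q l j.
  rewrite /Q (bigD1 j) //= eqxx mul1r big1 ?addr0 // => j' jj.
  by rewrite (inj_eq set1_inj) eq_sym (negbTE jj) mul0r.
have Q0 l S : #|S| != 1%N -> Q l S = 0.
  move=> S1; rewrite /Q big1 // => j _; case: eqP => [eS|]; last by rewrite mul0r.
  by rewrite eS cards1 in S1.
have hIi := hI.1.
pose c S := \sum_l s l * Q l S.
have [c' [Ic' hc']] : exists c', (forall S, I (c' S)) /\ forall S, #|S| = 1%N -> c S = dK xv c' S.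
  apply: cycle_boundary_I0 => [S|S S1|].
  - by apply: (ideal_sum _ hIi) => l _; exact: (ideal_mulr _ hIi (Is l)).
  - by rewrite /c big1 // => l _; rewrite Q0 // mulr0.
  rewrite /c dK_lin -[RHS]er; apply: eq_bigr => l _; rewrite dK_set0 rq mulrC; congr (_ * _).
  by apply: eq_bigr => j _; rewrite Q1.
have [tau [htau etau]] : exists tau : 'I_N -> chain, (forall S l, if (ds l < t)%N then tau l S \is (t - 1 - ds l).-homog : Prop else tau l S = 0) /\
    forall S, (if (0 < t)%N then hpart (t - 1) (c' S) else 0) = \sum_l s l * tau l S.
  suff [tau htau] : exists tau : {set 'I_n} -> 'I_N -> R, forall S,
      (forall l, if (ds l < t)%N then tau S l \is (t - 1 - ds l).-homog : Prop else tau S l = 0) /\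
      (if (0 < t)%N then hpart (t - 1) (c' S) else 0) = \sum_l s l * tau S l.
    by exists (fun l S => tau S l); split=> S; [exact: (htau S).1 | exact: (htau S).2].
  apply: (@choice_fun _ ('I_N -> R) (fun S u => (forall l, if (ds l < t)%N then u l \is (t - 1 - ds l).-homog : Prop else u l = 0) /\
     (if (0 < t)%N then hpart (t - 1) (c' S) else 0) = \sum_l s l * u l)) => S.
  case: (posnP t) => [t0|t0].
    by exists (fun=> 0); rewrite t0; split=> // ; rewrite big1 // => l _; rewrite mulr0.
  have tD' : (t - 1 <= D)%N by apply: leq_trans (ltnW tD); rewrite leq_subr.
  have [u hu eu] := gen_hom tD' (hI.2 (t - 1)%N _ (Ic' S)) (hpart_homog _ _).
  exists u; split=> [l|]; last by rewrite eu; apply: eq_bigr => l _; rewrite mulrC.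
  by have := hu l; rewrite subn1 -ltnS prednK.
pose r' j l := q l j - dK xv (tau l) [set j].
have r'0 j l : r' j l = 0.
  apply: (IH (r' j) (ltnW tD)) => [l'|].
    case: (leqP (ds l') t) => dl; last first.
      rewrite /r' /q leqNgt dl /= sub0r /dK big1 ?oppr0 // => j' _.
      by have := htau (j' |: [set j]) l'; rewrite ltnNge (ltnW dl) /= => ->; rewrite mulr0.
    apply: rpredB; first by have := hq j l'; rewrite dl.
    rewrite /dK; apply: rpred_sum => j' _; have := htau (j' |: [set j]) l'.
    case: (leqP t (ds l')) => dl' h; first by rewrite h mulr0; exact: rpred0.
    have := dhomogM (eps_homog j' [set j]) h; rewrite (_ : 1 + (t - 1 - ds l') = t - ds l')%N //.
    by move: dl'; clear; lia.
  have cE : hpart t (c [set j]) = c [set j].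
    rewrite /c hpart_sum; apply: eq_bigr => l' _; rewrite (hpart_mul _ _ (hs l')) Q1.
    have := hq j l'; case: (leqP (ds l') t) => dl h; first by rewrite (hpart_id h).
    by rewrite h mulr0.
  have := hc' [set j] (cards1 j); rewrite -cE => h.
  have h2 : hpart t (dK xv c' [set j]) = \sum_l' s l' * dK xv (tau l') [set j].
    rewrite -dK_lin /dK hpart_sum; apply: eq_bigr => j' _.
    by rewrite (hpart_mul _ _ (eps_homog j' [set j])) -etau; case: ifP => _; rewrite ?mulr0.
  have h3 : c [set j] = \sum_l' s l' * dK xv (tau l') [set j] by rewrite -cE h -h2 -h cE.
  rewrite /r'; under eq_bigr => l' _ do rewrite mulrBl.
  rewrite sumrB; apply/eqP; rewrite subr_eq0; apply/eqP.
  transitivity (c [set j]); first by apply: eq_bigr => l' _; rewrite Q1 mulrC.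
  by rewrite h3; apply: eq_bigr => l' _; rewrite mulrC.
rewrite rq -[RHS](dK_dK xv (tau i) set0) dK_set0; apply: eq_bigr => j _; congr (_ * _).
by apply/eqP; rewrite -subr_eq0; apply/eqP; exact: r'0.
Qed.

End Relations.
End BourbakiKoszul.

Section MinimalGenerators.
Variables (k : closedFieldType) (n : nat) (I : {mpoly k[n]} -> Prop).
Notation R := {mpoly k[n]}.
Hypothesis hI : homog_ideal I.

Lemma finite_generators D : exists (T : finType) (s : T -> R) (ds : T -> nat),
  [/\ forall i, I (s i), forall i, s i \is (ds i).-homog &
  forall t g, (t < D)%N -> I g -> g \is t.-homog -> exists r, g = \sum_i r i * s i].
Proof.
elim: D => [|D [T [s [ds [Is hs gen]]]]]; first by exists 'I_0, (fun=> 0), (fun=> 0%N); split=> // [[]|[]].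
have [N [_ [T' [b [_ [Wb spb _]]]] _]] := HF_codim D hI.1.
exists (T + T')%type, (fun i => match i with inl j => s j | inr j => b j end),
  (fun i => match i with inl j => ds j | inr _ => D end).
split=> [[i|i]|[i|i]|t g]; [exact: Is | exact: (Wb i).1 | exact: hs | exact: (Wb i).2 | ].
rewrite ltnS leq_eqVlt => /orP[/eqP ->|tD] Ig hg.
  have [c hc] := spb g (conj Ig hg).
  exists (fun i => match i with inl j => 0 | inr j => (c j)%:MP end).
  rewrite big_sumType /= big1 => [|i _]; last by rewrite mul0r.
  rewrite add0r; under eq_bigr => i _ do rewrite mul_mpolyC.
  by apply/eqP; rewrite -subr_eq0; apply/eqP.
have [r er] := gen t g tD Ig hg.
exists (fun i => match i with inl j => r j | inr j => 0 end).
by rewrite big_sumType /= [X in _ + X]big1 ?addr0 // => i _; rewrite mul0r.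
Qed.

(** The components of degree at most D are finite-dimensional and supply a finite family; one with
    the least number of members has no redundant generator. *)
Lemma minimal_generators D : exists N (s : 'I_N -> R) (ds : 'I_N -> nat),
  [/\ forall i, I (s i), forall i, s i \is (ds i).-homog,
  forall t g, (t <= D)%N -> I g -> g \is t.-homog -> exists r, g = \sum_i r i * s i &
  forall i (c : 'I_N -> R), s i <> \sum_(j | j != i) c j * s j].
Proof.
pose P N := exists (s : 'I_N -> R) (ds : 'I_N -> nat),
  [/\ forall i, I (s i), forall i, s i \is (ds i).-homog &
  forall t g, (t <= D)%N -> I g -> g \is t.-homog -> exists r, g = \sum_i r i * s i].
have exP : exists N, P N.
  have [T [s [ds [Is hs gen]]]] := finite_generators D.+1.
  exists #|T|, (fun i => s (enum_val i)), (fun i => ds (enum_val i)); split=> // t g tD Ig hg.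
  have [r er] := gen t g tD Ig hg; exists (fun i => r (enum_val i)).
  by rewrite er (big_enum_val (fun i => r i * s i)).
have [N [[s [ds [Is hs gen]]] minN]] := nat_least (P := P) exP.
exists N, s, ds; split=> // i c ei.
case: N s ds Is hs gen minN i c ei => [|N] s ds Is hs gen minN i c ei; first by case: i {c ei}.
apply: (minN N (ltnSn N)).
exists (fun l => s (lift i l)), (fun l => ds (lift i l)); split=> // t g tD Ig hg.
have [r er] := gen t g tD Ig hg.
have lf (G : 'I_N.+1 -> R) : \sum_(j | j != i) G j = \sum_l G (lift i l).
  apply: (addrI (G i)); transitivity (\sum_j G j); [by rewrite [RHS](bigD1 i) | by rewrite (bigD1_ord i)].
exists (fun l => r i * c (lift i l) + r (lift i l)).
rewrite er (bigD1_ord i) //= {1}ei lf mulr_sumr -big_split; apply: eq_bigr => l _ /=.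
by rewrite mulrDl mulrA.
Qed.

End MinimalGenerators.

Section BourbakiUnit.
Variables (k : closedFieldType) (n e d : nat) (f nu : 'I_3 -> {mpoly k[n]}).
Notation R := {mpoly k[n]}.
Hypotheses (hn : forall i, nu i \is e.-homog).
Hypotheses (cf : cop f) (cn : cop nu) (nuf : dot nu f = 0) (e0 : (0 < e)%N).
Variables (jf jn : 'I_3).
Hypotheses (hf : forall i, f i \is d.-homog) (fj : f jf != 0) (nj : nu jn != 0).
Hypothesis mine : forall t (u : 'I_3 -> R), (t < e)%N -> (forall i, u i \is t.-homog) -> dot u f = 0 -> forall i, u i = 0.
Hypothesis ac : acyclic (fun i : 'I_n => 'X_i : R) (ideal_gen f) 3.
Notation I := (I0 f nu).
Hypothesis hI : homog_ideal I.
Variables h1 h2 : R.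
Hypotheses (I1 : I h1) (I2 : I h2) (h10 : h1 != 0) (hh1 : h1 \is e.-homog) (hh2 : h2 \is e.-homog)
  (c12 : cop (fun i : bool => if i then h1 else h2)).

(** Two generators of degree at most e would have a nontrivial Koszul relation. So there is one
    only, it divides both h1 and h2, and these are coprime. *)
Lemma I0_unit : I 1.
Proof.
(* 2e bounds the degree of the Koszul relation between two generators of degree at most e. *)
have [N [s [ds [Is hs gen irr]]]] := minimal_generators hI (e + e).
have nr := no_relation hn cf cn nuf e0 hf fj nj mine ac hI Is hs gen irr.
have s0 i : s i != 0.
  by apply/eqP => si; apply: (irr i (fun=> 0)); rewrite si big1 // => j _; rewrite mul0r.
have [r hr er] := gen_hom hs gen (leq_addr e e) I1 hh1.
have [r' hr' er'] := gen_hom hs gen (leq_addr e e) I2 hh2.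
have [i di] : exists i, (ds i <= e)%N.
  apply: NNPP => no; case/eqP: h10; rewrite er big1 // => i _.
  have := hr i; case: (leqP (ds i) e) => di; first by case: no; exists i.
  by move=> ->; rewrite mul0r.
have uniq j : j != i -> (e < ds j)%N.
  move=> ji; rewrite ltnNge; apply/negP => dj.
  pose q l : R := if l == i then s j else if l == j then - s i else 0.
  have tD : (ds i + ds j <= e + e)%N by exact: leq_add.
  have hq : homr ds q (ds i + ds j).
    move=> l; rewrite /q; case: (l =P i) => [->|_]; first by rewrite leq_addr addKn.
    case: (l =P j) => [->|_]; first by rewrite leq_addl addnK rpredN.
    by case: (leqP (ds l) _) => // _; exact: rpred0.
  have eq : \sum_l q l * s l = 0.
    rewrite (bigD1 i) //= (bigD1 j) //= big1 => [|l /andP[li lj]].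
      by rewrite /q eqxx (negbTE ji) eqxx addr0; ring.
    by rewrite /q (negbTE li) (negbTE lj) mul0r.
  by have := nr _ _ tD hq eq i; rewrite /q eqxx => /eqP; apply/negP.
have one u (g : R) : homr ds u e -> g = \sum_l u l * s l -> g = u i * s i.
  move=> hu ->; rewrite (bigD1 i) //= big1 ?addr0 // => l li.
  by have := hu l; rewrite leqNgt (uniq l li) => ->; rewrite mul0r.
case u : (s i \is a GRing.unit); first by rewrite -(mulVr u); exact: (idealM _ hI.1 (Is i)).
have [q pq [b eb]] := ufd_prime_factor (@ufd_mpoly k n) (s0 i) (negbT u).
case: (c12 pq); case; [rewrite (one _ _ hr er) | rewrite (one _ _ hr' er')]; rewrite eb mulrA.
  by exists (r i * b).
by exists (r' i * b).
Qed.

End BourbakiUnit.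

Section Perfection.
Variables (k : closedFieldType) (m d e : nat) (f : 'rV[{mpoly k[m.+3]}]_3).
Notation R := {mpoly k[m.+3]}.
Hypotheses (hf : forall i, f 0 i \is d.-homog) (hgcd : coprime_forms f) (he : is_indeg (syz f) e).
Notation J := (ideal3 f).
Hypothesis aci : almost_complete_intersection J.

Let hh : ideal_height J 2 := (aci_height hf hgcd aci).1.
Let e0 : (0 < e)%N := (mingen_d hf hgcd he (aci_height hf hgcd aci).2).1.
Let d0 : (0 < d)%N := (mingen_d hf hgcd he (aci_height hf hgcd aci).2).2.

(** The lowest prime of a chain over J has height at least 2 and leaves h independent elements, so h
    + 2 <= n = m + 3. *)
Lemma chain_bound p h : prime_ideal p -> prime_chain J p h -> (h <= m.+1)%N.
Proof.
move=> pp ch; have [hp p1 _] := pp.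
have [F [h1 [h2 [[h10 hh1 hh2 c12 ci] J1 J2 _]]]] := J_frame hf hgcd d0.
pose g : {rmorphism {mpoly k[0]} -> R} := (mmap (@mpolyC m.+3 k) (fun=> 0) : {rmorphism _ -> _}).
have gC c : g c%:MP = c%:MP by exact: mmapC.
have tg : trivial_mod g p.
  split=> // x; rewrite (mpoly0_const x) gC => pc; apply: NNPP => nz; apply: p1.
  have c0 : x@_0%MM != 0 by apply/eqP => c0; apply: nz; rewrite c0 mpolyC0.
  by rewrite -(mulVr (mpolyC_unit m.+3 c0)); exact: (idealM _ hp pc).
have [q [pq sq [g' tg']]] := prime_chain_trivial_mod ch tg.
have := prime_chain_bound (cop2_height pq h10 c12 (sq _ J1) (sq _ J2)) tg'.
by rewrite addn0 -[m.+3]/(2 + m.+1)%N leq_add2l.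
Qed.

(** If the Bourbaki ideal is R, then f = u x nu is the vector of minors. The Nullstellensatz finds
    X_i - c_i in the maximal ideal; they are regular on R/J, so depth reaches m + 1, and
    [chain_bound] keeps the dimension from exceeding it. *)
Lemma perfect_of_unit nu : min_syzygy f nu -> bourb f nu 1 -> perfect_ideal J.
Proof.
move=> hnu [u hu] p mp sp; have pp := maximal_prime mp; have [hJ _] := J_homog hf.
have [l [mu [F [h10 hh1 hh2 c12 ci]]]] := generic_frame (fv_cop hgcd) hf d0 (fv_neq0 hgcd).
(* The row operation on (u, nu) that turns the first two minors into the combinations adapted to the
   frame and keeps the third. *)
pose tw (w : 'I_3 -> R) (i : 'I_3) : R := if val i == 2 then w i2 - l%:MP * w i0 - mu%:MP * w i1 else w i.
pose nu' := tw (cvec nu); pose u' := tw u.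
have E0 : cross u' nu' i0 = fv f i0 + l%:MP * fv f i2.
  rewrite -[fv f i0]mul1r -[fv f i2]mul1r -!hu /cross /u' /nu' /tw /=.
  by move: (cvec nu) (l%:MP) (mu%:MP) => *; ring.
have E1 : cross u' nu' i1 = fv f i1 + mu%:MP * fv f i2.
  rewrite -[fv f i1]mul1r -[fv f i2]mul1r -!hu /cross /u' /nu' /tw /=.
  by move: (cvec nu) (l%:MP) (mu%:MP) => *; ring.
have E2 : cross u' nu' i2 = fv f i2 by rewrite -[fv f i2]mul1r -hu.
have JE x : J x <-> exists a, x = dot a (cross u' nu').
  split=> [[c ->]|[a ->]].
    exists (fun i => if val i == 2 then c i2 - c i0 * l%:MP - c i1 * mu%:MP else c i).
    rewrite sum3 /dot E0 E1 E2 /= /fv; move: (f 0 i0) (f 0 i1) (f 0 i2) (l%:MP) (mu%:MP) (c i0) (c i1) (c i2) => *; ring.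
  rewrite /dot E0 E1 E2; have hg := J_gen f.
  have h0 := idealD hJ (hg i0) (idealM l%:MP hJ (hg i2)); have h1 := idealD hJ (hg i1) (idealM mu%:MP hJ (hg i2)).
  exact: (idealD hJ (idealD hJ (idealM _ hJ h0) (idealM _ hJ h1)) (idealM _ hJ (hg i2))).
have ci' : ci_frame F (cross u' nu' i0) (cross u' nu' i1) by rewrite E0 E1.
have [c hc] : exists c : 'I_m.+1 -> k, forall i, p (fb F ('X_i - (c i)%:MP)).
  apply: (@choice_fun _ k (fun i c => p (fb F ('X_i - c%:MP)))) => i.
  have [x hx] := nullstellensatz mp (fb F 'X_i); exists x.
  by rewrite (rmorphB (fb F)) fbC.
have [S [SC SX]] := subst_exists c.
have reg := frame_regular ci' JE SC SX hc.
have ch r (x : 'I_r -> R) : local_regular_seq J p x -> prime_chain J p r.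
  move=> rx; have [hp _ _] := pp.
  have hs : subideal (loc_ideal p (add_prefix J x r)) p.
    apply: (loc_ideal_in pp); apply: (add_prefix_least hp sp) => j _; exact: rx.1.
  by have [q [q1 q2]] := prime_chain_regular hJ pp rx pp (fun _ h => h) hs; exact: (nat_chain q1 q2).
exists m.+1; split.
- exact: (ch _ _ reg).
- by move/(chain_bound pp); rewrite ltnn.
- by eexists; exact: reg.
- by move=> [x /ch/(chain_bound pp)]; rewrite ltnn.
Qed.

(** At the irrelevant ideal lying over yields a chain of length m + 1. Perfection then gives depth
    at least n - 2, so the Koszul homology of R/J vanishes from degree 3 on. *)
Lemma unit_of_perfect nu : min_syzygy f nu -> perfect_ideal J -> bourb f nu 1.
Proof.
move=> hnu hper; have hJ := J_homog hf; have [hJi _] := hJ.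
have sJ : subideal J (@origin k m.+3) := homog_origin hJ (J_proper hf d0).
have [r [_ nch] [[x rx] _]] := hper _ (@origin_maximal k m.+3) sJ.
have [F [h1 [h2 [[h10 hh1 hh2 c12 ci] J1 J2 _]]]] := J_frame hf hgcd d0.
have noB b : J (fb F b) -> b = 0.
  move=> Jb; apply: NNPP => /eqP b0; have [_ [p [pp sp [_ nc]]]] := hh.
  by apply: nc; exact: (meet_chain3 h10 c12 ci hJ J1 J2 b0 Jb pp sp).
have [p [pp sp [_ tp]]] := frame_prime hJi noB.
have [hp _ _] := pp.
have [S [SC SX]] := subst_exists (fun _ : 'I_m.+1 => 0 : k).
have sc := core_least hJ sp.
have lo : lies_over F h1 h2 S 0 (core p).
  split; [exact: core_prime | exact: core_homog | exact: sc | exact: sc |] => b.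
  have h : S 0%N =1 (idfun : {rmorphism _ -> _}) by apply: mpoly_rmorph_ext => [a|j]; rewrite ?SC ?SX.
  rewrite /subst_ker h; split=> [/(core_sub hp)/tp //|/= ->].
  by rewrite (rmorph0 (fb F)); exact: (ideal0 (core_homog hp).1).
have [q [sq hq]] := lying_over_chain ci SC SX lo.
have ch : prime_chain J (@origin k m.+3) m.+1.
  by exists q; split=> // i; have [h1' h2' h3'] := hq i; split=> // y /sc/h2'.
have rm : (m.+1 <= r)%N.
  by rewrite leqNgt; apply/negP => rm; apply: nch; exact: (prime_chain_le ch rm).
have ac := acyclic_regular hJi sJ rx (isT : (0 < 3)%N) (ltac:(by rewrite -[(3 + r)%N]/(r.+3) !ltnS)).
have [sn n0 hn] := min_syzygyP he hnu.
have [j nj] := nu_neq0 he hnu; have [jf fj] := fv_neq0 hgcd.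
have mine t (u : 'I_3 -> R) : (t < e)%N -> (forall i, u i \is t.-homog) -> dot u (fv f) = 0 -> forall i, u i = 0.
  move=> te hu su; have su' : syz f (colv u) by apply/syzE; rewrite (eq_dot (colvE _) (fun=> erefl)).
  have [z|nz] := eqVneq (colv u) 0.
    by move=> i; rewrite -(colvE u) z /cvec mxE.
  have := he.2 t _ su' nz (ltac:(by move=> i; rewrite mxE)); by rewrite leqNgt te.
have [F' [g1 [g2 [[g10 hg1 hg2 cg _] [hI I1 I2 _]]]]] := bourb_frame hf hgcd he hnu e0.
exact: (I0_unit hn (fv_cop hgcd) (nu_cop he hnu) sn e0 hf fj nj mine ac hI I1 I2 g10 hg1 hg2 cg).
Qed.

Lemma bour0_perfect : bour f = 0 <-> perfect_ideal J.
Proof.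
have [nu hnu] := ex_min_syzygy he; have hb := bourb_bourbaki hf hgcd he hnu.
have [_ _ /(_ nu _ hnu hb)[_ _ iff _]] := bour_spec hf hgcd he.
rewrite iff; split; [exact: perfect_of_unit | exact: unit_of_perfect].
Qed.

End Perfection.

Lemma clear_denominators (A B : comNzRingType) (g : {rmorphism B -> A}) (I : A -> Prop) (P : {poly B}) s u v y :
  is_ideal I -> size P = s.+1 -> I (map_poly g P).[y] -> I (u * y - v) ->
  I (\sum_(l < s.+1) g P`_l * (u ^+ (s - l) * v ^+ l)).
Proof.
move=> hI sP rP h.
have pw l : I ((u * y) ^+ l - v ^+ l).
  elim: l => [|l IH]; first by rewrite !expr0 subrr; exact: ideal0.
  have -> : (u * y) ^+ l.+1 - v ^+ l.+1 = (u * y) * ((u * y) ^+ l - v ^+ l) + v ^+ l * (u * y - v).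
    by rewrite !exprS; ring.
  exact: (idealD hI (idealM _ hI IH) (idealM _ hI h)).
have h2 : I (\sum_(l < s.+1) g P`_l * u ^+ (s - l) * ((u * y) ^+ l - v ^+ l)).
  by apply: (ideal_sum _ hI) => l _; exact: (idealM _ hI (pw l)).
have := idealB hI (idealM (u ^+ s) hI rP) h2; congr (I _).
rewrite (horner_coef_wide _ (size_poly _ _)) sP mulr_sumr -sumrB; apply: eq_bigr => l _.
rewrite coef_poly ltn_ord exprMn.
have -> : u ^+ s = u ^+ (s - l) * u ^+ l by rewrite -exprD subnK // -ltnS.
move: (g P`_l) (u ^+ (s - l)) (u ^+ l) (y ^+ l) (v ^+ l) => *; ring.
Qed.

(** * Ideals of multiplicity at most two *)

Section LinearForms.
Variables (k : closedFieldType) (n : nat).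
Notation R := {mpoly k[n]}.

Lemma linear_factor (q l u : R) : prime_elt q -> l \is 1.-homog -> l != 0 -> l = u * q ->
  exists2 c : k, c != 0 & u = c%:MP.
Proof.
move=> [q0 nq _] hl l0 e; have u0 : u != 0 by apply: contraNneq l0 => u0; rewrite e u0 mul0r.
have h : u * q \is 1.-homog by rewrite -e.
have [i [j [hu hq ij]]] := homog_prod_factor u0 q0 h.
case: i ij hu => [|i] ij hu.
  have uc := homog0_const hu; exists u@_0%MM => //.
  by apply: contraNneq u0 => c0; rewrite uc c0 mpolyC0.
have j0 : j = 0%N by move: ij; clear; lia.
rewrite j0 in hq; case/negP: nq; have qc := homog0_const hq.
by rewrite qc; apply: mpolyC_unit; apply: contraNneq q0 => c0; rewrite qc c0 mpolyC0.
Qed.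

Lemma independent_cop (l0 l1 : R) : l0 \is 1.-homog -> l1 \is 1.-homog ->
  (forall a b : k, a *: l0 + b *: l1 = 0 -> a = 0 /\ b = 0) ->
  l0 != 0 /\ cop (fun i : bool => if i then l0 else l1).
Proof.
move=> h0 h1 ind.
have z0 : l0 != 0.
  apply/eqP => z; have [|/eqP] := ind 1 0; first by rewrite z scaler0 scale0r addr0.
  by rewrite oner_eq0.
have z1 : l1 != 0.
  apply/eqP => z; have [|_ /eqP] := ind 0 1; first by rewrite z scaler0 scale0r addr0.
  by rewrite oner_eq0.
split=> // q pq h; have [u eu] := h true; have [v ev] := h false.
have [a a0 ea] := linear_factor pq h0 z0 eu; have [b b0 eb] := linear_factor pq h1 z1 ev.
have [] := ind b (- a); last by move=> bz; rewrite bz eqxx in b0.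
rewrite -!mul_mpolyC eu ev ea eb mpolyCN; move: (a%:MP) (b%:MP) => *; ring.
Qed.

End LinearForms.

Section FrameQuotients.
Variables (k : closedFieldType) (m : nat).
Notation B := {mpoly k[m.+1]}.
Notation R := {mpoly k[m.+3]}.
Variable F : frame k m.+1.
Notation fb := (fb F).
Notation z := (fz F).
Notation w := (fw F).

Lemma frame_point_ker (I : R -> Prop) a c g : is_ideal I -> I (z - fb a) -> I (w - fb c) ->
  I (g - fb (fpt F a c g)).
Proof.
move=> hI hz hw; have pt := fpt_base F a c.
move: g; apply: (fr_ind (f := F)) => [b|x y hx hy|x hx|x hx].
- by rewrite pt subrr; exact: ideal0.
- by rewrite (rmorphD (fpt F a c)) (rmorphD fb) opprD addrACA; exact: (idealD hI hx hy).
- rewrite (rmorphM (fpt F a c)) fpt_z (rmorphM fb) mulr_sub_split.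
  exact: (idealD hI (idealM _ hI hz) (idealM _ hI hx)).
rewrite (rmorphM (fpt F a c)) fpt_w (rmorphM fb) mulr_sub_split.
exact: (idealD hI (idealM _ hI hw) (idealM _ hI hx)).
Qed.

(** The linear prime (z - a, w - c) when a and c are linear, as the kernel of a B-valued point;
    every linear prime of height two has this form in suitable coordinates ([linear_height2]). *)
Definition ptker a c (g : R) := fpt F a c g = 0.

Lemma ptker_prime a c : prime_ideal (ptker a c).
Proof.
split; [split|..].
- exact: (rmorph0 (fpt F a c)).
- by move=> x u v hu hv; rewrite /ptker (rmorphD (fpt F a c)) (rmorphM (fpt F a c)) hu hv mulr0 addr0.
- by rewrite /ptker (rmorph1 (fpt F a c)) => /eqP; rewrite oner_eq0.
by move=> x y; rewrite /ptker (rmorphM (fpt F a c)) => /eqP; rewrite mulf_eq0 => /orP[] /eqP; [left | right].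
Qed.

Lemma ptker_z a c : ptker a c (z - fb a).
Proof. by rewrite /ptker (rmorphB (fpt F a c)) fpt_z fpt_base subrr. Qed.

Lemma ptker_w a c : ptker a c (w - fb c).
Proof. by rewrite /ptker (rmorphB (fpt F a c)) fpt_w fpt_base subrr. Qed.

Lemma ptker_fb a c b : ptker a c (fb b) -> b = 0.
Proof. by rewrite /ptker fpt_base. Qed.

Definition pts a c (i : 'I_2) : R := if i == ord0 then z - fb a else w - fb c.

Lemma pts_homog a c i : a \is 1.-homog -> c \is 1.-homog -> pts a c i \is 1.-homog.
Proof.
move=> ha hc; rewrite /pts; case: ifP => _; apply: rpredB;
  [exact: fz_homog | exact: fb_homog | exact: fw_homog | exact: fb_homog].
Qed.

Lemma sum_ord2 (V : nmodType) (G : 'I_2 -> V) : \sum_i G i = G ord0 + G ord_max.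
Proof. by rewrite big_ord_recl big_ord1; congr (_ + G _); exact: val_inj. Qed.

Lemma ptker_least a c (I : R -> Prop) : is_ideal I -> I (z - fb a) -> I (w - fb c) ->
  (forall b, I (fb b) -> b = 0) -> eq_ideal I (ptker a c).
Proof.
move=> hI hz hw no g; have h := frame_point_ker g hI hz hw.
split=> [Ig|e]; last by rewrite e (rmorph0 fb) subr0 in h.
by apply: no; have := idealB hI Ig h; rewrite subKr.
Qed.

Lemma ptker_gen a c : eq_ideal (ptker a c) (ideal_gen (pts a c)).
Proof.
have hI := ideal_gen_ideal (pts a c).
have hz : ideal_gen (pts a c) (z - fb a) by exact: (ideal_gen_gen (pts a c) ord0).
have hw : ideal_gen (pts a c) (w - fb c) by exact: (ideal_gen_gen (pts a c) ord_max).
move=> g; split=> [e|].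
  by have := frame_point_ker g hI hz hw; rewrite e (rmorph0 fb) subr0.
move: g; have [hp _ _] := ptker_prime a c; apply: (ideal_gen_sub hp) => i.
by rewrite /pts; case: ifP => _; [exact: ptker_z | exact: ptker_w].
Qed.

Lemma pts_independent a c (x y : k) : x *: (z - fb a) + y *: (w - fb c) = 0 -> x = 0 /\ y = 0.
Proof.
have C0 (e : B) b : e = b%:MP -> e = 0 -> b = 0.
  by move=> -> /eqP; rewrite mpolyC_eq0 => /eqP.
rewrite -!mul_mpolyC -!(fbC F) => h.
have key u v : fpt F u v (fb x%:MP * (z - fb a) + fb y%:MP * (w - fb c)) = x%:MP * (u - a) + y%:MP * (v - c).
  by rewrite (rmorphD (fpt F u v)) !(rmorphM (fpt F u v)) !(rmorphB (fpt F u v)) fpt_z fpt_w !fpt_base.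
split.
  apply: (C0 (x%:MP * ((a + 1) - a) + y%:MP * (c - c))); first by ring.
  by rewrite -key h (rmorph0 (fpt F _ _)).
apply: (C0 (x%:MP * (a - a) + y%:MP * ((c + 1) - c))); first by ring.
by rewrite -key h (rmorph0 (fpt F _ _)).
Qed.

Lemma pts_cop a c : a \is 1.-homog -> c \is 1.-homog ->
  z - fb a != 0 /\ cop (fun i : bool => if i then z - fb a else w - fb c).
Proof.
move=> ha hc; apply: independent_cop; last exact: pts_independent.
  by apply: rpredB; [exact: fz_homog | exact: fb_homog].
by apply: rpredB; [exact: fw_homog | exact: fb_homog].
Qed.

Lemma ptker_linear a c : a \is 1.-homog -> c \is 1.-homog ->
  linear_prime (ptker a c) /\ ideal_height (ptker a c) 2.
Proof.
move=> ha hc; have pp := ptker_prime a c; split.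
  by split=> //; exists 2%N, (pts a c); split; [move=> i; exact: pts_homog | exact: ptker_gen].
have [z0 cp] := pts_cop ha hc; have [hp _ _] := pp.
apply: (@ideal_height2 k m F _ _ _ hp z0 cp); [exact: ptker_z | exact: ptker_w | exact: ptker_fb].
Qed.

Section Torsion.
Variables (h1 h2 : R) (t : nat) (I : R -> Prop).
Hypotheses (fr : framed F h1 h2 t I) (n1 : ~ I 1).

Lemma torsion_homog : homog_ideal I. Proof. by case: fr => _ []. Qed.
Let hI := torsion_homog.
Let hIi := hI.1.

Lemma torsion_free b g : b != 0 -> I (fb b * g) -> I g.
Proof. by case: fr => _ [_ _ _ h]; exact: h. Qed.

Lemma no_base b : I (fb b) -> b = 0.
Proof.
move=> h; apply: NNPP => /eqP b0; apply: n1; apply: (torsion_free b0); by rewrite mulr1.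
Qed.

Lemma integral y : exists2 P : {poly B}, P \is monic & I (map_poly fb P).[y].
Proof.
have [[h10 hh1 hh2 c12 ci] [_ I1 I2 _]] := fr.
have [L [g [e [_ gen]]]] := frame_finite ci hI I1 I2.
exact: (cayley_hamilton y hIi gen).
Qed.

(** The rational root test: y is integral over the factorial ring B and equals -b0/b1, so each prime
    factor of b1 divides b0 and can be cancelled in both. *)
Lemma integral_in_base y b0 b1 : b1 != 0 -> I (fb b0 + fb b1 * y) -> exists b, I (y - fb b).
Proof.
have [P monP rP] := integral y.
have [s sP] : exists s, size P = s.+1.
  by exists (size P).-1; rewrite prednK // size_poly_gt0 monic_neq0.
have lP : P`_s = 1 by move/monicP: monP; rewrite lead_coefE sP.
move: {2}(msize b1) (leqnn (msize b1)) => N; elim: N b0 b1 => [|N IH] b0 b1 bN bz h.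
  by move: bN; rewrite leqn0 msize_poly_eq0 (negbTE bz).
have [u|nu] := boolP (b1 \is a GRing.unit).
  exists (- (b1^-1 * b0)); have := idealM (fb b1^-1) hIi h; congr (I _).
  rewrite mulrDr mulrA -!(rmorphM fb) mulVr // (rmorph1 fb) mul1r (rmorphN fb) opprK addrC //.
have [q pq [b1' e1]] := ufd_prime_factor (@ufd_mpoly k _) bz nu.
have hu : I (fb b1 * y - fb (- b0)) by rewrite (rmorphN fb) opprK addrC.
have := clear_denominators hIi sP rP hu.
rewrite (_ : \sum_(l < s.+1) _ = fb (\sum_(l < s.+1) P`_l * (b1 ^+ (s - l) * (- b0) ^+ l))); last first.
  by rewrite (rmorph_sum fb); apply: eq_bigr => l _; rewrite (rmorphM fb) (rmorphM fb (_ ^+ _)) !(rmorphXn fb).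
move=> /no_base; rewrite big_ord_recr /= subnn expr0 mul1r lP mul1r => /eqP; rewrite addrC addr_eq0 => /eqP e2.
have pqi := prime_elt_ideal pq; have [hq _ _] := pqi.
have q0 : divides q b0.
  have : divides q ((- b0) ^+ s).
    rewrite e2; apply: (idealN hq); apply: (ideal_sum _ hq) => l _; apply: (idealM _ hq).
    apply: (ideal_mulr _ hq); case: (s - l)%N (ltn_ord l) (subn_gt0 l s) => [->//|j] _ _.
    by rewrite exprS e1; apply: (ideal_mulr _ hq); exact: divides_mull (divides_refl q).
  by move=> /(primeX pqi) /dividesN; rewrite opprK.
have [b0' e0] := q0; have [qz nq _] := pq.
have b1z : b1' != 0 by apply: contraNneq bz => z'; rewrite e1 z' mul0r.
apply: (IH b0' b1') => //.
  have sq : (1 < msize q)%N.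
    rewrite ltnNge; apply/negP => s1; case/negP: nq.
    have [c' ec] : exists c', q = c'%:MP by have /msize1_polyC := s1; exists q@_0.
    by rewrite ec; apply: mpolyC_unit; apply: contraNneq qz => c'0; rewrite ec c'0 mpolyC0.
  have := bN; rewrite e1 msizeM // => bN'.
  have : (0 < msize b1')%N by rewrite lt0n msize_poly_eq0.
  by move: bN' sq; move: (msize b1') (msize q) => x y'; clear; lia.
apply: (torsion_free qz); have := h; rewrite e0 e1 !(rmorphM fb); congr (I _).
by move: (fb b0') (fb b1') (fb q) => *; ring.
Qed.

Lemma base_homog y b : y \is 1.-homog -> I (y - fb b) -> I (y - fb (hpart 1 b)).
Proof. by move=> hy /(hI.2 1%N); rewrite raddfB /= (hpart_id hy) fb_hpart. Qed.

Definition free1 y := forall b0 b1, I (fb b0 + fb b1 * y) -> b0 = 0 /\ b1 = 0.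

Lemma base_or_free y : (exists b, I (y - fb b)) \/ free1 y.
Proof.
case: (classic (free1 y)) => [|no]; [by right | left].
have [b0 [b1 [h nz]]] : exists b0 b1, I (fb b0 + fb b1 * y) /\ ~ (b0 = 0 /\ b1 = 0).
  by apply: NNPP => no'; apply: no => b0 b1 h; apply: NNPP => nz; apply: no'; exists b0, b1.
have [b10|b10] := eqVneq b1 0; last exact: (integral_in_base b10 h).
by case: nz; split=> //; apply: no_base; move: h; rewrite b10 (rmorph0 fb) mul0r addr0.
Qed.

Lemma free1_rank y d c : y \is d.-homog -> free1 y -> epolc m (hfr I) c -> 2 <= c.
Proof.
move=> hy fy hc.
have := @rank_lower k m F I 'I_2 (fun i => if i == ord0 then 1 else y) (fun i => if i == ord0 then 0%N else d) c hIi.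
rewrite card_ord; apply=> // [i|b]; first by case: ifP => _ //; exact: (mpolyC_homog _ 1).
rewrite sum_ord2 /= mulr1 => /fy[e0 e1] i.
have [->|i0'] := eqVneq i ord0 => //.
by have -> : i = ord_max; [apply/val_inj; case: i i0' => [[|[]]] | ].
Qed.

(** With rank below 2, neither z nor w is independent of 1 over B, so both are congruent to linear
    forms of B. *)
Lemma rank1 x : epolc m (hfr I) x -> x < 2 ->
  exists a c, [/\ a \is 1.-homog, c \is 1.-homog & eq_ideal I (ptker a c)].
Proof.
move=> hc x2; have nofree y : y \is 1.-homog -> exists2 b, b \is 1.-homog & I (y - fb b).
  move=> hy; case: (base_or_free y) => [[b hb]|fy]; last by have := free1_rank hy fy hc; rewrite leNgt x2.
  by exists (hpart 1 b); [exact: hpart_homog | exact: base_homog].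
have [a ha Iz] := nofree _ (fz_homog F); have [c hc' Iw] := nofree _ (fw_homog F).
by exists a, c; split=> //; apply: ptker_least => //; exact: no_base.
Qed.

End Torsion.
End FrameQuotients.

(** A, D, C stand for z'^2, z'w', w'^2. Both (A, D) and (D, C) are proportional to (b2, -b1), which
    forces the shape of a square. *)
Lemma square_ratio (B : idomainType) (b1 b2 A C D : B) : ufd B ->
  cop (fun i : bool => if i then b1 else b2) -> b1 != 0 \/ b2 != 0 ->
  b1 * A + b2 * D = 0 -> b1 * D + b2 * C = 0 ->
  exists a, [/\ A = b2 ^+ 2 * a, D = - (b1 * b2 * a) & C = b1 ^+ 2 * a].
Proof.
move=> hufd c12 nz eA eC; have [b20|b20] := eqVneq b2 0.
  have b10 : b1 != 0 by case: nz => //; rewrite b20 eqxx.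
  have u : b1 \is a GRing.unit.
    apply/negPn/negP => nu; have [q pq qb] := ufd_prime_factor hufd b10 nu.
    by apply: (c12 q pq); case=> //; rewrite b20; exact: divides0.
  have A0 : A = 0 by apply: (mulfI b10); rewrite mulr0 -eA b20 mul0r addr0.
  have D0 : D = 0 by apply: (mulfI b10); rewrite mulr0 -eC b20 mul0r addr0.
  exists (b1 ^- 2 * C); split; rewrite ?A0 ?D0 ?b20 ?mulr0 ?mul0r ?oppr0 ?expr0n ?mul0r //.
  by rewrite mulrA mulrV ?mul1r // unitrX.
have div x y : x * b1 = b2 * y -> divides b2 x.
  move=> e; apply: (@cop_div _ hufd _ (fun i : bool => if i then y else x) _ x b2 c12 b20).
  by case; rewrite ?e // mulrC.
have [A' eA'] : divides b2 A.
  by apply: (div _ (- D)); rewrite mulrN mulrC; apply/eqP; rewrite -addr_eq0 eA.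
have eD : D = - (b1 * A').
  apply: (mulfI b20); move: eA => /eqP; rewrite addrC addr_eq0 => /eqP ->.
  by rewrite eA'; ring.
have e2 : b1 * (b1 * A') = b2 * C.
  by move: eC => /eqP; rewrite eD addrC addr_eq0 => /eqP ->; ring.
have [x ex] : divides b2 (b1 * A') by apply: (div _ C); rewrite mulrC.
have [a ea] : divides b2 A' by apply: (div _ x); rewrite mulrC ex mulrC.
exists a; split; [by rewrite eA' ea; ring | by rewrite eD ea; ring | ].
by apply: (mulfI b20); rewrite -e2 ea; ring.
Qed.

(** * Normal form of unmixed ideals of multiplicity two *)

Section RankTwo.
Variables (k : closedFieldType) (m : nat).
Notation B := {mpoly k[m.+1]}.
Notation R := {mpoly k[m.+3]}.
Variable F : frame k m.+1.
Notation fb := (fb F).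
Notation z := (fz F).
Notation w := (fw F).

Lemma pairI_gen (x : 'I_2 -> R) : pairI (x ord0) (x ord_max) = ideal_gen x.
Proof.
apply: eq_ideal_eq => g; split=> [[u [v ->]]|[c ->]].
  by exists (fun i => if i == ord0 then u else v); rewrite sum_ord2.
by rewrite sum_ord2; exists (c ord0), (c ord_max).
Qed.

Lemma ptker_epolc a c : a \is 1.-homog -> c \is 1.-homog -> epolc m (hfr (ptker F a c)) 1.
Proof.
move=> ha hc; have [z0 cp] := pts_cop F ha hc.
have h := pairI_epolc z0 (pts_homog F ord0 ha hc) (pts_homog F ord_max ha hc) cp.
rewrite mulr1 in h; rewrite (eq_ideal_eq (@ptker_gen _ _ F a c)) -pairI_gen; exact: h.
Qed.

Lemma decompose (K : R -> Prop) be ga A C D : is_ideal K ->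
  K ((z - fb be) ^+ 2 - fb A) -> K ((z - fb be) * (w - fb ga) - fb D) -> K ((w - fb ga) ^+ 2 - fb C) ->
  forall x, exists x0 x1 x2, K (x - (fb x0 + fb x1 * (z - fb be) + fb x2 * (w - fb ga))).
Proof.
move=> hK hA hD hC.
set z' := z - fb be; set w' := w - fb ga.
have ez : z = z' + fb be by rewrite /z' subrK.
have ew : w = w' + fb ga by rewrite /w' subrK.
apply: (fr_ind (f := F)) => [b|x y [x0 [x1 [x2 hx]]] [y0 [y1 [y2 hy]]]|x [x0 [x1 [x2 hx]]]|x [x0 [x1 [x2 hx]]]].
- by exists b, 0, 0; rewrite (rmorph0 fb) !mul0r !addr0 subrr; exact: ideal0.
- exists (x0 + y0), (x1 + y1), (x2 + y2); have := idealD hK hx hy; congr (K _).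
  by rewrite !(rmorphD fb); move: (fb x0) (fb x1) (fb x2) (fb y0) (fb y1) (fb y2) z' w' {ez ew hA hD hC hx hy} => *; ring.
- exists (be * x0 + x1 * A + x2 * D), (x0 + be * x1), (be * x2).
  have := idealD hK (idealM z hK hx) (idealD hK (idealM (fb x1) hK hA) (idealM (fb x2) hK hD)); congr (K _).
  rewrite -/z' -/w' ez !(rmorphD fb) !(rmorphM fb).
  by move: (fb x0) (fb x1) (fb x2) (fb be) (fb A) (fb D) z' w' {ez ew hA hD hC hx} => *; ring.
exists (ga * x0 + x1 * D + x2 * C), (ga * x1), (x0 + ga * x2).
have := idealD hK (idealM w hK hx) (idealD hK (idealM (fb x1) hK hD) (idealM (fb x2) hK hC)); congr (K _).
rewrite -/z' -/w' ew !(rmorphD fb) !(rmorphM fb).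
by move: (fb x0) (fb x1) (fb x2) (fb ga) (fb C) (fb D) z' w' {ez ew hA hD hC hx} => *; ring.
Qed.

Variables (h1 h2 : R) (t0 : nat) (I : R -> Prop).
Hypotheses (fr : framed F h1 h2 t0 I) (n1 : ~ I 1) (hc : epolc m (hfr I) 2) (char0 : (2 : k) != 0).
Let hI := torsion_homog fr.
Let hIi := hI.1.
Let nob := no_base fr n1.

Lemma two_neq0 : (2%:R : B) != 0.
Proof. by rewrite -mpolyC_nat mpolyC_eq0. Qed.

Lemma rank2_dep (y : 'I_3 -> R) (d : 'I_3 -> nat) : (forall i, y i \is (d i).-homog) ->
  exists b : 'I_3 -> B, I (fb (b i0) * y i0 + fb (b i1) * y i1 + fb (b i2) * y i2) /\ exists i, b i != 0.
Proof.
move=> hy; apply: NNPP => no.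
have := @rank_lower k m F I 'I_3 y d 2 hIi hy; rewrite card_ord.
move=> /(_ _ hc) h; suff : (3%:R : rat) <= 2 by [].
apply: h => b; rewrite sum3 => hb i; apply: NNPP => /eqP bi; apply: no; exists b.
by split=> //; exists i.
Qed.

(** In rank two, 1, y, y^2 are dependent. The primitive part of the dependency is quadratic and
    divides the monic equation of y by Gauss's lemma, so its leading coefficient is a unit; then the
    square is completed. *)
Lemma free1_quadratic y : y \is 1.-homog -> free1 F I y ->
  exists be A, [/\ be \is 1.-homog, A \is 2.-homog & I ((y - fb be) ^+ 2 - fb A)].
Proof.
move=> hy fy.
have [b [hb [i bi]]] := rank2_dep (y := fun i : 'I_3 => y ^+ i) (fun i => homog_exp i hy).
rewrite /= expr0 expr1 mulr1 in hb.
have b2 : b i2 != 0.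
  apply: contraNneq bi => b20; move: hb; rewrite b20 (rmorph0 fb) mul0r addr0 => /fy[e0 e1].
  by move: (i); apply: (@all3 (fun i => b i == 0)); rewrite ?e0 ?e1 ?b20.
pose Q : {poly B} := Poly [:: b i0; b i1; b i2].
have sQ : (size Q <= 3)%N by exact: size_Poly.
have hQ : I (map_poly fb Q).[y].
  rewrite (horner_coef_wide _ (leq_trans (size_poly _ _) sQ)) !big_ord_recl big_ord0 /= addr0.
  rewrite !coef_map_id0 ?(rmorph0 fb) // !coef_Poly /= expr0 mulr1 expr1.
  by move: hb; congr (I _); rewrite addrA.
have Q0 : Q != 0.
  apply: contraNneq b2 => Q0; have := congr1 (fun P : {poly B} => P`_2) Q0.
  by rewrite coef_Poly coef0 /= => ->.
have [c [g [c0 pg eQ]]] := primitive_part (@ufd_mpoly k _) Q0.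
have Ig : I (map_poly fb g).[y].
  apply: (torsion_free fr c0); move: hQ; congr (I _).
  by rewrite eQ rmorphM /= map_polyC hornerM hornerC.
have g0 : g != 0 by apply: contraNneq Q0 => g0; rewrite eQ g0 mulr0.
have sg : (size g <= 3)%N by move: sQ; rewrite eQ mul_polyC size_scale.
have lin (r : {poly B}) : (size r <= 2)%N -> I (map_poly fb r).[y] -> r = 0.
  move=> sr; rewrite (horner_coef_wide _ (leq_trans (size_poly _ _) sr)) !big_ord_recl big_ord0 /= addr0.
  rewrite !coef_map_id0 ?(rmorph0 fb) // expr0 mulr1 expr1 => /fy[e0 e1].
  by apply/polyP => [[|[|j]]]; rewrite coef0 //; apply: nth_default; apply: leq_trans sr _.
have sg3 : size g = 3.
  apply/eqP; rewrite eqn_leq sg ltnNge; apply/negP => s2.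
  by case/eqP: g0; exact: lin.
have [P monP rP] := integral fr y.
have dg : divides g P.
  apply: (divides_primitive (@ufd_mpoly k _) (c := lead_coef g ^+ scalp P g)) => //.
    by rewrite expf_neq0 // lead_coef_eq0.
  have e := Pdiv.Idomain.divp_eq P g.
  exists (P %/ g); rewrite e -[RHS]addr0; congr (_ + _); apply: lin.
    by have := ltn_modp P g; rewrite g0 sg3.
  have -> : P %% g = lead_coef g ^+ scalp P g *: P - P %/ g * g by rewrite e addrC addKr.
  rewrite rmorphB rmorphM /= -mul_polyC rmorphM /= map_polyC hornerD hornerN !hornerM hornerC.
  exact: (idealB hIi (idealM _ hIi rP) (idealM _ hIi Ig)).
have [P' eP] := dg.
have u : g`_2 \is a GRing.unit.
  have := monicP monP; rewrite eP lead_coefM [lead_coef g]lead_coefE sg3 => e.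
  by apply/unitrP; exists (lead_coef P'); split=> //; rewrite mulrC.
have Iy : I (y ^+ 2 + fb ((g`_2)^-1 * g`_1) * y + fb ((g`_2)^-1 * g`_0)).
  have h := idealM (fb (g`_2)^-1) hIi Ig.
  move: h; rewrite (horner_coef_wide _ (leq_trans (size_poly _ _) sg)) !big_ord_recl big_ord0 /= addr0.
  rewrite !coef_map_id0 ?(rmorph0 fb) // expr0 mulr1 expr1.
  congr (I _); rewrite !mulrDr !mulrA -!(rmorphM fb) mulVr // (rmorph1 fb) mul1r addrC.
  by rewrite [fb _ * y + _]addrC.
have := hI.2 2%N _ Iy; rewrite !raddfD /= (hpart_id (homog_exp 2 hy)) (hpart_fb_mul F _ _ hy) /= fb_hpart.
set p1 := hpart (2 - 1) _; set p0 := hpart 2 _ => Iy'.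
have hp1 : p1 \is 1.-homog by exact: hpart_homog.
have hp0 : p0 \is 2.-homog by exact: hpart_homog.
pose h : B := (2^-1)%:MP.
have eh : 2%:R * h = 1 by rewrite /h -mpolyC_nat -mpolyCM mulfV // mpolyC1.
have hh x j : x \is j.-homog -> h * x \is j.-homog by move=> hx; have := dhomogM (mpolyC_homog _ (2^-1 : k)) hx.
exists (- (h * p1)), ((h * p1) ^+ 2 - p0); split.
- by rewrite rpredN; exact: hh.
- by apply: rpredB => //; exact: (homog_exp 2 (hh _ _ hp1)).
have e2 : fb p1 = 2%:R * fb (h * p1).
  by rewrite -[2%:R](rmorph_nat fb) -(rmorphM fb) mulrA eh mul1r.
move: Iy'; rewrite e2; congr (I _); rewrite (rmorphN fb) (rmorphB fb) (rmorphXn fb).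
by move: (fb (h * p1)) (fb p0) => *; ring.
Qed.

Lemma trace_zero y : y \is 1.-homog -> exists be A, [/\ be \is 1.-homog, A \is 2.-homog,
  I ((y - fb be) ^+ 2 - fb A) & I (y - fb be) \/ free1 F I (y - fb be)].
Proof.
move=> hy; have [[b hb]|fy] := base_or_free fr n1 y.
  have h := base_homog fr hy hb; exists (hpart 1 b), 0; split; [exact: hpart_homog | exact: rpred0 | | by left].
  by rewrite (rmorph0 fb) subr0 expr2; exact: (idealM _ hIi h).
have [be [A [h1' h2' h3]]] := free1_quadratic hy fy; exists be, A; split=> //; right => b0 b1 h.
have h' : I (fb (b0 - b1 * be) + fb b1 * y).
  by move: h; congr (I _); rewrite (rmorphB fb) (rmorphM fb); move: (fb b0) (fb b1) (fb be) => *; ring.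
have [e0 e1] := fy _ _ h'; split=> //; by move: e0; rewrite e1 mul0r subr0.
Qed.

End RankTwo.

Section RankTwoStructure.
Variables (k : closedFieldType) (m : nat).
Notation B := {mpoly k[m.+1]}.
Notation R := {mpoly k[m.+3]}.
Variable F : frame k m.+1.
Notation fb := (fb F).
Notation z := (fz F).
Notation w := (fw F).
Variables (h1 h2 : R) (t0 : nat) (I : R -> Prop).
Hypotheses (fr : framed F h1 h2 t0 I) (n1 : ~ I 1) (hc : epolc m (hfr I) 2) (char0 : (2 : k) != 0).
Let hI := torsion_homog fr.
Let hIi := hI.1.
Let nob := no_base fr n1.

(** A relation of least degree is coprime: a common prime factor has positive degree and can be
    divided out because R/I is torsion-free. *)
Lemma coprime_relation (y y' : R) : y \is 1.-homog -> y' \is 1.-homog ->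
  (exists b1 b2, (b1 != 0 \/ b2 != 0) /\ I (fb b1 * y + fb b2 * y')) ->
  exists t b1 b2, [/\ b1 \is t.-homog, b2 \is t.-homog, b1 != 0 \/ b2 != 0,
    cop (fun i : bool => if i then b1 else b2) & I (fb b1 * y + fb b2 * y')].
Proof.
move=> hy hy' [b1 [b2 [nz Ib]]].
pose P t := exists b1 b2, [/\ b1 \is t.-homog, b2 \is t.-homog, b1 != 0 \/ b2 != 0 & I (fb b1 * y + fb b2 * y')].
have exP : exists t, P t.
  have hp t : I (fb (hpart t b1) * y + fb (hpart t b2) * y').
    have := hI.2 t.+1 _ Ib; rewrite raddfD /= (hpart_fb_mul F _ _ hy) (hpart_fb_mul F _ _ hy') /=.
    by rewrite subn1.
  have nz' (b : B) : b != 0 -> exists t, hpart t b != 0.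
    move=> b0; apply: NNPP => no; case/eqP: b0; rewrite (hpart_sumw (leqnn (msize b))) big1 // => i _.
    by apply: NNPP => /eqP n0; apply: no; exists i.
  have [t ht] : exists t, hpart t b1 != 0 \/ hpart t b2 != 0.
    by case: nz => /nz'[t ht]; exists t; [left | right].
  by exists t, (hpart t b1), (hpart t b2); split=> //; exact: hpart_homog.
have [t [[c1 [c2 [hc1 hc2 cz Ic]]] mint]] := nat_least exP.
exists t, c1, c2; split=> // q pq dq; have [q0 nq _] := pq.
have [d1 e1] := dq true; have [d2 e2] := dq false.
have [s [s0 hq]] : exists s, (0 < s)%N /\ q \is s.-homog.
  have key c d : c \is t.-homog -> c != 0 -> c = d * q -> exists s, (0 < s)%N /\ q \is s.-homog.
    move=> hc' c0 e; have d0 : d != 0 by apply: contraNneq c0 => d0; rewrite e d0 mul0r.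
    have h : d * q \is t.-homog by rewrite -e.
    have [i [j [_ hq _]]] := homog_prod_factor d0 q0 h; exists j; split=> //.
    rewrite lt0n; apply: contra nq => /eqP j0; rewrite j0 in hq.
    rewrite (homog0_const hq); apply: mpolyC_unit.
    by apply: contraNneq q0 => c'0; rewrite (homog0_const hq) c'0 mpolyC0.
  by case: cz => n0; [exact: (key _ _ hc1 n0 e1) | exact: (key _ _ hc2 n0 e2)].
have hd c d : c \is t.-homog -> c = d * q -> if (s <= t)%N then d \is (t - s).-homog : Prop else d = 0.
  by move=> hc' e; apply: (homog_factor q0 hq); rewrite mulrC -e.
have st : (s <= t)%N.
  rewrite leqNgt; apply/negP => ts; have := hd _ _ hc1 e1; have := hd _ _ hc2 e2.
  by rewrite leqNgt ts /= => z2 z1; move: cz; rewrite e1 e2 z1 z2 mul0r eqxx => -[].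
apply: (mint (t - s)%N); first by rewrite ltn_subrL s0 (leq_trans s0 st).
exists d1, d2; split.
- by have := hd _ _ hc1 e1; rewrite st.
- by have := hd _ _ hc2 e2; rewrite st.
- by case: cz => n0; [left; apply: contraNneq n0 => d0; rewrite e1 d0 mul0r | right; apply: contraNneq n0 => d0; rewrite e2 d0 mul0r].
apply: (torsion_free fr q0); move: Ic; rewrite e1 e2 !(rmorphM fb); congr (I _).
by move: (fb d1) (fb d2) (fb q) => *; ring.
Qed.

Lemma rank2_structure : exists (be ga b1 b2 a : B) t,
  [/\ be \is 1.-homog, ga \is 1.-homog, b1 \is t.-homog, b2 \is t.-homog & (b1 != 0 \/ b2 != 0)] /\
  [/\ cop (fun i : bool => if i then b1 else b2), b2 != 0 -> free1 F I (z - fb be), b1 != 0 -> free1 F I (w - fb ga)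
    & a = 0 \/ (t = 0%N /\ a \is 2.-homog) \/ (t = 1%N /\ a \is 0.-homog)] /\
  [/\ I ((z - fb be) ^+ 2 - fb (b2 ^+ 2 * a)), I ((z - fb be) * (w - fb ga) - fb (- (b1 * b2 * a))),
     I ((w - fb ga) ^+ 2 - fb (b1 ^+ 2 * a)) & I (fb b1 * (z - fb be) + fb b2 * (w - fb ga))].
Proof.
have [be [A [hbe hA IA zf]]] := trace_zero fr n1 hc char0 (fz_homog F).
have [ga [C [hga hC IC wf]]] := trace_zero fr n1 hc char0 (fw_homog F).
set z' := z - fb be in IA zf *; set w' := w - fb ga in IC wf *.
have hz' : z' \is 1.-homog by apply: rpredB; [exact: fz_homog | exact: fb_homog].
have hw' : w' \is 1.-homog by apply: rpredB; [exact: fw_homog | exact: fb_homog].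
have nboth : ~ (I z' /\ I w').
  move=> [hz hw]; have e := eq_ideal_eq (ptker_least hIi hz hw nob).
  have := ptker_epolc F hbe hga; rewrite -e => h; have := epolc_uniq h hc; lra.
have notfree y : I y -> ~ free1 F I y.
  move=> Iy fy; have [|_ /eqP] := fy 0 1; first by rewrite (rmorph0 fb) (rmorph1 fb) add0r mul1r.
  by rewrite oner_eq0.
have zw : (I z' /\ free1 F I w') \/ (free1 F I z' /\ I w') \/ (free1 F I z' /\ free1 F I w').
  by case: zf => hz; case: wf => hw; [case: nboth | left | right; left | right; right].
have rel : exists b1 b2, (b1 != 0 \/ b2 != 0) /\ I (fb b1 * z' + fb b2 * w').
  case: zw => [[hz _]|[[_ hw]|[fz fw]]].
  - by exists 1, 0; rewrite oner_neq0 (rmorph1 fb) (rmorph0 fb) mul1r mul0r addr0; split=> //; left.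
  - by exists 0, 1; rewrite oner_neq0 (rmorph1 fb) (rmorph0 fb) mul1r mul0r add0r; split=> //; right.
  pose y (i : 'I_3) : R := match val i with 0 => 1 | 1 => z' | _ => w' end.
  pose dy (i : 'I_3) : nat := match val i with 0 => 0%N | _ => 1%N end.
  have hy i : y i \is (dy i).-homog by move: i; apply: all3; rewrite /y /dy //=; exact: (mpolyC_homog _ 1).
  have [b [hb [i bi]]] := rank2_dep fr hc hy.
  rewrite /y /= mulr1 in hb.
  have [b1z|b1z] := eqVneq (b i1) 0.
    move: hb; rewrite b1z (rmorph0 fb) mul0r addr0 => /fw[e0 e2].
    by case/eqP: bi; move: (i); apply: all3.
  exists (b i1), (b i2); split; first by left.
  (* Since z'^2 and w'^2 lie in B, squaring b0 + b1 z' = -b2 w' leaves 2 b0 b1 z' congruent to an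
     element of B. As z' is free and b1 nonzero, b0 = 0. *)
  suff b0 : b i0 = 0 by move: hb; rewrite b0 (rmorph0 fb) add0r.
  have h : I (fb (b i0 ^+ 2 + b i1 ^+ 2 * A - b i2 ^+ 2 * C) + fb (2%:R * (b i0 * b i1)) * z').
    have h1' := idealM (fb (b i0) + fb (b i1) * z' - fb (b i2) * w') hIi hb.
    have h2' := idealB hIi (idealM (fb (b i2) ^+ 2) hIi IC) (idealM (fb (b i1) ^+ 2) hIi IA).
    have := idealD hIi h1' h2'; congr (I _).
    rewrite (rmorphB fb) (rmorphD fb) !(rmorphM fb) (rmorph_nat fb).
    by move: (fb (b i0)) (fb (b i1)) (fb (b i2)) (fb A) (fb C) z' w' {hz' hw' hb nboth zf wf IA IC fz fw y dy hy h1' h2'} => *; ring.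
  have [_ /eqP] := fz _ _ h.
  rewrite mulf_eq0 (negbTE (two_neq0 m char0)) mulf_eq0 (negbTE b1z) orbF => /eqP; exact: id.
have [t [b1 [b2 [hb1 hb2 nz c12 IX]]]] := coprime_relation hz' hw' rel.
have f2 : b2 != 0 -> free1 F I z'.
  move=> b20; case: zw => [[hz fw]|[[]|[]]] //.
  have h : I (fb 0 + fb b2 * w').
    by have := idealB hIi IX (idealM (fb b1) hIi hz); rewrite addrAC subrr (rmorph0 fb).
  by have [_ e] := fw _ _ h; rewrite e eqxx in b20.
have f1 : b1 != 0 -> free1 F I w'.
  move=> b10; case: zw => [[]|[[fz hw]|[]]] //.
  have h : I (fb 0 + fb b1 * z').
    by have := idealB hIi IX (idealM (fb b2) hIi hw); rewrite addrK (rmorph0 fb) add0r.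
  by have [_ e] := fz _ _ h; rewrite e eqxx in b10.
(* Multiplying the relation by w' or z' puts b1 z'w' or b2 z'w' in B, and integrality then puts z'w'
   itself in B. *)
have [D ID] : exists D, I (z' * w' - fb D).
  have [b20|b20] := eqVneq b2 0.
    have b10 : b1 != 0 by case: nz => //; rewrite b20 eqxx.
    apply: (integral_in_base fr n1 b10 (b0 := b2 * C)).
    have := idealB hIi (idealM w' hIi IX) (idealM (fb b2) hIi IC); congr (I _).
    by rewrite (rmorphM fb); move: (fb b1) (fb b2) (fb C) z' w' {hz' hw' nboth zf wf zw IA IC IX f1 f2 rel} => *; ring.
  apply: (integral_in_base fr n1 b20 (b0 := b1 * A)).
  have := idealB hIi (idealM z' hIi IX) (idealM (fb b1) hIi IA); congr (I _).
  by rewrite (rmorphM fb); move: (fb b1) (fb b2) (fb A) z' w' {hz' hw' nboth zf wf zw IA IC IX f1 f2 rel} => *; ring.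
have eA : b1 * A + b2 * D = 0.
  apply: nob; have := idealB hIi (idealM z' hIi IX) (idealD hIi (idealM (fb b1) hIi IA) (idealM (fb b2) hIi ID)); congr (I _).
  by rewrite (rmorphD fb) !(rmorphM fb); move: (fb b1) (fb b2) (fb A) (fb D) z' w' {hz' hw' nboth zf wf zw IA IC IX f1 f2 rel ID} => *; ring.
have eC : b1 * D + b2 * C = 0.
  apply: nob; have := idealB hIi (idealM w' hIi IX) (idealD hIi (idealM (fb b1) hIi ID) (idealM (fb b2) hIi IC)); congr (I _).
  by rewrite (rmorphD fb) !(rmorphM fb); move: (fb b1) (fb b2) (fb C) (fb D) z' w' {hz' hw' nboth zf wf zw IA IC IX f1 f2 rel ID} => *; ring.
have [a [ea ed ec]] := square_ratio (@ufd_mpoly k _) c12 nz eA eC.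
exists be, ga, b1, b2, a, t; rewrite -/z' -/w' -ea -ed -ec; split=> //; split=> //; split=> //.
have key b X : b != 0 -> b \is t.-homog -> X \is 2.-homog -> X = b ^+ 2 * a ->
    if (t * 2 <= 2)%N then a \is (2 - t * 2).-homog : Prop else a = 0.
  move=> b0 hb hX eX; apply: (@homog_factor _ _ (t * 2) 2 a (b ^+ 2)); first by rewrite expf_neq0.
    exact: homog_exp.
  by rewrite -eX.
have : if (t * 2 <= 2)%N then a \is (2 - t * 2).-homog : Prop else a = 0.
  by case: nz => b0; [exact: (key b1 C) | exact: (key b2 A)].
case: (t) => [|[|j]] /= h; [by right; left | by right; right | left].
exact: h.
Qed.

End RankTwoStructure.

Lemma proportional (B : idomainType) (b1 b2 x1 x2 : B) : ufd B ->
  cop (fun i : bool => if i then b1 else b2) -> b1 != 0 \/ b2 != 0 ->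
  b2 * x1 = b1 * x2 -> exists y, x1 = y * b1 /\ x2 = y * b2.
Proof.
move=> hufd c12 nz e; have [b10|b10] := eqVneq b1 0.
  have b20 : b2 != 0 by case: nz => //; rewrite b10 eqxx.
  have [y ey] : divides b2 x2.
    apply: (@cop_div _ hufd _ (fun i : bool => if i then x1 else x2) _ x2 b2 c12 b20).
    by case; rewrite ?e mulrC.
  by exists y; split=> //; apply: (mulfI b20); rewrite e ey; ring.
have [y ey] : divides b1 x1.
  apply: (@cop_div _ hufd _ (fun i : bool => if i then x1 else x2) _ x1 b1 c12 b10).
  by case; rewrite -?e mulrC.
by exists y; split=> //; apply: (mulfI b10); rewrite -e ey; ring.
Qed.

Lemma cap_ideal_ideal (A : comNzRingType) (I J : A -> Prop) :
  is_ideal I -> is_ideal J -> is_ideal (cap_ideal I J).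
Proof.
move=> hI hJ; split; first by split; exact: ideal0.
by move=> a u v [? ?] [? ?]; split; [exact: hI.2 | exact: hJ.2].
Qed.

Lemma ideal_congr (A : comNzRingType) (Q : A -> Prop) x y : is_ideal Q -> Q (x - y) -> Q y -> Q x.
Proof. by move=> hQ h hy; have := idealD hQ h hy; rewrite subrK. Qed.

Lemma ideal_congr_sym (A : comNzRingType) (Q : A -> Prop) x y : is_ideal Q -> Q (x - y) -> Q x -> Q y.
Proof. by move=> hQ h hx; have := idealB hQ hx h; rewrite subKr. Qed.

Section RankTwoCases.
Variables (k : closedFieldType) (m : nat).
Notation B := {mpoly k[m.+1]}.
Notation R := {mpoly k[m.+3]}.
Variable F : frame k m.+1.
Notation fb := (fb F).
Notation z := (fz F).
Notation w := (fw F).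
Variables (h1 h2 : R) (t0 : nat) (I : R -> Prop).
Hypotheses (fr : framed F h1 h2 t0 I) (n1 : ~ I 1) (char0 : (2 : k) != 0).
Let hI := torsion_homog fr.
Let hIi := hI.1.
Let nob := no_base fr n1.
Variables (be ga b1 b2 a : B) (t : nat).
Hypotheses (hbe : be \is 1.-homog) (hga : ga \is 1.-homog) (hb1 : b1 \is t.-homog) (hb2 : b2 \is t.-homog)
  (nz : b1 != 0 \/ b2 != 0) (c12 : cop (fun i : bool => if i then b1 else b2)).
Notation z' := (z - fb be).
Notation w' := (w - fb ga).
Hypotheses (f2 : b2 != 0 -> free1 F I z') (f1 : b1 != 0 -> free1 F I w').
Hypotheses (IA : I (z' ^+ 2 - fb (b2 ^+ 2 * a))) (ID : I (z' * w' - fb (- (b1 * b2 * a))))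
  (IC : I (w' ^+ 2 - fb (b1 ^+ 2 * a))) (IX : I (fb b1 * z' + fb b2 * w')).
Notation comb x0 x1 x2 := (fb x0 + fb x1 * z' + fb x2 * w').
Let hz' : z' \is 1.-homog. Proof. by apply: rpredB; [exact: fz_homog | exact: fb_homog]. Qed.
Let hw' : w' \is 1.-homog. Proof. by apply: rpredB; [exact: fw_homog | exact: fb_homog]. Qed.

(** Together with [decompose] this determines I: modulo the quadratic relations every element is a
    combination of 1, z', w', and those in I are the multiples of b1 z' + b2 w'. *)
Lemma comb_in x0 x1 x2 : I (comb x0 x1 x2) <-> x0 = 0 /\ b2 * x1 = b1 * x2.
Proof.
split=> [h|[-> e]]; last first.
  have [y [-> ->]] := proportional (@ufd_mpoly k _) c12 nz e.
  have := idealM (fb y) hIi IX; congr (I _); rewrite (rmorph0 fb) !(rmorphM fb).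
  by move: (fb y) (fb b1) (fb b2) (z') (w') => *; ring.
case: nz => b0.
  have h' : I (fb (b1 * x0) + fb (b1 * x2 - b2 * x1) * w').
    have := idealB hIi (idealM (fb b1) hIi h) (idealM (fb x1) hIi IX); congr (I _).
    by rewrite (rmorphB fb) !(rmorphM fb); move: (fb x0) (fb x1) (fb x2) (fb b1) (fb b2) (z') (w') => *; ring.
  have [/eqP e0 /eqP e1] := f1 b0 h'; rewrite mulf_eq0 (negbTE b0) in e0.
  by split; [exact/eqP | apply/esym/eqP; rewrite -subr_eq0].
have h' : I (fb (b2 * x0) + fb (b2 * x1 - b1 * x2) * z').
  have := idealB hIi (idealM (fb b2) hIi h) (idealM (fb x2) hIi IX); congr (I _).
  by rewrite (rmorphB fb) !(rmorphM fb); move: (fb x0) (fb x1) (fb x2) (fb b1) (fb b2) (z') (w') => *; ring.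
have [/eqP e0 /eqP e1] := f2 b0 h'; rewrite mulf_eq0 (negbTE b0) in e0.
by split; [exact/eqP | apply/eqP; rewrite -subr_eq0].
Qed.

Lemma ptker_comb u v x0 x1 x2 : ptker F (be + u) (ga + v) (comb x0 x1 x2) <-> x0 + x1 * u + x2 * v = 0.
Proof.
rewrite /ptker; set pt := fpt F _ _.
have -> : pt (comb x0 x1 x2) = x0 + x1 * u + x2 * v; last by [].
rewrite !(rmorphD pt) !(rmorphM pt) !(rmorphB pt) /pt fpt_z fpt_w !fpt_base; ring.
Qed.

Lemma pt_z' u v : fpt F (be + u) (ga + v) z' = u.
Proof. by rewrite (rmorphB (fpt F _ _)) fpt_z fpt_base addrC addKr. Qed.

Lemma pt_w' u v : fpt F (be + u) (ga + v) w' = v.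
Proof. by rewrite (rmorphB (fpt F _ _)) fpt_w fpt_base addrC addKr. Qed.

Lemma ptker_relations u v : u ^+ 2 = b2 ^+ 2 * a -> u * v = - (b1 * b2 * a) -> v ^+ 2 = b1 ^+ 2 * a ->
  [/\ ptker F (be + u) (ga + v) (z' ^+ 2 - fb (b2 ^+ 2 * a)),
      ptker F (be + u) (ga + v) (z' * w' - fb (- (b1 * b2 * a))) &
      ptker F (be + u) (ga + v) (w' ^+ 2 - fb (b1 ^+ 2 * a))].
Proof.
move=> e1 e2 e3; pose pt := fpt F (be + u) (ga + v).
have key x y c : pt (x * y - fb c) = pt x * pt y - c.
  by rewrite (rmorphB pt) (rmorphM pt) /pt fpt_base.
have ez : pt z' = u := pt_z' u v.
have ew : pt w' = v := pt_w' u v.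
rewrite /ptker -/pt ![(_ - _) ^+ 2]expr2 !key ez ew -!expr2 e1 e2 e3 !subrr; split=> //.
Qed.

(** For a = 0 all products of z' and w' lie in I, so I lies between p^2 and p = (z', w'). Locally at
    p the single relation b1 z' + b2 w' leaves p/I of length one. *)
Lemma case_primary : a = 0 -> linear_primary2 I.
Proof.
move=> a0; pose p := ptker F be ga.
have pp : prime_ideal p := ptker_prime F be ga; have [hp p1 pM] := pp.
have [lp hp2] := ptker_linear F hbe hga.
have p0 x0 x1 x2 : p (comb x0 x1 x2) <-> x0 = 0.
  by have := ptker_comb 0 0 x0 x1 x2; rewrite !addr0 !mulr0 !addr0.
have [pA pD pC] : [/\ p (z' ^+ 2 - fb (b2 ^+ 2 * a)), p (z' * w' - fb (- (b1 * b2 * a))) & p (w' ^+ 2 - fb (b1 ^+ 2 * a))].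
  by have := @ptker_relations 0 0; rewrite !addr0; apply; rewrite a0 ?expr0n ?mulr0 ?oppr0 ?mul0r.
have dec x : exists x0 x1 x2, I (x - comb x0 x1 x2) /\ p (x - comb x0 x1 x2).
  exact: (decompose (cap_ideal_ideal hIi hp) (conj IA pA) (conj ID pD) (conj IC pC) x).
have Ip : subideal I p.
  move=> x Ix; have [x0 [x1 [x2 [hx hpx]]]] := dec x.
  by apply: (ideal_congr hp hpx); apply/p0; have /comb_in[] := ideal_congr_sym hIi hx Ix.
have zz : [/\ I (z' ^+ 2), I (z' * w') & I (w' ^+ 2)].
  by move: IA ID IC; rewrite a0 !mulr0 oppr0 (rmorph0 fb) !subr0.
have [Izz Izw Iww] := zz.
have prim x y : I (x * y) -> ~ p y -> I x.
  move=> Ixy ny; have [x0 [x1 [x2 [hx _]]]] := dec x; have [y0 [y1 [y2 [hy hpy]]]] := dec y.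
  have y00 : y0 != 0 by apply/eqP => y00; apply: ny; apply: (ideal_congr hp hpy); apply/p0.
  apply: (ideal_congr hIi hx); apply/comb_in.
  have : I (comb (x0 * y0) (x0 * y1 + x1 * y0) (x0 * y2 + x2 * y0)).
    have h := idealD hIi (idealD hIi (idealM (fb (x1 * y1)) hIi Izz) (idealM (fb (x1 * y2 + x2 * y1)) hIi Izw)) (idealM (fb (x2 * y2)) hIi Iww).
    have g := idealD hIi (idealM y hIi hx) (idealM (comb x0 x1 x2) hIi hy).
    have := idealB hIi (idealB hIi Ixy g) h; congr (I _).
    rewrite !(rmorphD fb) !(rmorphM fb).
    by move: (fb x0) (fb x1) (fb x2) (fb y0) (fb y1) (fb y2) (z') (w') => *; ring.
  move=> /comb_in[/eqP e0 e1]; rewrite mulf_eq0 (negbTE y00) orbF in e0.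
  split; first exact/eqP.
  apply: (mulIf y00); move: e1; rewrite (eqP e0) !mul0r !add0r !mulrA; exact: id.
have sqI x : p x -> I (x ^+ 2).
  move=> px; have [x0 [x1 [x2 [hx hpx]]]] := dec x.
  have /p0 e0 : p (comb x0 x1 x2) by exact: (ideal_congr_sym hp hpx).
  have h := idealD hIi (idealD hIi (idealM (fb (x1 * x1)) hIi Izz) (idealM (fb (2%:R * (x1 * x2))) hIi Izw)) (idealM (fb (x2 * x2)) hIi Iww).
  have := idealD hIi (idealM (x + comb x0 x1 x2) hIi hx) h; congr (I _).
  rewrite e0 !(rmorphM fb) (rmorph_nat fb) (rmorph0 fb).
  by move: (fb x1) (fb x2) (z') (w') => *; ring.
exists p; split=> //.
  split=> // [x y Ixy|x]; last by split=> [px|[j /Ip/(primeX pp)]] //; exists 2%N; exact: sqI.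
  case: (classic (p y)) => [py|ny]; last by left; exact: (prim x y).
  by right; exists 2%N; exact: sqI.
have locI : subideal (loc_ideal p I) I.
  by move=> x [s ns h]; apply: (prim x s) => //; rewrite mulrC.
have npI : ~ subideal p I.
  move=> h; case: nz => b0.
    have Iw : I (fb 0 + fb 1 * w') by rewrite (rmorph0 fb) (rmorph1 fb) add0r mul1r; apply: h; exact: ptker_w.
    by have [_ /eqP] := f1 b0 Iw; rewrite oner_eq0.
  have Iz : I (fb 0 + fb 1 * z') by rewrite (rmorph0 fb) (rmorph1 fb) add0r mul1r; apply: h; exact: ptker_z.
  by have [_ /eqP] := f2 b0 Iz; rewrite oner_eq0.
split.
  exists (fun i : 'I_3 => match val i with 0 => I | 1 => p | _ => @unit_ideal R end); split.
    move=> i j; move: i; apply: all3; move: j; apply: all3 => //= _; split=> //.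
    - by move=> h; apply: n1; exact: h.
    - by move=> h; apply: p1; exact: h.
  apply: all3 => /=; split=> //.
  by move=> x [s ns h]; case: (pM _ _ h).
move=> [q [sq hq]].
pose o (i : nat) (hi : (i < 4)%N) : 'I_4 := Ordinal hi.
have ex (i j : 'I_4) : (i < j)%N -> exists x, q j x /\ ~ q i x.
  move=> ij; have [_ h] := sq i j ij; apply: NNPP => no; apply: h => x qx; apply: NNPP => nx.
  by apply: no; exists x.
have whole i x : q i x -> ~ p x -> forall y, q i y.
  move=> qx nx y; have [hQ _ lQ] := hq i; apply: (ideal1 y hQ); apply: lQ.
  by exists x => //; rewrite mulr1.
(* A member of the chain that exceeds I inside p contains some x1 z' + x2 w' with b2 x1 - b1 x2
   nonzero, hence a unit at p; with b1 z' + b2 w' in I, Cramer's rule gives z' and w'. *)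
have above i x : q i x -> ~ I x -> subideal p (q i).
  move=> qx nIx; have [hQ IQ lQ] := hq i; case: (classic (p x)) => [px|nx]; last by move=> y _; exact: (whole i x).
  have [x0 [x1 [x2 [hx hpx]]]] := dec x.
  have /p0 e0 : p (comb x0 x1 x2) by exact: (ideal_congr_sym hp hpx).
  have qc : q i (comb x0 x1 x2) by exact: (ideal_congr_sym hQ (IQ _ hx)).
  have de : b2 * x1 - b1 * x2 != 0.
    rewrite subr_eq0; apply/eqP => e; apply: nIx; apply: (ideal_congr hIi hx); apply/comb_in; by split.
  have nd : ~ p (fb (b2 * x1 - b1 * x2)) by move=> /ptker_fb /eqP; apply/negP.
  have qz : q i z'.
    apply: lQ; exists (fb (b2 * x1 - b1 * x2)) => //.
    have := idealB hQ (idealM (fb b2) hQ qc) (idealM (fb x2) hQ (IQ _ IX)); congr (q i _).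
    rewrite e0 (rmorph0 fb) (rmorphB fb) !(rmorphM fb).
    by move: (fb x1) (fb x2) (fb b1) (fb b2) (z') (w') => *; ring.
  have qw : q i w'.
    apply: lQ; exists (fb (b2 * x1 - b1 * x2)) => //.
    have := idealB hQ (idealM (fb x1) hQ (IQ _ IX)) (idealM (fb b1) hQ qc); congr (q i _).
    rewrite e0 (rmorph0 fb) (rmorphB fb) !(rmorphM fb).
    by move: (fb x1) (fb x2) (fb b1) (fb b2) (z') (w') => *; ring.
  by move=> y py; have := frame_point_ker y hQ qz qw; rewrite py (rmorph0 fb) subr0.
have [x [qx nx]] := ex (o 0%N isT) (o 1%N isT) isT.
have p1' : subideal p (q (o 1%N isT)).
  by apply: (above _ x qx) => Ix; apply: nx; have [_ h _] := hq (o 0%N isT); exact: h.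
have [y [qy ny]] := ex (o 1%N isT) (o 2%N isT) isT.
have all2 : forall u, q (o 2%N isT) u by apply: (whole _ y qy) => py; apply: ny; exact: p1'.
by have [u [_ []]] := ex (o 2%N isT) (o 3%N isT) isT.
Qed.

(** a is a nonzero scalar s^2, and the relations are solved by the two points (z', w') = (s b2, -s
    b1) and its negative, which differ because 2 is nonzero. *)
Lemma case_primes : t = 1%N -> a \is 0.-homog -> a != 0 -> two_linear_primes I.
Proof.
move=> t1 /homog0_const ea a0.
have [s es] : exists s : k, s ^+ 2 = a@_0%MM.
  have /closed_rootP[s] : size ('X^2 - (a@_0%MM)%:P : {poly k}) != 1%N by rewrite size_XnsubC.
  by rewrite rootE !hornerE /= subr_eq0 => /eqP e; exists s.
have s0 : s != 0 by apply: contraNneq a0 => s0; rewrite ea -es s0 expr0n mpolyC0.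
have {}ea : a = s%:MP ^+ 2 by rewrite ea -es !expr2 mpolyCM.
pose S : B := s%:MP.
have S0 : S != 0 by rewrite mpolyC_eq0.
have hS b : b \is t.-homog -> S * b \is 1.-homog.
  by rewrite t1 => hb; have := dhomogM (mpolyC_homog _ s) hb; rewrite add0n.
pose u := S * b2; pose v := - (S * b1).
have hu : be + u \is 1.-homog by apply: rpredD => //; exact: hS.
have hv : ga + v \is 1.-homog by apply: rpredD => //; rewrite rpredN; exact: hS.
have hu' : be - u \is 1.-homog by apply: rpredB => //; exact: hS.
have hv' : ga - v \is 1.-homog by apply: rpredB => //; rewrite rpredN; exact: hS.
pose p := ptker F (be + u) (ga + v); pose q := ptker F (be - u) (ga - v).
have [hp _ _] : prime_ideal p := ptker_prime _ _ _; have [hq _ _] : prime_ideal q := ptker_prime _ _ _.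
have [pA pD pC] : [/\ p (z' ^+ 2 - fb (b2 ^+ 2 * a)), p (z' * w' - fb (- (b1 * b2 * a))) & p (w' ^+ 2 - fb (b1 ^+ 2 * a))].
  by apply: ptker_relations; rewrite ea /u /v -/S; ring.
have [qA qD qC] : [/\ q (z' ^+ 2 - fb (b2 ^+ 2 * a)), q (z' * w' - fb (- (b1 * b2 * a))) & q (w' ^+ 2 - fb (b1 ^+ 2 * a))].
  by apply: ptker_relations; rewrite ea /u /v -/S; ring.
have dec x : exists x0 x1 x2, I (x - comb x0 x1 x2) /\ (p (x - comb x0 x1 x2) /\ q (x - comb x0 x1 x2)).
  exact: (decompose (cap_ideal_ideal hIi (cap_ideal_ideal hp hq)) (conj IA (conj pA qA)) (conj ID (conj pD qD)) (conj IC (conj pC qC)) x).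
have t2 := two_neq0 m char0.
exists p, q; split; [exact: ptker_linear | exact: ptker_linear | |].
  move=> e; have z0 : q (comb (- u) 1 0).
    apply/e/ptker_comb; ring.
  have z1 : q (comb (- v) 0 1).
    apply/e/ptker_comb; ring.
  have y1 : 2%:R * (S * b2) = 0.
    by have /(ptker_comb (- u) (- v)) h := z0; rewrite -[RHS]oppr0 -[X in _ = - X]h /u; ring.
  have y2 : 2%:R * (S * b1) = 0.
    by have /(ptker_comb (- u) (- v)) h := z1; rewrite -[RHS]h /v; ring.
  by case: nz => b0; [move/eqP: y2 | move/eqP: y1]; rewrite !mulf_eq0 (negbTE t2) (negbTE S0) (negbTE b0).
move=> x; have [x0 [x1 [x2 [hx [px qx]]]]] := dec x.
split=> [/(ideal_congr_sym hIi hx)/comb_in[e0 e1]|[Px Qx]]; last first.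
  apply: (ideal_congr hIi hx); apply/comb_in.
  have /ptker_comb e1 := ideal_congr_sym hp px Px.
  have /(ptker_comb (- u) (- v)) e2 := ideal_congr_sym hq qx Qx.
  have x00 : x0 = 0.
    by apply: (mulfI t2); rewrite mulr0 -[RHS]addr0 -{1}e1 -e2; ring.
  split=> //; move: e1; rewrite x00 /u /v => e1.
  by apply: (mulfI S0); apply/eqP; rewrite -subr_eq0; apply/eqP; rewrite -e1; ring.
split; [apply: (ideal_congr hp px); apply/ptker_comb | apply: (ideal_congr hq qx); apply/(ptker_comb (- u) (- v))];
  rewrite e0 /u /v.
  transitivity (S * (b2 * x1 - b1 * x2)); first by ring.
  by rewrite e1 subrr mulr0.
transitivity (- (S * (b2 * x1 - b1 * x2))); first by ring.
by rewrite e1 subrr mulr0 oppr0.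
Qed.

(** In degree t = 0 one of b1, b2 is a nonzero scalar, so l = b1 z' + b2 w' is a nonzero linear
    form. *)
Lemma case_ci : t = 0%N -> a \is 2.-homog -> ci_type12 I.
Proof.
move=> tz ha; pose l := fb b1 * z' + fb b2 * w'.
have hl : l \is 1.-homog.
  have hh (b : B) (y : R) : b \is t.-homog -> y \is 1.-homog -> fb b * y \is 1.-homog.
    by rewrite tz => hb hy; have := dhomogM (fb_homog F hb) hy.
  by apply: rpredD; apply: hh.
have ub (b : B) : b \is t.-homog -> b != 0 -> b \is a GRing.unit.
  rewrite tz => hb b0; have eb := homog0_const hb; rewrite eb; apply: mpolyC_unit.
  by apply: contraNneq b0 => c0; rewrite eb c0 mpolyC0.
have l0 : l != 0.
  apply/eqP => l0; have h u v : b1 * u + b2 * v = 0.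
    have := ptker_comb u v 0 b1 b2; rewrite (rmorph0 fb) add0r -/l l0 add0r => -[h _]; apply: h.
    exact: (rmorph0 (fpt F _ _)).
  have := h 1 0; have := h 0 1; rewrite !mulr1 !mulr0 addr0 add0r => e2 e1.
  by move: nz; rewrite e1 e2 eqxx => -[].
have Kdiv (K : R -> Prop) (b : B) y : is_ideal K -> b \is a GRing.unit -> K (fb b * y) -> K y.
  move=> hK u h; have := idealM (fb b^-1) hK h; congr (K _).
  by rewrite mulrA -(rmorphM fb) mulVr // (rmorph1 fb) mul1r.
have hq (b : B) (y : R) : b \is t.-homog -> y \is 1.-homog -> y ^+ 2 - fb (b ^+ 2 * a) \is 2.-homog.
  rewrite tz => hb hy; apply: rpredB; first exact: (homog_exp 2 hy).
  by apply: fb_homog; exact: (dhomogM (homog_exp 2 hb) ha).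
(* When b1 is a unit, l eliminates z' and the equation for w'^2 implies the other two; symmetrically
   for b2. *)
have [Q [hQ IQ gQ]] : exists Q, [/\ Q \is 2.-homog, I Q & forall K, is_ideal K -> K l -> K Q ->
    [/\ K (z' ^+ 2 - fb (b2 ^+ 2 * a)), K (z' * w' - fb (- (b1 * b2 * a))) & K (w' ^+ 2 - fb (b1 ^+ 2 * a))]].
  case: nz => b0.
    exists (w' ^+ 2 - fb (b1 ^+ 2 * a)); split=> // [|K hK Kl KQ]; first exact: hq.
    have u := ub _ hb1 b0; split=> //.
      apply: (Kdiv _ _ _ hK u); apply: (Kdiv _ _ _ hK u).
      have := idealD hK (idealM (l - 2%:R * fb b2 * w') hK Kl) (idealM (fb b2 ^+ 2) hK KQ); congr (K _).
      by rewrite /l !(rmorphM fb) ?(rmorphXn fb); move: (fb b1) (fb b2) (fb a) (z') (w') => *; ring.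
    apply: (Kdiv _ _ _ hK u); have := idealB hK (idealM w' hK Kl) (idealM (fb b2) hK KQ); congr (K _).
    by rewrite /l (rmorphN fb) !(rmorphM fb) ?(rmorphXn fb); move: (fb b1) (fb b2) (fb a) (z') (w') => *; ring.
  exists (z' ^+ 2 - fb (b2 ^+ 2 * a)); split=> // [|K hK Kl KQ]; first exact: hq.
  have u := ub _ hb2 b0; split=> //.
    apply: (Kdiv _ _ _ hK u); have := idealB hK (idealM z' hK Kl) (idealM (fb b1) hK KQ); congr (K _).
    by rewrite /l (rmorphN fb) !(rmorphM fb) ?(rmorphXn fb); move: (fb b1) (fb b2) (fb a) (z') (w') => *; ring.
  apply: (Kdiv _ _ _ hK u); apply: (Kdiv _ _ _ hK u).
  have := idealD hK (idealM (l - 2%:R * fb b1 * z') hK Kl) (idealM (fb b1 ^+ 2) hK KQ); congr (K _).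
  by rewrite /l !(rmorphM fb) ?(rmorphXn fb); move: (fb b1) (fb b2) (fb a) (z') (w') => *; ring.
pose X (i : 'I_2) : R := if i == ord0 then l else Q.
have hX := ideal_gen_ideal X.
have Xl : ideal_gen X l by exact: (ideal_gen_gen X ord0).
have XQ : ideal_gen X Q by exact: (ideal_gen_gen X ord_max).
have XI : subideal (ideal_gen X) I by apply: (ideal_gen_sub hIi) => i; rewrite /X; case: ifP.
have IX' : subideal I (ideal_gen X).
  have [kA kD kC] := gQ _ hX Xl XQ => x Ix.
  have [x0 [x1 [x2 hx]]] := decompose hX kA kD kC x.
  have /comb_in[e0 e1] : I (comb x0 x1 x2) by have := idealB hIi Ix (XI _ hx); rewrite subKr.
  have [y [e2 e3]] := proportional (@ufd_mpoly k _) c12 nz e1.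
  have hc : ideal_gen X (comb x0 x1 x2).
    rewrite e0 e2 e3; have := idealM (fb y) hX Xl; congr (ideal_gen X _).
    by rewrite /l (rmorph0 fb) !(rmorphM fb); move: (fb y) (fb b1) (fb b2) (z') (w') => *; ring.
  by have := idealD hX hx hc; rewrite subrK.
have eqX : eq_ideal I (ideal_gen X) by move=> x; split; [exact: IX' | exact: XI].
have zi : is_ideal (@zero_ideal R) := zero_ideal_ideal k m.+3.
exists X; split=> //; split; first by move=> /XI.
move=> i x; have [->|i0'] := eqVneq i ord0.
  move=> [h [c [-> e]]]; exists 0, (fun=> 0); split=> //.
  rewrite big_pred0 // addr0; apply: (mulfI l0); rewrite mulr0 -[l]/(X ord0) e.
  by rewrite big_pred0 // addr0.
have -> : i = ord_max; first by apply/val_inj; case: i i0' => [[|[]]].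
move=> [h [c [-> e]]].
have e' : Q * x = c ord0 * l.
  move: e; rewrite add0r (bigD1 ord0) //= big1 ?addr0; first exact: id.
  by move=> [[|[]] //].
(* A common prime of l and Q would be l up to a scalar, and I would lie in a principal prime. *)
have cQ : cop (fun i : bool => if i then l else Q).
  move=> q pq dq; have [u eu] := dq true; have [c0 c00 ec] := linear_factor pq hl l0 eu.
  have lQ : divides l Q.
    have [v ev] := dq false; exists (v * (c0^-1)%:MP); rewrite ev eu ec -mulrA; congr (_ * _).
    by rewrite mulrA -mpolyCM mulVf // mpolyC1 mul1r.
  have ql : divides q l by exists u.
  have [ht _] := framed_height fr n1; apply: (principal_prime_chain pq); apply: ht.
    exact: prime_elt_ideal.
  have hq' := divides_ideal q.
  move=> y /IX' ; apply: (ideal_gen_sub hq') => j; rewrite /X; case: ifP => _ //.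
  by have [v ->] := lQ; exact: divides_mull.
have [y ->] := cop_regular l0 cQ e'.
exists 0, (fun=> y); split=> //; rewrite add0r (bigD1 ord0) //= big1 ?addr0 //.
by move=> [[|[]] //].
Qed.

End RankTwoCases.

(** * Linear primes and converse multiplicity computations *)

Section LinearPrimes.
Variables (k : closedFieldType) (m : nat).
Notation R := {mpoly k[m.+3]}.
Implicit Types (p q I : R -> Prop).

Lemma cop2_chain3 p q h1 h2 : prime_ideal p -> prime_ideal q -> h1 != 0 ->
  cop (fun i : bool => if i then h1 else h2) -> q h1 -> q h2 -> Defs.proper_sub q p ->
  prime_chain (@zero_ideal R) p 3.
Proof.
move=> pp pq h10 c12 q1 q2 [qp npq].
have [u [[pu _ sq] nu]] := cop2_chain pq h10 c12 q1 q2.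
have [hp _ _] := pp; have [hq _ _] := pq; have [u0 _ _] := pu.
pose c (j : nat) : R -> Prop := match j with 0 => @zero_ideal R | 1 => divides u | 2 => q | _ => p end.
apply: (@nat_chain _ _ _ _ c) => [[|[|[|j]]]|[|[|[|//]]]] _ /=.
- by split=> [||x ->]; [exact: zero_prime | | exact: ideal0].
- by split=> [|x ->|x /sq/qp]; [exact: prime_elt_ideal | exact: divides0 | ].
- by split=> // x ->; exact: ideal0.
- by split=> // x ->; exact: ideal0.
- split=> [x ->|h]; first exact: divides0.
  by have := h u (divides_refl u); move/eqP: u0.
- by split=> // h; apply: nu; apply: h.
- by split.
Qed.

Lemma height2_no_chain p : ideal_height p 2 -> ~ prime_chain (@zero_ideal R) p 3.
Proof.
move=> [_ [q [_ sq [_ nc]]]] [c [sc hc]]; apply: nc; exists c; split=> // i.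
by have [a b d] := hc i; split=> // x /d/sq.
Qed.

Lemma pairI_framed (l0 l1 : R) : l0 \is 1.-homog -> l1 \is 1.-homog -> l0 != 0 ->
  cop (fun i : bool => if i then l0 else l1) -> exists F, framed F l0 l1 1 (pairI l0 l1).
Proof.
move=> h0 h1 z0 c; have [F ci] := ci_frame_exists z0 (ltac:(by rewrite (msize_of_homog z0 h0))) c.
exists F; split=> //; have [_ _ tf _] := ci; split; [exact: (pairI_homog h0 h1) | exact: pairI1 | exact: pairI2 |].
by move=> b g b0; exact: tf.
Qed.

(** Height 2 provides two independent linear generators. They already generate a prime, by [rank1],
    and a strictly larger p would have height at least 3. *)
Lemma linear_height2 p : linear_prime p -> ideal_height p 2 ->
  exists F a c, [/\ a \is 1.-homog, c \is 1.-homog & p = ptker F a c].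
Proof.
move=> [pp [r [l [hl /eq_ideal_eq ep]]]] hh; have [hp p1 _] := pp; have [h2 _] := hh.
have pl i : p (l i) by rewrite ep; exact: ideal_gen_gen.
have [i li] : exists i, l i != 0.
  apply: NNPP => no; have [q [sq hq]] := h2 p pp (fun x h => h).
  have [_ n12] := sq i1 i2 isT; apply: n12 => x qx.
  have [[hq1 _ _] _ _] := hq i1; have [_ _ /(_ x qx)] := hq i2; rewrite ep => -[c ->].
  rewrite big1 => [|j _]; first exact: ideal0.
  by apply: NNPP => nz; apply: no; exists j; apply/eqP => lj; apply: nz; rewrite lj mulr0.
have [j indj] : exists j, forall a b : k, a *: l i + b *: l j = 0 -> a = 0 /\ b = 0.
  apply: NNPP => no.
  have dl j : divides (l i) (l j).
    apply: NNPP => nd; apply: no; exists j => a b e.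
    have [b0|b0] := eqVneq b 0.
      split=> //; move: e; rewrite b0 scale0r addr0 => /eqP.
      by rewrite scaler_eq0 (negbTE li) orbF => /eqP.
    case: nd; exists (- (b^-1 * a))%:MP; rewrite mul_mpolyC scaleNr -scalerA.
    move: e => /eqP; rewrite addr_eq0 => /eqP ->; rewrite scalerN scalerA mulVf // scale1r opprK //.
  have pd : p = divides (l i).
    apply: eq_ideal_eq => x; split; last by move=> [b ->]; exact: (idealM _ hp (pl i)).
    by rewrite ep; move: x; apply: (ideal_gen_sub (divides_ideal (l i))).
  have pe : prime_elt (l i).
    split=> // [|a b]; last by rewrite -pd; case: pp => _ _; apply.
    apply/negP => u; apply: p1; rewrite pd; exact: divides_unit.
  by apply: (principal_prime_chain pe); rewrite -pd; exact: h2.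
have [z0 c12] := independent_cop (hl i) (hl j) indj.
have [F fr] := pairI_framed (hl i) (hl j) z0 c12.
have sp : subideal (pairI (l i) (l j)) p.
  by move=> x [u [v ->]]; exact: (idealD hp (idealM _ hp (pl i)) (idealM _ hp (pl j))).
have n1 : ~ pairI (l i) (l j) 1 by move=> /sp.
have hc := pairI_epolc z0 (hl i) (hl j) c12; rewrite mulr1 in hc.
have [a [c [ha hc' e]]] := rank1 fr n1 hc isT.
exists F, a, c; split=> //; rewrite -(eq_ideal_eq e); apply: eq_ideal_eq => x; split; last exact: sp.
apply: NNPP => nx; apply: (height2_no_chain hh).
have pq : prime_ideal (pairI (l i) (l j)) by rewrite (eq_ideal_eq e); exact: ptker_prime.
apply: (cop2_chain3 pp pq z0 c12 (pairI1 _ _) (pairI2 _ _)); split=> // h.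
by apply: nx => /h.
Qed.

Lemma linear_height2_incl p q : linear_prime p -> ideal_height p 2 -> linear_prime q -> ideal_height q 2 ->
  subideal q p -> eq_ideal p q.
Proof.
move=> lp hp lq hq sq; have [pp _] := lp; have [pq _] := lq.
have [F [a [c [ha hc eq]]]] := linear_height2 lq hq.
have [z0 cp] := pts_cop F ha hc.
move=> x; split; last exact: sq.
apply: NNPP => nx; apply: (height2_no_chain hp).
apply: (cop2_chain3 pp pq z0 cp); [rewrite eq; exact: ptker_z | rewrite eq; exact: ptker_w |].
by split=> // h; apply: nx => /h.
Qed.

Lemma HF_cap_le p q t : is_ideal p -> is_ideal q -> (HF (cap_ideal p q) t <= HF p t + HF q t)%N.
Proof.
move=> hp hq; have hI := cap_ideal_ideal hp hq.
have [b [hb _ ib]] := std_basis t hI; have [b1 [_ s1 _]] := std_basis t hp; have [b2 [_ s2 _]] := std_basis t hq.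
pose V := (R * R)%type; pose Z (v : V) := p v.1 /\ q v.2.
have hZ : subspace Z.
  have sp := ideal_subspace hp; have sq := ideal_subspace hq.
  split; first by split; [case: sp | case: sq].
  by move=> c u v [? ?] [? ?]; split; [apply: sp.2 | apply: sq.2].
pose bb (i : 'I_(HF p t) + 'I_(HF q t)) : V := match i with inl i => (b1 i, 0) | inr i => (0, b2 i) end.
have pr1 (T : finType) (c : T -> k) (v : T -> V) : (lincomb v c).1 = lincomb (fun i => (v i).1) c.
  by apply: (big_morph (fun v : V => v.1)).
have pr2 (T : finType) (c : T -> k) (v : T -> V) : (lincomb v c).2 = lincomb (fun i => (v i).2) c.
  by apply: (big_morph (fun v : V => v.2)).
have := @indep_le_span k V Z 'I_(HF (cap_ideal p q) t) ('I_(HF p t) + 'I_(HF q t))%type (fun i => (b i, b i)) bb hZ.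
rewrite card_sum !card_ord; apply.
  by move=> c [h h']; apply: ib; move: h h'; rewrite pr1 pr2.
have z0 (T : finType) (c : T -> k) : \sum_i c i *: (0 : R) = 0 by rewrite big1 // => j _; exact: scaler0.
move=> i; have [c1 e1] := s1 _ (hb i); have [c2 e2] := s2 _ (hb i).
exists (fun j => match j with inl j => c1 j | inr j => c2 j end); split.
  by move: e1; rewrite /= pr1 /lincomb big_sumType /= z0 addr0.
by move: e2; rewrite /= pr2 /lincomb big_sumType /= z0 add0r.
Qed.

(** Multiplication by a linear form of q outside p embeds (R/p)(-1) in the kernel of the map from
    R/(p & q), the quotient by the intersection, onto R/q. *)
Lemma HF_cap_ge p q l t : prime_ideal p -> is_ideal q -> q l -> ~ p l -> l \is 1.-homog ->
  (HF q t.+1 + HF p t <= HF (cap_ideal p q) t.+1)%N.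
Proof.
move=> pp hq ql npl hl; have [hp _ pM] := pp.
have [b1 [hb1 _ in1]] := std_basis t.+1 hq; have [b2 [hb2 _ in2]] := std_basis t hp.
pose bb (i : 'I_(HF q t.+1) + 'I_(HF p t)) : R := match i with inl i => b1 i | inr i => l * b2 i end.
have := @HF_indep k m.+3 (cap_ideal p q) t.+1 ('I_(HF q t.+1) + 'I_(HF p t))%type bb (cap_ideal_ideal hp hq).
rewrite card_sum !card_ord; apply.
  by move=> [i|i]; [exact: hb1 | exact: (dhomogM hl (hb2 i))].
move=> c [hcp hcq]; have ec : lincomb bb c = lincomb b1 (fun i => c (inl i)) + l * lincomb b2 (fun i => c (inr i)).
  rewrite /lincomb big_sumType /=; congr (_ + _); rewrite mulr_sumr; apply: eq_bigr => i _.
  by rewrite scalerAr.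
have z1 i : c (inl i) = 0.
  apply: (in1 (fun i => c (inl i))); have := idealB hq hcq (ideal_mulr (lincomb b2 (fun i => c (inr i))) hq ql).
  by rewrite ec addrK.
have z2 i : c (inr i) = 0.
  apply: (in2 (fun i => c (inr i))); have : p (l * lincomb b2 (fun i => c (inr i))).
    move: hcp; rewrite ec (_ : lincomb b1 _ = 0) ?add0r //.
    by rewrite /lincomb big1 // => j _; rewrite z1 scale0r.
  by move=> /pM[].
by case.
Qed.

Lemma two_primes_epolc p q : linear_prime p -> ideal_height p 2 -> linear_prime q -> ideal_height q 2 ->
  ~ eq_ideal p q -> epolc m (hfr (cap_ideal p q)) 2.
Proof.
move=> lp hp lq hq npq.
have [F [a [c [ha hc ep]]]] := linear_height2 lp hp; have [F' [a' [c' [ha' hc' eq]]]] := linear_height2 lq hq.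
have [pp _] := lp; have [pq [r [l [hl eql]]]] := lq; have [hpi _ _] := pp; have [hqi _ _] := pq.
have [i nl] : exists i, ~ p (l i).
  apply: NNPP => no; apply: npq; apply: linear_height2_incl => // x /eql.
  by move: x; apply: (ideal_gen_sub hpi) => i; apply: NNPP => nl; apply: no; exists i.
have ql : q (l i) by apply/eql; exact: ideal_gen_gen.
have e1 : epolc m (hfr p) 1 by rewrite ep; exact: ptker_epolc.
have e2 : epolc m (hfr q) 1 by rewrite eq; exact: ptker_epolc.
have [x hx] : exists x, epolc m (hfr (cap_ideal p q)) x.
  apply: epol_epolc; apply: epol_bounded (hfr_epol (cap_ideal_ideal hpi hqi)) (epolcW (epolcD e1 e2)) _ _.
    by move=> t; exact: ler0n.
  by exists 0%N => t _; rewrite /hfr -natrD ler_nat; exact: HF_cap_le.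
have le : x <= 1 + 1.
  by apply: (epolc_le hx (epolcD e1 e2)); exists 0%N => t _; rewrite /hfr -natrD ler_nat; exact: HF_cap_le.
have ge : 1 + 1 <= x.
  apply: (epolc_le (epolcD e2 (epolc_shift 1 e1)) hx); exists 1%N => -[//|t] _.
  by rewrite /hfr -natrD ler_nat subn1; exact: (HF_cap_ge _ pp hqi ql nl (hl i)).
by have -> : (2 : rat) = x by apply/eqP; rewrite eq_le; apply/andP.
Qed.

Lemma ci12_epolc I : ci_type12 I -> epolc m (hfr I) 2.
Proof.
move=> [x [h0 h1 [_ reg] /eq_ideal_eq ->]].
have z0 : x ord0 != 0.
  apply/eqP => e; have : add_prefix (@zero_ideal R) x (@ord0 1) 1.
    apply: (reg ord0); rewrite e mul0r; exists 0, (fun=> 0); split=> //.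
    by rewrite big1 ?addr0 // => j _; rewrite mul0r.
  by move=> [h [c [-> ]]]; rewrite big_pred0 // addr0 => /eqP; rewrite oner_eq0.
have c12 : cop (fun i : bool => if i then x ord0 else x ord_max).
  move=> q [q0 nq _] dq; have [u eu] := dq true; have [v ev] := dq false.
  have /(reg ord_max) : add_prefix (@zero_ideal R) x (@ord_max 1) (x ord_max * u).
    exists 0, (fun=> v); split=> //; rewrite add0r (bigD1 ord0) //= big1 ?addr0.
      by rewrite eu ev; ring.
    by move=> [[|[]] //].
  move=> [h [c [-> e]]].
  have eu' : u = c ord0 * x ord0.
    by rewrite e add0r (bigD1 ord0) //= big1 ?addr0 // => -[[|[]] //].
  have u0 : u != 0 by apply: contraNneq z0 => u0; rewrite eu u0 mul0r.
  case/negP: nq; apply/unitrP; exists (c ord0).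
  have e1 : c ord0 * q = 1 by apply: (mulfI u0); rewrite mulr1 {2}eu' eu; ring.
  by split; rewrite // mulrC.
by have := pairI_epolc z0 h0 h1 c12; rewrite mul1r pairI_gen.
Qed.

End LinearPrimes.

Section LinearPrimary.
Variables (k : closedFieldType) (m : nat).
Notation B := {mpoly k[m.+1]}.
Notation R := {mpoly k[m.+3]}.
Variables (F : frame k m.+1) (a c : B).
Notation fb := (fb F).
Notation z' := (fz F - fb a).
Notation w' := (fw F - fb c).
Notation p := (ptker F a c).
Hypotheses (ha : a \is 1.-homog) (hc : c \is 1.-homog).
Variable I : R -> Prop.
Hypotheses (hI : homog_ideal I) (n1 : ~ I 1).
Hypotheses (prim : forall x y, I (x * y) -> ~ p y -> I x) (Ip : subideal I p).
Hypotheses (len2 : local_chain I p 2) (nlen3 : ~ local_chain I p 3).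
Let hIi := hI.1.
Let pp : prime_ideal p := ptker_prime F a c.
Let hp : is_ideal p. Proof. by case: pp. Qed.

(** A local ideal strictly between I and p would refine I < p < R to a chain that contradicts length
    two. *)
Lemma between (Q : R -> Prop) u : is_ideal Q -> subideal I Q -> subideal Q p ->
  subideal (loc_ideal p Q) Q -> Q u -> ~ I u -> subideal p Q.
Proof.
move=> hQ IQ Qp lQ Qu nIu v pv; apply: NNPP => nQ; apply: nlen3.
have [_ p1 pM] := pp.
exists (fun i : 'I_4 => match val i with 0 => I | 1 => Q | 2 => p | _ => @unit_ideal R end); split.
  have st : [/\ Defs.proper_sub I Q, Defs.proper_sub Q p & Defs.proper_sub p (@unit_ideal R)].
    split; split=> //.
    - by move=> h; apply: nIu; exact: h.
    - by move=> h; apply: nQ; exact: h.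
    - by move=> h; apply: p1; exact: h.
  have [s1 s2 s3] := st.
  have tr (X Y Z : R -> Prop) : Defs.proper_sub X Y -> subideal Y Z -> Defs.proper_sub X Z.
    by move=> [h1 h2] h3; split=> [x /h1/h3 //|h]; apply: h2 => x /h3/h.
  move=> [[|[|[|[|//]]]] hi] [[|[|[|[|//]]]] hj] //= _; try by [].
  - exact: (tr _ _ _ s1 Qp).
  - by apply: (tr _ _ _ s1).
  - by apply: (tr _ _ _ s2).
move=> [[|[|[|[|//]]]] hi] /=; split=> //.
- by move=> x [s ns h]; apply: (prim (y := s)) => //; rewrite mulrC.
- by move=> x [s ns h]; case: (pM _ _ h).
Qed.

Lemma locq_ideal (h : R) : is_ideal (loc_ideal p (add_elt I h)).
Proof. by apply: (loc_ideal_ideal pp); exact: add_elt_ideal. Qed.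

Lemma local_generator x v : p x -> ~ I x -> p v -> exists s h, ~ p s /\ I (s * v - x * h).
Proof.
move=> px nIx pv.
have IQ : subideal I (add_elt I x) by move=> u Iu; exists 0, u; split=> //; rewrite mulr0 add0r.
have Qp : subideal (add_elt I x) p.
  by move=> _ [g [l [Il ->]]]; apply: (idealD hp (ideal_mulr _ hp px)); exact: Ip.
have xQ : add_elt I x x by exists 1, 0; split; [exact: ideal0 | rewrite mulr1 addr0].
have [s ns [h [l [Il e]]]] := between (u := x) (locq_ideal x)
  (fun u Iu => loc_ideal_sub pp (IQ u Iu)) (loc_ideal_in pp Qp) (fun u => @loc_ideal_idem _ p _ u pp)
  (loc_ideal_sub pp xQ) nIx pv.
by exists s, h; split=> //; rewrite e addrC addKr.
Qed.

(** Nakayama: if x y were outside I, it would generate p/I locally, so s x = x y h modulo I with s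
    outside p. Then s - y h is also outside p, and x itself lies in I. *)
Lemma square_in x y : p x -> p y -> I (x * y).
Proof.
move=> px py; case: (classic (I (x * y))) => // nI.
have pxy : p (x * y) by exact: (idealM _ hp py).
have [s [h [ns e]]] := local_generator pxy nI px.
apply: (ideal_mulr _ hIi); apply: (prim (y := s - y * h)).
  by move: e; congr (I _); ring.
move=> h'; apply: ns; have := idealD hp h' (ideal_mulr h hp py); by rewrite subrK.
Qed.

Lemma not_all : ~ subideal p I.
Proof.
move=> pI; have [q [sq hq]] := len2.
have [_ n01] := sq i0 i1 isT; have [_ n12] := sq i1 i2 isT.
apply: n01 => x q1x; apply: NNPP => n0; apply: n12 => y _.
have [h1 I1 l1] := hq i1; have [_ I0' _] := hq i0.
apply: (ideal1 y h1); apply: l1; exists x; last by rewrite mulr1.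
by move=> /pI/I0'.
Qed.

(** 1, x, y generate R/I over B. The first two are independent, and y is a multiple of x after
    multiplication by a nonzero element of B. *)
Lemma primary_generators x y : x \is 1.-homog -> y \is 1.-homog -> p x -> p y -> ~ I x ->
  (forall g, exists g0 g1 g2, I (g - (fb g0 + fb g1 * x + fb g2 * y))) ->
  forall q, epolc m (hfr I) q -> q = 2.
Proof.
move=> hx hy px py nIx gen q hq.
have [s [h [ns e]]] := local_generator px nIx py.
(* Since p^2 lies in I, ring elements act on p/I through their values in B. *)
have mod_p g v : p v -> I (g * v - fb (fpt F a c g) * v).
  by move=> pv; rewrite -mulrBl; apply: square_in => //; apply: (frame_point_ker g hp); [exact: ptker_z | exact: ptker_w].
set s0 := fpt F a c s in ns *; set h0 := fpt F a c h.
have es : I (fb s0 * y - fb h0 * x).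
  have := idealD hIi (idealB hIi e (mod_p s y py)) (mod_p h x px); congr (I _).
  by rewrite -/s0 -/h0; move: (fb s0) (fb h0) => *; ring.
have [t st] : exists t, hpart t s0 != 0.
  apply: NNPP => no; apply: ns; rewrite /ptker -/s0 (hpart_sumw (leqnn (msize s0))) big1 // => i _.
  by apply: NNPP => /eqP nz; apply: no; exists i.
have es' : I (fb (hpart t s0) * y - fb (hpart t h0) * x).
  by have := hI.2 t.+1 _ es; rewrite raddfB /= (hpart_fb_mul F _ _ hx) (hpart_fb_mul F _ _ hy) /= subn1.
have le : q <= 2.
  have := @rank_upper k m F I 'I_2 'I_3 (fun i => if i == ord0 then 1 else x) (fun i => if i == ord0 then 0%N else 1%N)
    (fun l => match val l with 0 => 1 | 1 => x | _ => y end) (fun l => match val l with 0 => 0%N | _ => 1%N end)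
    (hpart t s0) t q hI.
  rewrite card_ord; apply=> //.
  - by move=> i; case: ifP => _ //; exact: (mpolyC_homog _ 1).
  - by apply: all3 => //=; exact: (mpolyC_homog _ 1).
  - exact: hpart_homog.
  - move=> g; have [g0 [g1 [g2 hg]]] := gen g.
    exists (fun l => match val l with 0 => g0 | 1 => g1 | _ => g2 end); rewrite sum3 /= mulr1; exact: hg.
  apply: all3 => /=.
  - exists (fun i => if i == ord0 then hpart t s0 else 0); rewrite sum_ord2 /= (rmorph0 fb) mul0r addr0 subrr.
    exact: (ideal0 hIi).
  - exists (fun i => if i == ord0 then 0 else hpart t s0); rewrite sum_ord2 /= (rmorph0 fb) mul0r add0r subrr.
    exact: (ideal0 hIi).
  exists (fun i => if i == ord0 then 0 else hpart t h0); rewrite sum_ord2 /= (rmorph0 fb) mul0r add0r.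
  exact: es'.
have ge : 2 <= q.
  have := @rank_lower k m F I 'I_2 (fun i => if i == ord0 then 1 else x) (fun i => if i == ord0 then 0%N else 1%N) q hIi.
  rewrite card_ord; apply=> //.
    by move=> i; case: ifP => _ //; exact: (mpolyC_homog _ 1).
  move=> b; rewrite sum_ord2 /= mulr1 => hb.
  have b0 : b ord0 = 0.
    apply: (@ptker_fb _ _ F a c); have := idealB hp (Ip hb) (idealM (fb (b ord_max)) hp px).
    by rewrite addrK.
  have b1 : b ord_max = 0.
    apply: NNPP => b1; apply: nIx; apply: (prim (y := fb (b ord_max))); last by move=> /ptker_fb.
    by move: hb; rewrite b0 (rmorph0 fb) add0r mulrC.
  move=> i; have [->|i0'] := eqVneq i ord0 => //.
  by have -> : i = ord_max; [apply/val_inj; case: i i0' => [[|[]]] | ].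
by apply/eqP; rewrite eq_le le ge.
Qed.

Lemma primary_rank q : epolc m (hfr I) q -> q = 2.
Proof.
have pz : p z' := ptker_z F a c; have pw : p w' := ptker_w F a c.
have hz : z' \is 1.-homog by apply: rpredB; [exact: fz_homog | exact: fb_homog].
have hw : w' \is 1.-homog by apply: rpredB; [exact: fw_homog | exact: fb_homog].
have s0 y y' : p y -> p y' -> I (y * y' - fb 0) by move=> py py'; rewrite (rmorph0 fb) subr0; exact: square_in.
have dec := decompose hIi (s0 _ _ pz pz) (s0 _ _ pz pw) (s0 _ _ pw pw).
have [Iz|nIz] := classic (I z'); last by apply: (primary_generators hz hw pz pw nIz dec).
have [Iw|nIw] := classic (I w').
  case: not_all => y py; have := frame_point_ker y hIi Iz Iw.
  by rewrite py (rmorph0 fb) subr0.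
apply: (primary_generators hw hz pw pz nIw) => g; have [g0 [g1 [g2 hg]]] := dec g.
by exists g0, g2, g1; rewrite addrAC.
Qed.

End LinearPrimary.

Section LowBourbakiDegree.
Variables (k : closedFieldType) (m d e : nat) (f : 'rV[{mpoly k[m.+3]}]_3).
Notation R := {mpoly k[m.+3]}.
Hypothesis hk : [pchar k] =i pred0.
Hypotheses (hf : forall i, f 0 i \is d.-homog) (hgcd : coprime_forms f) (he : is_indeg (syz f) e).
Variables (nu : 'cV[R]_3) (I : R -> Prop).
Hypotheses (hnu : min_syzygy f nu) (hb : bourbaki_ideal f nu I).

Lemma char_two : (2 : k) != 0.
Proof. by rewrite (pcharf0P k).1. Qed.

Lemma proper_framed : bour f <> 0 -> ~ I 1 /\ exists F h1 h2, framed F h1 h2 e I.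
Proof.
move=> b0; have [_ _ /(_ nu I hnu hb)[_ _ iff [/iff //|fr]]] := bour_spec hf hgcd he.
exact: fr.
Qed.

Lemma hfr_bour : epolc m (hfr I) (bour f).
Proof. by have [_ _ /(_ nu I hnu hb)[]] := bour_spec hf hgcd he. Qed.

Lemma framed_of_proper : ~ I 1 -> exists F h1 h2, framed F h1 h2 e I.
Proof. by have [_ _ /(_ nu I hnu hb)[_ _ _ [//|[_ fr]]]] := bour_spec hf hgcd he. Qed.

Lemma bour1_linear : bour f = 1 <-> linear_ci2 I.
Proof.
have hc := hfr_bour; split=> [b1|[_ [l [hl ind /eq_ideal_eq eI]]]].
  have [|n1 [F [h1 [h2 fr]]]] := proper_framed; first by rewrite b1; apply/eqP; rewrite oner_eq0.
  rewrite b1 in hc; have [a [c [ha hc' e1]]] := rank1 fr n1 hc isT.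
  have eI := eq_ideal_eq (fun x => iff_trans (e1 x) (ptker_gen F a c x)).
  split.
    exists 2%N; first exact: (framed_height fr n1).
    by exists (pts F a c) => x; rewrite eI.
  exists (pts F a c); split=> [i|x|x]; [exact: pts_homog | | by rewrite eI].
  rewrite sum_ord2 => /pts_independent[e0 e2] i.
  have [->|i0'] := eqVneq i ord0 => //.
  by have -> : i = ord_max; [apply/val_inj; case: i i0' => [[|[]]] | ].
have [|z0 cp] := independent_cop (hl ord0) (hl ord_max).
  move=> a b ab; have h := ind (fun i => if i == ord0 then a else b).
  have h' : forall i : 'I_2, (if i == ord0 then a else b) = 0 by apply: h; rewrite sum_ord2.
  by split; [exact: (h' ord0) | exact: (h' ord_max)].
have := pairI_epolc z0 (hl ord0) (hl ord_max) cp; rewrite mulr1 pairI_gen -eI => h.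
exact: (epolc_uniq hc h).
Qed.

Lemma bour2_cases : bour f = 2 <-> [\/ two_linear_primes I, linear_primary2 I | ci_type12 I].
Proof.
have hc := hfr_bour; split=> [b2|].
  have [|n1 [F [h1 [h2 fr]]]] := proper_framed; first by rewrite b2.
  rewrite b2 in hc; have ch := char_two.
  have [be [ga [b1 [c2 [a [t [[hbe hga hb1 hb2 nz] [[c12 f2 f1 ha] [IA ID IC IX]]]]]]]]] := rank2_structure fr n1 hc ch.
  have [a0|a0] := eqVneq a 0.
    by apply: Or32; exact: (case_primary fr n1 hbe hga nz c12 f2 f1 IA ID IC IX a0).
  case: ha => [e0|[[t0 ha]|[t1 ha]]]; first by rewrite e0 eqxx in a0.
    by apply: Or33; exact: (case_ci fr n1 hbe hga hb1 hb2 nz c12 f2 f1 IA IC IX t0 ha).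
  by apply: Or31; exact: (case_primes fr ch hbe hga hb1 hb2 nz c12 f2 f1 IA ID IC IX t1 ha a0).
case=> [[p [q [[lp hp] [lq hq] npq /eq_ideal_eq eI]]]|[p [lp hp prp [len nlen]]]|h].
- by apply: (epolc_uniq hc); rewrite eI; exact: two_primes_epolc.
- have [F [a [c [ha hc' ep]]]] := linear_height2 lp hp.
  have [_ n1 pr pE] := prp; have [F' [h1 [h2 fr]]] := framed_of_proper n1.
  have hI := torsion_homog fr.
  apply: (@primary_rank k m F a c ha hc' I hI) hc; rewrite -?ep //.
  + move=> x y Ixy ny; case: (pr x y Ixy) => // -[j Iy]; case: ny; apply/pE; by exists j.
  + by move=> x Ix; apply/pE; exists 1%N; rewrite expr1.
exact: (epolc_uniq hc (ci12_epolc h)).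
Qed.

End LowBourbakiDegree.

Lemma clear_fraction (K : fieldType) (s t u a x : K) : s != 0 -> t != 0 ->
  t * s * x * (u / s * (a / t)) = a * x * u.
Proof. by move=> s0 t0; field; rewrite s0 t0. Qed.

Lemma cancel_fraction (K : fieldType) (s u y : K) : s != 0 -> u / s * (y * s) = y * u.
Proof. by move=> s0; field. Qed.

(** * Locally free syzygies and quadratic forms *)

Section LocallyFree.
Variables (k : closedFieldType) (n : nat) (f : 'rV[{mpoly k[n]}]_3).
Notation R := {mpoly k[n]}.
Notation K := {fraction R}.
Hypothesis hgcd : coprime_forms f.
Notation hufd := (@ufd_mpoly k n).
Implicit Types (u v : 'I_3 -> R).

Definition col4 v : 'cV[R]_(3 + 1) := col_mx (colv v) 0.

Lemma syz_theta_col v : dot v (fv f) = 0 -> syz (Defs.theta f) (col4 v).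
Proof.
move=> h; rewrite /syz /Defs.theta /col4 mul_block_col !mul0mx mulmx0 add0r addr0.
have h' : syz f (colv v) by apply/syzE; rewrite (eq_dot (colvE _) (fun=> erefl)).
by rewrite (h' : f *m colv v = 0) col_mx0.
Qed.

Lemma syz_theta_inv (x : 'cV[R]_(3 + 1)) : syz (Defs.theta f) x -> exists v, dot v (fv f) = 0 /\ x = col4 v.
Proof.
rewrite /syz /Defs.theta -[x]vsubmxK mul_block_col !mul0mx add0r addr0 mul1mx => /eqP.
rewrite -col_mx0 => /eqP /eq_col_mx[e1 e2]; exists (cvec (usubmx x)).
split; first exact/syzE.
rewrite /col4 e1; congr (col_mx _ _); apply/matrixP => i j.
by rewrite [j]ord1 [RHS]mxE.
Qed.

(** Clearing denominators turns a local basis in the fraction field into honest syzygies, generating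
    up to factors outside p and still independent over R. The last entry of a syzygy of [theta f] is
    0 and is dropped. *)
Lemma free_at_basis p : prime_ideal p -> free_at p (syz (Defs.theta f)) ->
  exists r (u : 'I_r -> 'I_3 -> R),
  [/\ forall j, dot (u j) (fv f) = 0,
     forall v, dot v (fv f) = 0 -> exists s y, ~ p s /\ forall i, s * v i = \sum_j y j * u j i
   & forall y : 'I_r -> R, (forall i, \sum_j y j * u j i = 0) -> forall j, y j = 0].
Proof.
move=> pp [r [b [hb gb]]]; have [hp p1 pM] := pp.
have [us hus] : exists us : 'I_r -> ('I_3 -> R) * R, forall j,
   [/\ dot (us j).1 (fv f) = 0, ~ p (us j).2 & col j b = (tofrac (us j).2)^-1 *: map_mx (@tofrac R) (col4 (us j).1)].
  apply: (@choice_fun _ (('I_3 -> R) * R)%type (fun j us => [/\ dot us.1 (fv f) = 0, ~ p us.2 & col j b = (tofrac us.2)^-1 *: map_mx (@tofrac R) (col4 us.1)])) => j.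
  have [x [s [sx ns e]]] := hb j; have [v [hv ev]] := syz_theta_inv sx.
  by exists (v, s); split=> //; rewrite e ev.
pose u j := (us j).1; pose s j := (us j).2.
have s0 j : tofrac (s j) != 0 :> K.
  by rewrite tofrac_eq0; apply/eqP => e; have [_ ns _] := hus j; apply: ns; rewrite -/(s j) e; exact: ideal0.
have bE i j : b (lshift 1 i) j = tofrac (u j i) / tofrac (s j).
  have [_ _ /matrixP/(_ (lshift 1 i) 0)] := hus j.
  by rewrite !mxE (unsplitK (inl i)) mxE mulrC.
have bE' j : b (rshift 3 0) j = 0.
  have [_ _ /matrixP/(_ (rshift 3 0) 0)] := hus j.
  by rewrite !mxE (unsplitK (inr 0)) mxE tofrac0 mulr0.
exists r, u; split.
- by move=> j; have [] := hus j.
- move=> v hv.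
  have [|c [[hc ec] _]] := gb (map_mx (@tofrac R) (col4 v)).
    exists (col4 v), 1; split; [exact: syz_theta_col | exact: p1 | by rewrite tofrac1 invr1 scale1r].
  have [at' hat] : exists at' : 'I_r -> R * R, forall j, ~ p (at' j).2 /\ c j 0 = tofrac (at' j).1 / tofrac (at' j).2.
    apply: (@choice_fun _ (R * R)%type (fun j a => ~ p a.2 /\ c j 0 = tofrac a.1 / tofrac a.2)) => j.
    by have [a [t [nt e]]] := hc j; exists (a, t).
  pose a j := (at' j).1; pose t j := (at' j).2.
  have t0 j : tofrac (t j) != 0 :> K.
    by rewrite tofrac_eq0; apply/eqP => e; have [nt _] := hat j; apply: nt; rewrite -/(t j) e; exact: ideal0.
  pose sg := \prod_j (t j * s j).
  exists sg, (fun j => a j * \prod_(l | l != j) (t l * s l)); split.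
    apply: (big_ind (fun x => ~ p x)) => // [x y hx hy|j _]; first exact: (primeM pp hx hy).
    by have [nt _] := hat j; have [_ ns _] := hus j; exact: (primeM pp nt ns).
  move=> i; apply/eqP; rewrite -tofrac_eq; apply/eqP.
  rewrite tofracM rmorph_sum /=.
  have -> : tofrac (v i) = \sum_j (tofrac (u j i) / tofrac (s j)) * (tofrac (a j) / tofrac (t j)).
    have := congr1 (fun M : 'cV[K]_(3 + 1) => M (lshift 1 i) 0) ec; rewrite !mxE (unsplitK (inl i)) mxE => ->.
    by apply: eq_bigr => j _; rewrite bE (hat j).2.
  rewrite mulr_sumr; apply: eq_bigr => j _.
  rewrite /sg (bigD1 j) //= !tofracM.
  exact: clear_fraction.
move=> y hy j.
have [|c [[hc ec] uc]] := gb 0.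
  exists 0, 1; split; [by rewrite /syz mulmx0 | exact: p1 | by rewrite map_mx0 scaler0].
have loc (x : R) : local_ring p (tofrac x).
  by exists x, 1; split=> //; rewrite tofrac1 divr1.
have e0 : c = 0.
  apply: uc; split; last by rewrite mulmx0.
  by move=> i; rewrite mxE -tofrac0; exact: loc.
have e1 : c = \col_j tofrac (y j * s j).
  apply: uc; split; first by move=> i; rewrite mxE; exact: loc.
  apply/matrixP => i l; rewrite [l]ord1 !mxE; apply/esym.
  rewrite -(splitK i); case: (split i) => i' /=.
    transitivity (tofrac (\sum_j y j * u j i') : K); last by rewrite hy tofrac0.
    rewrite rmorph_sum /=; apply: eq_bigr => j' _; rewrite bE mxE !tofracM.
    exact: cancel_fraction.
  rewrite big1 // => j' _; rewrite ord1 bE' mul0r //.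
have := congr1 (fun M : 'cV[K]_r => M j 0) (etrans (esym e1) e0); rewrite !mxE => /eqP.
rewrite tofracM mulf_eq0 (negbTE (s0 j)) orbF tofrac_eq0 => /eqP; exact: id.
Qed.

End LocallyFree.

Lemma crossZr (A : comNzRingType) (c : A) (u v : 'I_3 -> A) i :
  cross u (fun i => c * v i) i = c * cross u v i.
Proof. by move: i; apply: all3; rewrite /cross /=; ring. Qed.

Section FreeCross.
Variables (k : closedFieldType) (n : nat) (f : 'rV[{mpoly k[n]}]_3).
Notation R := {mpoly k[n]}.
Hypothesis hgcd : coprime_forms f.
Notation hufd := (@ufd_mpoly k n).
Implicit Types (u v : 'I_3 -> R).

(** Vectors orthogonal to f lie in a plane, so any three satisfy the linear relation whose
    coefficients are their pairwise cross products divided by f. *)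
Lemma cross_plane (u v w : 'I_3 -> R) a b c l : fv f l != 0 -> dot u (fv f) = 0 ->
  (forall i, cross v w i = a * fv f i) -> (forall i, cross w u i = b * fv f i) ->
  (forall i, cross u v i = c * fv f i) -> forall i, a * u i + b * v i + c * w i = 0.
Proof.
move=> fl su ha hb hc i; apply: (mulfI fl); rewrite mulr0.
have e1 : dot u (cross v w) = 0.
  by rewrite (eq_dot (fun=> erefl) ha) dotC dotZl dotC su mulr0.
transitivity (if i == l then dot u (cross v w) else 0); last by rewrite e1; case: ifP.
rewrite !mulrDr ![fv f l * (_ * _)]mulrA ![fv f l * _]mulrC -ha -hb -hc.
by move: i; apply: all3; move: (l); apply: all3; rewrite /dot /cross /=; ring.
Qed.

Lemma cross_koszul l l' i : cross (cross (unitv R l) (fv f)) (cross (unitv R l') (fv f)) i =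
  cross (unitv R l') (fv f) l * fv f i.
Proof. by rewrite cross_cross dot_unitv [dot (fv f) _]dotC dot_crossr mulr0 subr0 mulrC. Qed.

(** The local rank is 2: Koszul syzygies are not all parallel, and three vectors orthogonal to f are
    dependent. For a basis u, v write u x v = t f. Cross products of Koszul syzygies are f_i f up to
    sign, so t divides every f_i up to a factor outside p; as the f_i are coprime, t divides an
    element outside p. *)
Lemma free_cross p : prime_ideal p -> free_at p (syz (Defs.theta f)) ->
  exists (u v : 'I_3 -> R) s, [/\ dot u (fv f) = 0, dot v (fv f) = 0, ~ p s & forall i, cross u v i = s * fv f i].
Proof.
move=> pp /(free_at_basis pp) [r [u [su gen ind]]]; have [hp p1 _] := pp.
have [l fl] := fv_neq0 hgcd.
have par v w : dot v (fv f) = 0 -> dot w (fv f) = 0 -> exists t, forall i, cross v w i = t * fv f i.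
  move=> sv sw; apply: (@parallel_multiple _ hufd _ (fv f) l (fv_cop hgcd) fl) => i.
  by rewrite cross_cross sv sw !mulr0 subrr.
have nz s : ~ p s -> s != 0 by move=> ns; apply/eqP => s0; apply: ns; rewrite s0; exact: ideal0.
pose ka l' := cross (unitv R l') (fv f).
have sk l' : dot (ka l') (fv f) = 0 by rewrite dot_crossr.
have f0 : (forall a b, ka b a = 0) -> False.
  move=> h; case/eqP: fl; move: (l); apply: all3.
  - by have := h i2 i1; rewrite /ka /cross /unitv /= => e; apply: oppr_inj; rewrite oppr0 -[RHS]e; ring.
  - by have := h i0 i2; rewrite /ka /cross /unitv /= => e; apply: oppr_inj; rewrite oppr0 -[RHS]e; ring.
  - by have := h i1 i0; rewrite /ka /cross /unitv /= => e; apply: oppr_inj; rewrite oppr0 -[RHS]e; ring.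
have key a b s s' : ~ p s -> ~ p s' -> (forall i, cross (fun i => s * ka a i) (fun i => s' * ka b i) i = 0) -> ka b a = 0.
  move=> ns ns' h; have := h l; rewrite crossZl crossZr cross_koszul => /eqP; rewrite !mulf_eq0 (negbTE (nz _ ns)) (negbTE (nz _ ns')) (negbTE fl) orbF => /eqP; exact: id.
case: r u su gen ind => [|[|[|r]]] u su gen ind.
- case: f0 => a b; have [s [y [ns h]]] := gen _ (sk a); have [s' [y' [ns' h']]] := gen _ (sk b).
  apply: (key a b s s' ns ns') => i; rewrite (eq_cross (u' := fun=> 0) (v' := fun=> 0) i); first by move: i; apply: all3; rewrite /cross /=; ring.
    by move=> j; rewrite h big_ord0.
  by move=> j; rewrite h' big_ord0.
- case: f0 => a b; have [s [y [ns h]]] := gen _ (sk a); have [s' [y' [ns' h']]] := gen _ (sk b).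
  apply: (key a b s s' ns ns') => i.
  rewrite (eq_cross (u' := fun i => y ord0 * u ord0 i) (v' := fun i => y' ord0 * u ord0 i) i).
  + by move: i; apply: all3; rewrite /cross /=; ring.
  + by move=> j; rewrite h big_ord1.
  + by move=> j; rewrite h' big_ord1.
- have [t ht] := par _ _ (su ord0) (su ord_max).
  exists (u ord0), (u ord_max), t; split=> //.
  have kab a b : exists s, ~ p s /\ divides t (s * ka b a).
    have [s [y [ns h]]] := gen _ (sk a); have [s' [y' [ns' h']]] := gen _ (sk b).
    exists (s * s'); split; first exact: (primeM pp ns ns').
    exists (y ord0 * y' ord_max - y ord_max * y' ord0); apply: (mulIf fl).
    transitivity (cross (fun i => s * ka a i) (fun i => s' * ka b i) l).
      rewrite crossZl crossZr cross_koszul -/(ka b); move: (fv f l) (ka b a) => *; ring.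
    rewrite (eq_cross (u' := fun i => y ord0 * u ord0 i + y ord_max * u ord_max i) (v' := fun i => y' ord0 * u ord0 i + y' ord_max * u ord_max i) l).
    + rewrite -[RHS]mulrA -ht; move: (l); apply: all3; rewrite /cross /=;
      by move: (u ord0) (u ord_max) (y ord0) (y ord_max) (y' ord0) (y' ord_max) => *; ring.
    + by move=> j; rewrite h sum_ord2.
    + by move=> j; rewrite h' sum_ord2.
  have [s hs] : exists s : 'I_3 -> R, forall i, ~ p (s i) /\ divides t (s i * fv f i).
    apply: (@choice_fun _ R (fun i s => ~ p s /\ divides t (s * fv f i))); apply: all3.
    - have [s [ns h]] := kab i2 i1; exists s; split=> //; have := dividesN h; rewrite /ka /cross /unitv /=; congr (divides _ _); ring.
    - have [s [ns h]] := kab i0 i2; exists s; split=> //; have := dividesN h; rewrite /ka /cross /unitv /=; congr (divides _ _); ring.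
    - have [s [ns h]] := kab i1 i0; exists s; split=> //; have := dividesN h; rewrite /ka /cross /unitv /=; congr (divides _ _); ring.
  have t0 : t != 0.
    apply/eqP => t0; have [ns [b eb]] := hs l; move: eb; rewrite t0 mulr0 => /eqP.
    by rewrite mulf_eq0 (negbTE (nz _ ns)) (negbTE fl).
  have [x ex] : divides t (s i0 * s i1 * s i2).
    have [a ha] : exists a : 'I_3 -> R, forall i, s i0 * s i1 * s i2 * fv f i = t * a i.
      apply: (@choice_fun _ R (fun i a => s i0 * s i1 * s i2 * fv f i = t * a)); apply: all3.
      + by have [_ [b eb]] := hs i0; exists (s i1 * s i2 * b); rewrite mulrCA -mulrA [t * _]mulrC -mulrA -eb; ring.
      + by have [_ [b eb]] := hs i1; exists (s i0 * s i2 * b); rewrite mulrCA [t * _]mulrC -eb; ring.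
      + by have [_ [b eb]] := hs i2; exists (s i0 * s i1 * b); rewrite mulrCA [t * _]mulrC -eb; ring.
    exact: (@cop_div _ hufd _ a (fv f) _ t (fv_cop hgcd) t0 ha).
  move=> pt; have : ~ p (s i0 * s i1 * s i2).
    by apply: (primeM pp _ (hs i2).1); exact: (primeM pp (hs i0).1 (hs i1).1).
  by apply; rewrite ex; exact: (idealM _ hp pt).
pose o0 : 'I_r.+3 := @Ordinal r.+3 0 isT; pose o1 : 'I_r.+3 := @Ordinal r.+3 1 isT; pose o2 : 'I_r.+3 := @Ordinal r.+3 2 isT.
have ind3 a b c : (forall i, a * u o0 i + b * u o1 i + c * u o2 i = 0) -> [/\ a = 0, b = 0 & c = 0].
  move=> h; pose y (j : 'I_r.+3) : R := match val j with 0 => a | 1 => b | 2 => c | _ => 0 end.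
  have hy : forall j, y j = 0.
    apply: ind => i; rewrite (bigD1 o0) // (bigD1 o1) // (bigD1 o2) //= big1 => [|[[|[|[|j]]] hj] //= _]; last by rewrite mul0r.
    by rewrite addr0 addrA; exact: h.
  by split; [exact: (hy o0) | exact: (hy o1) | exact: (hy o2)].
have [t0 h0] := par _ _ (su o1) (su o2); have [t1 h1] := par _ _ (su o2) (su o0); have [t2 h2] := par _ _ (su o0) (su o1).
have [_ _ t20] := ind3 _ _ _ (cross_plane fl (su o0) h0 h1 h2).
have u00 i : u o0 i = 0.
  have h j : u o0 i * u o1 j = u o0 j * u o1 i by apply: cross_swap => j'; rewrite h2 t20 mul0r.
  have [_ e _] : [/\ - u o1 i = 0, u o0 i = 0 & (0 : R) = 0].
    by apply: ind3 => j; rewrite h; ring.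
  exact: e.
have [/eqP] := ind3 1 0 0 (fun i => ltac:(by rewrite u00; ring)).
by rewrite oner_eq0.
Qed.

End FreeCross.

Section SaturatedPrime.
Variables (k : closedFieldType) (n : nat).
Notation R := {mpoly k[n]}.
Variable J : R -> Prop.
Hypothesis hJ : is_ideal J.

Definition colon (g x : R) := J (x * g).

Lemma colon_ideal g : is_ideal (colon g).
Proof.
split; first by rewrite /colon mul0r; exact: ideal0.
by move=> a u v hu hv; rewrite /colon mulrDl -mulrA; exact: (idealD hJ (idealM _ hJ hu) hv).
Qed.

(** If only the irrelevant ideal lay over J : g, every variable would be nilpotent modulo J : g, and
    a power of the irrelevant ideal would carry g into J. *)
Lemma saturated_prime g : saturated J -> ~ J g ->
  exists p, [/\ prime_ideal p, subideal (colon g) p & ~ eq_ideal p (@irrelevant_ideal k n)].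
Proof.
move=> sat nJ; have hC := colon_ideal g; apply: NNPP => no; apply: nJ; apply: sat.
have [N hN] : exists N : 'I_n -> nat, forall i, colon g ('X_i ^+ N i).
  apply: (@choice_fun _ nat (fun i N => colon g ('X_i ^+ N))) => i; apply: NNPP => no'.
  have [p [pp sp np]] := @krull_prime _ (colon g) (fun x => exists N, x = 'X_i ^+ N) hC
    (ex_intro _ 0%N erefl)
    (fun x y '(ex_intro a ea) '(ex_intro b eb) => ex_intro _ (a + b)%N
      (etrans (f_equal2 *%R ea eb) (esym (exprD _ a b))))
    (fun x Cx '(ex_intro a ea) => no' (ex_intro _ a (eq_ind x (colon g) Cx _ ea))).
  apply: no; exists p; split=> // e; apply: (np ('X_i)); last by exists 1%N.
  by apply/e; exact: (ideal_gen_gen (fun i : 'I_n => 'X_i : R)).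
(* In a monomial of this degree some exponent reaches the bound N i, by the pigeonhole principle. *)
exists (\sum_i N i).+1 => mm hm.
have [i hi] : exists i, (N i <= mm i)%N.
  apply: NNPP => no'; have : (mdeg mm <= \sum_i N i)%N.
    rewrite mdegE; apply: leq_sum => i _; rewrite leqNgt; apply/negP => h; apply: no'; exists i; exact: ltnW.
  by rewrite hm ltnn.
rewrite mpolyXE_id (bigD1 i) //= -(subnK hi) exprD -/(colon g _).
by apply: (ideal_mulr _ hC); apply: (idealM _ hC).
Qed.

End SaturatedPrime.

Section LocallyFreeTorsion.
Variables (k : closedFieldType) (m d e : nat) (f : 'rV[{mpoly k[m.+3]}]_3).
Notation R := {mpoly k[m.+3]}.
Hypotheses (hf : forall i, f 0 i \is d.-homog) (hgcd : coprime_forms f) (he : is_indeg (syz f) e).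
Notation J := (ideal3 f).
Variables (F : frame k m.+1) (l mu : R).
Notation fb := (fb F).
Notation g1 := (fv f i0 + l * fv f i2).
Notation g2 := (fv f i1 + mu * fv f i2).
Hypothesis ci : ci_frame F g1 g2.

Definition twist (w : 'I_3 -> R) (i : 'I_3) : R := if val i == 2 then w i2 - l * w i0 - mu * w i1 else w i.
Definition twisted (i : 'I_3) : R := match val i with 0 => g1 | 1 => g2 | _ => fv f i2 end.

Lemma cross_twist u v s : (forall i, cross u v i = s * fv f i) ->
  forall i, cross (twist u) (twist v) i = s * twisted i.
Proof.
move=> h; have := h i0; have := h i1; have := h i2; rewrite /cross /= => e2 e1 e0.
apply: all3; rewrite /twisted /cross /twist /=.
- by transitivity (s * fv f i0 + l * (s * fv f i2)); [rewrite -e0 -e2; ring | ring].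
- by transitivity (s * fv f i1 + mu * (s * fv f i2)); [rewrite -e1 -e2; ring | ring].
exact: e2.
Qed.

Lemma J_twisted x : J x <-> exists a, x = dot a twisted.
Proof.
have [hJ _] := J_homog hf; split=> [[c ->]|[a ->]].
  exists (fun i => if val i == 2 then c i2 - c i0 * l - c i1 * mu else c i).
  rewrite sum3 /dot /twisted /= /fv; move: (f 0 i0) (f 0 i1) (f 0 i2) (c i0) (c i1) (c i2) => *; ring.
rewrite /dot /twisted /=; have hg := J_gen f.
have h0 := idealD hJ (hg i0) (idealM l hJ (hg i2)); have h1 := idealD hJ (hg i1) (idealM mu hJ (hg i2)).
exact: (idealD hJ (idealD hJ (idealM _ hJ h0) (idealM _ hJ h1)) (idealM _ hJ (hg i2))).
Qed.

(** If b g lies in J and g does not, take a prime p over J : g other than the irrelevant ideal.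
    There f is u x v up to a factor outside p, and [regular_mod] with E0 = 0 and c = b carries g
    into J by a multiplier outside p. *)
Lemma locally_free_torsion b g : saturated J -> locally_free (syz (Defs.theta f)) ->
  b != 0 -> J (fb b * g) -> J g.
Proof.
move=> sat lf b0 hbg; have [hJ _] := J_homog hf; apply: NNPP => nJ.
have [p [pp sp np]] := saturated_prime hJ sat nJ; have [hp p1 _] := pp.
have [u [v [s [su sv ns huv]]]] := free_cross hgcd pp (lf p pp np).
have tw := cross_twist huv; set f' := cross (twist u) (twist v) in tw.
have [reg1 reg2 _ _] := ci.
(* The contraction of b R_p to R. *)
pose E x := exists sg y, ~ p sg /\ sg * x = fb b * y.
have hE : is_ideal E.
  split; first by exists 1, 0; rewrite !mulr0.
  move=> a x x' [sg [y [n1 e1]]] [sg' [y' [n2 e2]]].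
  exists (sg * sg'), (a * sg' * y + sg * y'); split; first exact: (primeM pp n1 n2).
  transitivity (a * sg' * (sg * x) + sg * (sg' * x')); first by ring.
  by rewrite e1 e2; ring.
have hb := divides_ideal b.
have [a ea] := proj1 (J_twisted _) hbg.
have fb0 : fb b != 0 by apply: contraNneq b0 => h; apply/eqP/(@fb_eq0 _ _ F).
have hzero : @zero_ideal R (fb b * (s * g) - dot a f').
  rewrite /zero_ideal (eq_dot (fun=> erefl) tw) dotC dotZl dotC -ea; ring.
have [sg [a' [nsg hs]]] : exists sg a', ~ p sg /\ @zero_ideal R (sg * (s * g) - dot a' f').
  apply: (@regular_mod _ E (twist u) (twist v) hE (fun x => ~ p x) (fun x y => primeM pp) _ _ (@zero_ideal R) (fb b) (s * g) a (zero_ideal_ideal _ _)).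
  - move=> x; rewrite -/f' (tw i0) /twisted /= => -[sg [y [n1 h]]].
    have /fext_divides[y' ey] : fext F (divides b) (sg * s * x).
      by apply: (reg1 _ _ hb); apply/fext_divides; exists y; rewrite -h; ring.
    by exists (sg * s), y'; split=> //; exact: (primeM pp n1 ns).
  - move=> x q; rewrite -/f' (tw i0) (tw i1) /twisted /= => -[sg [y [n1 h]]].
    have [q' [t' [/fext_divides[y' ey] e1]]] : exists q' t', fext F (divides b) t' /\ sg * s * x = q' * g1 + t'.
      apply: (reg2 _ (sg * s * q) (fb b * y) _ hb); first by apply/fext_divides; exists y.
      by rewrite -h; ring.
    exists (s * (sg * s)), q'; split; first exact: (primeM pp ns (primeM pp n1 ns)).
    exists 1, (s * y'); split=> //; rewrite mul1r -mulrA e1 ey; ring.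
  - by move=> x [sg [y [n1 h]]]; exists sg, y; split=> //; rewrite h subrr.
  - by move=> x /eqP; rewrite mulf_eq0 (negbTE fb0) => /eqP.
  - by exists 1, 1; split=> //; ring.
  - by move=> x ->; exists 1, 0; rewrite !mulr0.
  - exact: hzero.
apply: nsg; apply: sp; apply/J_twisted; exists a'.
have s0 : s != 0 by apply/eqP => s0; apply: ns; rewrite s0; exact: ideal0.
apply: (mulfI s0); move: hs => /eqP; rewrite subr_eq0 => /eqP.
rewrite (eq_dot (fun=> erefl) tw) dotC dotZl dotC => <-; ring.
Qed.

End LocallyFreeTorsion.

(** * Three quadrics of Bourbaki degree two *)

Section Quadrics.
Variables (k : closedFieldType) (m : nat) (f : 'rV[{mpoly k[m.+3]}]_3).
Notation R := {mpoly k[m.+3]}.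
Notation B := {mpoly k[m.+1]}.
Hypotheses (hf : forall i, f 0 i \is 2.-homog) (hgcd : coprime_forms f) (he : is_indeg (syz f) 2).
Notation J := (ideal3 f).

Lemma no_low_syzygy t (u : 'I_3 -> R) : (t < 2)%N -> (forall i, u i \is t.-homog) -> dot u (fv f) = 0 -> forall i, u i = 0.
Proof.
move=> te hu su; have su' : syz f (colv u) by apply/syzE; rewrite (eq_dot (colvE _) (fun=> erefl)).
have [z|nz] := eqVneq (colv u) 0; first by move=> i; rewrite -(colvE u) z /cvec mxE.
by have := he.2 t _ su' nz (ltac:(by move=> i; rewrite mxE)); rewrite leqNgt te.
Qed.

Lemma J_scalars g : J g -> g \is 2.-homog -> exists c : 'I_3 -> k, g = \sum_i (c i)%:MP * fv f i.
Proof.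
move=> [c ec] hg; exists (fun i => (hpart 0 (c i))@_0%MM).
rewrite -(hpart_id hg) ec hpart_sum; apply: eq_bigr => i _.
by rewrite mulrC (hpart_mul _ _ (hf i)) /= subnn mulrC -(homog0_const (hpart_homog 0 (c i))).
Qed.

Lemma no_linear_form g : J g -> g \is 1.-homog -> g = 0.
Proof.
move=> [c ec] hg; rewrite -(hpart_id hg) ec hpart_sum big1 // => i _.
by rewrite mulrC (hpart_mul _ _ (hf i)).
Qed.

(** If y^2 and y y' are the combinations of the f_i with scalars alpha and beta, then alpha y' -
    beta y is a linear syzygy, which must vanish. *)
Lemma no_common_factor (y y' : R) : y \is 1.-homog -> y' \is 1.-homog ->
  (forall a b : k, a *: y + b *: y' = 0 -> a = 0 /\ b = 0) -> J (y ^+ 2) -> J (y * y') -> False.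
Proof.
move=> hy hy' ind J1 J2.
have [al ea] := J_scalars J1 (homog_exp 2 hy); have [be eb] := J_scalars J2 (dhomogM hy hy').
pose u i := (al i)%:MP * y' - (be i)%:MP * y.
have hh (c : k) (x : R) : x \is 1.-homog -> c%:MP * x \is 1.-homog.
  by move=> hx; have := dhomogM (mpolyC_homog _ c) hx.
have u0 : forall i, u i = 0.
  apply: (no_low_syzygy (t := 1)) => // [i|]; first by apply: rpredB; exact: hh.
  transitivity (y' * (\sum_i (al i)%:MP * fv f i) - y * (\sum_i (be i)%:MP * fv f i)).
    by rewrite !sum3 /dot /u; move: (fv f i0) (fv f i1) (fv f i2) => *; ring.
  by rewrite -ea -eb; ring.
have al0 i : al i = 0.
  have [_ e1] : - be i = 0 /\ al i = 0.
    by apply: ind; rewrite -!mul_mpolyC mpolyCN -[RHS](u0 i) /u; ring.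
  exact: e1.
have y0 : y = 0.
  have : y ^+ 2 = 0 by rewrite ea big1 // => i _; rewrite al0 mpolyC0 mul0r.
  by move=> /eqP; rewrite expf_eq0 => /andP[_ /eqP].
have [|/eqP] := ind 1 0; first by rewrite y0 scaler0 scale0r addr0.
by rewrite oner_eq0.
Qed.

(** Write f_i = u_i l + v_i Q with scalars v_i. Then u x v is a linear syzygy, so it vanishes, which
    makes the v_j f_i - v_i f_j vanish; these are scalar syzygies, so v = 0 and l divides all
    f_i. *)
Lemma no_linear_pencil (l Q : R) : l \is 1.-homog -> Q \is 2.-homog ->
  subideal J (pairI l Q) -> False.
Proof.
move=> hl hQ sJ.
have [uv huv] : exists uv : 'I_3 -> R * k, forall i, (uv i).1 \is 1.-homog /\ fv f i = (uv i).1 * l + (uv i).2%:MP * Q.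
  apply: (@choice_fun _ (R * k)%type (fun i uv => uv.1 \is 1.-homog /\ fv f i = uv.1 * l + uv.2%:MP * Q)) => i.
  have [x [y e1]] := sJ _ (J_gen f i).
  exists (hpart 1 x, (hpart 0 y)@_0%MM); split; first exact: hpart_homog.
  rewrite /= -(homog0_const (hpart_homog 0 y)) -[LHS]/(f 0 i) -(hpart_id (hf i)) -[f 0 i]/(fv f i) e1 raddfD /=.
  by rewrite [x * l]mulrC [y * Q]mulrC (hpart_mul _ _ hl) (hpart_mul _ _ hQ) /= subnn ![_ * hpart _ _]mulrC.
pose u i := (uv i).1; pose v i : R := (uv i).2%:MP.
have fE i : fv f i = u i * l + v i * Q by case: (huv i).
have hu i : u i \is 1.-homog by case: (huv i).
have hv i : v i \is 0.-homog by exact: mpolyC_homog.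
have c0 : forall i, cross u v i = 0.
  apply: (no_low_syzygy (t := 1)) => //.
    have hm i j : u i * v j \is 1.-homog by have := dhomogM (hu i) (hv j).
    have hm' i j : u i * v j - u j * v i \is 1.-homog by apply: rpredB.
    by apply: all3; rewrite /cross /=; exact: hm'.
  by rewrite /dot !fE /cross /=; ring.
have uv' i j : u i * v j = u j * v i := cross_swap i j c0.
have fv' i j : v j * fv f i = v i * fv f j.
  transitivity (l * (u i * v j) + v i * v j * Q); first by rewrite fE; ring.
  by rewrite uv' fE; ring.
have v0 : forall i, v i = 0.
  have hC (i : 'I_3) : forall w : 'I_3 -> R, (forall j, w j \is 0.-homog) -> dot w (fv f) = 0 -> w i = 0.
    by move=> w hw sw; exact: (no_low_syzygy (t := 0) isT hw sw).
  have r0 (x : R) : x = x by [].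
  apply: all3.
  - have := hC i1 (fun j => match val j with 0 => - v i1 | 1 => v i0 | _ => 0 end); apply.
      by apply: all3 => /=; rewrite ?dhomogN ?dhomog0 //; exact: hv.
    by rewrite /dot /= mulNr fv'; ring.
  - have := hC i0 (fun j => match val j with 0 => v i1 | 1 => - v i0 | _ => 0 end); apply.
      by apply: all3 => /=; rewrite ?dhomogN ?dhomog0 //; exact: hv.
    by rewrite /dot /= mulNr fv'; ring.
  have := hC i0 (fun j => match val j with 0 => v i2 | 1 => 0 | _ => - v i0 end); apply.
    by apply: all3 => /=; rewrite ?dhomogN ?dhomog0 //; exact: hv.
  by rewrite /dot /= mulNr fv'; ring.
have lu : l \is a GRing.unit.
  by apply: hgcd => i; exists (u i); rewrite -[f 0 i]/(fv f i) fE v0 mul0r addr0 mulrC.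
have hl1 : l * l^-1 \is 0.-homog by rewrite mulrV //; exact: (mpolyC_homog _ 1).
have l0 : l != 0 by apply: contraTneq lu => ->; rewrite unitr0.
have := homog_factor l0 hl hl1 => /= li0; move: lu; rewrite -unitrV li0 unitr0 //.
Qed.

End Quadrics.

Section TorsionClosure.
Variables (k : closedFieldType) (m : nat) (F : frame k m.+1).
Notation R := {mpoly k[m.+3]}.
Notation B := {mpoly k[m.+1]}.
Notation fb := (fb F).
Variable J : R -> Prop.
Hypothesis hJ : homog_ideal J.
Let hi : is_ideal J := hJ.1.

Definition torsion (g : R) : Prop := exists2 b : B, b != 0 & J (fb b * g).

Lemma torsion_ideal : is_ideal torsion.
Proof.
split; first by exists 1; rewrite ?oner_eq0 // mulr0; exact: ideal0.
move=> a u v [b b0 hu] [b' b0' hv]; exists (b * b'); first by rewrite mulf_neq0.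
have := idealD hi (idealM (fb b' * a) hi hu) (idealM (fb b) hi hv); congr (J _).
rewrite (rmorphM fb); ring.
Qed.

Lemma torsion_sub : subideal J torsion.
Proof. by move=> x Jx; exists 1; rewrite ?oner_eq0 // (rmorph1 fb) mul1r. Qed.

Lemma torsion_div (b : B) g : b != 0 -> torsion (fb b * g) -> torsion g.
Proof.
move=> b0 [b' b0' h]; exists (b' * b); first by rewrite mulf_neq0.
by rewrite (rmorphM fb) -mulrA.
Qed.

Lemma top_part (b : B) : b != 0 -> exists2 t, hpart t b != 0 & forall j, (t < j)%N -> hpart j b = 0.
Proof.
move=> b0; have [j0 j0P] : exists j, hpart j b != 0.
  apply: NNPP => no; case/eqP: b0; rewrite (hpart_sumw (leqnn (msize b))) big1 // => i _.
  by apply/eqP/negPn/negP => h; apply: no; exists (val i).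
have ub j : hpart j b != 0 -> (j <= msize b)%N.
  by move=> h; rewrite leqNgt; apply/negP => h'; case/eqP: h; apply: hpart_large; exact: ltnW.
have [t tP tmax] := @ex_maxnP (fun j => hpart j b != 0) (msize b) (ex_intro _ j0 j0P) ub.
exists t => // j tj; apply/eqP/negPn/negP => h; by have := tmax _ h; rewrite leqNgt tj.
Qed.

(** The product of the top form of b and the top form of x is the top form of b x and lies in J, so
    the top form of x is torsion; it is subtracted and the degree bound drops. *)
Lemma torsion_hpart t g : torsion g -> torsion (hpart t g).
Proof.
have hT := torsion_ideal.
suff H N (b : B) (x : R) : b != 0 -> J (fb b * x) -> (forall j, (N <= j)%N -> hpart j x = 0) ->
    forall t, torsion (hpart t x).
  by move=> [b b0 h]; apply: (H (msize g) b g b0 h) => j; exact: hpart_large.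
elim: N b x => [|N IH] b x b0 hx hN s; first by rewrite hN //; exact: (ideal0 hT).
have [be be0 bemax] := top_part b0.
have h1 : J (fb (hpart be b) * hpart N x).
  have := hJ.2 (be + N)%N _ hx; rewrite (hpart_prod _ _ (leqnn _)).
  have bs : (be < msize (fb b))%N.
    rewrite ltnNge; apply/negP => h; have := hpart_large h; rewrite fb_hpart => /eqP h'.
    by case/eqP: be0; apply: (@fb_eq0 _ _ F); apply/eqP.
  rewrite (bigD1 (Ordinal bs)) //= leq_addr addKn big1 ?addr0 ?fb_hpart //.
  move=> i ib; case: ifP => // le; rewrite fb_hpart.
  have [lt|lt|e1] := ltngtP (val i) be.
  - rewrite (hN (be + N - i)%N) ?mulr0 //; by move: lt; clear; rewrite /= => lt; lia.
  - by rewrite (bemax _ lt) (rmorph0 fb) mul0r.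
  - by case/eqP: ib; apply/val_inj.
have h2 : torsion (hpart N x) by exists (hpart be b).
have h3 s' : torsion (hpart s' (x - hpart N x)).
  apply: (IH (hpart be b * b)); first by rewrite mulf_neq0.
    have := idealB hi (idealM (fb (hpart be b)) hi hx) (idealM (fb b) hi h1); congr (J _).
    by rewrite (rmorphM fb); ring.
  move=> j; rewrite raddfB /= leq_eqVlt => /orP[/eqP<-|lt].
    by rewrite (hpart_id (hpart_homog N x)) subrr.
  by rewrite (hN j lt) (hpart_ne (hpart_homog N x)) ?subrr // neq_ltn lt.
have [->|ne] := eqVneq s N; first exact: h2.
by have := h3 s; rewrite raddfB /= (hpart_ne (hpart_homog N x)) ?subr0 // eq_sym.
Qed.

(** Each of the finitely many B-module generators of R/J agrees with an element of B up to torsion,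
    so one multiplier b carries all of them into B modulo J. *)
Lemma torsion_rank (h1 h2 : R) (t : nat) (a c : B) : ci_data F h1 h2 t -> J h1 -> J h2 ->
  subideal (ptker F a c) torsion -> forall r, epolc m (hfr J) r -> r <= 1.
Proof.
move=> [h10 hh1 hh2 c12 ci] J1 J2 sub r hr.
have [L [g [e [hg gen]]]] := frame_finite ci hJ J1 J2.
have [be hbe] : exists be : L -> B, forall l, be l != 0 /\ J (fb (be l) * (g l - fb (fpt F a c (g l)))).
  apply: (@choice_fun _ B (fun l b => b != 0 /\ J (fb b * (g l - fb (fpt F a c (g l)))))) => l.
  have [b b0 h] : torsion (g l - fb (fpt F a c (g l))).
    by apply: sub; rewrite /ptker (rmorphB (fpt F a c)) fpt_base subrr.
  by exists b.
pose b := \prod_l be l.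
have b0 : b != 0 by apply/prodf_neq0 => l _; case: (hbe l).
have hb l : J (fb b * (g l - fb (fpt F a c (g l)))).
  rewrite /b (bigD1 l) //= (rmorphM fb) mulrAC mulrC; apply: (idealM _ hi); exact: (hbe l).2.
have [t' t0 _] := top_part b0.
have := @rank_upper k m F J 'I_1 L (fun=> 1) (fun=> 0%N) g e (hpart t' b) t' r hJ.
rewrite card_ord; apply=> //; [by move=> _; exact: (mpolyC_homog _ 1) | exact: hpart_homog |].
move=> l; exists (fun=> hpart (t' + e l) (b * fpt F a c (g l))).
have := hJ.2 (t' + e l)%N _ (hb l); congr (J _).
by rewrite big_ord1 mulr1 mulrBr raddfB /= -(rmorphM fb) fb_hpart (hpart_fb_mul F _ _ (hg l)) leq_addl addnK.
Qed.

End TorsionClosure.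

Lemma univariate_homog (k : fieldType) (b : {mpoly k[1]}) t : b \is t.-homog ->
  exists c : k, b = c%:MP * 'X_ord0 ^+ t.
Proof.
move=> hb; exists (b@_(U_(ord0) *+ t)%MM); apply/mpolyP => i; rewrite mpolyXn mcoeffCM mcoeffX.
have [<-|ne] := eqVneq; first by rewrite mulr1.
rewrite mulr0; apply: (dhomog_nemf_coeff hb); apply: contraNneq ne => e1; apply/eqP/mnmP => j.
rewrite (ord1 j) mulmnE mnm1E eqxx mul1n. by rewrite -e1 /= mdegE big_ord1.
Qed.

(** Forms of degree t in one variable are scalar multiples of the t-th power of that variable. *)
Lemma univariate_cop (k : closedFieldType) (b1 b2 : {mpoly k[1]}) t : b1 \is t.-homog -> b2 \is t.-homog ->
  b1 != 0 \/ b2 != 0 -> cop (fun i : bool => if i then b1 else b2) -> t = 0%N.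
Proof.
move=> h1 h2 nz c12; have [c1 e1] := univariate_homog h1; have [c2 e2] := univariate_homog h2.
have [y [y1 y2]] : exists y, c1%:MP = y * b1 /\ c2%:MP = y * b2.
  by apply: (proportional (@ufd_mpoly k 1) c12 nz); rewrite {1}e2 {1}e1; ring.
apply/eqP; rewrite -leqn0 leqNgt; apply/negP => t0.
have key (b : {mpoly k[1]}) (c : k) : b \is t.-homog -> b = c%:MP * 'X_ord0 ^+ t -> c%:MP = y * b -> b = 0.
  move=> hb e3 e4; apply: NNPP => /eqP b0; have := mpolyC_homog 1 c; rewrite e4 mulrC => h.
  have := homog_factor b0 hb h; rewrite leqn0 eqn0Ngt t0 /= => y0.
  by case/eqP: b0; rewrite e3 e4 y0 !mul0r.
by case: nz => /eqP; apply; [exact: (key _ _ h1 e1 y1) | exact: (key _ _ h2 e2 y2)].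
Qed.

Section QuadraticForms.
Variables (k : closedFieldType) (m : nat) (f : 'rV[{mpoly k[m.+3]}]_3).
Notation R := {mpoly k[m.+3]}.
Notation B := {mpoly k[m.+1]}.
Hypothesis hk : [pchar k] =i pred0.
Hypotheses (hf : forall i, f 0 i \is 2.-homog) (hgcd : coprime_forms f) (he : is_indeg (syz f) 2).
Notation J := (ideal3 f).
Hypotheses (ht : ideal_height J 2) (hb : bour f = 2).
Let hJ : homog_ideal J := J_homog hf.

Lemma quadric_frame : exists F (l mu : k), [/\ ci_data F (fv f i0 + l%:MP * fv f i2) (fv f i1 + mu%:MP * fv f i2) 2,
  J (fv f i0 + l%:MP * fv f i2), J (fv f i1 + mu%:MP * fv f i2) & forall b, J (fb F b) -> b = 0].
Proof.
have [l [mu [F ci]]] := generic_frame (fv_cop hgcd) hf isT (fv_neq0 hgcd).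
have J1 := idealD hJ.1 (J_gen f i0) (idealM l%:MP hJ.1 (J_gen f i2)).
have J2 := idealD hJ.1 (J_gen f i1) (idealM mu%:MP hJ.1 (J_gen f i2)).
exists F, l, mu; split=> // b Jb; apply: NNPP => /eqP b0.
have [h10 _ _ c12 ci'] := ci; have [_ [q [pq sq [_ nq]]]] := ht.
by apply: nq; exact: (meet_chain3 h10 c12 ci' hJ J1 J2 b0 Jb pq sq).
Qed.

Lemma J_epolc : epolc m (hfr J) 2.
Proof. by have [h _ _] := bour_spec hf hgcd he; move: h; rewrite hb; congr (epolc m _ _); lra. Qed.

(** No shape of [rank2_structure] fits J: a = 0 puts z'^2 and z'w' in J, t = 0 puts a nonzero linear
    form in J, and t = 1 puts four independent quadrics in the span of three. *)
Lemma no_two_torsion_free F h1 h2 : framed F h1 h2 2 J -> ~ J 1 -> False.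
Proof.
move=> fr n1; have c2 := char_two hk.
have [be [ga [b1 [b2 [a [t [[hbe hga hb1 hb2 nz] [[c12 f2 f1 ha] [IA ID IC IX]]]]]]]]] := rank2_structure fr n1 J_epolc c2.
set z' := fz F - fb F be in IA ID IX; set w' := fw F - fb F ga in ID IC IX.
have hz' : z' \is 1.-homog by apply: rpredB; [exact: fz_homog | exact: fb_homog].
have hw' : w' \is 1.-homog by apply: rpredB; [exact: fw_homog | exact: fb_homog].
case: ha => [a0|[[t0 ha]|[t1 ha]]].
- apply: (no_common_factor hf he hz' hw'); first exact: pts_independent.
    by move: IA; rewrite a0 mulr0 (rmorph0 (fb F)) subr0.
  by move: ID; rewrite a0 mulr0 oppr0 (rmorph0 (fb F)) subr0.
- have hh (b : B) (y : R) : b \is t.-homog -> y \is 1.-homog -> fb F b * y \is 1.-homog.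
    by rewrite t0 => h hy; have := dhomogM (fb_homog F h) hy.
  have l0 := no_linear_form hf IX (rpredD (hh _ _ hb1 hz') (hh _ _ hb2 hw')).
  have h u v : b1 * u + b2 * v = 0.
    have := ptker_comb F be ga u v 0 b1 b2; rewrite (rmorph0 (fb F)) !add0r -/z' -/w' l0 => -[h _]; apply: h.
    exact: (rmorph0 (fpt F _ _)).
  have := h 1 0; have := h 0 1; rewrite !mulr1 !mulr0 addr0 add0r => e2 e1.
  by move: nz; rewrite e1 e2 eqxx => -[].
pose q (i : 'I_4) : R := match val i with
  | 0 => z' ^+ 2 - fb F (b2 ^+ 2 * a) | 1 => z' * w' - fb F (- (b1 * b2 * a))
  | 2 => w' ^+ 2 - fb F (b1 ^+ 2 * a) | _ => fb F b1 * z' + fb F b2 * w' end.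
have hq i : J (q i) /\ q i \is 2.-homog.
  have hh (x y : B) : x \is t.-homog -> y \is t.-homog -> fb F (x * y * a) \is 2.-homog.
    by rewrite t1 => hx hy; apply: fb_homog; exact: (dhomogM (dhomogM hx hy) ha).
  have hh' (x : B) (y : R) : x \is t.-homog -> y \is 1.-homog -> fb F x * y \is 2.-homog.
    by rewrite t1 => hx hy; exact: (dhomogM (fb_homog F hx) hy).
  case: i => [[|[|[|[|i]]]] lt]; rewrite /q /=; split=> //.
  - by apply: rpredB; [exact: (homog_exp 2 hz') | exact: hh].
  - by rewrite (rmorphN (fb F)) opprK; apply: rpredD; [exact: (dhomogM hz' hw') | exact: hh].
  - by apply: rpredB; [exact: (homog_exp 2 hw') | exact: hh].
  - by apply: rpredD; exact: hh'.
have sub0 : @subspace k R (fun x : R => x = 0).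
  by split=> // c u v -> ->; rewrite scaler0 addr0.
suff : (#|'I_4| <= #|'I_3|)%N by rewrite !card_ord.
apply: (indep_le_span (b := q) (b' := fv f) sub0); last first.
  move=> i; have [hJi hqi] := hq i; have [c ec] := J_scalars hf hJi hqi; exists c.
  by rewrite ec /lincomb; apply/eqP; rewrite subr_eq0; apply/eqP/eq_bigr => j _; rewrite mul_mpolyC.
move=> c hc; pose C (i : nat) : B := (c (inord i))%:MP.
have ev (u v : B) : C 0%N * (u ^+ 2 - b2 ^+ 2 * a) + C 1%N * (u * v + b1 * b2 * a) +
    C 2%N * (v ^+ 2 - b1 ^+ 2 * a) + C 3%N * (b1 * u + b2 * v) = 0.
  have := f_equal (fpt F (be + u) (ga + v)) hc; rewrite (rmorph0 (fpt F _ _)) /lincomb => <-.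
  have pz : fpt F (be + u) (ga + v) z' = u by rewrite (rmorphB (fpt F _ _)) fpt_z fpt_base addrC addKr.
  have pw : fpt F (be + u) (ga + v) w' = v by rewrite (rmorphB (fpt F _ _)) fpt_w fpt_base addrC addKr.
  have pC (x : k) (y : R) : fpt F (be + u) (ga + v) (x *: y) = x%:MP * fpt F (be + u) (ga + v) y.
    by rewrite -mul_mpolyC -(fbC F) (rmorphM (fpt F _ _)) fpt_base.
  rewrite (rmorph_sum (fpt F _ _)) !big_ord_recr big_ord0 /= add0r !pC /q /=.
  rewrite !(rmorphB (fpt F _ _)) (rmorphD (fpt F _ _)) !(rmorphXn (fpt F _ _)) !(rmorphM (fpt F _ _)) pz pw !fpt_base opprK.
  by congr (_ * _ + _ * _ + _ * _ + _ * _); rewrite /C; congr ((c _)%:MP); apply/val_inj; rewrite /= inordK.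
have d2 : (2 : B) != 0 := two_neq0 m c2.
have z0 := ev 0 0.
(* A linear relation among the four quadrics is evaluated at the points z' = u, w' = v; the values
   at (1, 0), (0, 1), their negatives and (1, 1) isolate the coefficients. *)
have E (u v : B) : C 0%N * u ^+ 2 + C 1%N * (u * v) + C 2%N * v ^+ 2 + C 3%N * (b1 * u + b2 * v) = 0.
  by rewrite -[RHS]subr0 -{1}(ev u v) -z0; ring.
have tw (x y : B) : x + y = 0 -> x - y = 0 -> x = 0 /\ y = 0.
  move=> e1 e2; split; apply: (mulfI d2); rewrite mulr0.
    by rewrite -[RHS]addr0 -{1}e1 -e2; ring.
  by rewrite -[RHS]subr0 -{1}e1 -e2; ring.
have [C0 C3] : C 0%N = 0 /\ C 3%N * b1 = 0.
  by apply: tw; [rewrite -(E 1 0) | rewrite -(E (- 1) 0)]; ring.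
have [C2 C3'] : C 2%N = 0 /\ C 3%N * b2 = 0.
  by apply: tw; [rewrite -(E 0 1) | rewrite -(E 0 (- 1))]; ring.
have C3z : C 3%N = 0.
  by case: nz => b0; [move/eqP: C3 | move/eqP: C3']; rewrite mulf_eq0 (negbTE b0) orbF => /eqP.
have C1 : C 1%N = 0 by rewrite -(E 1 1) C0 C2 C3z; ring.
move=> i; apply/eqP; rewrite -(@mpolyC_eq0 m.+1); apply/eqP.
have -> : (c i)%:MP = C (val i) by rewrite /C inord_val.
by case: i => [[|[|[|[|i]]]] lt].
Qed.

Lemma bour_two_saturated : locally_free (syz (Defs.theta f)) -> saturated J -> False.
Proof.
move=> lf sat; have [F [l [mu [ci J1 J2 jb]]]] := quadric_frame.
apply: (no_two_torsion_free (F := F) (h1 := fv f i0 + l%:MP * fv f i2) (h2 := fv f i1 + mu%:MP * fv f i2)).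
  split=> //; split=> // b g; have [_ _ _ _ ci'] := ci.
  exact: (locally_free_torsion hf hgcd ci' sat lf).
move=> j1; have /eqP := jb 1 (eq_ind_r J j1 (rmorph1 (fb F))); by rewrite oner_eq0.
Qed.

End QuadraticForms.

(** The B-torsion closure of J has rank at most 2. In rank 2 the form degree t is 0, since B has one
    variable, so the closure is (l, Q) and contains J, which [no_linear_pencil] forbids. In smaller
    rank [torsion_rank] contradicts the rank 2 of R/J. *)
Lemma bour_two_ternary (k : closedFieldType) (hk : [pchar k] =i pred0) (f : 'rV[{mpoly k[3]}]_3)
  (hf : forall i, f 0 i \is 2.-homog) (hgcd : coprime_forms f) (he : is_indeg (syz f) 2) :
  ideal_height (ideal3 f) 2 -> bour f <> 2.
Proof.
move=> ht hb; have [F [l [mu [ci J1 J2 jb]]]] := quadric_frame hf hgcd ht.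
have hJ := J_homog hf; have hE := J_epolc hf hgcd he hb.
have hT := torsion_ideal F hJ; have sT := @torsion_sub _ _ F (ideal3 f).
have fr : framed F (fv f i0 + l%:MP * fv f i2) (fv f i1 + mu%:MP * fv f i2) 2 (torsion F (ideal3 f)).
  split=> //; split; [|exact: sT|exact: sT|by move=> b g b0; exact: torsion_div].
  by split=> // t g; exact: torsion_hpart.
have n1 : ~ torsion F (ideal3 f) 1.
  by move=> [b /eqP b0]; rewrite mulr1 => /jb.
have [c hc _] := framed_epolc fr.
have c2 : c <= 2.
  apply: (epolc_le hc hE); exists 0%N => t _; rewrite /hfr ler_nat.
  exact: (HF_sub _ hJ.1 hT sT).
move: c2; rewrite le_eqVlt => /orP[/eqP c2|lt].
  rewrite c2 in hc.
  have [be [ga [b1 [b2 [a [t [[hbe hga hb1 hb2 nz] [[c12 f2 f1 ha] [IA ID IC IX]]]]]]]]] :=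
    rank2_structure fr n1 hc (char_two hk).
  have t0 := univariate_cop hb1 hb2 nz c12.
  have ha' : a \is 2.-homog.
    by case: ha => [->|[[_ h]|[t1 _]]]; [exact: dhomog0 | exact: h | move: t1; rewrite t0].
  have [x [x0 x1 _ ex]] := case_ci fr n1 hbe hga hb1 hb2 nz c12 f2 f1 IA IC IX t0 ha'.
  apply: (no_linear_pencil hf hgcd he x0 x1) => y /sT /ex; by rewrite pairI_gen.
have [a [b [ha hb' eI]]] := rank1 fr n1 hc lt.
have := torsion_rank hJ ci J1 J2 (fun x px => proj2 (eI x) px) hE; lra.
Qed.

Theorem theorem2 (k : closedFieldType) (hk : [pchar k] =i pred0)
    (n : nat) (hn : (3 <= n)%N) (d e : nat) (f : 'rV[{mpoly k[n]}]_3)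
    (hf : forall i, f 0 i \is d.-homog) (hgcd : coprime_forms f)
    (he : is_indeg (syz f) e) :
  let J := ideal3 f in
  let D : rat := d%:R in
  let E : rat := e%:R in
  [/\ almost_complete_intersection J ->
        degree J + bour f = D ^+ 2 + E ^+ 2 - E * D /\
        [/\ bour f = 0 <-> perfect_ideal J,
            forall nu I, min_syzygy f nu -> bourbaki_ideal f nu I ->
              (bour f = 1 <-> linear_ci2 I),
            forall nu I, min_syzygy f nu -> bourbaki_ideal f nu I ->
              (bour f = 2 <->
                 [\/ two_linear_primes I, linear_primary2 I | ci_type12 I])
          & bour f = D ^+ 2 - 1 <-> (e = d /\ degree J = 1)],
      min_generated_by J 3 ->
        (bour f = D ^+ 2 <-> complete_intersection J),
      almost_complete_intersection J -> locally_free (syz f) ->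
        bour f <= E ^+ 2 /\
        D * (D - E) <= degree J <= D ^+ 2 + E ^+ 2 - E * D
    & ideal_height J 2 -> d = 2%N ->
        (n = 3%N -> bour f <> 2) /\
        ((4 <= n)%N -> locally_free (syz (theta f)) -> saturated J ->
           bour f <> 2)].
Proof.
move: n hn f hf hgcd he => [|[|[|m]]] // _ f hf hgcd he /=.
split.
- move=> aci; split; first exact: (degree_formula hf hgcd he).
  split; [exact: (bour0_perfect hf hgcd he) | exact: (bour1_linear hf hgcd he) | exact: (bour2_cases hk hf hgcd he) | exact: (bour_almost_max hf hgcd he)].
- exact: (bour_max hf hgcd he).
- by move=> aci _; split; [exact: (bour_le hf hgcd he) | exact: (degree_bounds hf hgcd he)].
move=> ht d2; rewrite {}d2 in hf.
(* 2 <= e^2 and e <= 2 leave only e = 2. *)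
have e2 : bour f = 2 -> e = 2%N.
  move=> hb; have := bour_le hf hgcd he; have := indeg_le hf hgcd he; rewrite hb.
  by case: e he => [|[|[|e]]] he' // _; rewrite ?expr0n ?expr1n.
split=> [[m0]|_ lf sat] hb; have he2 := he; rewrite (e2 hb) in he2.
  by subst m; exact: (bour_two_ternary hk hf hgcd he2 ht hb).
exact: (bour_two_saturated hk hf hgcd he2 ht hb lf sat).
Qed.
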